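(* The following $51$ vectors are a set of generators of the polyhedral cone $D_3(C_3)=D_3(B_3)$ in the $9$-dimensional space $\mathfrak{a}^3=(\mathbb{R}^3)^3$, i.e. the cone is the set of all nonnegative real linear combinations of them. Each vector is written as a string of nine digits, which are its components in the order $x_1,x_2,x_3,y_1,y_2,y_3,z_1,z_2,z_3$, where $v_i=(x_i,y_i,z_i)$, $1\le i\le 3$, for $(v_1,v_2,v_3)\in\mathfrak{a}^3$: (1) 112110000; (2) 112110110; (3) 112111001; (4) 112111010; (5) 112111100; (6) 121101000; (7) 121101101; (8) 121111001; (9) 121111010; (10) 121111100; (11) 211011000; (12) 211011011; (13) 211111001; (14) 211111010; (15) 211111100; (16) 011000000; (17) 112112110; (18) 121121101; (19) 123121101; (20) 132112110; (21) 101000000; (22) 211211011; (23) 213211011; (24) 110000000; (25) 231211011; (26) 312112110; (27) 321121101; (28) 122112010; (29) 122121001; (30) 212112100; (31) 212211001; (32) 221121100; (33) 221211010; (34) 011011000; (35) 101101000; (36) 110110000; (37) 111001000; (38) 111010000; (39) 111100000; (40) 011011011; (41) 101101101; (42) 110110110; (43) 111011001; (44) 111011010; (45) 111101001; (46) 111101100; (47) 111110010; (48) 111110100; (49) 111111001; (50) 111111010; (51) 111111100.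
   Context: Let $G$ be a connected complex semisimple Lie group, $K$ a maximal compact subgroup, $X=G/K$ with base point $o=eK$, $\mathfrak{g}=\mathfrak{k}\oplus\mathfrak{p}$ the Cartan decomposition, $\mathfrak{a}\subset\mathfrak{p}$ a maximal abelian subspace, $\Delta\subset\mathfrak{a}$ a closed Weyl chamber. For $x_1,x_2\in X$ there is a unique $\delta\in\Delta$ such that some $g\in G$ maps $x_1$ to $o$ and $x_2$ to $\exp(\delta)o$; put $d_\Delta(x_1,x_2)=\delta$. The set $D_3(X)\subset\Delta^3$ consists of the $(v_1,v_2,v_3)$ for which there are points $p_1,p_2,p_3\in X$ with $d_\Delta(p_1,p_2)=v_1$, $d_\Delta(p_2,p_3)=v_2$, $d_\Delta(p_3,p_1)=v_3$. It is known to be a polyhedral cone. $D_3(C_3)$ denotes $D_3(X)$ for $G=Sp(6,\mathbb{C})$, with coordinates $(x,y,z)$ on $\mathfrak{a}=\mathbb{R}^3$ in which the simple roots are $x-y,\ y-z,\ 2z$; $D_3(B_3)$ denotes $D_3(X)$ for $G=Spin(7,\mathbb{C})$, with coordinates in which the simple roots are $x-y,\ y-z,\ z$. In both cases $\Delta=\{x\ge y\ge z\ge 0\}$, and $D_3(B_3)=D_3(C_3)$ in these coordinates. *)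

(* Defs.v *)
From HB Require Import structures.
From mathcomp Require Import all_boot all_order all_algebra.
From mathcomp Require Import spectral.
From mathcomp Require Import complex mxtens.
From mathcomp Require Import all_classical all_reals all_analysis.

Set Implicit Arguments.
Unset Strict Implicit.
Unset Printing Implicit Defensive.

Import Order.TTheory GRing.Theory Num.Theory.
Import numFieldNormedType.Exports.

Local Open Scope classical_set_scope.
Local Open Scope ring_scope.
Local Open Scope complex_scope.
Local Open Scope sesquilinear_scope.

Definition expmx (K : numFieldType) (n : nat) (A : 'M[K]_n.+1) : 'M[K]_n.+1 :=
  limn (series (fun k => (k`!%:R)^-1 *: A ^+ k)).

(* A group G is given as a subgroup of GL_n(C) stable under conjugate
   transpose; its unitary elements then form a maximal compact subgroup K.
   A point of X = G/K is a left coset g K, i.e. a set of matrices. *)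
Section SymmetricSpace.
Variables (R : realType) (n : nat) (G : set 'M[R[i]]_n.+1).

Definition maxcompact : set 'M[R[i]]_n.+1 := [set k | G k /\ k \is unitarymx].

Definition act (g : 'M[R[i]]_n.+1) (p : set 'M[R[i]]_n.+1) :
  set 'M[R[i]]_n.+1 := [set g *m h | h in p].

Definition symspace : set (set 'M[R[i]]_n.+1) :=
  [set act g maxcompact | g in G].

Definition basepoint : set 'M[R[i]]_n.+1 := maxcompact.

(* The closed Weyl chamber x >= y >= z >= 0 common to types B_3 and C_3. *)
Definition chamber : set 'rV[R]_3 :=
  [set v | [/\ v 0 1 <= v 0 0, v 0 2 <= v 0 1 & 0 <= v 0 2]].

(* iota identifies R^3 with the chosen maximal abelian subspace of p. *)
Variable iota : 'rV[R]_3 -> 'M[R[i]]_n.+1.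

(* The graph of d_Delta: d_Delta(p1, p2) = v. *)
Definition dDelta (p1 p2 : set 'M[R[i]]_n.+1) (v : 'rV[R]_3) : Prop :=
  chamber v /\
  exists2 g, G g &
    act g p1 = basepoint /\ act g p2 = act (expmx (iota v)) basepoint.

Definition D3 : set ('rV[R]_3 * 'rV[R]_3 * 'rV[R]_3) :=
  [set v | exists p1 p2 p3,
     [/\ symspace p1, symspace p2 & symspace p3] /\
     [/\ dDelta p1 p2 v.1.1, dDelta p2 p3 v.1.2 & dDelta p3 p1 v.2]].

End SymmetricSpace.

Section TypeC3.
Variable R : realType.

Definition Jmx : 'M[R[i]]_6 := block_mx (0 : 'M[R[i]]_3) 1%:M (- 1%:M) 0.

Definition Sp6 : set 'M[R[i]]_6 := [set g | g^T *m Jmx *m g = Jmx].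

(* diag(x, y, z, -x, -y, -z) *)
Definition cartanC3 (v : 'rV[R]_3) : 'M[R[i]]_6 :=
  let w : 'rV[R[i]]_3 := map_mx (real_complex R) v in
  diag_mx (row_mx w (- w)).

End TypeC3.

Section TypeB3.
Variable R : realType.

Definition sigmax : 'M[R[i]]_2 := \matrix_(i, j) (i != j)%:R.
Definition sigmay : 'M[R[i]]_2 :=
  \matrix_(i, j) (if i == j then 0 else if i == 0 then - 'i else 'i).
Definition sigmaz : 'M[R[i]]_2 := \matrix_(i, j) ((-1) ^+ i *+ (i == j)).
Definition id2 : 'M[R[i]]_2 := 1%:M.

(* Pairwise anticommuting Hermitian matrices with square 1. They define a
   representation of the complex Clifford algebra of C^7 whose restriction to
   the even part is an isomorphism onto the 8 x 8 matrices (the spin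
   representation), so that Spin(7, C) can be realized in GL_8(C). *)
Definition gammas : seq 'M[R[i]]_8 :=
  [:: sigmax *t id2 *t id2;
      sigmay *t id2 *t id2;
      sigmaz *t sigmax *t id2;
      sigmaz *t sigmay *t id2;
      sigmaz *t sigmaz *t sigmax;
      sigmaz *t sigmaz *t sigmay;
      sigmaz *t sigmaz *t sigmaz].

Definition gamma (j : nat) : 'M[R[i]]_8 := gammas`_j.

Definition clifford (u : 'rV[R[i]]_7) : 'M[R[i]]_8 :=
  \sum_(j < 7) u 0 j *: gamma j.

(* Products of an even number of vectors u with u_1^2 + ... + u_7^2 = 1
   (complex squares, no conjugation). *)
Definition Spin7 : set 'M[R[i]]_8 :=
  [set g | exists s : seq 'rV[R[i]]_7,
     [/\ ~~ odd (size s),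
         forall u, u \in s -> \sum_(j < 7) u 0 j ^+ 2 = 1
       & g = \prod_(u <- s) clifford u]].

(* The element with coordinates (x, y, z) is
   (1/2) (x (-i e_1 e_2) + y (-i e_3 e_4) + z (-i e_5 e_6)).
   On C^7 its eigenvalues are x, y, z, -x, -y, -z, 0, whence the simple roots
   x - y, y - z, z. *)
Definition cartanB3 (v : 'rV[R]_3) : 'M[R[i]]_8 :=
  \sum_(j < 3)
    ((v 0 j / 2)%:C * - 'i) *: (gamma (2 * j)%N *m gamma (2 * j).+1%N).

End TypeB3.

Definition D3_C3 (R : realType) : set ('rV[R]_3 * 'rV[R]_3 * 'rV[R]_3) :=
  D3 (@Sp6 R) (@cartanC3 R).

Definition D3_B3 (R : realType) : set ('rV[R]_3 * 'rV[R]_3 * 'rV[R]_3) :=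
  D3 (@Spin7 R) (@cartanB3 R).

Definition generators : seq (seq nat) :=
  [:: [:: 1; 1; 2; 1; 1; 0; 0; 0; 0];  [:: 1; 1; 2; 1; 1; 0; 1; 1; 0];
     [:: 1; 1; 2; 1; 1; 1; 0; 0; 1];  [:: 1; 1; 2; 1; 1; 1; 0; 1; 0];
     [:: 1; 1; 2; 1; 1; 1; 1; 0; 0];  [:: 1; 2; 1; 1; 0; 1; 0; 0; 0];
     [:: 1; 2; 1; 1; 0; 1; 1; 0; 1];  [:: 1; 2; 1; 1; 1; 1; 0; 0; 1];
     [:: 1; 2; 1; 1; 1; 1; 0; 1; 0];  [:: 1; 2; 1; 1; 1; 1; 1; 0; 0];
     [:: 2; 1; 1; 0; 1; 1; 0; 0; 0];  [:: 2; 1; 1; 0; 1; 1; 0; 1; 1];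
     [:: 2; 1; 1; 1; 1; 1; 0; 0; 1];  [:: 2; 1; 1; 1; 1; 1; 0; 1; 0];
     [:: 2; 1; 1; 1; 1; 1; 1; 0; 0];  [:: 0; 1; 1; 0; 0; 0; 0; 0; 0];
     [:: 1; 1; 2; 1; 1; 2; 1; 1; 0];  [:: 1; 2; 1; 1; 2; 1; 1; 0; 1];
     [:: 1; 2; 3; 1; 2; 1; 1; 0; 1];  [:: 1; 3; 2; 1; 1; 2; 1; 1; 0];
     [:: 1; 0; 1; 0; 0; 0; 0; 0; 0];  [:: 2; 1; 1; 2; 1; 1; 0; 1; 1];
     [:: 2; 1; 3; 2; 1; 1; 0; 1; 1];  [:: 1; 1; 0; 0; 0; 0; 0; 0; 0];
     [:: 2; 3; 1; 2; 1; 1; 0; 1; 1];  [:: 3; 1; 2; 1; 1; 2; 1; 1; 0];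
     [:: 3; 2; 1; 1; 2; 1; 1; 0; 1];  [:: 1; 2; 2; 1; 1; 2; 0; 1; 0];
     [:: 1; 2; 2; 1; 2; 1; 0; 0; 1];  [:: 2; 1; 2; 1; 1; 2; 1; 0; 0];
     [:: 2; 1; 2; 2; 1; 1; 0; 0; 1];  [:: 2; 2; 1; 1; 2; 1; 1; 0; 0];
     [:: 2; 2; 1; 2; 1; 1; 0; 1; 0];  [:: 0; 1; 1; 0; 1; 1; 0; 0; 0];
     [:: 1; 0; 1; 1; 0; 1; 0; 0; 0];  [:: 1; 1; 0; 1; 1; 0; 0; 0; 0];
     [:: 1; 1; 1; 0; 0; 1; 0; 0; 0];  [:: 1; 1; 1; 0; 1; 0; 0; 0; 0];
     [:: 1; 1; 1; 1; 0; 0; 0; 0; 0];  [:: 0; 1; 1; 0; 1; 1; 0; 1; 1];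
     [:: 1; 0; 1; 1; 0; 1; 1; 0; 1];  [:: 1; 1; 0; 1; 1; 0; 1; 1; 0];
     [:: 1; 1; 1; 0; 1; 1; 0; 0; 1];  [:: 1; 1; 1; 0; 1; 1; 0; 1; 0];
     [:: 1; 1; 1; 1; 0; 1; 0; 0; 1];  [:: 1; 1; 1; 1; 0; 1; 1; 0; 0];
     [:: 1; 1; 1; 1; 1; 0; 0; 1; 0];  [:: 1; 1; 1; 1; 1; 0; 1; 0; 0];
     [:: 1; 1; 1; 1; 1; 1; 0; 0; 1];  [:: 1; 1; 1; 1; 1; 1; 0; 1; 0];
     [:: 1; 1; 1; 1; 1; 1; 1; 0; 0]]%N.

(* The digits are ordered x1 x2 x3 y1 y2 y3 z1 z2 z3 where
   v_i = (x_i, y_i, z_i): coordinate c of v_(i+1) is digit number 3 c + i. *)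
Definition vec_of_digits (R : realType) (s : seq nat) :
    'rV[R]_3 * 'rV[R]_3 * 'rV[R]_3 :=
  let v i : 'rV[R]_3 := \row_(c < 3) (nth 0 s (3 * c + i))%N%:R in
  (v 0%N, v 1%N, v 2%N).

Definition cone_of (R : realType) (V : lmodType R) (s : seq V) : set V :=
  [set u | exists a : 'I_(size s) -> R,
     (forall k, 0 <= a k) /\ u = \sum_(k < size s) a k *: s`_k].

Arguments D3_C3 R : clear implicits.
Arguments D3_B3 R : clear implicits.

(* Main.v *)
(* A triple lies in D_3 iff W1 k1 W2 k2 W3 k3 = 1 for some k_i in the maximal
   compact subgroup, where W_i is the exponential of v_i. In suitable
   coordinates W_i = diag(exp(-x), exp(-y), exp(-z), [1,] exp z, exp y, exp x)
   acts on C^N, N = 6 or 7, and the group preserves the form J.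

   Necessity. Comparing Gram determinants, such an identity with merely unitary
   k_i shows that the total slope of every subspace with respect to three flags
   is nonnegative. Subspaces obtained from the flags by elementary incidence
   constructions then give the facet inequalities of the cone, and a pulling
   triangulation shows that these inequalities cut out the cone of the
   generators.

   Sufficiency. For three osculating flags of the rational normal curve,
   counting the zeros of a Wronskian bounds the positions of an isotropic
   subspace, and this makes every generator semistable, hence every positive
   combination of all of them stable. For a stable configuration the map Psi,
   which moves a positive Hermitian form towards the three flags in turn, has a
   fixed point, and the fixed point gives the closed triangle: the perturbations
   f_e(Psi), f_e(t) = (t + e) / (1 + e t), are contractions for the Thompson
   metric, and an unbounded sequence of their fixed points would yield a
   destabilizing isotropic subspace in the limit. The general case follows by
   compactness.

   For Spin(7) everything is transported through the vector representation; real
   rotations lift to products of vectors by Cartan-Dieudonne. *)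
From Stdlib Require BinInt.
From Corelib Require Import BinNums.
Require Import Defs.
From HB Require Import structures.
From mathcomp Require Import all_boot all_order all_algebra.
From mathcomp Require Import spectral.
From mathcomp Require Import complex mxtens.
From mathcomp Require Import all_classical all_reals all_analysis.
From mathcomp Require Import ring lra ssrZ zify.

Set Implicit Arguments.
Unset Strict Implicit.
Unset Printing Implicit Defensive.

Import Order.TTheory GRing.Theory Num.Theory.
Import numFieldNormedType.Exports.

Local Open Scope ring_scope.
Local Open Scope sesquilinear_scope.

(** * Cones from facet inequalities *)

(** Necessity never uses the group: only unitarity of the k_i enters, so the inequalities hold for
    all linear subspaces and the same ones serve both groups. Sufficiency must stay inside the
    group, where only isotropic subspaces can destabilize. The signs of the form J alternate so that
    the substitution of X + 1 for X preserves it in both dimensions; this puts the osculating flags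
    at infinity, 0 and -1 into the group. The map Psi is merely nonexpansive for the Thompson metric
    and need not have a fixed point. The function f_e is chosen because it maps the positive half
    line between e and 1/e, is operator monotone, contracts strictly on bounded sets, and satisfies
    f_e(1/t) = 1/f_e(t), so that it does not leave the group. It also moves every eigenvalue towards
    1, so at a fixed point Psi does not shrink the large directions; this is what makes their limit
    destabilizing. A single generator is only known to be semistable, but each isotropic subspace
    has positive slope for at least one generator. This is why a small multiple of the sum of all of
    them is added and then removed by a limit. *)

Section Cone.

Fixpoint zdot (l g : seq Z) : Z :=
  match l, g with a :: l', b :: g' => BinInt.Z.add (BinInt.Z.mul a b) (zdot l' g') | _, _ => Z0 end.

Definition zeros (S : seq (seq Z)) (f : seq Z) : bitseq :=
  [seq BinInt.Z.eqb (zdot f g) Z0 | g <- S].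

Definition subbits (a b : bitseq) : bool := all2 implb a b.

(** A facet of the face spanned by [S] is a functional whose zero pattern is maximal among those not
    vanishing on all of [S]; [seen] removes repetitions. Soundness uses only that the result is a
    part of [L], so the selection acts as a heuristic. *)
Fixpoint facets_among (S : seq (seq Z)) (seen all_zs : seq bitseq)
    (L : seq (seq Z)) : seq (seq Z) :=
  if L is f :: L' then
    let z := zeros S f in
    if [|| all id z, has (fun z' => z == z') seen |
           has (fun z' => [&& ~~ all id z', z != z' & subbits z z']) all_zs]
    then facets_among S seen all_zs L'
    else f :: facets_among S (z :: seen) all_zs L'
  else [::].

Definition face_facets (S L : seq (seq Z)) :=
  facets_among S [::] (map (zeros S) L) L.

(** Fraction-free Gaussian elimination: the answer [true] certifies that the equations have rank
    [n], hence only the zero solution. *)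
Fixpoint elim (n : nat) (eqs : seq (seq Z)) : bool :=
  if n is n'.+1 then
    if ohead [seq e <- eqs | ~~ BinInt.Z.eqb (head Z0 e) Z0] is Some e0 then
      elim n' [seq [seq BinInt.Z.sub (BinInt.Z.mul (head Z0 e0) p.1) (BinInt.Z.mul (head Z0 e) p.2)
                   | p <- zip (behead e) (behead e0)] | e <- eqs]
    else false
  else true.

Definition branching (L : seq (seq Z)) (g : seq Z) :=
  [seq f <- L | BinInt.Z.ltb Z0 (zdot f g)].

(** Pulling at a ray that lies on as many facets as possible keeps the recursion small. *)
Fixpoint best_ray (L : seq (seq Z)) (g : seq Z) (S : seq (seq Z)) :=
  if S is h :: S' then
    best_ray L (if (size (branching L h) < size (branching L g))%N then h else g) S'
  else g.

(** [T] collects the functionals made tight so far and [S] the rays of the current face. The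
    recursion visits the facets that avoid the chosen ray; a face without rays has to be the origin,
    which [elim] certifies. *)
Fixpoint covered (n fuel : nat) (T L S : seq (seq Z)) : bool :=
  if fuel is k.+1 then
    if S is g0 :: S' then
      let g := best_ray L g0 S' in
      let B := branching L g in
      [&& ~~ nilp B, all (fun f => BinInt.Z.eqb (zdot f g) Z0) T &
       all (fun f =>
         let Sf := [seq h <- S | BinInt.Z.eqb (zdot f h) Z0] in
         covered n k (f :: T) (face_facets Sf L) Sf) B]
    else elim n T
  else false.
End Cone.

Section ConeSound.
Variable R : realFieldType.
Implicit Types (v : nat -> R) (l g : seq Z) (S T L : seq (seq Z)).

Definition zR (z : Z) : R := (ssrZ.int_of_Z z)%:~R.

Lemma zRD a b : zR (BinInt.Z.add a b) = zR a + zR b.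
Proof. by rewrite /zR -intrD; congr (_%:~R); lia. Qed.
Lemma zRM a b : zR (BinInt.Z.mul a b) = zR a * zR b.
Proof. by rewrite /zR -intrM; congr (_%:~R); lia. Qed.
Lemma zRB a b : zR (BinInt.Z.sub a b) = zR a - zR b.
Proof. by rewrite /zR -intrB; congr (_%:~R); lia. Qed.
Lemma zR_gt0 a : BinInt.Z.ltb Z0 a -> 0 < zR a.
Proof. by rewrite /zR ltr0z; lia. Qed.
Lemma zR_neq0 a : ~~ BinInt.Z.eqb a Z0 -> zR a != 0.
Proof. by rewrite /zR intr_eq0; lia. Qed.
Lemma zR_le0 a : ~~ BinInt.Z.ltb Z0 a -> zR a <= 0.
Proof. by rewrite /zR lerz0; lia. Qed.

Fixpoint rdot l v : R :=
  if l is a :: l' then zR a * v 0%N + rdot l' (fun i => v i.+1) else 0.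

Definition zvec g : nat -> R := fun i => zR (nth Z0 g i).

Lemma rdot0 l v : (forall i, v i = 0) -> rdot l v = 0.
Proof.
elim: l v => //= a l IH v v0; rewrite v0 mulr0 add0r IH // => i.
Qed.

Lemma rdot_zvec l g : rdot l (zvec g) = zR (zdot l g).
Proof.
elim: l g => [|a l IH] [|b g] //=.
  by rewrite /zvec /= mulr0 add0r; apply: rdot0 => i.
by rewrite zRD zRM /zvec /= -IH.
Qed.

Lemma rdotB l v w t : rdot l (fun i => v i - t * w i) = rdot l v - t * rdot l w.
Proof.
elim: l v w => [|a l IH] v w /=; first by rewrite mulr0 subr0.
by rewrite IH; ring.
Qed.

Lemma eq_rdot l v w : (forall i, (i < size l)%N -> v i = w i) -> rdot l v = rdot l w.
Proof.
elim: l v w => //= a l IH v w vw; rewrite (vw 0%N) //; congr (_ + _).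
by apply: IH => i il; apply: vw.
Qed.

Lemma rdot_lincomb a b l l' v : size l = size l' ->
  rdot [seq BinInt.Z.sub (BinInt.Z.mul a p.1) (BinInt.Z.mul b p.2) | p <- zip l l'] v
  = zR a * rdot l v - zR b * rdot l' v.
Proof.
elim: l l' v => [|x l IH] [|y l'] v //= => [_|[sl]].
  by rewrite !mulr0 subr0.
by rewrite IH // zRB !zRM; ring.
Qed.

Lemma elim_sound n (eqs : seq (seq Z)) v : {in eqs, forall e, size e = n} -> elim n eqs ->
  {in eqs, forall e, rdot e v = 0} -> forall i, (i < n)%N -> v i = 0.
Proof.
elim: n eqs v => [//|n IH] eqs v sz /=.
case E: [seq e <- eqs | _] => [//|e0 es] /= el van.
have : e0 \in [seq e <- eqs | ~~ BinInt.Z.eqb (head Z0 e) Z0] by rewrite E inE eqxx.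
rewrite mem_filter => /andP[/zR_neq0 h0 e0in].
have v1 : forall i, (i < n)%N -> v i.+1 = 0.
  move=> i; apply: (IH _ (fun i => v i.+1) _ el _ i) => [e|e] /mapP[e' e'in ->].
    by rewrite size_map size_zip !size_behead (sz _ e'in) (sz _ e0in) /= minnn.
  rewrite rdot_lincomb; last by rewrite !size_behead (sz _ e'in) (sz _ e0in).
  move: (van _ e'in) (van _ e0in) (sz _ e'in) (sz _ e0in).
  case: (e') => [//|a l']; case: (e0) => [//|b l0] /= H1 H2 _ _.
  (* The terms in the first coordinate cancel, so the reduced equation is a combination of two
     equations that hold. *)
  have -> : zR b * rdot l' (fun i => v i.+1) - zR a * rdot l0 (fun i => v i.+1)
     = zR b * (zR a * v 0%N + rdot l' (fun i => v i.+1))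
     - zR a * (zR b * v 0%N + rdot l0 (fun i => v i.+1)) by ring.
  by rewrite H1 H2 !mulr0 subr0.
case=> [_|i]; last exact: v1.
move: (van _ e0in) (sz _ e0in) h0; case: (e0) => [//|b l] /= H [sl] b0.
have E0 : rdot l (fun i => v i.+1) = 0.
  rewrite (@eq_rdot l _ (fun=> 0)) ?rdot0 // => i; rewrite sl; exact: v1.
by move: H; rewrite E0 addr0 => /eqP; rewrite mulf_eq0 (negbTE b0) => /eqP.
Qed.

Definition in_cone n S v := exists a : nat -> R, (forall k, 0 <= a k) /\
  forall i, (i < n)%N -> v i = \sum_(k < size S) a k * zvec (nth [::] S k) i.

Lemma in_cone0 n S v : (forall i, (i < n)%N -> v i = 0) -> in_cone n S v.
Proof.
move=> v0; exists (fun=> 0); split=> // i iln.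
by rewrite v0 // big1 // => k _; rewrite mul0r.
Qed.

Lemma in_cone_add n S v g t : g \in S -> 0 <= t ->
  in_cone n S (fun i => v i - t * zvec g i) -> in_cone n S v.
Proof.
move=> gS t0 [a [a0 av]].
exists (fun k => a k + (if k == index g S then t else 0)); split.
  by move=> k; rewrite addr_ge0 //; case: ifP.
move=> i iln; have := av i iln; move/eqP; rewrite subr_eq => /eqP ->.
under [RHS]eq_bigr do rewrite mulrDl.
rewrite big_split /=; congr (_ + _).
have iS : (index g S < size S)%N by rewrite index_mem.
rewrite (bigD1 (Ordinal iS)) //= eqxx nth_index // big1 ?addr0 // => k /eqP kn.
by case: eqP => [ki|]; rewrite ?mul0r //; case: kn; apply: val_inj.
Qed.

Lemma exists_min_ratio (B : seq (seq Z)) (c d : seq Z -> R) : ~~ nilp B ->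
  {in B, forall f, 0 < d f} -> exists2 f, f \in B &
    {in B, forall f', c f / d f * d f' <= c f'}.
Proof.
elim: B => [//|f B IH] _ dB.
have [/nilP ->|nB] := boolP (nilp B).
  exists f; rewrite ?inE ?eqxx // => f'; rewrite inE => /eqP ->.
  by rewrite divfK // gt_eqF // dB ?inE ?eqxx.
have [|f1 f1B m1] := IH nB; first by move=> h hB; apply: dB; rewrite inE hB orbT.
have df : 0 < d f by apply: dB; rewrite inE eqxx.
have df1 : 0 < d f1 by apply: dB; rewrite inE f1B orbT.
have [le|le] := lerP (c f1 / d f1) (c f / d f).
  exists f1; rewrite ?inE ?f1B ?orbT // => h; rewrite inE => /predU1P[->|]; last exact: m1.
  by rewrite -ler_pdivlMr.
exists f; rewrite ?inE ?eqxx // => h; rewrite inE => /predU1P[->|hB].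
  by rewrite divfK // gt_eqF.
by apply: le_trans (m1 _ hB); rewrite ler_wpM2r ?ltW // dB // inE hB orbT.
Qed.

Lemma best_ray_in L g S S0 : g \in S0 -> {subset S <= S0} -> best_ray L g S \in S0.
Proof.
elim: S g => //= h S IH g gS sub; apply: IH.
  by case: ifP => // _; apply: sub; rewrite inE eqxx.
by move=> x xS; apply: sub; rewrite inE xS orbT.
Qed.

Lemma face_facets_sub S L : {subset face_facets S L <= L}.
Proof.
rewrite /face_facets; move: (map _ L) [::] => zs.
elim: L => [|f L IH] seen x //=; case: ifP => _; rewrite !inE.
  by move/IH => ->; rewrite orbT.
by case/orP => [->//|/IH ->]; rewrite orbT.
Qed.

(* Pulling triangulation: subtract from [v] the largest multiple of the ray
   [g] that stays in the face, which makes some facet of the face tight. *)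
Lemma covered_sound n S0 fuel T L S v :
  {in T, forall f, size f = n} -> {in L, forall f, size f = n} ->
  {subset S <= S0} -> covered n fuel T L S ->
  {in T, forall f, rdot f v = 0} -> {in L, forall f, 0 <= rdot f v} ->
  in_cone n S0 v.
Proof.
elim: fuel T L S v => [//|k IH] T L [|g0 S] v sT sL SS0.
  by move=> /= el vT _; apply: in_cone0; apply: elim_sound el vT.
cbn [covered]; set g := best_ray L g0 S; set B := branching L g.
case/and3P => nB /allP gT /allP chk vT vL.
have gS : g \in g0 :: S.
  by apply: best_ray_in; rewrite ?inE ?eqxx // => x xS; rewrite inE xS orbT.
have Bpos : {in B, forall f, 0 < rdot f (zvec g)}.
  by move=> f; rewrite mem_filter rdot_zvec => /andP[/zR_gt0].
have BL : {subset B <= L} by move=> f; rewrite mem_filter => /andP[].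
have [f fB fmin] := exists_min_ratio (fun f => rdot f v) nB Bpos.
set t := rdot f v / rdot f (zvec g) in fmin.
have t0 : 0 <= t by rewrite divr_ge0 ?vL ?BL // ltW // Bpos.
apply: (@in_cone_add n S0 v g t); [exact: SS0 | exact: t0 |].
apply: (IH (f :: T) (face_facets [seq h <- g0 :: S | BinInt.Z.eqb (zdot f h) Z0] L) _) (chk f fB) _ _.
- by move=> h; rewrite inE => /predU1P[->|/sT//]; apply/sL/BL.
- by move=> h /face_facets_sub/sL.
- by move=> h; rewrite mem_filter => /andP[_ /SS0].
- move=> h; rewrite inE rdotB => /predU1P[->|hT].
    by rewrite divfK ?subrr // gt_eqF // Bpos.
  rewrite vT // rdot_zvec; have -> : zdot h g = Z0 by have := gT _ hT; lia.
  by rewrite mulr0 subr0.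
- move=> h /face_facets_sub hL; rewrite rdotB subr_ge0.
  have [hB|] := boolP (h \in B); first exact: fmin.
  rewrite mem_filter hL andbT => /zR_le0; rewrite -rdot_zvec => le.
  by apply: le_trans (vL _ hL); apply: mulr_ge0_le0.
Qed.
End ConeSound.

(** * Slopes and Gram determinants *)

Section Volume.
Variable C : numClosedFieldType.
Implicit Types (N d k : nat).

Lemma adjM m n p (A : 'M[C]_(m, n)) (B : 'M[C]_(n, p)) :
  (A *m B)^t* = B^t* *m A^t*.
Proof. by rewrite trmx_mul map_mxM. Qed.

Lemma adjD m n (A B : 'M[C]_(m, n)) : (A + B)^t* = A^t* + B^t*.
Proof. by apply/matrixP => i j; rewrite !mxE rmorphD. Qed.

Lemma adjZ m n (a : C) (A : 'M[C]_(m, n)) : (a *: A)^t* = a^* *: A^t*.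
Proof. by apply/matrixP => i j; rewrite !mxE rmorphM. Qed.

Lemma adj_diag n (e : 'rV[C]_n) : (diag_mx e)^t* = diag_mx (map_mx Num.conj e).
Proof. by rewrite tr_diag_mx map_diag_mx. Qed.

Lemma det_adj n (A : 'M[C]_n) : \det (A^t*) = (\det A)^*.
Proof. by rewrite det_map_mx det_tr. Qed.

Definition cproj N k : 'M[C]_N := diag_mx (\row_j (k <= j)%:R).
Definition stretch N k (tau : C) : 'M[C]_N :=
  diag_mx (\row_(j < N) if (k <= j)%N then tau else 1).
(** For independent rows, [d - rk k t] is the dimension of the intersection of the row space with
    the span of the first [k] coordinates. *)
Definition rk d N k (t : 'M[C]_(d, N)) := \rank (t *m cproj N k).
(** The squared volume spanned by the rows. *)
Definition gram d N (t : 'M[C]_(d, N)) : C := \det (t *m t^t*).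

Lemma cproj_idem N k : cproj N k *m cproj N k = cproj N k.
Proof.
rewrite mulmx_diag; congr diag_mx; apply/rowP => j; rewrite !mxE.
by case: leqP; rewrite ?mulr1 ?mulr0.
Qed.

Lemma adj_cproj N k : (cproj N k)^t* = cproj N k.
Proof.
rewrite adj_diag; congr diag_mx; apply/rowP => j; rewrite !mxE.
by case: leqP; rewrite ?conjC1 ?conjC0.
Qed.

Lemma gram_mul d N (a : 'M[C]_d) (t : 'M[C]_(d, N)) :
  gram (a *m t) = `|\det a| ^+ 2 * gram t.
Proof.
rewrite /gram adjM -mulmxA det_mulmx mulmxA det_mulmx det_adj normCK.
by rewrite [X in _ * X]mulrC mulrA.
Qed.

Lemma gram_unitary d N (q : 'M[C]_(d, N)) : q \is unitarymx -> gram q = 1.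
Proof. by move=> /unitarymxP uq; rewrite /gram uq det1. Qed.

Lemma gram_mulr_unitary d N (t : 'M[C]_(d, N)) (u : 'M[C]_N) :
  u \is unitarymx -> gram (t *m u) = gram t.
Proof. by move=> uu; rewrite /gram adjM mulmxA mulmxtVK. Qed.

Lemma gram_rank_lt d N (t : 'M[C]_(d, N)) : (\rank t < d)%N -> gram t = 0.
Proof.
move=> rt; apply/eqP; rewrite -[_ == 0]negbK -unitfE -[_ \is a _]/(_ \in unitmx).
rewrite -row_free_unit /row_free neq_ltn.
by rewrite (leq_ltn_trans (mxrankM_maxl _ _)).
Qed.

Lemma unitary_factor d N (t : 'M[C]_(d, N)) : row_free t ->
  exists2 q : 'M[C]_(d, N), q \is unitarymx & exists2 a, a \in unitmx & t = a *m q.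
Proof.
move=> ft; have dN : (d <= N)%N by rewrite -(eqP ft) rank_leq_col.
exists (schmidt t); first exact: schmidt_unitarymx.
have /submxP[a ta] := schmidt_sub t; exists a => //.
rewrite -row_free_unit -row_leq_rank -{1}(eqP ft) {1}ta; exact: mxrankM_maxl.
Qed.

Lemma gram_gt0 d N (t : 'M[C]_(d, N)) : row_free t -> 0 < gram t.
Proof.
case/unitary_factor => q uq [a ua ->]; rewrite gram_mul gram_unitary // mulr1.
by rewrite exprn_gt0 // normr_gt0 -unitfE.
Qed.

(** The rows and columns with nonzero entry form an invertible diagonal block. *)
Lemma card_diag_rank n (e : 'rV[C]_n) :
  (#|[pred j | e 0%R j != 0%R]| <= \rank (diag_mx e))%N.
Proof.
set S := [pred j | _]; pose X : 'M[C]_(#|S|, n) := \matrix_(i, j) (enum_val i == j)%:R.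
have XD : X *m diag_mx e *m X^T = diag_mx (\row_i e 0 (enum_val i)).
  apply/matrixP => i j; rewrite mul_mx_diag !mxE (bigD1 (enum_val j)) //= !mxE eqxx mulr1.
  rewrite big1 ?addr0 => [|k kj]; last by rewrite !mxE [enum_val j == k]eq_sym (negbTE kj) mulr0.
  have -> : (enum_val i == enum_val j) = (i == j).
    by apply/eqP/eqP => [/enum_val_inj|->].
  by case: eqP => [->|]; rewrite ?mul1r ?mul0r.
have uD : diag_mx (\row_i e 0 (enum_val i)) \in unitmx (n := #|S|).
  rewrite unitmxE det_diag unitfE; apply/prodf_neq0 => i _; rewrite mxE.
  by have := enum_valP i; rewrite inE.
move: uD; rewrite -row_free_unit -row_leq_rank -XD => /leq_trans; apply.
by rewrite (leq_trans (mxrankM_maxl _ _)) // mxrankM_maxr.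
Qed.

Lemma hermitian_spectral n (A : 'M[C]_n) : A^t* = A ->
  exists2 u : 'M[C]_n, u \is unitarymx & exists e, A = u^t* *m diag_mx e *m u.
Proof.
move=> hA; have /orthomx_spectralP AE : A \is normalmx by apply/normalmxP; rewrite hA.
exists (spectralmx A); first exact: spectral_unitarymx.
by exists (spectral_diag A); rewrite -invmx_unitary ?spectral_unitarymx.
Qed.

Lemma mulmx_stretch N k tau d (t : 'M[C]_(d, N)) :
  t *m stretch N k tau = t + (tau - 1) *: (t *m cproj N k).
Proof.
rewrite !mul_mx_diag; apply/matrixP => i j; rewrite !mxE.
by case: leqP => _ /=; ring.
Qed.

Lemma unitary_row_norm d N (q : 'M[C]_(d, N)) i : q \is unitarymx ->
  \sum_j `|q i j| ^+ 2 = 1.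
Proof.
move=> /unitarymxP/matrixP/(_ i i); rewrite !mxE eqxx => H.
rewrite -[1]/(true%:R) -H; by apply: eq_bigr => j _; rewrite !mxE normCK.
Qed.

(* In an orthonormal basis of the row space diagonalizing the compression of
   the projection, at most [rk k t] directions are stretched. *)
Lemma gram_stretch d N k (tau : C) (t : 'M[C]_(d, N)) : 1 <= tau ->
  gram (t *m stretch N k tau) <= tau ^+ (2 * rk k t) * gram t.
Proof.
move=> tau1; have tau0 : 0 <= tau by apply: le_trans tau1.
have [rt|] := ltnP (\rank t) d.
  rewrite (gram_rank_lt rt) mulr0 gram_rank_lt //.
  by rewrite (leq_ltn_trans (mxrankM_maxl _ _)).
rewrite row_leq_rank => /unitary_factor[q uq [a ua ->]].
rewrite -mulmxA !gram_mul (gram_unitary uq) mulr1 mulrC.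
rewrite ler_pM2r ?exprn_gt0 ?normr_gt0 -?unitfE //.
have -> : rk k (a *m q) = rk k q.
  by rewrite /rk -mulmxA (eqmxMfull _ (_ : row_full a)) // row_full_unit.
set H := q *m cproj N k *m q^t*.
have hH : H^t* = H by rewrite /H !adjM adj_cproj trmxCK mulmxA.
have [u uu [e He]] := hermitian_spectral hH.
have tau2 : 0 <= tau ^+ 2 - 1 by rewrite subr_ge0 exprn_ege1.
(* As the projection is idempotent and [q] has orthonormal rows, the Gram matrix is 1 + (tau^2 - 1)
   H; its determinant is read off the eigenvalues of H. *)
have gE : gram (q *m stretch N k tau) = \prod_j (1 + (tau ^+ 2 - 1) * e 0 j).
  have -> : gram (q *m stretch N k tau) = \det (1%:M + (tau ^+ 2 - 1) *: H).
    have cE : (tau - 1)^* = tau - 1 by apply/CrealP; rewrite ger0_real // subr_ge0.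
    congr (\det _); rewrite mulmx_stretch adjD adjZ adjM adj_cproj cE.
    rewrite mulmxDl !mulmxDr (unitarymxP uq) -!scalemxAl -!scalemxAr !mulmxA.
    rewrite -[q *m _ *m cproj N k]mulmxA cproj_idem -/H -addrA; congr (_ + _).
    by rewrite scalerA -!scalerDl; congr (_ *: _); ring.
  rewrite He; have u1 : u^t* *m u = 1%:M.
    by apply: mulmx1C; apply/unitarymxP.
  have -> : 1%:M + (tau ^+ 2 - 1) *: (u^t* *m diag_mx e *m u) =
     u^t* *m diag_mx (\row_j (1 + (tau ^+ 2 - 1) * e 0 j)) *m u.
    have -> : diag_mx (\row_j (1 + (tau ^+ 2 - 1) * e 0 j)) =
       1%:M + (tau ^+ 2 - 1) *: diag_mx e.
      by apply/matrixP => i j; rewrite !mxE; case: (i == j); rewrite ?mulr1n ?mulr0n ?mulr0 ?addr0.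
    by rewrite mulmxDr mulmx1 mulmxDl u1 -scalemxAr -scalemxAl.
  rewrite !det_mulmx mulrC mulrA -det_mulmx (unitarymxP uu) det1 mul1r det_diag.
  by apply: eq_bigr => j _; rewrite mxE.
have eE j : e 0 j = \sum_(l < N | (k <= l)%N) `|(u *m q) j l| ^+ 2.
  have : (u *m H *m u^t*) j j = e 0 j.
    rewrite He !mulmxA (unitarymxP uu) mul1mx -mulmxA (unitarymxP uu) mulmx1.
    by rewrite mxE eqxx.
  move=> <-; rewrite /H !mulmxA -!mulmxA -adjM !mulmxA mul_mx_diag.
  move: (u *m q) => w; rewrite mxE [RHS]big_mkcond /=; apply: eq_bigr => l _.
  by rewrite !mxE normCK; case: leqP => _ /=; rewrite ?mulr1 // mulr0 mul0r.
have e0 j : 0 <= e 0 j by rewrite eE sumr_ge0 // => l _; rewrite exprn_ge0.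
have e1 j : e 0 j <= 1.
  rewrite eE -(unitary_row_norm j (mul_unitarymx uu uq)) [X in _ <= X](bigID (fun l : 'I_N => (k <= l)%N)) /=.
  by rewrite lerDl sumr_ge0 // => l _; rewrite exprn_ge0.
rewrite gE.
(* The eigenvalues lie in [0, 1]: the zero ones contribute the factor 1, the others at most tau^2,
   and at most rank H of them are nonzero. *)
apply: (@le_trans _ _ (\prod_j (if e 0 j != 0 then tau ^+ 2 else 1))).
  apply: ler_prod => j _; rewrite addr_ge0 ?mulr_ge0 //=.
  case: eqP => /= [->|_]; first by rewrite mulr0 addr0.
  by rewrite -lerBrDl ler_piMr.
rewrite -big_mkcond prodr_const exprM.
apply: ler_weXn2l; first by rewrite exprn_ege1.
apply: leq_trans (card_diag_rank e) _.
have -> : diag_mx e = u *m H *m u^t*.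
  by rewrite He !mulmxA (unitarymxP uu) mul1mx -mulmxA (unitarymxP uu) mulmx1.
rewrite (leq_trans (mxrankM_maxl _ _)) // (leq_trans (mxrankM_maxr _ _)) //.
exact: mxrankM_maxl.
Qed.
End Volume.

Section Weights.
Variable R : realType.
Local Notation C := R[i].
Local Notation cexp a := ((expR a)%:C)%C.
Implicit Types (s : seq (nat * R)).

Definition stretches N s : 'M[C]_N :=
  foldr (fun p A => stretch N p.1 (cexp p.2) *m A) 1%:M s.

Definition level d N s (t : 'M[C]_(d, N)) : R :=
  \sum_(p <- s) p.2 * (rk p.1 t)%:R.

Lemma stretch_cproj N j k (tau : C) :
  stretch N j tau *m cproj C N k = cproj C N k *m stretch N j tau.
Proof. by rewrite !mulmx_diag; congr diag_mx; apply/rowP => i; rewrite !mxE mulrC. Qed.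

Lemma stretch_unit N k (tau : C) : tau != 0 -> stretch N k tau \in unitmx.
Proof.
move=> tau0; rewrite unitmxE det_diag unitfE; apply/prodf_neq0 => i _; rewrite mxE.
by case: ifP; rewrite ?oner_eq0.
Qed.

Lemma rk_stretch d N j k (tau : C) (t : 'M[C]_(d, N)) : tau != 0 ->
  rk k (t *m stretch N j tau) = rk k t.
Proof.
move=> tau0; rewrite /rk -mulmxA stretch_cproj mulmxA mxrankMfree //.
by rewrite row_free_unit stretch_unit.
Qed.

Lemma cexp_neq0 (a : R) : cexp a != 0.
Proof. by rewrite fmorph_eq0 gt_eqF ?expR_gt0. Qed.

(** Stretches are diagonal and invertible, so each leaves the ranks seen by the next ones unchanged
    and the exponents add up. *)
Lemma gram_stretches d N s (t : 'M[C]_(d, N)) : all (fun p => 0 <= p.2) s ->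
  gram (t *m stretches N s) <= cexp (2 * level s t) * gram t.
Proof.
elim: s t => [|[k a] s IH] t /=.
  by rewrite mulmx1 /level big_nil mulr0 expR0 mul1r.
case/andP => a0 s0; rewrite mulmxA; apply: le_trans (IH _ s0) _.
have -> : level s (t *m stretch N k (cexp a)) = level s t.
  by apply: eq_bigr => p _; rewrite rk_stretch ?cexp_neq0.
rewrite [in leRHS]/level big_cons -/(level s t) mulrDr expRD rmorphM /= -mulrA.
rewrite [X in _ <= X]mulrCA.
apply: ler_wpM2l; first by rewrite lecR expR_ge0.
have -> : cexp (2 * (a * (rk k t)%:R)) = cexp a ^+ (2 * rk k t).
  by rewrite -rmorphXn /= -expRM_natl natrM; congr (cexp _); ring.
by apply: gram_stretch; rewrite -[1]/(1%:C)%C lecR -expR0 ler_expR.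
Qed.

Lemma stretches_diag N s : stretches N s =
  diag_mx (\row_(j < N) cexp (\sum_(p <- s | (p.1 <= j)%N) p.2)).
Proof.
elim: s => [|[k a] s IH] /=.
  by apply/matrixP => i j; rewrite !mxE big_nil expR0.
rewrite IH mulmx_diag; congr diag_mx; apply/rowP => j; rewrite !mxE big_cons /=.
by case: leqP => _; rewrite ?mul1r // expRD rmorphM.
Qed.

(** The indices at which the diagonal weights jump, with the heights of the jumps; the chamber is
    where all jumps are nonnegative. For N = 6 the indices 3 and N - 3 coincide, and the jump 2z
    from -z to z is entered as two halves. *)
Definition steps N (v : 'rV[R]_3) : seq (nat * R) :=
  [:: (1%N, v 0 0 - v 0 1); ((N - 1)%N, v 0 0 - v 0 1);
      (2%N, v 0 1 - v 0 2); ((N - 2)%N, v 0 1 - v 0 2);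
      (3%N, v 0 2); ((N - 3)%N, v 0 2)].

(* The diagonal matrix exp(-x, -y, -z, 0, ..., 0, z, y, x); locked, as are other
   matrices below, to keep unification from unfolding it. *)
Definition weight N (v : 'rV[R]_3) : 'M[C]_N :=
  locked (cexp (- v 0 0) *: stretches N (steps N v)).

Lemma weightE N v : weight N v = cexp (- v 0 0) *: stretches N (steps N v).
Proof. by rewrite /weight -lock. Qed.

(** By [gram_weight] this bounds the logarithm of the factor by which the weight matrix expands
    volumes in the row space; by [slope_leads] it is the sum of the weights at the positions of that
    space. *)
Definition slope d N (v : 'rV[R]_3) (t : 'M[C]_(d, N)) : R :=
  level (steps N v) t - v 0 0 * d%:R.

Lemma chamber_steps N v : chamber v -> all (fun p => 0 <= p.2) (steps N v).
Proof.
by case=> h1 h2 h3 /=; rewrite !subr_ge0 h1 h2 h3.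
Qed.

Lemma gram_weight d N v (t : 'M[C]_(d, N)) : chamber v ->
  gram (t *m weight N v) <= cexp (2 * slope v t) * gram t.
Proof.
move=> cv; rewrite weightE -scalemxAr -mul_scalar_mx gram_mul det_scalar.
rewrite ger0_norm ?exprn_ge0 ?lecR ?expR_ge0 //.
apply: le_trans (ler_wpM2l _ (gram_stretches t (chamber_steps N cv))) _.
  by rewrite !exprn_ge0 // lecR expR_ge0.
rewrite mulrA -!rmorphXn -rmorphM /=.
rewrite le_eqVlt; apply/orP; left; apply/eqP; congr (_%:C%C * _).
rewrite -exprM -expRM_natl -expRD; congr expR; rewrite /slope natrM.
by clear; move: (level _ _) (v 0 0) => l x; ring.
Qed.

Definition wcoord N (v : 'rV[R]_3) (j : nat) : R :=
  \sum_(p <- steps N v | (p.1 <= j)%N) p.2 - v 0 0.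

Lemma weight_diag N v : weight N v = diag_mx (\row_(j < N) cexp (wcoord N v j)).
Proof.
rewrite weightE stretches_diag -linearZ /=; congr diag_mx; apply/rowP => j.
by rewrite !mxE -rmorphM /= -expRD addrC.
Qed.
End Weights.

(** * Facet inequalities from incidences *)

Section Subspaces.
Variables (F : fieldType) (N : nat).
Implicit Types (T U V W X Y Z : 'M[F]_N).

(** Rows of [U] outside [W] are added one by one, each raising the dimension by one. *)
Lemma subspace_between W U m : (W <= U)%MS -> (\rank W <= m <= \rank U)%N ->
  exists T, [/\ (W <= T)%MS, (T <= U)%MS & \rank T = m].
Proof.
move=> WU /andP[]; move: {2}(m - \rank W)%N (erefl (m - \rank W)%N) => n.
elim: n W WU => [|n IH] W WU nE Wm mU.
  by exists W; split=> //; apply/eqP; rewrite eqn_leq Wm /= -subn_eq0 nE.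
have ltW : (\rank W < m)%N by rewrite -subn_gt0 nE.
have /row_subPn[i iW] : ~~ (U <= W)%MS.
  by apply/negP => /mxrankS; rewrite leqNgt (leq_trans ltW mU).
have rW' : \rank (W + row i U)%MS = (\rank W).+1.
  apply/eqP; rewrite eqn_leq; apply/andP; split.
    have := mxrank_adds_leqif W (row i U); have := rank_leq_row (row i U).
    by move=> r1 [r2 _]; lia.
  by apply: rank_ltmx; rewrite ltmxE addsmxSl addsmx_sub submx_refl /= iW.
have [||||T [WT TU rT]] := IH (W + row i U)%MS.
- by rewrite addsmx_sub WU row_sub.
- by rewrite rW' subnS nE.
- by rewrite rW'.
- exact: mU.
by exists T; split=> //; apply: submx_trans (addsmxSl _ _) WT.
Qed.

Lemma exists_line X : (0 < \rank X)%N -> exists L : 'M[F]_N, (L <= X)%MS /\ \rank L = 1%N.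
Proof.
move=> X0; have [|L [_ LX rL]] := @subspace_between 0 X 1%N (sub0mx N X).
  by rewrite mxrank0 X0.
by exists L.
Qed.

Lemma rank_cap_ge m T X (W : 'M[F]_(m, N)) : (W <= T)%MS -> (W <= X)%MS ->
  (\rank W <= \rank (T :&: X)%MS)%N.
Proof. by move=> WT WX; apply: mxrankS; rewrite sub_capmx WT. Qed.

Lemma rank_cap_lower X Y U : (X <= U)%MS -> (Y <= U)%MS ->
  (\rank X + \rank Y <= \rank U + \rank (X :&: Y)%MS)%N.
Proof.
move=> XU YU; rewrite -mxrank_sum_cap leq_add2r; apply: mxrankS.
by rewrite addsmx_sub XU.
Qed.

Lemma rank_add_le X Y : (\rank (X + Y)%MS <= \rank X + \rank Y)%N.
Proof. exact: mxrank_adds_leqif. Qed.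

(* A plane in [U] meeting three subspaces of [U]: join a line of [X] with a
   point of [Z] lying on the join of that line and [Y]. *)
Lemma plane_meeting X Y Z U :
  (X <= U)%MS -> (Y <= U)%MS -> (Z <= U)%MS -> (1 < \rank U)%N ->
  (0 < \rank X)%N -> (0 < \rank Y)%N -> (0 < \rank Z)%N ->
  (\rank U <= \rank Y + \rank Z)%N ->
  exists T, [/\ (T <= U)%MS, \rank T = 2%N, (0 < \rank (T :&: X)%MS)%N,
    (0 < \rank (T :&: Y)%MS)%N & (0 < \rank (T :&: Z)%MS)%N].
Proof.
move=> XU YU ZU U2 /exists_line[l [lX rl]] Y0 Z0 YZ.
have finish l1 l2 l3 : (l1 <= X)%MS -> (l2 <= Y)%MS -> (l3 <= Z)%MS ->
    (0 < \rank l1)%N -> (0 < \rank l2)%N -> (0 < \rank l3)%N ->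
    (\rank (l1 + l2 + l3)%MS <= 2)%N ->
    exists T, [/\ (T <= U)%MS, \rank T = 2%N, (0 < \rank (T :&: X)%MS)%N,
      (0 < \rank (T :&: Y)%MS)%N & (0 < \rank (T :&: Z)%MS)%N].
  move=> l1X l2Y l3Z l10 l20 l30 r2.
  have [||T [WT TU rT]] := @subspace_between (l1 + l2 + l3)%MS U 2%N.
  - rewrite !addsmx_sub (submx_trans l1X XU) (submx_trans l2Y YU).
    by rewrite (submx_trans l3Z ZU).
  - by rewrite r2 U2.
  move: WT; rewrite !addsmx_sub => /andP[/andP[l1T l2T] l3T].
  exists T; split=> //.
  - exact: leq_trans l10 (rank_cap_ge l1T l1X).
  - exact: leq_trans l20 (rank_cap_ge l2T l2Y).
  - exact: leq_trans l30 (rank_cap_ge l3T l3Z).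
(* In the special positions where [l] already lies in [Y], or below in [Z], one further line is
   enough. *)
have [lY|nlY] := boolP (l <= Y)%MS.
  have [m [mZ rm]] := exists_line Z0.
  apply: (finish _ _ _ l l m) => //; rewrite ?rl ?rm //.
  apply: (@leq_trans (\rank (l + m)%MS)); last by rewrite (leq_trans (rank_add_le _ _)) ?rl ?rm.
  by apply: mxrankS; rewrite !addsmx_sub ?addsmxSl ?addsmxSr.
have ltY : (\rank Y < \rank (Y + l)%MS)%N.
  by apply: rank_ltmx; rewrite ltmxE addsmxSl addsmx_sub submx_refl /= nlY.
have cap0 : (0 < \rank ((Y + l) :&: Z)%MS)%N.
  have YlU : (Y + l <= U)%MS by rewrite addsmx_sub YU (submx_trans lX XU).
  have := rank_cap_lower YlU ZU; lia.
have [lZ|nlZ] := boolP (l <= Z)%MS.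
  have [m [mY rm]] := exists_line Y0.
  apply: (finish _ _ _ l m l) => //; rewrite ?rl ?rm //.
  apply: (@leq_trans (\rank (l + m)%MS)); last by rewrite (leq_trans (rank_add_le _ _)) ?rl ?rm.
  by apply: mxrankS; rewrite !addsmx_sub ?addsmxSl ?addsmxSr.
have [z [zc rz]] := exists_line cap0.
move: zc; rewrite sub_capmx => /andP[zYl zZ].
(* The plane [z + l] lies in [Y + l], in which [Y] has codimension at most one, so it meets [Y]. *)
have zl : (0 < \rank ((z + l)%MS :&: Y)%MS)%N.
  have rzl : \rank (z + l)%MS = 2%N.
    apply/eqP; rewrite eqn_leq (leq_trans (rank_add_le _ _)) ?rz ?rl //=.
    rewrite -{1}rz; apply: rank_ltmx; rewrite ltmxE addsmxSl addsmx_sub submx_refl /=.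
    apply: contra nlZ => lz; exact: submx_trans lz zZ.
  have zlYl : (z + l <= Y + l)%MS by rewrite addsmx_sub zYl addsmxSr.
  have := rank_cap_lower zlYl (addsmxSl Y l).
  have := rank_add_le Y l; rewrite rl rzl.
  by move: (\rank _) (\rank _) (\rank _) => a b c; lia.
have [y [yc ry]] := exists_line zl.
move: yc; rewrite sub_capmx => /andP[yzl yY].
apply: (finish _ _ _ l y z) => //; rewrite ?rl ?ry ?rz //.
apply: (@leq_trans (\rank (z + l)%MS)).
  by apply: mxrankS; rewrite !addsmx_sub addsmxSr yzl addsmxSl.
by apply: leq_trans (rank_add_le _ _) _; rewrite rl rz.
Qed.

Lemma plane_between X Z : (X <= Z)%MS -> (\rank X <= 2)%N -> (1 < \rank Z)%N ->
  exists T, [/\ (X <= T)%MS, (T <= Z)%MS & \rank T = 2%N].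
Proof. by move=> XZ X2 Z2; apply: subspace_between XZ _; rewrite X2 Z2. Qed.
End Subspaces.

Lemma leq_sub3 N : (6 <= N -> 3 <= N - 3)%N. Proof. lia. Qed.

Lemma leq_subl_swap N k x y : (k <= N -> x + (N - k) <= N + y -> x <= y + k)%N.
Proof. lia. Qed.

Lemma leq_cap_arith N j k x y : (x <= N -> x + y = j + k -> j + k - N <= y)%N.
Proof. lia. Qed.

Section Dims.
Variables (F : fieldType) (N : nat).
Implicit Types (T : 'M[F]_N) (A : nat -> 'M[F]_N).

Definition is_flag A := (forall k, (k <= N)%N -> \rank (A k) = k) /\
  (forall j k, (j <= k)%N -> (A j <= A k)%MS).

(** The indices are those of [steps]: the slope depends on the flag only through them. *)
Definition dims T A : seq nat :=
  [seq \rank (T :&: A k)%MS | k <- [:: 1; 2; 3; N - 3; N - 2; N - 1]%N].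

Lemma dims_facts A T : (6 <= N)%N -> is_flag A ->
  [/\ nth 0%N (dims T A) 0 <= nth 0%N (dims T A) 1,
      nth 0%N (dims T A) 1 <= nth 0%N (dims T A) 2,
      nth 0%N (dims T A) 2 <= nth 0%N (dims T A) 3,
      nth 0%N (dims T A) 3 <= nth 0%N (dims T A) 4
    & nth 0%N (dims T A) 4 <= nth 0%N (dims T A) 5]%N /\
  [/\ \rank T <= nth 0%N (dims T A) 3 + 3,
      \rank T <= nth 0%N (dims T A) 4 + 2
    & \rank T <= nth 0%N (dims T A) 5 + 1]%N.
Proof.
move=> N6 [rA lA].
have mono j k : (j <= k)%N -> (\rank (T :&: A j)%MS <= \rank (T :&: A k)%MS)%N.
  by move=> jk; apply: mxrankS; apply: capmxS (submx_refl _) (lA _ _ jk).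
have low k : (k <= N)%N -> (\rank T + k <= N + \rank (T :&: A k)%MS)%N.
  move=> kN; rewrite -{1}(rA k kN) -mxrank_sum_cap leq_add2r; exact: rank_leq_col.
split; split=> /=; try by apply: mono; rewrite ?leq_sub2l // leq_sub3.
- by apply: leq_subl_swap (low _ (leq_subr _ _)); apply: leq_trans N6.
- by apply: leq_subl_swap (low _ (leq_subr _ _)); apply: leq_trans N6.
- by apply: leq_subl_swap (low _ (leq_subr _ _)); apply: leq_trans N6.
Qed.

Lemma cap_flags A B j k : is_flag A -> is_flag B -> (j <= N)%N -> (k <= N)%N ->
  (j + k - N <= \rank (A j :&: B k)%MS)%N.
Proof.
move=> [rA _] [rB _] jN kN; apply: leq_cap_arith (rank_leq_col (A j + B k)%MS) _.
by rewrite mxrank_sum_cap rA // rB.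
Qed.
End Dims.

Section Cost.
Variable R : realType.
Local Notation C := R[i].
Implicit Types (v : 'rV[R]_3).

(** The slope in terms of intersection dimensions instead of ranks. In the chamber it decreases when
    these dimensions grow ([cost_le]), so lower bounds on them suffice below. *)
Definition costr (x y z : R) (d : nat) (n : seq nat) : R :=
  (x - y) * ((2 * d)%:R - (nth 0%N n 0)%:R - (nth 0%N n 5)%:R)
  + (y - z) * ((2 * d)%:R - (nth 0%N n 1)%:R - (nth 0%N n 4)%:R)
  + z * ((2 * d)%:R - (nth 0%N n 2)%:R - (nth 0%N n 3)%:R) - x * d%:R.

Lemma costr_codim (x y z : R) d r1 r2 r3 r4 r5 r6 n1 n2 n3 n4 n5 n6 :
  r1%:R = d%:R - n1%:R :> R -> r2%:R = d%:R - n2%:R :> R ->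
  r3%:R = d%:R - n3%:R :> R -> r4%:R = d%:R - n4%:R :> R ->
  r5%:R = d%:R - n5%:R :> R -> r6%:R = d%:R - n6%:R :> R ->
  (x - y) * (r1%:R + r6%:R) + (y - z) * (r2%:R + r5%:R) + z * (r3%:R + r4%:R) - x * d%:R
  = costr x y z d [:: n1; n2; n3; n4; n5; n6].
Proof. by move=> -> -> -> -> -> ->; rewrite /costr /= (natrM _ 2 d); ring. Qed.

Definition cost v := costr (v 0 0) (v 0 1) (v 0 2).

Lemma cost_le v d m n : chamber v -> all2 leq m n -> size m = 6%N -> size n = 6%N ->
  cost v d n <= cost v d m.
Proof.
rewrite /cost; case; move: (v 0 0) (v 0 1) (v 0 2) => x y z h1 h2 h3.
case: m => [|m0 [|m1 [|m2 [|m3 [|m4 [|m5 [|]]]]]]] //.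
case: n => [|n0 [|n1 [|n2 [|n3 [|n4 [|n5 [|]]]]]]] //=.
case/and5P=> a0 a1 a2 a3 /andP[a4 /andP[a5 _]] _ _; rewrite /costr /=.
rewrite -!(ler_nat R) in a0 a1 a2 a3 a4 a5.
rewrite lerD2r; apply: lerD; [apply: lerD|]; apply: ler_wpM2l; rewrite ?subr_ge0 //; lra.
Qed.

Variable N : nat.
Implicit Types (c : 'M[C]_N).

Definition flag c k : 'M[C]_N := kermx (c *m cproj C N k).

Lemma cproj_copid k : cproj C N k = copid_mx k.
Proof.
apply/matrixP => i j; rewrite !mxE; have [->|ij] := eqVneq i j.
  by rewrite eqxx mulr1n andTb; case: leqP => _; rewrite ?subr0 ?subrr.
have -> : (i == j :> nat) = false by apply/negbTE; rewrite val_eqE.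
by rewrite mulr0n subr0.
Qed.

Lemma flagP c : c \in unitmx -> is_flag (flag c).
Proof.
move=> uc; split=> [k kN|j k jk].
  rewrite mxrank_ker (eqmxMfull _ (_ : row_full c)) ?row_full_unit //.
  by rewrite cproj_copid rank_copid_mx // subKn.
apply/sub_kermxP.
have -> : cproj C N k = cproj C N j *m cproj C N k.
  rewrite mulmx_diag; congr diag_mx; apply/rowP => i; rewrite !mxE.
  by case: leqP => [ki|_]; rewrite ?mulr0 // (leq_trans jk ki) mulr1.
by rewrite [c *m _]mulmxA mulmxA mulmx_ker mul0mx.
Qed.

Lemma rk_flag d (t : 'M[C]_(d, N)) c k : row_free t ->
  (rk k (t *m c) + \rank (t :&: flag c k)%MS)%N = d.
Proof. by move=> /eqP ft; rewrite /rk -mulmxA mxrank_mul_ker ft. Qed.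

Lemma slope_rk d (t : 'M[C]_(d, N)) v : slope v t =
  (v 0 0 - v 0 1) * ((rk 1 t)%:R + (rk (N - 1) t)%:R) +
  (v 0 1 - v 0 2) * ((rk 2 t)%:R + (rk (N - 2) t)%:R) +
  v 0 2 * ((rk 3 t)%:R + (rk (N - 3) t)%:R) - v 0 0 * d%:R.
Proof.
rewrite /slope /level /steps !big_cons big_nil /=.
move: (rk 1 _) (rk 2 _) (rk 3 _) (rk (N - 3) _) (rk (N - 2) _) (rk (N - 1) _).
by move: (v 0 0) (v 0 1) (v 0 2) => *; ring.
Qed.

Lemma slope_cost d (t : 'M[C]_(d, N)) (T : 'M[C]_N) v c : row_free t -> (t :=: T)%MS ->
  slope v (t *m c) = cost v d (dims T (flag c)).
Proof.
move=> ft tT.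
have E k : (rk k (t *m c))%:R = d%:R - (\rank (T :&: flag c k)%MS)%:R :> R.
  have := congr1 (fun n => n%:R : R) (rk_flag c k ft).
  rewrite natrD (cap_eqmx tT (eqmx_refl _)) => H.
  by rewrite -[LHS](addrK (\rank (T :&: flag c k)%MS)%:R) H.
by rewrite slope_rk; apply: costr_codim; exact: E.
Qed.

(** For a closed triangle the flags come from 1, W1 k1 and W1 k1 W2 k2. The condition is
    semistability of the three weighted flags, tested on all subspaces. *)
Definition tri v1 v2 v3 := [/\ chamber v1, chamber v2, chamber v3 &
  exists A B D, [/\ is_flag A, is_flag B, is_flag D &
    forall T : 'M[C]_N, 0 <= cost v1 (\rank T) (dims T A) +
      cost v2 (\rank T) (dims T B) + cost v3 (\rank T) (dims T D)]].

Lemma tri_slope v1 v2 v3 c1 c2 c3 : chamber v1 -> chamber v2 -> chamber v3 ->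
  c1 \in unitmx -> c2 \in unitmx -> c3 \in unitmx ->
  (forall d (t : 'M[C]_(d, N)), row_free t ->
    0 <= slope v1 (t *m c1) + slope v2 (t *m c2) + slope v3 (t *m c3)) ->
  tri v1 v2 v3.
Proof.
move=> h1 h2 h3 u1 u2 u3 H; split=> //; exists (flag c1), (flag c2), (flag c3).
split=> [||| T]; [exact: flagP | exact: flagP | exact: flagP |].
have ft := row_base_free T.
by have := H _ _ ft; rewrite !(slope_cost _ _ ft (eq_row_base T)).
Qed.

Lemma triC v1 v2 v3 : tri v1 v2 v3 -> tri v2 v1 v3.
Proof.
case=> h1 h2 h3 [A [B [D [fA fB fD H]]]]; split=> //; exists B, A, D; split=> // T.
by rewrite [cost v2 _ _ + _]addrC.
Qed.

Lemma triA v1 v2 v3 : tri v1 v2 v3 -> tri v2 v3 v1.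
Proof.
case=> h1 h2 h3 [A [B [D [fA fB fD H]]]]; split=> //; exists B, D, A; split=> // T.
by have := H T; rewrite -addrA addrC.
Qed.
End Cost.

Lemma ltn_add_subS N k : (k < N -> N < k.+1 + (N - k))%N. Proof. lia. Qed.
Lemma leq_sub_cap N j k x : (j <= N -> k + (N - j) - N <= x -> k - j <= x)%N.
Proof. lia. Qed.
Lemma subn_sub_cap N j k x : (j + k <= N -> (N - j) + (N - k) - N <= x -> N - j - k <= x)%N.
Proof. lia. Qed.

Lemma triple_arith N a s c : (3 <= N -> 3 - 1 <= a -> s <= N -> s + c = a + (N - 1) -> 1 <= c)%N.
Proof. lia. Qed.

Lemma sub_sub_gt N j k : (6 <= N -> j + k <= 5 -> 0 < N - j - k)%N. Proof. lia. Qed.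
Lemma sub_sub_gt1 N : (6 <= N -> 1 < N - 1 - 2)%N. Proof. lia. Qed.
Lemma hyperplane_arith N x : (6 <= N -> 3 + (N - 2) <= N - 1 + x -> 1 < x)%N. Proof. lia. Qed.
Lemma sum_cap_arith w c : (1 <= c -> w + c = 2 + 2 -> w <= 3)%N. Proof. lia. Qed.
Lemma cap3_arith N z za c x :
  (6 <= N -> N - 1 - 2 <= z -> z < za -> 3 - 1 <= c -> za + c <= N - 1 + x -> 0 < x)%N.
Proof. lia. Qed.
Lemma capz_arith z za x : (za <= z + 1 -> 2 + z <= za + x -> 0 < x)%N. Proof. lia. Qed.
Lemma sub_sub_gt2 N : (6 <= N -> 1 < N - 2 - 1)%N. Proof. lia. Qed.
Lemma sum_arith N a b : (6 <= N -> 3 - 1 <= a -> N - 1 - 2 <= b -> N - 1 <= a + b)%N.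
Proof. lia. Qed.
Lemma sum_arith2 N b : (6 <= N -> N - 2 - 2 <= b -> N - 2 <= 2 + b)%N.
Proof. lia. Qed.

Section Inequalities.
Variables (R : realType) (N : nat).
Hypothesis N6 : (6 <= N)%N.
Local Notation C := R[i].
Implicit Types (T X Y Z U : 'M[C]_N).

(** The dimensions forced by known lower bounds [p]: they increase along the flag, and a flag member
    of codimension c lowers the dimension [d] by at most c. *)
Definition propagate (d : nat) (p : seq nat) : seq nat :=
  let b1 := nth 0%N p 0 in let b2 := maxn b1 (nth 0%N p 1) in
  let b3 := maxn b2 (nth 0%N p 2) in
  let b4 := maxn (maxn b3 (nth 0%N p 3)) (d - 3) in
  let b5 := maxn (maxn b4 (nth 0%N p 4)) (d - 2) in
  let b6 := maxn (maxn b5 (nth 0%N p 5)) (d - 1) in [:: b1; b2; b3; b4; b5; b6].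

Lemma propagateP (F : fieldType) (T : 'M[F]_N) A p : is_flag A -> size p = 6%N ->
  all2 leq p (dims T A) -> all2 leq (propagate (\rank T) p) (dims T A).
Proof.
move=> fA; have [] := dims_facts T N6 fA; rewrite /propagate /=.
case: p => [|p1 [|p2 [|p3 [|p4 [|p5 [|p6 [|]]]]]]] //=.
case=> m1 m2 m3 m4 m5 [l3 l2 l1] _ /and5P[q1 q2 q3 q4 /and3P[q5 q6 _]].
have le1 := q1; have le2 : (maxn p1 p2 <= \rank (T :&: A 2))%N.
  by rewrite geq_max q2 andbT (leq_trans q1).
have le3 : (maxn (maxn p1 p2) p3 <= \rank (T :&: A 3))%N.
  by rewrite geq_max q3 andbT (leq_trans le2).
have le4 : (maxn (maxn (maxn (maxn p1 p2) p3) p4) (\rank T - 3) <= \rank (T :&: A (N - 3)))%N.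
  by rewrite !geq_max q4 andbT -geq_max -geq_max (leq_trans le3) //= leq_subLR addnC.
have le5 : (maxn (maxn (maxn (maxn (maxn (maxn p1 p2) p3) p4) (\rank T - 3)) p5) (\rank T - 2)
    <= \rank (T :&: A (N - 2)))%N.
  by rewrite geq_max [X in X && _]geq_max q5 (leq_trans le4) //= leq_subLR addnC.
have le6 : (maxn (maxn (maxn (maxn (maxn (maxn (maxn (maxn p1 p2) p3) p4) (\rank T - 3)) p5)
    (\rank T - 2)) p6) (\rank T - 1) <= \rank (T :&: A (N - 1)))%N.
  by rewrite geq_max [X in X && _]geq_max q6 (leq_trans le5) //= leq_subLR addnC.
by rewrite le1 le2 le3 le4 le5 le6.
Qed.

Variables (A B D : nat -> 'M[C]_N) (x1 y1 z1 x2 y2 z2 x3 y3 z3 : R).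
Hypotheses (fA : is_flag A) (fB : is_flag B) (fD : is_flag D).
Hypothesis H : forall T : 'M[C]_N, forall p1 p2 p3 : seq nat,
  size p1 = 6%N -> size p2 = 6%N -> size p3 = 6%N ->
  all2 leq p1 (dims T A) -> all2 leq p2 (dims T B) -> all2 leq p3 (dims T D) ->
  0 <= costr x1 y1 z1 (\rank T) (propagate (\rank T) p1) +
    costr x2 y2 z2 (\rank T) (propagate (\rank T) p2) +
    costr x3 y3 z3 (\rank T) (propagate (\rank T) p3).

Let le6 k : (k <= 6)%N -> (k <= N)%N. Proof. by move=> k6; apply: leq_trans N6. Qed.

Lemma dim_cap T X d : \rank T = d -> (T <= X)%MS -> (d <= \rank (T :&: X)%MS)%N.
Proof. by move=> <- TX; apply: rank_cap_ge. Qed.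

(** The source of the facet inequalities. A summand -x, -y, -z, z, y or x of a side is the weight of
    a direction of T that first appears in the flag member of index 1, 2, 3, N - 2, N - 1 or N. The
    signs of an inequality thus prescribe a position, and each proof constructs a subspace in that
    position. *)
Lemma position (p1 p2 p3 : seq nat) d T : \rank T = d ->
  size p1 = 6%N -> size p2 = 6%N -> size p3 = 6%N ->
  all2 leq p1 (dims T A) -> all2 leq p2 (dims T B) -> all2 leq p3 (dims T D) ->
  0 <= costr x1 y1 z1 d (propagate d p1) +
    costr x2 y2 z2 d (propagate d p2) + costr x3 y3 z3 d (propagate d p3).
Proof. by move=> <-; apply: H. Qed.

Ltac conclude :=
  repeat match goal with |- context [propagate ?d ?p] =>
    let e := eval vm_compute in (propagate d p) in change (propagate d p) with e end;
  rewrite /costr /=; intros; lra.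

Lemma line_AB j k : (j <= N)%N -> (k <= N)%N -> (N < j + k)%N ->
  exists T, [/\ \rank T = 1%N, (1 <= \rank (T :&: A j)%MS)%N & (1 <= \rank (T :&: B k)%MS)%N].
Proof.
move=> jN kN jk; have := cap_flags fA fB jN kN.
move/(leq_trans (_ : (1 <= j + k - N)%N)); rewrite subn_gt0 => /(_ jk)/exists_line[T [TAB rT]].
by move: TAB; rewrite sub_capmx => /andP[TA TB]; exists T; split; rewrite ?(dim_cap rT).
Qed.

Lemma tri_1 : 0 <= - x1 + x2 + x3.
Proof.
have r1 : \rank (A 1) = 1%N by apply: fA.1; apply: le6.
have h := dim_cap r1 (submx_refl (A 1)).
have := @position [:: 1; 0; 0; 0; 0; 0]%N (nseq 6 0%N) (nseq 6 0%N) _ _ r1 erefl erefl erefl.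
rewrite /dims /= h => /(_ isT isT isT); conclude.
Qed.

Lemma tri_2 : 0 <= - y1 + y2 + x3.
Proof.
have [T [rT h1 h2]] := @line_AB 2 (N - 1) (@le6 2 isT) (leq_subr _ _) (@ltn_add_subS N 1 (@le6 2 isT)).
have := @position [:: 0; 1; 0; 0; 0; 0]%N [:: 0; 0; 0; 0; 0; 1]%N (nseq 6 0%N) _ _ rT erefl erefl erefl.
rewrite /dims /= h1 h2 => /(_ isT isT isT); conclude.
Qed.

Lemma tri_3 : 0 <= - z1 + z2 + x3.
Proof.
have [T [rT h1 h2]] := @line_AB 3 (N - 2) (@le6 3 isT) (leq_subr _ _) (@ltn_add_subS N 2 (@le6 3 isT)).
have := @position [:: 0; 0; 1; 0; 0; 0]%N [:: 0; 0; 0; 0; 1; 0]%N (nseq 6 0%N) _ _ rT erefl erefl erefl.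
rewrite /dims /= h1 h2 => /(_ isT isT isT); conclude.
Qed.

Lemma tri_plane X Y Z U (p1 p2 p3 : seq nat) : (X <= U)%MS -> (Y <= U)%MS -> (Z <= U)%MS ->
  (1 < \rank U)%N -> (0 < \rank X)%N -> (0 < \rank Y)%N -> (0 < \rank Z)%N ->
  (\rank U <= \rank Y + \rank Z)%N ->
  size p1 = 6%N -> size p2 = 6%N -> size p3 = 6%N ->
  (forall T, (T <= U)%MS -> \rank T = 2%N -> (0 < \rank (T :&: X))%N ->
     (0 < \rank (T :&: Y))%N -> (0 < \rank (T :&: Z))%N ->
     [/\ all2 leq p1 (dims T A), all2 leq p2 (dims T B) & all2 leq p3 (dims T D)]) ->
  0 <= costr x1 y1 z1 2 (propagate 2 p1) +
    costr x2 y2 z2 2 (propagate 2 p2) + costr x3 y3 z3 2 (propagate 2 p3).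
Proof.
move=> XU YU ZU U2 X0 Y0 Z0 YZ s1 s2 s3 K.
have [T [TU rT h1 h2 h3]] := plane_meeting XU YU ZU U2 X0 Y0 Z0 YZ.
by have [k1 k2 k3] := K T TU rT h1 h2 h3; apply: position rT s1 s2 s3 k1 k2 k3.
Qed.

Lemma cap_pos T X Y : (X <= Y)%MS -> (0 < \rank (T :&: X)%MS)%N -> (0 < \rank (T :&: Y)%MS)%N.
Proof. by move=> XY /leq_trans; apply; apply: mxrankS; apply: capmxS. Qed.

Lemma tri_4 : 0 <= - x1 - y1 + x2 + y2 + x3 + y3.
Proof.
have r2 : \rank (A 2) = 2%N by apply: fA.1; apply: le6.
have r1 : \rank (A 1) = 1%N by apply: fA.1; apply: le6.
have h := dim_cap r2 (submx_refl (A 2)).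
have h1 := rank_cap_ge (fA.2 1%N 2%N isT) (submx_refl (A 1)); rewrite r1 in h1.
have := @position [:: 1; 2; 0; 0; 0; 0]%N (nseq 6 0%N) (nseq 6 0%N) _ _ r2 erefl erefl erefl.
rewrite /dims /= h h1 => /(_ isT isT isT); conclude.
Qed.

Let rA k : (k <= 6)%N -> \rank (A k) = k. Proof. by move=> k6; apply/fA.1/le6. Qed.
Let rAs k : \rank (A (N - k)) = (N - k)%N. Proof. exact/fA.1/leq_subr. Qed.
Let lA j k : (j <= k)%N -> (A j <= A k)%MS := fA.2 j k.
Let A1s k : (k <= 3)%N -> (A 1 <= A (N - k))%MS.
Proof.
move=> k3; apply: lA; apply: leq_trans (leq_sub2l N k3).
by apply: leq_trans (leq_sub3 N6).
Qed.
Let A3s k : (k <= 3)%N -> (A 3 <= A (N - k))%MS.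
Proof. by move=> k3; apply: lA; apply: leq_trans (leq_sub2l N k3); apply: leq_sub3. Qed.

Let cAB j k : (k <= N)%N -> (j <= 6)%N -> (j - k <= \rank (A j :&: B (N - k)))%N.
Proof. by move=> kN j6; apply: leq_sub_cap kN (cap_flags fA fB (le6 j6) (leq_subr k N)). Qed.
Let cBA j k : (k <= N)%N -> (j <= 6)%N -> (j - k <= \rank (B j :&: A (N - k)))%N.
Proof. by move=> kN j6; apply: leq_sub_cap kN (cap_flags fB fA (le6 j6) (leq_subr k N)). Qed.
Let cAD j k : (k <= N)%N -> (j <= 6)%N -> (j - k <= \rank (A j :&: D (N - k)))%N.
Proof. by move=> kN j6; apply: leq_sub_cap kN (cap_flags fA fD (le6 j6) (leq_subr k N)). Qed.
Let cDA j k : (k <= N)%N -> (j <= 6)%N -> (j - k <= \rank (D j :&: A (N - k)))%N.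
Proof. by move=> kN j6; apply: leq_sub_cap kN (cap_flags fD fA (le6 j6) (leq_subr k N)). Qed.
Let cAsDs j k : (j + k <= N)%N -> (N - j - k <= \rank (A (N - j) :&: D (N - k)))%N.
Proof.
by move=> jk; apply: subn_sub_cap jk (cap_flags fA fD (leq_subr j N) (leq_subr k N)).
Qed.
Let cAsBs j k : (j + k <= N)%N -> (N - j - k <= \rank (A (N - j) :&: B (N - k)))%N.
Proof.
by move=> jk; apply: subn_sub_cap jk (cap_flags fA fB (leq_subr j N) (leq_subr k N)).
Qed.

(* y2 + y3 >= z1: a line in the intersection of three flag members *)
Lemma tri_5 : 0 <= - z1 + y2 + y3.
Proof.
have h := @cAB 3 1 (@le6 1 isT) isT.
(* A_3 is cut by two hyperplanes, each lowering the dimension by at most one. *)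
have h' : (1 <= \rank (A 3 :&: B (N - 1) :&: D (N - 1))%MS)%N.
  have := mxrank_sum_cap (A 3 :&: B (N - 1))%MS (D (N - 1)).
  rewrite (fD.1 _ (leq_subr 1 N)); have := rank_leq_col (A 3 :&: B (N - 1) + D (N - 1))%MS.
  exact: triple_arith (@le6 3 isT) h.
have [T [TAB rT]] := exists_line h'.
move: TAB; rewrite !sub_capmx -andbA => /and3P[TA TB TD].
have h1 := dim_cap rT TA; have h2 := dim_cap rT TB; have h3 := dim_cap rT TD.
have := @position [:: 0; 0; 1; 0; 0; 0]%N [:: 0; 0; 0; 0; 0; 1]%N [:: 0; 0; 0; 0; 0; 1]%N
  _ _ rT erefl erefl erefl.
rewrite /dims /= h1 h2 h3 => /(_ isT isT isT); conclude.
Qed.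

Let rank_A1 : (0 < \rank (A 1))%N. Proof. by rewrite rA. Qed.
Let sub_gt k j : (j + k < 6)%N -> (j < N - k)%N.
Proof. by move=> jk; rewrite ltn_subRL addnC; apply: leq_trans N6. Qed.

Let sub_ge k j : (j + k <= 6)%N -> (j <= N - k)%N.
Proof.
by move=> jk; rewrite leq_subRL ?(leq_trans (leq_addl j k) (leq_trans jk N6)) // addnC (leq_trans jk).
Qed.

Lemma tri_6 : 0 <= - x1 + x2 + x3 + y1 - y2 + y3.
Proof.
have := @tri_plane (A 1) (B 2 :&: A (N - 1))%MS (A (N - 1)) (A (N - 1))
  [:: 1; 0; 0; 0; 0; 2]%N [:: 0; 1; 0; 0; 0; 0]%N (nseq 6 0%N).
have h := @cBA 2 1 (@le6 1 isT) isT.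
have h1 : (1 < N - 1)%N by apply: sub_gt.
move/(_ (@A1s 1 isT) (capmxSr _ _) (submx_refl _)); rewrite !rAs.
move=> /(_ h1 rank_A1 h (ltnW h1) (leq_addl _ _) erefl erefl erefl).
move=> K; apply: le_trans (K _) _; last by conclude.
move=> T TU rT k1 k2 k3; have k2' := cap_pos (capmxSl _ _) k2.
by split; rewrite /dims /= ?leq0n ?k1 ?k2' ?(dim_cap rT TU).
Qed.

Lemma tri_7 : 0 <= - x1 - z1 + x2 + z2 + x3 + y3.
Proof.
have := @tri_plane (A 1) (A 3 :&: B (N - 2))%MS (A 3) (A 3)
  [:: 1; 0; 2; 0; 0; 0]%N [:: 0; 0; 0; 0; 1; 0]%N (nseq 6 0%N).
have h := @cAB 3 2 (@le6 2 isT) isT.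
move/(_ (lA (isT : 1 <= 3)%N) (capmxSl _ _) (submx_refl _)); rewrite !(@rA 3 isT).
move=> /(_ isT rank_A1 h isT (leq_addl _ _) erefl erefl erefl).
move=> K; apply: le_trans (K _) _; last by conclude.
move=> T TU rT k1 k2 k3; have k2' := cap_pos (capmxSr _ _) k2.
by split; rewrite /dims /= ?k1 ?k2' ?(dim_cap rT TU).
Qed.

Lemma tri_8 : 0 <= - x1 + z1 + x2 - z2 + x3 + y3.
Proof.
have := @tri_plane (A 1) (B 3 :&: A (N - 2))%MS (A (N - 2)) (A (N - 2))
  [:: 1; 0; 0; 0; 2; 0]%N [:: 0; 0; 1; 0; 0; 0]%N (nseq 6 0%N).
have h := @cBA 3 2 (@le6 2 isT) isT.
have h1 : (1 < N - 2)%N by apply: sub_gt.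
move/(_ (@A1s 2 isT) (capmxSr _ _) (submx_refl _)); rewrite !rAs.
move=> /(_ h1 rank_A1 h (ltnW h1) (leq_addl _ _) erefl erefl erefl).
move=> K; apply: le_trans (K _) _; last by conclude.
move=> T TU rT k1 k2 k3; have k2' := cap_pos (capmxSl _ _) k2.
by split; rewrite /dims /= ?k1 ?k2' ?(dim_cap rT TU).
Qed.

Lemma tri_9 : 0 <= - x1 + y1 + x2 - z2 + x3 + z3.
Proof.
have := @tri_plane (A 1) (B 3 :&: A (N - 1))%MS (A (N - 1) :&: D (N - 2))%MS (A (N - 1))
  [:: 1; 0; 0; 0; 0; 2]%N [:: 0; 0; 1; 0; 0; 0]%N [:: 0; 0; 0; 0; 1; 0]%N.
have h := @cBA 3 1 (@le6 1 isT) isT.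
have h1 : (1 < N - 1)%N by apply: sub_gt.
have h2 := @cAsDs 1 2 (@le6 3 isT).
move/(_ (@A1s 1 isT) (capmxSr _ _) (capmxSl _ _)); rewrite !rAs.
move=> /(_ h1 rank_A1 (ltnW h) (leq_trans (@sub_sub_gt N 1 2 N6 isT) h2) (sum_arith N6 h h2) erefl erefl erefl).
move=> K; apply: le_trans (K _) _; last by conclude.
move=> T TU rT k1 k2 k3; have k2' := cap_pos (capmxSl _ _) k2; have k3' := cap_pos (capmxSr _ _) k3.
by split; rewrite /dims /= ?k1 ?k2' ?k3' ?(dim_cap rT TU).
Qed.

Lemma tri_10 : 0 <= - y1 - z1 + y2 + z2 + x3 + y3.
Proof.
have := @tri_plane (A 3 :&: B (N - 2))%MS (A 2 :&: B (N - 1))%MS (A 3 :&: B (N - 1))%MS (A 3 :&: B (N - 1))%MS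
  [:: 0; 1; 2; 0; 0; 0]%N [:: 0; 0; 0; 0; 1; 2]%N (nseq 6 0%N).
have h := @cAB 3 2 (@le6 2 isT) isT; have h1 := @cAB 2 1 (@le6 1 isT) isT.
have h2 := @cAB 3 1 (@le6 1 isT) isT.
move/(_ (capmxS (submx_refl _) (fB.2 _ _ (leq_sub2l N (isT : 1 <= 2)%N)))
  (capmxS (lA (isT : 2 <= 3)%N) (submx_refl _)) (submx_refl _)).
move=> /(_ h2 h h1 (ltnW h2) (leq_addl _ _) erefl erefl erefl).
move=> K; apply: le_trans (K _) _; last by conclude.
move=> T TU rT k1 k2 k3; move: TU; rewrite sub_capmx => /andP[TA TB].
have k1' := cap_pos (capmxSr _ _) k1; have k2' := cap_pos (capmxSl _ _) k2.
by split; rewrite /dims /= ?k1' ?k2' ?(dim_cap rT TA) ?(dim_cap rT TB).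
Qed.

Lemma tri_11 : 0 <= - y1 + z1 + y2 - z2 + x3 + y3.
Proof.
have := @tri_plane (A 2 :&: B (N - 1))%MS (B 3 :&: A (N - 2))%MS (A (N - 2) :&: B (N - 1))%MS (A (N - 2) :&: B (N - 1))%MS
  [:: 0; 1; 0; 0; 2; 0]%N [:: 0; 0; 1; 0; 0; 2]%N (nseq 6 0%N).
have h := @cAB 2 1 (@le6 1 isT) isT; have h1 := @cBA 3 2 (@le6 2 isT) isT.
have h2 := leq_trans (sub_sub_gt2 N6) (@cAsBs 2 1 (@le6 3 isT)).
move/(_ (capmxS (lA (sub_ge (isT : 2 + 2 <= 6)%N)) (submx_refl _))).
rewrite sub_capmx capmxSr (submx_trans (capmxSl _ _) (fB.2 _ _ (sub_ge (isT : 3 + 1 <= 6)%N))).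
move/(_ isT (submx_refl _)).
move=> /(_ h2 h h1 (ltnW h2) (leq_addl _ _) erefl erefl erefl).
move=> K; apply: le_trans (K _) _; last by conclude.
move=> T TU rT k1 k2 k3; move: TU; rewrite sub_capmx => /andP[TA TB].
have k1' := cap_pos (capmxSl _ _) k1; have k2' := cap_pos (capmxSl _ _) k2.
by split; rewrite /dims /= ?k1' ?k2' ?(dim_cap rT TA) ?(dim_cap rT TB).
Qed.

Lemma tri_12 : 0 <= - y1 - z1 + x2 + z2 + x3 + z3.
Proof.
have := @tri_plane (A 3 :&: B (N - 2))%MS (A 2) (A 3 :&: D (N - 2))%MS (A 3)
  [:: 0; 1; 2; 0; 0; 0]%N [:: 0; 0; 0; 0; 1; 0]%N [:: 0; 0; 0; 0; 1; 0]%N.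
have h := @cAB 3 2 (@le6 2 isT) isT; have h1 := @cAD 3 2 (@le6 2 isT) isT.
move/(_ (capmxSl _ _) (lA (isT : 2 <= 3)%N) (capmxSl _ _)); rewrite (@rA 3 isT) (@rA 2 isT).
have h2 : (3 <= 2 + \rank (A 3 :&: D (N - 2)))%N by rewrite -{1}[2%N]addn0 ltn_add2l.
move=> /(_ isT h isT h1 h2 erefl erefl erefl).
move=> K; apply: le_trans (K _) _; last by conclude.
move=> T TU rT k1 k2 k3; have k1' := cap_pos (capmxSr _ _) k1; have k3' := cap_pos (capmxSr _ _) k3.
by split; rewrite /dims /= ?k1' ?k2 ?k3' ?(dim_cap rT TU).
Qed.

Lemma tri_13 : 0 <= - y1 + z1 + x2 - z2 + x3 + z3.
Proof.
have := @tri_plane (B 3 :&: A (N - 2))%MS (A 2) (A (N - 2) :&: D (N - 2))%MS (A (N - 2))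
  [:: 0; 1; 0; 0; 2; 0]%N [:: 0; 0; 1; 0; 0; 0]%N [:: 0; 0; 0; 0; 1; 0]%N.
have h := @cBA 3 2 (@le6 2 isT) isT; have h2 := @cAsDs 2 2 (@le6 4 isT).
have h1 : (1 < N - 2)%N by apply: sub_gt.
move/(_ (capmxSr _ _) (lA (sub_ge (isT : 2 + 2 <= 6)%N)) (capmxSl _ _)); rewrite rAs (@rA 2 isT).
move=> /(_ h1 h isT (leq_trans (@sub_sub_gt N 2 2 N6 isT) h2) (sum_arith2 N6 h2) erefl erefl erefl).
move=> K; apply: le_trans (K _) _; last by conclude.
move=> T TU rT k1 k2 k3; have k1' := cap_pos (capmxSl _ _) k1; have k3' := cap_pos (capmxSr _ _) k3.
by split; rewrite /dims /= ?k1' ?k2 ?k3' ?(dim_cap rT TU).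
Qed.

Lemma tri_14 : 0 <= - x1 - y1 - z1 + x2 + y2 + z2 + x3 + y3 + z3.
Proof.
have r1 := @rA 1 isT; have r2 := @rA 2 isT; have r3 := @rA 3 isT.
have h := dim_cap r3 (submx_refl (A 3)).
have h1 := rank_cap_ge (lA (isT : 1 <= 3)%N) (submx_refl (A 1)); rewrite r1 in h1.
have h2 := rank_cap_ge (lA (isT : 2 <= 3)%N) (submx_refl (A 2)); rewrite r2 in h2.
have := @position [:: 1; 2; 3; 0; 0; 0]%N (nseq 6 0%N) (nseq 6 0%N) _ _ r3 erefl erefl erefl.
rewrite /dims /= h h1 h2 => /(_ isT isT isT); conclude.
Qed.

Lemma tri_solid (W U : 'M[C]_N) (p1 p2 p3 : seq nat) : (W <= U)%MS -> (\rank W <= 3)%N ->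
  (2 < \rank U)%N -> size p1 = 6%N -> size p2 = 6%N -> size p3 = 6%N ->
  (forall T, (W <= T)%MS -> (T <= U)%MS -> \rank T = 3%N ->
     [/\ all2 leq p1 (dims T A), all2 leq p2 (dims T B) & all2 leq p3 (dims T D)]) ->
  0 <= costr x1 y1 z1 3 (propagate 3 p1) +
    costr x2 y2 z2 3 (propagate 3 p2) + costr x3 y3 z3 3 (propagate 3 p3).
Proof.
move=> WU W3 U3 s1 s2 s3 K.
have [|T [WT TU rT]] := @subspace_between _ _ W U 3 WU; first by rewrite W3 U3.
by have [k1 k2 k3] := K T WT TU rT; apply: position rT s1 s2 s3 k1 k2 k3.
Qed.

Lemma tri_15 : 0 <= - x1 - y1 + z1 + x2 + y2 - z2 + x3 + y3 + z3.
Proof.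
have [l [lX rl]] := exists_line (@cBA 3 2 (@le6 2 isT) isT).
move: lX; rewrite sub_capmx => /andP[lB lU].
have := @tri_solid (A 2 + l)%MS (A (N - 2)) [:: 1; 2; 0; 0; 3; 0]%N [:: 0; 0; 1; 0; 0; 0]%N
  (nseq 6 0%N).
rewrite addsmx_sub lU (lA (sub_ge (isT : 2 + 2 <= 6)%N)) rAs => /(_ isT).
move=> /(_ (leq_trans (rank_add_le _ _) _)); rewrite (@rA 2 isT) rl.
move=> /(_ isT (sub_gt (isT : 2 + 2 < 6)%N) erefl erefl erefl) K.
apply: le_trans (K _) _; last by conclude.
move=> T WT TU rT; move: WT; rewrite addsmx_sub => /andP[A2T lT].
have h1 := rank_cap_ge (submx_trans (lA (isT : 1 <= 2)%N) A2T) (submx_refl (A 1)).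
have h2 := rank_cap_ge A2T (submx_refl (A 2)); have h3 := rank_cap_ge lT lB.
rewrite (@rA 1 isT) in h1; rewrite (@rA 2 isT) in h2; rewrite rl in h3.
by split; rewrite /dims /= ?h1 ?h2 ?h3 ?(dim_cap rT TU).
Qed.

Let line_b : exists b : 'M[C]_N,
  [/\ \rank b = 1%N, (b <= B 2)%MS & (b <= B (N - 2) :&: A (N - 1))%MS].
Proof.
have [b [bX rb]] := exists_line (@cBA 2 1 (@le6 1 isT) isT).
move: bX; rewrite sub_capmx => /andP[bB bU]; exists b; split=> //.
by rewrite sub_capmx bU andbT (submx_trans bB) // (fB.2 _ _ (sub_ge (isT : 2 + 2 <= 6)%N)).
Qed.

(** A_(N-2) is a hyperplane of A_(N-1), so every 3-space there meets it in a plane at least; this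
    supplies the term z1 of the last two inequalities. *)
Let hyperplane T : (T <= A (N - 1))%MS -> \rank T = 3%N -> (1 < \rank (T :&: A (N - 2)))%N.
Proof.
move=> TU rT; have := rank_cap_lower TU (lA (leq_sub2l N (isT : 1 <= 2)%N)).
by rewrite rT !rAs; apply: hyperplane_arith N6.
Qed.

Lemma tri_16 : 0 <= - x1 + y1 - z1 + x2 - y2 + z2 + x3 + y3 + z3.
Proof.
(* The planes [Q] and [P] wanted for the flags A and B are made to share the line [e], which keeps
   their sum in dimension 3. *)
have [e [eX re]] := exists_line (@cAB 3 2 (@le6 2 isT) isT).
move: eX; rewrite sub_capmx => /andP[eA eB].
have [b [rb bB bZ]] := line_b.
set U := A (N - 1) in bZ *; set Z := (B (N - 2) :&: U)%MS in bZ.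
have eZ : (e <= Z)%MS by rewrite sub_capmx eB (submx_trans eA) ?(@A3s 1).
have rZ : (1 < \rank Z)%N.
  by rewrite /Z capmxC (leq_trans (sub_sub_gt1 N6) (@cAsBs 1 2 (@le6 3 isT))).
have [Q [AQ QY rQ]] : exists T, [/\ (A 1 + e <= T)%MS, (T <= A 3)%MS & \rank T = 2%N].
  apply: plane_between; rewrite ?(@rA 3 isT) // ?addsmx_sub ?eA ?lA //.
  by rewrite (leq_trans (rank_add_le _ _)) // (@rA 1 isT) re.
have [P [bP PZ rP]] : exists T, [/\ (b + e <= T)%MS, (T <= Z)%MS & \rank T = 2%N].
  apply: plane_between; rewrite // ?addsmx_sub ?bZ ?eZ //.
  by rewrite (leq_trans (rank_add_le _ _)) // rb re.
move: AQ bP; rewrite !addsmx_sub => /andP[A1Q eQ] /andP[bP eP].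
have W3 : (\rank (Q + P)%MS <= 3)%N.
  have := mxrank_sum_cap Q P; have := rank_cap_ge eQ eP.
  by rewrite rQ rP re; apply: sum_cap_arith.
have WU : (Q + P <= U)%MS.
  by rewrite addsmx_sub (submx_trans QY) ?(@A3s 1) // (submx_trans PZ) // capmxSr.
have := @tri_solid (Q + P)%MS U [:: 1; 0; 2; 0; 0; 3]%N [:: 0; 1; 0; 0; 2; 0]%N
  (nseq 6 0%N) WU W3.
rewrite rAs; move=> /(_ (sub_gt (isT : 2 + 1 < 6)%N) erefl erefl erefl) K.
apply: le_trans (K _) _; last by conclude.
move=> T; rewrite addsmx_sub => /andP[QT PT] TU rT.
have h1 := rank_cap_ge (submx_trans A1Q QT) (submx_refl (A 1)); rewrite (@rA 1 isT) in h1.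
have h2 := rank_cap_ge QT QY; rewrite rQ in h2.
have h3 := rank_cap_ge (submx_trans bP PT) bB; rewrite rb in h3.
have h4 := rank_cap_ge PT (submx_trans PZ (capmxSl _ _)); rewrite rP in h4.
by split; rewrite /dims /= ?h1 ?h2 ?h3 ?h4 ?(dim_cap rT TU).
Qed.

Lemma tri_17 : 0 <= - x1 + y1 + z1 + x2 - y2 - z2 + x3 + y3 + z3.
Proof.
have [b [bX rb]] := exists_line (@cBA 2 1 (@le6 1 isT) isT).
move: bX; rewrite sub_capmx => /andP[bB bU].
have rZ := @cBA 3 1 (@le6 1 isT) isT.
have [P [bP PZ rP]] : exists T, [/\ (b <= T)%MS, (T <= B 3 :&: A (N - 1))%MS & \rank T = 2%N].
  apply: plane_between; rewrite ?rb // sub_capmx bU andbT.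
  by rewrite (submx_trans bB) // (fB.2 2%N 3%N isT).
move: PZ; rewrite sub_capmx => /andP[PB PU].
have := @tri_solid (A 1 + P)%MS (A (N - 1)) [:: 1; 0; 0; 0; 2; 3]%N [:: 0; 1; 2; 0; 0; 0]%N
  (nseq 6 0%N).
rewrite addsmx_sub PU (@A1s 1 isT) rAs => /(_ isT).
move=> /(_ (leq_trans (rank_add_le _ _) _)); rewrite (@rA 1 isT) rP.
move=> /(_ isT (sub_gt (isT : 2 + 1 < 6)%N) erefl erefl erefl) K.
apply: le_trans (K _) _; last by conclude.
move=> T WT TU rT; move: WT; rewrite addsmx_sub => /andP[A1T PT].
have h1 := rank_cap_ge A1T (submx_refl (A 1)); rewrite (@rA 1 isT) in h1.
have h2 := hyperplane TU rT.
have h3 := rank_cap_ge (submx_trans bP PT) bB; rewrite rb in h3.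
have h4 := rank_cap_ge PT PB; rewrite rP in h4.
by split; rewrite /dims /= ?h1 ?h2 ?h3 ?h4 ?(dim_cap rT TU).
Qed.

Lemma tri_18 : 0 <= - x1 + y1 + z1 + x2 - y2 + z2 + x3 + y3 - z3.
Proof.
have [b [rb bB bZ]] := line_b.
set U := A (N - 1) in bZ *; set Z := (B (N - 2) :&: U)%MS in bZ.
have rZ : (N - 1 - 2 <= \rank Z)%N by rewrite /Z capmxC; exact: (@cAsBs 1 2 (@le6 3 isT)).
have rZ1 : (1 < \rank Z)%N by apply: leq_trans rZ; apply: sub_sub_gt1.
have rC := @cDA 3 1 (@le6 1 isT) isT.
have A1U : (A 1 <= U)%MS by apply: (@A1s 1).
have r1 := @rA 1 isT.
(* The 3-space has to contain A_1, a plane [P] of [Z] through [b] and a line [c] of D_3, so [c] is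
   sought inside A_1 + P. *)
suff [W [P [c [[WU W3 A1W PW cW] [bP PZ rP] [cC rc]]]]] : exists W P c : 'M[C]_N,
    [/\ [/\ (W <= U)%MS, (\rank W <= 3)%N, (A 1 <= W)%MS, (P <= W)%MS & (c <= W)%MS],
      [/\ (b <= P)%MS, (P <= Z)%MS & \rank P = 2%N] & (c <= D 3)%MS /\ \rank c = 1%N].
  have := @tri_solid W U [:: 1; 0; 0; 0; 2; 3]%N [:: 0; 1; 0; 0; 2; 0]%N
    [:: 0; 0; 1; 0; 0; 0]%N WU W3.
  rewrite rAs; move=> /(_ (sub_gt (isT : 2 + 1 < 6)%N) erefl erefl erefl) K.
  apply: le_trans (K _) _; last by conclude.
  move=> T WT TU rT.
  have h1 := rank_cap_ge (submx_trans A1W WT) (submx_refl (A 1)); rewrite r1 in h1.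
  have h2 := hyperplane TU rT.
  have h3 := rank_cap_ge (submx_trans bP (submx_trans PW WT)) bB; rewrite rb in h3.
  have h4 := rank_cap_ge (submx_trans PW WT) (submx_trans PZ (capmxSl _ _)); rewrite rP in h4.
  have h5 := rank_cap_ge (submx_trans cW WT) cC; rewrite rc in h5.
  by split; rewrite /dims /= ?h1 ?h2 ?h3 ?h4 ?h5 ?(dim_cap rT TU).
have plane_b (z : 'M[C]_N) : (z <= Z)%MS -> \rank z = 1%N ->
    exists P : 'M[C]_N, [/\ (b + z <= P)%MS, (P <= Z)%MS & \rank P = 2%N].
  move=> zZ rz; apply: plane_between; rewrite // ?addsmx_sub ?bZ ?zZ //.
  by rewrite (leq_trans (rank_add_le _ _)) // rb rz.
(* If A_1 lies in [Z], the plane [P] may pass through it, and [c] is then free. *)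
have [A1Z|nA1Z] := boolP (A 1 <= Z)%MS.
  have [P [bP PZ rP]] := plane_b _ A1Z r1.
  have [c [cX rc]] := exists_line (ltnW rC).
  move: cX bP; rewrite sub_capmx addsmx_sub => /andP[cC cU] /andP[bP A1P].
  exists (P + c)%MS, P, c; split=> //; split; rewrite ?addsmxSl ?addsmxSr //.
  - by rewrite addsmx_sub cU (submx_trans PZ (capmxSr _ _)).
  - by rewrite (leq_trans (rank_add_le _ _)) // rP rc.
  - by rewrite (submx_trans A1P) ?addsmxSl.
have rZA : (\rank Z < \rank (Z + A 1)%MS)%N.
  by apply: rank_ltmx; rewrite ltmxE addsmxSl addsmx_sub submx_refl /= nA1Z.
have ZAU : (Z + A 1 <= U)%MS by rewrite addsmx_sub capmxSr A1U.
(* A line [c] of D_3 inside Z + A_1 lies in A_1 + z for some line [z] of [Z]; the plane [P] is then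
   taken through [b] and [z]. *)
have capC : (0 < \rank ((Z + A 1) :&: (D 3 :&: U))%MS)%N.
  have := rank_cap_lower ZAU (capmxSr (D 3) U); rewrite rAs.
  by apply: cap3_arith N6 rZ rZA rC.
have [c [cX rc]] := exists_line capC.
move: cX; rewrite !sub_capmx => /and3P[cZA cC cU].
have finish (z : 'M[C]_N) : (z <= Z)%MS -> \rank z = 1%N -> (c <= A 1 + z)%MS ->
  exists W P c : 'M[C]_N,
    [/\ [/\ (W <= U)%MS, (\rank W <= 3)%N, (A 1 <= W)%MS, (P <= W)%MS & (c <= W)%MS],
      [/\ (b <= P)%MS, (P <= Z)%MS & \rank P = 2%N] & (c <= D 3)%MS /\ \rank c = 1%N].
  move=> zZ rz cAz; have [P [bP PZ rP]] := plane_b _ zZ rz.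
  move: bP; rewrite addsmx_sub => /andP[bP zP].
  exists (A 1 + P)%MS, P, c; split=> //; split; rewrite ?addsmxSl ?addsmxSr //.
  - by rewrite addsmx_sub A1U (submx_trans PZ (capmxSr _ _)).
  - by rewrite (leq_trans (rank_add_le _ _)) // rP r1.
  - by rewrite (submx_trans cAz) // addsmxS.
have [cA1|ncA1] := boolP (c <= A 1)%MS.
  by apply: (finish b bZ rb); rewrite (submx_trans cA1) ?addsmxSl.
have rcA : \rank (A 1 + c)%MS = 2%N.
  apply/eqP; rewrite eqn_leq (leq_trans (rank_add_le _ _)) ?r1 ?rc //=.
  by rewrite -{1}r1; apply: rank_ltmx; rewrite ltmxE addsmxSl addsmx_sub submx_refl /= ncA1.
have cAZ : (A 1 + c <= Z + A 1)%MS by rewrite addsmx_sub addsmxSr cZA.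
have capz : (0 < \rank ((A 1 + c) :&: Z)%MS)%N.
  have := rank_cap_lower cAZ (addsmxSl Z (A 1)); have := rank_add_le Z (A 1).
  by rewrite rcA r1; apply: capz_arith.
have [z [zX rz]] := exists_line capz.
move: zX; rewrite sub_capmx => /andP[zAc zZ].
apply: (finish z zZ rz).
have nz : ~~ (z <= A 1)%MS.
  apply: contra nA1Z => zA; have : (z == A 1)%MS by rewrite -(geq_leqif (mxrank_leqif_eq zA)) r1 rz.
  by move/eqmxP => zE; rewrite -zE.
have rAz : (\rank (A 1 + c)%MS <= \rank (A 1 + z)%MS)%N.
  have : (\rank (A 1) < \rank (A 1 + z)%MS)%N.
    by apply: rank_ltmx; rewrite ltmxE addsmxSl addsmx_sub submx_refl /= nz.
  by rewrite r1 rcA.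
have sub : (A 1 + z <= A 1 + c)%MS by rewrite addsmx_sub addsmxSl zAc.
have : (A 1 + z == A 1 + c)%MS by rewrite -(geq_leqif (mxrank_leqif_eq sub)).
by case/andP => _; rewrite addsmx_sub => /andP[].
Qed.
End Inequalities.

(* One facet inequality per orbit of the permutations of the three sides, as
   coefficients of x1 x2 x3 y1 y2 y3 z1 z2 z3. *)
Definition facet_reps : seq (seq Z) := map (map ssrZ.Z_of_int) ([::
  [:: -1; 1; 1; 0; 0; 0; 0; 0; 0];
  [:: 0; 0; 1; -1; 1; 0; 0; 0; 0];
  [:: 0; 0; 1; 0; 0; 0; -1; 1; 0];
  [:: -1; 1; 1; -1; 1; 1; 0; 0; 0];
  [:: 0; 0; 0; 0; 1; 1; -1; 0; 0];
  [:: -1; 1; 1; 1; -1; 1; 0; 0; 0];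
  [:: -1; 1; 1; 0; 0; 1; -1; 1; 0];
  [:: -1; 1; 1; 0; 0; 1; 1; -1; 0];
  [:: -1; 1; 1; 1; 0; 0; 0; -1; 1];
  [:: 0; 0; 1; -1; 1; 1; -1; 1; 0];
  [:: 0; 0; 1; -1; 1; 1; 1; -1; 0];
  [:: 0; 1; 1; -1; 0; 0; -1; 1; 1];
  [:: 0; 1; 1; -1; 0; 0; 1; -1; 1];
  [:: -1; 1; 1; -1; 1; 1; -1; 1; 1];
  [:: -1; 1; 1; -1; 1; 1; 1; -1; 1];
  [:: -1; 1; 1; 1; -1; 1; -1; 1; 1];
  [:: -1; 1; 1; 1; -1; 1; 1; -1; 1];
  [:: -1; 1; 1; 1; -1; 1; 1; 1; -1];
  [:: 0; 0; 0; 0; 0; 0; 0; 0; 1];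
  [:: 0; 0; 0; 0; 0; 1; 0; 0; -1];
  [:: 0; 0; 1; 0; 0; -1; 0; 0; 0]])%Z.

Definition perms3 : seq (seq nat) :=
  [:: [:: 0; 1; 2]; [:: 0; 2; 1]; [:: 1; 0; 2]; [:: 1; 2; 0]; [:: 2; 0; 1]; [:: 2; 1; 0]]%N.

Definition permute (f : seq Z) (p : seq nat) : seq Z :=
  [seq nth Z0 f (3 * c + nth 0 p i) | c <- iota 0 3, i <- iota 0 3]%N.

Definition facets : seq (seq Z) := [seq permute f p | f <- facet_reps, p <- perms3].

Definition gens : seq (seq Z) := map (map BinInt.Z.of_nat) generators.

(** Each call descends to a proper face, and a chain of faces of a cone in dimension 9 has at most
    10 members, so the fuel 12 is enough. *)
Lemma covered_generators : covered 9 12 [::] (face_facets gens facets) gens.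
Proof. by vm_compute. Qed.

Lemma triple_eq (S T U : Type) (u : S * T * U) a b c :
  a = u.1.1 -> b = u.1.2 -> c = u.2 -> (a, b, c) = u.
Proof. by case: u => -[x y] z /= -> -> ->. Qed.

(** * Membership in the cone of the generators *)

Section Triangle.
Variable R : realType.
Implicit Types v : 'rV[R]_3.

Definition digits v1 v2 v3 : nat -> R := fun k =>
  nth 0 [:: v1 0 0; v2 0 0; v3 0 0; v1 0 1; v2 0 1; v3 0 1; v1 0 2; v2 0 2; v3 0 2] k.

Lemma rdot_permute f p v1 v2 v3 : size f = 9%N -> p \in perms3 ->
  exists w1 w2 w3, rdot (permute f p) (digits v1 v2 v3) = rdot f (digits w1 w2 w3) /\
    forall N, tri N v1 v2 v3 -> tri N w1 w2 w3.
Proof.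
case: f => [|f0 [|f1 [|f2 [|f3 [|f4 [|f5 [|f6 [|f7 [|f8 [|]]]]]]]]]] // _.
have R0 (g : seq Z) (a b c d e f h i j : R) : rdot [:: f0; f1; f2; f3; f4; f5; f6; f7; f8]
    (nth 0 [:: a; b; c; d; e; f; h; i; j]) = zR R f0 * a + (zR R f1 * b + (zR R f2 * c +
     (zR R f3 * d + (zR R f4 * e + (zR R f5 * f + (zR R f6 * h + (zR R f7 * i + (zR R f8 * j + 0)))))))).
  by [].
rewrite !inE => /or4P[|||/or3P[]] /eqP ->.
- by exists v1, v2, v3; split=> //; rewrite /digits /=; ring.
- exists v1, v3, v2; split; last by move=> N /triA/triA/triC.
  by rewrite /digits /=; ring.
- exists v2, v1, v3; split; last by move=> N /triC.
  by rewrite /digits /=; ring.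
- exists v3, v1, v2; split; last by move=> N /triA/triA.
  by rewrite /digits /=; ring.
- exists v2, v3, v1; split; last by move=> N /triA.
  by rewrite /digits /=; ring.
- exists v3, v2, v1; split; last by move=> N /triA/triC.
  by rewrite /digits /=; ring.
Qed.

Lemma tri_facet_reps N v1 v2 v3 f : (6 <= N)%N -> tri N v1 v2 v3 -> f \in facet_reps ->
  0 <= rdot f (digits v1 v2 v3).
Proof.
move=> N6 [h1 h2 h3 [A [B [D [fA fB fD H]]]]].
have K T p1 p2 p3 : size p1 = 6%N -> size p2 = 6%N -> size p3 = 6%N ->
    all2 leq p1 (dims T A) -> all2 leq p2 (dims T B) -> all2 leq p3 (dims T D) ->
    0 <= costr (v1 0 0) (v1 0 1) (v1 0 2) (\rank T) (propagate (\rank T) p1) +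
      costr (v2 0 0) (v2 0 1) (v2 0 2) (\rank T) (propagate (\rank T) p2) +
      costr (v3 0 0) (v3 0 1) (v3 0 2) (\rank T) (propagate (\rank T) p3).
  move=> s1 s2 s3 l1 l2 l3; apply: le_trans (H T) _.
  have q1 := propagateP N6 fA s1 l1; have q2 := propagateP N6 fB s2 l2.
  have q3 := propagateP N6 fD s3 l3.
  by apply: lerD; [apply: lerD|]; apply: cost_le.
case: h1 h2 h3 => [a1 b1 e1] [a2 b2 e2] [a3 b3 e3].
rewrite /digits; move: (v1 0 0) (v1 0 1) (v1 0 2) (v2 0 0) (v2 0 1) (v2 0 2)
  (v3 0 0) (v3 0 1) (v3 0 2) K a1 b1 e1 a2 b2 e2 a3 b3 e3 => x1 y1 z1 x2 y2 z2 x3 y3 z3 K.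
move=> a1 b1 e1 a2 b2 e2 a3 b3 e3.
have zm : zR R (Zneg xH) = - 1 by rewrite /zR /= NegzE mulrNz.
have zp : zR R (Zpos xH) = 1 by [].
have zz : zR R Z0 = 0 by [].
case/mapP => g; rewrite !inE => gin ->; move: gin.
case/orP => [/eqP ->|].
  have E : 0 <= - x1 + x2 + x3 
    by have E := @tri_1 R N N6 A B D x1 y1 z1 x2 y2 z2 x3 y3 z3;
      first [exact: E | exact: (E fA K) | exact: (E fA fB K) | exact: (E fA fB fD K)].
  by apply: le_trans E _; rewrite /= ?zm ?zp ?zz; lra.
case/orP => [/eqP ->|].
  have E : 0 <= - y1 + y2 + x3 
    by have E := @tri_2 R N N6 A B D x1 y1 z1 x2 y2 z2 x3 y3 z3;
      first [exact: E | exact: (E fA K) | exact: (E fA fB K) | exact: (E fA fB fD K)].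
  by apply: le_trans E _; rewrite /= ?zm ?zp ?zz; lra.
case/orP => [/eqP ->|].
  have E : 0 <= - z1 + z2 + x3 
    by have E := @tri_3 R N N6 A B D x1 y1 z1 x2 y2 z2 x3 y3 z3;
      first [exact: E | exact: (E fA K) | exact: (E fA fB K) | exact: (E fA fB fD K)].
  by apply: le_trans E _; rewrite /= ?zm ?zp ?zz; lra.
case/orP => [/eqP ->|].
  have E : 0 <= - x1 - y1 + x2 + y2 + x3 + y3 
    by have E := @tri_4 R N N6 A B D x1 y1 z1 x2 y2 z2 x3 y3 z3;
      first [exact: E | exact: (E fA K) | exact: (E fA fB K) | exact: (E fA fB fD K)].
  by apply: le_trans E _; rewrite /= ?zm ?zp ?zz; lra.
case/orP => [/eqP ->|].
  have E : 0 <= - z1 + y2 + y3 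
    by have E := @tri_5 R N N6 A B D x1 y1 z1 x2 y2 z2 x3 y3 z3;
      first [exact: E | exact: (E fA K) | exact: (E fA fB K) | exact: (E fA fB fD K)].
  by apply: le_trans E _; rewrite /= ?zm ?zp ?zz; lra.
case/orP => [/eqP ->|].
  have E : 0 <= - x1 + x2 + x3 + y1 - y2 + y3 
    by have E := @tri_6 R N N6 A B D x1 y1 z1 x2 y2 z2 x3 y3 z3;
      first [exact: E | exact: (E fA K) | exact: (E fA fB K) | exact: (E fA fB fD K)].
  by apply: le_trans E _; rewrite /= ?zm ?zp ?zz; lra.
case/orP => [/eqP ->|].
  have E : 0 <= - x1 - z1 + x2 + z2 + x3 + y3 
    by have E := @tri_7 R N N6 A B D x1 y1 z1 x2 y2 z2 x3 y3 z3;
      first [exact: E | exact: (E fA K) | exact: (E fA fB K) | exact: (E fA fB fD K)].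
  by apply: le_trans E _; rewrite /= ?zm ?zp ?zz; lra.
case/orP => [/eqP ->|].
  have E : 0 <= - x1 + z1 + x2 - z2 + x3 + y3 
    by have E := @tri_8 R N N6 A B D x1 y1 z1 x2 y2 z2 x3 y3 z3;
      first [exact: E | exact: (E fA K) | exact: (E fA fB K) | exact: (E fA fB fD K)].
  by apply: le_trans E _; rewrite /= ?zm ?zp ?zz; lra.
case/orP => [/eqP ->|].
  have E : 0 <= - x1 + y1 + x2 - z2 + x3 + z3 
    by have E := @tri_9 R N N6 A B D x1 y1 z1 x2 y2 z2 x3 y3 z3;
      first [exact: E | exact: (E fA K) | exact: (E fA fB K) | exact: (E fA fB fD K)].
  by apply: le_trans E _; rewrite /= ?zm ?zp ?zz; lra.
case/orP => [/eqP ->|].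
  have E : 0 <= - y1 - z1 + y2 + z2 + x3 + y3 
    by have E := @tri_10 R N N6 A B D x1 y1 z1 x2 y2 z2 x3 y3 z3;
      first [exact: E | exact: (E fA K) | exact: (E fA fB K) | exact: (E fA fB fD K)].
  by apply: le_trans E _; rewrite /= ?zm ?zp ?zz; lra.
case/orP => [/eqP ->|].
  have E : 0 <= - y1 + z1 + y2 - z2 + x3 + y3 
    by have E := @tri_11 R N N6 A B D x1 y1 z1 x2 y2 z2 x3 y3 z3;
      first [exact: E | exact: (E fA K) | exact: (E fA fB K) | exact: (E fA fB fD K)].
  by apply: le_trans E _; rewrite /= ?zm ?zp ?zz; lra.
case/orP => [/eqP ->|].
  have E : 0 <= - y1 - z1 + x2 + z2 + x3 + z3 
    by have E := @tri_12 R N N6 A B D x1 y1 z1 x2 y2 z2 x3 y3 z3;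
      first [exact: E | exact: (E fA K) | exact: (E fA fB K) | exact: (E fA fB fD K)].
  by apply: le_trans E _; rewrite /= ?zm ?zp ?zz; lra.
case/orP => [/eqP ->|].
  have E : 0 <= - y1 + z1 + x2 - z2 + x3 + z3 
    by have E := @tri_13 R N N6 A B D x1 y1 z1 x2 y2 z2 x3 y3 z3;
      first [exact: E | exact: (E fA K) | exact: (E fA fB K) | exact: (E fA fB fD K)].
  by apply: le_trans E _; rewrite /= ?zm ?zp ?zz; lra.
case/orP => [/eqP ->|].
  have E : 0 <= - x1 - y1 - z1 + x2 + y2 + z2 + x3 + y3 + z3 
    by have E := @tri_14 R N N6 A B D x1 y1 z1 x2 y2 z2 x3 y3 z3;
      first [exact: E | exact: (E fA K) | exact: (E fA fB K) | exact: (E fA fB fD K)].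
  by apply: le_trans E _; rewrite /= ?zm ?zp ?zz; lra.
case/orP => [/eqP ->|].
  have E : 0 <= - x1 - y1 + z1 + x2 + y2 - z2 + x3 + y3 + z3 
    by have E := @tri_15 R N N6 A B D x1 y1 z1 x2 y2 z2 x3 y3 z3;
      first [exact: E | exact: (E fA K) | exact: (E fA fB K) | exact: (E fA fB fD K)].
  by apply: le_trans E _; rewrite /= ?zm ?zp ?zz; lra.
case/orP => [/eqP ->|].
  have E : 0 <= - x1 + y1 - z1 + x2 - y2 + z2 + x3 + y3 + z3 
    by have E := @tri_16 R N N6 A B D x1 y1 z1 x2 y2 z2 x3 y3 z3;
      first [exact: E | exact: (E fA K) | exact: (E fA fB K) | exact: (E fA fB fD K)].
  by apply: le_trans E _; rewrite /= ?zm ?zp ?zz; lra.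
case/orP => [/eqP ->|].
  have E : 0 <= - x1 + y1 + z1 + x2 - y2 - z2 + x3 + y3 + z3 
    by have E := @tri_17 R N N6 A B D x1 y1 z1 x2 y2 z2 x3 y3 z3;
      first [exact: E | exact: (E fA K) | exact: (E fA fB K) | exact: (E fA fB fD K)].
  by apply: le_trans E _; rewrite /= ?zm ?zp ?zz; lra.
case/orP => [/eqP ->|].
  have E : 0 <= - x1 + y1 + z1 + x2 - y2 + z2 + x3 + y3 - z3 
    by have E := @tri_18 R N N6 A B D x1 y1 z1 x2 y2 z2 x3 y3 z3;
      first [exact: E | exact: (E fA K) | exact: (E fA fB K) | exact: (E fA fB fD K)].
  by apply: le_trans E _; rewrite /= ?zm ?zp ?zz; lra.
(* The last three representatives are the walls of the chamber. *)
case/orP => [/eqP ->|]; first by rewrite /= ?zm ?zp ?zz; lra.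
case/orP => [/eqP ->|]; first by rewrite /= ?zm ?zp ?zz; lra.
by move/eqP => ->; rewrite /= ?zm ?zp ?zz; lra.
Qed.

Lemma size_facet_reps f : f \in facet_reps -> size f = 9%N.
Proof.
by move=> ff; apply/eqP; move: f ff; apply/allP; vm_compute.
Qed.

Lemma size_facets f : f \in facets -> size f = 9%N.
Proof. by case/allpairsP => -[g p] /= [_ _ ->]; rewrite size_allpairs. Qed.

Lemma tri_facets N v1 v2 v3 f : (6 <= N)%N -> tri N v1 v2 v3 -> f \in facets ->
  0 <= rdot f (digits v1 v2 v3).
Proof.
move=> N6 h /allpairsP[[g p] /= [gr pp ->]].
have [w1 [w2 [w3 [-> tw]]]] := rdot_permute v1 v2 v3 (size_facet_reps gr) pp.
exact: tri_facet_reps N6 (tw _ h) gr.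
Qed.

Lemma in_cone_cone_of v1 v2 v3 : in_cone 9 gens (digits v1 v2 v3) ->
  cone_of (map (@vec_of_digits R) generators) (v1, v2, v3).
Proof.
have gE k c i : (i < 3)%N -> (c < 3)%N -> zvec R (nth [::] gens k) (3 * c + i) =
    (nth 0%N (nth [::] generators k) (3 * c + i))%:R.
  move=> _ _; rewrite /zvec /gens; have [kl|kg] := ltnP k (size generators).
    rewrite (nth_map [::]) //; set g := nth [::] generators k.
    have [jl|jg] := ltnP (3 * c + i) (size g).
      rewrite (nth_map 0%N) // /zR -[RHS]/((Posz _)%:~R); congr (_%:~R).
      by move: (nth _ _ _) => n; lia.
    by rewrite !nth_default // size_map.
  by rewrite [nth [::] (map _ _) k]nth_default ?size_map // [nth [::] generators k]nth_default // !nth_nil.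
case=> a [a0 H]; exists (fun k => a k); split=> //.
have sG : size (map (@vec_of_digits R) generators) = size gens by rewrite !size_map.
have comp (f : ('rV[R]_3 * 'rV[R]_3 * 'rV[R]_3)%type -> R) (i c : 'I_3) :
    (forall u w, f (u + w) = f u + f w) -> f 0 = 0 -> (forall b u, f (b *: u) = b * f u) ->
    (forall s, f (vec_of_digits R s) = (nth 0%N s (3 * c + i))%:R) ->
    f (\sum_(k < size (map (@vec_of_digits R) generators)) a k *:
       (map (@vec_of_digits R) generators)`_k) = digits v1 v2 v3 (3 * c + i).
  move=> fD f0 fZ fv; rewrite H; last first.
    by case: i {fv} => -[|[|[|?]]] //= _; case: c => -[|[|[|?]]].
  rewrite (big_morph f fD f0) sG; apply: eq_bigr => k _.
  by rewrite fZ (nth_map [::]) ?fv -?gE // -(size_map (map BinInt.Z.of_nat)).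
apply: triple_eq; apply/rowP => c.
- have -> : v1 0 c = digits v1 v2 v3 (3 * c + 0).
    by case: c => -[|[|[|]]] //= ?; congr (v1 0 _); apply: val_inj.
  by rewrite -(comp (fun u => u.1.1 0 c) 0 c) //; move=> *; rewrite /= ?mxE.
- have -> : v2 0 c = digits v1 v2 v3 (3 * c + 1).
    by case: c => -[|[|[|]]] //= ?; congr (v2 0 _); apply: val_inj.
  by rewrite -(comp (fun u => u.1.2 0 c) 1 c) //; move=> *; rewrite /= ?mxE.
- have -> : v3 0 c = digits v1 v2 v3 (3 * c + 2).
    by case: c => -[|[|[|]]] //= ?; congr (v3 0 _); apply: val_inj.
  by rewrite -(comp (fun u => u.2 0 c) 2 c) //; move=> *; rewrite /= ?mxE.
Qed.

Theorem tri_in_cone N v1 v2 v3 : (6 <= N)%N -> tri N v1 v2 v3 ->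
  cone_of (map (@vec_of_digits R) generators) (v1, v2, v3).
Proof.
move=> N6 h; apply: in_cone_cone_of.
have := @face_facets_sub gens facets; have := covered_generators.
move: (face_facets gens facets) => L cov sub.
have sL : {in L, forall f, size f = 9%N} by move=> f /sub/size_facets.
have sT : {in [::], forall f : seq Z, size f = 9%N} by [].
have SS : {subset gens <= gens} by move=> x.
apply: (covered_sound sT sL SS cov) => [//|f /sub fF]; exact: tri_facets N6 h fF.
Qed.
End Triangle.

(** * Positive forms and the flow towards a flag *)

Section PositiveForms.
Variable C : numClosedFieldType.

Definition qf N (A : 'M[C]_N) (v : 'rV[C]_N) : C := (v *m A *m v^t*) 0 0.
Definition nrm d N (a : 'M[C]_(d, N)) (v : 'rV[C]_d) : C :=
  \sum_j `|(v *m a) 0 j| ^+ 2.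
Definition pd N (A : 'M[C]_N) := A^t* = A /\ forall v, v != 0 -> 0 < qf A v.
Definition lowner N (A B : 'M[C]_N) := forall v, qf A v <= qf B v.
(** With vectors as rows, these matrices preserve the span of the first [k] coordinates for every
    [k]. *)
Definition lower N (b : 'M[C]_N) := forall i j : 'I_N, (i < j)%N -> b i j = 0.
Definition lowerpos N (b : 'M[C]_N) := lower b /\ forall i, 0 < b i i.

Implicit Types (N d : nat).

Lemma adjB m n (A B : 'M[C]_(m, n)) : (A - B)^t* = A^t* - B^t*.
Proof. by apply/matrixP => i j; rewrite !mxE rmorphB. Qed.

Lemma qf_sq d N (a : 'M[C]_(d, N)) v : qf (a *m a^t*) v = nrm a v.
Proof.
rewrite /qf /nrm mulmxA -mulmxA -adjM mxE; apply: eq_bigr => j _.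
by rewrite !mxE normCK.
Qed.

Lemma nrm_ge0 d N (a : 'M[C]_(d, N)) v : 0 <= nrm a v.
Proof. by apply: sumr_ge0 => j _; rewrite exprn_ge0. Qed.

Lemma nrm_eq0 d N (a : 'M[C]_(d, N)) v : (nrm a v == 0) = (v *m a == 0).
Proof.
rewrite psumr_eq0 => [|j _]; last by rewrite exprn_ge0.
apply/idP/eqP => [/allP h|->]; last first.
  by apply/allP => j _; rewrite mxE normr0 expr0n eqxx.
apply/rowP => j; rewrite [RHS]mxE; have := h j (mem_index_enum _).
by rewrite /= sqrf_eq0 normr_eq0 => /eqP.
Qed.

Lemma adj_inv N (a : 'M[C]_N) : (invmx a)^t* = invmx (a^t*).
Proof. by rewrite trmx_inv map_invmx. Qed.

Lemma adj_unit N (a : 'M[C]_N) : (a^t* \in unitmx) = (a \in unitmx).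
Proof. by rewrite map_unitmx unitmx_tr. Qed.

Lemma pd_sq N (a : 'M[C]_N) : a \in unitmx -> pd (a *m a^t*).
Proof.
move=> ua; split=> [|v v0]; first by rewrite adjM trmxCK.
rewrite qf_sq lt_neqAle nrm_ge0 andbT eq_sym nrm_eq0.
by apply: contra v0 => /eqP va; rewrite -(mulmxK ua v) va mul0mx.
Qed.

Lemma spectral_entry N (u A : 'M[C]_N) e j : u \is unitarymx ->
  A = u^t* *m diag_mx e *m u -> e 0 j = qf A (row j u).
Proof.
move=> uu AE; have : e 0 j = (u *m A *m u^t*) j j.
  rewrite AE !mulmxA (unitarymxP uu) mul1mx -mulmxA (unitarymxP uu) mulmx1.
  by rewrite mxE eqxx.
move=> ->; rewrite /qf -row_mul [RHS]mxE [LHS]mxE; apply: eq_bigr => k _.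
by rewrite !mxE.
Qed.

Lemma hermitian_qf0 N (H : 'M[C]_N) : H^t* = H -> (forall v, qf H v = 0) -> H = 0.
Proof.
move=> /hermitian_spectral[u uu [e HE]] q0; rewrite HE.
have -> : e = 0; last by rewrite raddf0 mulmx0 mul0mx.
by apply/rowP => j; rewrite mxE (spectral_entry j uu HE).
Qed.

Lemma qfB N (A B : 'M[C]_N) v : qf (A - B) v = qf A v - qf B v.
Proof. by rewrite /qf mulmxBr mulmxBl !mxE. Qed.

Lemma qfZ N a (A : 'M[C]_N) v : qf (a *: A) v = a * qf A v.
Proof. by rewrite /qf -scalemxAr -scalemxAl mxE. Qed.

Lemma lownerZP N s (A B : 'M[C]_N) :
  lowner A (s *: B) <-> forall v, qf A v <= s * qf B v.
Proof. by split=> H v; have := H v; rewrite qfZ. Qed.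

Lemma lowner_anti N (A B : 'M[C]_N) : A^t* = A -> B^t* = B ->
  lowner A B -> lowner B A -> A = B.
Proof.
move=> hA hB AB BA; apply/eqP; rewrite -subr_eq0; apply/eqP/hermitian_qf0.
  by rewrite adjB hA hB.
by move=> v; rewrite qfB; apply/eqP; rewrite subr_eq0 eq_le AB BA.
Qed.

Lemma pd_spectral N (A : 'M[C]_N) : pd A -> exists2 u : 'M[C]_N, u \is unitarymx &
  exists e : 'rV[C]_N, (forall j, 0 < e 0 j) /\ A = u^t* *m diag_mx e *m u.
Proof.
case=> hA pA; have [u uu [e AE]] := hermitian_spectral hA; exists u => //.
exists e; split=> // j.
rewrite (spectral_entry j uu AE); apply: pA; apply/eqP => r0.
have := row_unitarymxP uu j j; rewrite r0 eqxx dotmxE mul0mx mxE => /esym/eqP.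
by rewrite oner_eq0.
Qed.

Lemma pd_unit N (A : 'M[C]_N) : pd A -> A \in unitmx.
Proof.
case/pd_spectral => u uu [e [e0 ->]]; rewrite !unitmx_mul adj_unit.
rewrite (unitarymx_unit uu) unitmxE det_diag unitfE andbT /=.
by apply/prodf_neq0 => i _; rewrite gt_eqF.
Qed.

Lemma lower_cprojP N (b : 'M[C]_N) : lower b <->
  forall k, (1%:M - cproj C N k) *m b *m cproj C N k = 0.
Proof.
have E k : (1%:M - cproj C N k) *m b *m cproj C N k =
    \matrix_(i, j) (b i j *+ ((i < k <= j)%N)).
  rewrite mulmxBl mul1mx mulmxBl mul_diag_mx !mul_mx_diag; apply/matrixP => i j.
  rewrite !mxE; case: leqP => ki; case: leqP => kj;
    by rewrite /= ?mulr1 ?mulr0 ?mul1r ?mul0r ?subrr ?subr0 ?mulr0n ?mulr1n.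
split=> [lb k|H i j ij].
  rewrite E; apply/matrixP => i j; rewrite !mxE.
  by case: andP => [[ik kj]|_]; rewrite ?mulr0n // lb // (leq_trans ik kj).
by have := H j; rewrite E => /matrixP/(_ i j); rewrite !mxE ij leqnn.
Qed.

Lemma lowerM N (a b : 'M[C]_N) : lower a -> lower b -> lower (a *m b).
Proof.
move=> la lb i j ij; rewrite mxE big1 // => k _.
have [ik|ki] := ltnP i k; first by rewrite la ?mul0r.
by rewrite (lb k j) ?mulr0 // (leq_ltn_trans ki).
Qed.

Lemma lower_inv N (b : 'M[C]_N) : b \in unitmx -> lower b -> lower (invmx b).
Proof.
move=> ub lb; apply/lower_cprojP => k; set Q := 1%:M - cproj C N k.
have Qb : Q *m b = Q *m b *m Q.
  by rewrite [in RHS]/Q mulmxBr mulmx1 (lower_cprojP b).1 ?subr0.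
have : (Q <= Q *m b)%MS.
  rewrite -(geq_leqif (mxrank_leqif_sup (_ : Q *m b <= Q)%MS)); last by rewrite Qb submxMl.
  by rewrite mxrankMfree // row_free_unit.
case/submxP => X QE; rewrite {1}QE -(mulmxA X) mulmxK // -(mulmxA X).
by rewrite /Q mulmxBl mul1mx cproj_idem subrr mulmx0.
Qed.

Lemma lowerpos_unit N (b : 'M[C]_N) : lowerpos b -> b \in unitmx.
Proof.
case=> lb pb; rewrite unitmxE det_trig ?unitfE.
  by apply/prodf_neq0 => i _; rewrite gt_eqF.
by apply/is_trig_mxP => i j; apply: lb.
Qed.

Lemma lower_mul_diag N (a b : 'M[C]_N) i : lower a -> lower b ->
  (a *m b) i i = a i i * b i i.
Proof.
move=> la lb; rewrite mxE (bigD1 i) //= big1 ?addr0 // => k ki.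
have [ik|] := ltnP i k; first by rewrite la ?mul0r.
by rewrite leq_eqVlt => /orP[/eqP/val_inj kE|/lb ->]; rewrite ?mulr0 // kE eqxx in ki *.
Qed.

Lemma lowerpos_inv N (b : 'M[C]_N) : lowerpos b -> lowerpos (invmx b).
Proof.
move=> pb; have ub := lowerpos_unit pb; case: pb => lb pb.
have li := lower_inv ub lb; split=> // i.
have := lower_mul_diag i lb li; rewrite mulmxV // mxE eqxx => /esym/eqP.
by rewrite -(pmulr_rgt0 _ (pb i)) => /eqP ->; rewrite ltr01.
Qed.

(** The quotient of the two factors is lower triangular and unitary. Its inverse is both its adjoint
    and lower triangular, so it is diagonal with positive entries of modulus one. *)
Lemma cholesky_unique N (b c : 'M[C]_N) : lowerpos b -> lowerpos c ->
  b *m b^t* = c *m c^t* -> b = c.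
Proof.
move=> pb pc E; have ub := lowerpos_unit pb; have uc := lowerpos_unit pc.
have [li pi] := lowerpos_inv pb; set n := invmx b *m c.
have ln : lower n by apply: lowerM => //; case: pc.
have nn : n *m n^t* = 1%:M.
  rewrite /n adjM mulmxA -(mulmxA _ c) -E mulmxA mulVmx // mul1mx -adjM mulVmx //.
  by rewrite trmx1 map_mx1.
have un : n \in unitmx by case/mulmx1_unit: nn.
have np i : 0 < n i i by rewrite lower_mul_diag ?mulr_gt0 //; case: pc.
have nE : invmx n = n^t* by rewrite -[LHS]mulmx1 -nn mulmxA mulVmx // mul1mx.
have up (i j : 'I_N) : (i < j)%N -> n j i = 0.
  move=> ij; have := lower_inv un ln ij; rewrite nE !mxE => /eqP.
  by rewrite conjC_eq0 => /eqP.
have n1 : n = 1%:M.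
  apply/matrixP => i j; rewrite [RHS]mxE.
  have [->|ij] := eqVneq i j; last first.
    by case: (ltngtP i j) => [/ln //|/up //|/val_inj/eqP]; rewrite (negbTE ij).
  have /matrixP/(_ j j) := nn; rewrite mxE (bigD1 j) //= big1 => [|k kj]; last first.
    suff -> : n j k = 0 by rewrite mul0r.
    case: (ltngtP j k) => [/ln //|/up //|/val_inj/eqP]; by rewrite eq_sym (negbTE kj).
  rewrite addr0 [(n^t*) _ _]mxE [n^T _ _]mxE [RHS]mxE eqxx -normCK => /eqP.
  rewrite sqrp_eq1 // => /eqP.
  by rewrite ger0_norm // ltW.
by rewrite -[b]mulmx1 -n1 /n mulKVmx.
Qed.

Lemma cholesky N (A : 'M[C]_N) : pd A -> exists2 b, lowerpos b & A = b *m b^t*.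
Proof.
case/pd_spectral => u uu [e [e0 ->]].
have u1 : u^t* *m u = 1%:M by apply: mulmx1C; apply/unitarymxP.
set D := diag_mx (\row_j sqrtC (e 0 j)).
have DD : D *m D = diag_mx e.
  by rewrite mulmx_diag; congr diag_mx; apply/rowP => j; rewrite !mxE -expr2 sqrtCK.
have DH : D^t* = D.
  rewrite adj_diag; congr diag_mx; apply/rowP => j; rewrite !mxE.
  by apply/CrealP; rewrite ger0_real // sqrtC_ge0 ltW.
(* Gram-Schmidt applied to the rows of the positive square root [s] writes it as a lower triangular
   matrix times the unitary [q]. *)
set s := u^t* *m D *m u; set q := schmidt s.
have uq : q \is unitarymx by apply: schmidt_unitarymx.
have us : s \in unitmx.
  rewrite /s !unitmx_mul adj_unit (unitarymx_unit uu) /= andbT unitmxE det_diag unitfE.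
  by apply/prodf_neq0 => i _; rewrite mxE sqrtC_eq0 gt_eqF.
have q1 : q^t* *m q = 1%:M by apply: mulmx1C; apply/unitarymxP.
have bE i j : (s *m q^t*) i j = dotmx (row i s) (row j q).
  by rewrite dotmxE -row_mul [RHS]mxE [LHS]mxE [RHS]mxE; apply: eq_bigr => k _; rewrite !mxE.
have lb : lower (s *m q^t*).
  move=> i j ij; rewrite bE.
  have sub : (row i s <= \sum_(k < N | (k <= i)%N) <<row k q>>)%MS by apply: row_schmidt_sub.
  have: (\sum_(k < N | (k <= i)%N) <<row k q>> <= kermx ((row j q)^t*))%MS.
    apply/sumsmx_subP => k ki; rewrite genmxE; apply/sub_kermxP/matrixP => x y.
    rewrite !ord1 -dotmxE (row_unitarymxP uq) mxE.
    by case: eqP => // kj; rewrite kj leqNgt ij in ki.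
  by move/(submx_trans sub)/sub_kermxP; rewrite dotmxE => ->; rewrite mxE.
have ub : s *m q^t* \in unitmx by rewrite unitmx_mul us adj_unit unitarymx_unit.
exists (s *m q^t*); last first.
  rewrite adjM trmxCK mulmxA -(mulmxA s) q1 mulmx1.
  rewrite /s !adjM trmxCK DH !mulmxA -(mulmxA _ u) (unitarymxP uu) mulmx1.
  by rewrite -(mulmxA _ D D) DD.
split=> // i; rewrite lt_neqAle eq_sym bE form1_row_schmidt andbT -bE.
move: ub; rewrite unitmxE det_trig ?unitfE; last by apply/is_trig_mxP => k l; apply: lb.
by move/prodf_neq0; apply.
Qed.
End PositiveForms.

Lemma invmx_mul (F : fieldType) n (a b : 'M[F]_n) : a \in unitmx -> b \in unitmx ->
  invmx (a *m b) = invmx b *m invmx a.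
Proof.
move=> ua ub; have uab : a *m b \in unitmx by rewrite unitmx_mul ua.
have E : a *m b *m (invmx b *m invmx a) = 1%:M by rewrite mulmxA mulmxK // mulmxV.
by rewrite -[RHS](mulKmx uab) E mulmx1.
Qed.

Section Monotone.
Variable C : numClosedFieldType.

(** The Loewner inequality b b^* <= s c c^*, expressed by the factors. *)
Definition dominated N (s : C) (b c : 'M[C]_N) := forall v, nrm b v <= s * nrm c v.

Lemma nrm_stretch N k (tau : C) (b : 'M[C]_N) v : 0 <= tau ->
  nrm (b *m stretch N k tau) v = nrm b v + (tau ^+ 2 - 1) * nrm (b *m cproj C N k) v.
Proof.
move=> tau0; rewrite /nrm mulr_sumr -big_split /=; apply: eq_bigr => j _.
rewrite !mulmxA !mul_mx_diag !mxE; case: leqP => _.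
  by rewrite mulr1 normrM exprMn (ger0_norm tau0); ring.
by rewrite mulr1 mulr0 normr0 expr0n mulr0 addr0.
Qed.

Lemma nrm_cproj_le N k (b : 'M[C]_N) v : nrm (b *m cproj C N k) v <= nrm b v.
Proof.
apply: ler_sum => j _; rewrite mulmxA mul_mx_diag !mxE; case: leqP => _.
  by rewrite mulr1.
by rewrite mulr0 normr0 expr0n exprn_ge0.
Qed.

(* [v'] moves [v] inside the flag so that [v' c] is the projection of [v c];
   lower triangularity leaves the last coordinates of [v b] unchanged. *)
Lemma dominated_stretch N s k (tau : C) (b c : 'M[C]_N) : 1 <= tau -> 0 <= s ->
  lower b -> lower c -> c \in unitmx -> dominated s b c ->
  dominated s (b *m stretch N k tau) (c *m stretch N k tau).
Proof.
move=> tau1 s0 lb lc uc dom v.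
have tau0 : 0 <= tau by apply: le_trans tau1.
rewrite !nrm_stretch // mulrDr lerD // mulrCA.
rewrite ler_wpM2l ?subr_ge0 ?exprn_ege1 //.
set v' := v *m c *m cproj C N k *m invmx c.
have E : v' *m (b *m cproj C N k) = v *m (b *m cproj C N k).
  apply/eqP; rewrite -subr_eq0 -mulmxBl.
  have -> : v' - v = - (v *m c *m (1%:M - cproj C N k) *m invmx c).
    by rewrite mulmxBr mulmx1 mulmxBl mulmxK // opprB.
  rewrite mulNmx oppr_eq0 -!mulmxA (mulmxA (invmx c)) (mulmxA (1%:M - _)).
  by rewrite (lower_cprojP _).1 ?mulmx0 //; apply: lowerM lb; apply: lower_inv.
have <- : nrm (b *m cproj C N k) v' = nrm (b *m cproj C N k) v by rewrite /nrm E.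
apply: le_trans (nrm_cproj_le _ _ _) _; apply: le_trans (dom v') _.
rewrite ler_wpM2l // le_eqVlt; apply/orP; left; apply/eqP.
by rewrite /nrm /v' mulmxKV // mulmxA.
Qed.

Lemma lower_stretch N k (tau : C) : lower (stretch N k tau).
Proof. by move=> i j ij; rewrite !mxE; case: eqP => [ijE|]; rewrite ?mulr0n // ijE ltnn in ij. Qed.
End Monotone.

(** * The symplectic and orthogonal groups of an antidiagonal form *)

Section Group.
Variables (R : realType) (N : nat).
Local Notation C := R[i].
Local Notation cexp a := ((expR a)%:C)%C.

(** By [J_sign] the form is skew in even and symmetric in odd dimension, so one definition yields
    the symplectic and the orthogonal group. *)
Definition Jform : 'M[C]_N := \matrix_(i, j) ((-1) ^+ i *+ (j == rev_ord i)).
Definition inG (A : 'M[C]_N) := A *m Jform *m A^T = Jform.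

Lemma mulJmx d (A : 'M[C]_(N, d)) i j : (Jform *m A) i j = (-1) ^+ i * A (rev_ord i) j.
Proof.
rewrite mxE (bigD1 (rev_ord i)) //= mxE eqxx big1 ?addr0 // => k ki.
by rewrite mxE (negbTE ki) mulr0n mul0r.
Qed.

Lemma mulmxJ d (A : 'M[C]_(d, N)) i j :
  (A *m Jform) i j = A i (rev_ord j) * (-1) ^+ (rev_ord j).
Proof.
rewrite mxE (bigD1 (rev_ord j)) //= mxE rev_ordK eqxx big1 ?addr0 // => k kj.
rewrite mxE; case: eqP => [jE|]; last by rewrite mulr0n mulr0.
by rewrite jE rev_ordK eqxx in kj.
Qed.

Lemma J_adj : Jform^t* = Jform^T.
Proof.
apply/matrixP => i j; rewrite !mxE rmorphMn rmorphXn /= rmorphN1.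
by [].
Qed.

Lemma J_conj : map_mx Num.conj Jform = Jform.
Proof. by apply/matrixP => i j; rewrite !mxE rmorphMn rmorphXn /= rmorphN1. Qed.

Lemma JJT : Jform *m Jform^T = 1%:M.
Proof.
apply/matrixP => i j; rewrite mulJmx !mxE.
rewrite (inj_eq rev_ord_inj); case: eqP => [->|_]; last by rewrite mulr0.
by rewrite mulr1n -expr2 sqrr_sign.
Qed.

Lemma JTJ : Jform^T *m Jform = 1%:M. Proof. exact: mulmx1C JJT. Qed.

Lemma J_unit : Jform \in unitmx. Proof. by case/mulmx1_unit: JJT. Qed.

Lemma J_sign : Jform^T = (-1) ^+ N.-1 *: Jform.
Proof.
apply/matrixP => i j; rewrite !mxE.
have -> : (i == rev_ord j) = (j == rev_ord i).
  by apply/eqP/eqP => ->; rewrite rev_ordK.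
case: eqP => [->|_]; last by rewrite !mulr0n mulr0.
rewrite !mulr1n -exprD -signr_odd -[RHS]signr_odd; congr (_ ^+ nat_of_bool _).
have := ltn_ord i; rewrite /= oddD; lia.
Qed.

Lemma inG1 : inG 1%:M. Proof. by rewrite /inG mul1mx trmx1 mulmx1. Qed.

Lemma inGM A B : inG A -> inG B -> inG (A *m B).
Proof.
by rewrite /inG => hA hB; rewrite trmx_mul -!mulmxA (mulmxA B) (mulmxA (B *m _)) hB !mulmxA.
Qed.

Lemma inG_unit A : inG A -> A \in unitmx.
Proof.
move=> hA; have := J_unit; rewrite -hA !unitmx_mul => /andP[/andP[]] //.
Qed.

Lemma inGV A : inG A -> inG (invmx A).
Proof.
move=> hA; have uA := inG_unit hA; rewrite /inG -{1}hA !mulmxA mulVmx // mul1mx.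
by rewrite trmx_inv mulmxK // unitmx_tr.
Qed.

Lemma inGE A : inG A -> A *m (Jform *m A^T *m Jform^T) = 1%:M.
Proof. by move=> hA; rewrite !mulmxA hA JJT. Qed.

Lemma inG_tr A : inG A -> inG A^T.
Proof.
move=> /inGE/mulmx1C; rewrite -!mulmxA => H.
have : A^T *m (Jform^T *m A) = Jform^T.
  by rewrite -[LHS]mul1mx -JTJ -!mulmxA H mulmx1.
rewrite J_sign -scalemxAl -scalemxAr => /(congr1 (fun X => (-1) ^+ N.-1 *: X)).
by rewrite !scalerA -exprD addnn -signr_odd odd_double !scale1r mulmxA /inG trmxK.
Qed.

Lemma inG_conj A : inG A -> inG (map_mx Num.conj A).
Proof.
by move=> hA; rewrite /inG -{1}J_conj map_trmx -!map_mxM hA J_conj.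
Qed.

Lemma inG_adj A : inG A -> inG (A^t*).
Proof. by move=> hA; apply/inG_conj/inG_tr. Qed.

Lemma inG_J : inG Jform.
Proof. by rewrite /inG -mulmxA JJT mulmx1. Qed.

(** The involution taking b to J b^(-T) J^T respects lower triangular matrices with positive
    diagonal and maps the factor of a group element to another factor of the same element.
    Uniqueness makes the factor a fixed point, which is the group equation. *)
Lemma inG_cholesky (b : 'M[C]_N) : lowerpos b -> inG (b *m b^t*) -> inG b.
Proof.
move=> pb hA; have ub := lowerpos_unit pb.
set b' := Jform *m (invmx b)^T *m Jform^T.
have [li pi] := lowerpos_inv pb.
have pb' : lowerpos b'.
  have bE i j : b' i j = (-1) ^+ i * invmx b (rev_ord j) (rev_ord i) * (-1) ^+ j.
    rewrite /b' J_sign -scalemxAr mxE mulmxJ mulJmx mxE.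
    rewrite [_ ^+ N.-1 * _]mulrC -!mulrA -exprD; congr (_ * (_ * _)).
    rewrite -[LHS]signr_odd -[RHS]signr_odd; congr (_ ^+ nat_of_bool _).
    have := ltn_ord j; rewrite /= oddD; lia.
  split=> [i j ij|i]; last by rewrite bE mulrAC -expr2 sqrr_sign mul1r.
  by rewrite bE li ?mulr0 ?mul0r //=; have := ltn_ord j; lia.
suff E : b = b' by rewrite /inG {1}E /b' -!mulmxA (mulmxA Jform^T) JTJ mul1mx -trmx_mul mulmxV // trmx1 mulmx1.
apply: cholesky_unique => //.
rewrite /b' !adjM.
have -> : (Jform^T)^t* = Jform by rewrite -J_adj trmxCK.
rewrite J_adj -!mulmxA (mulmxA Jform^T) JTJ mul1mx.
have -> : ((invmx b)^T)^t* = map_mx Num.conj (invmx b) by rewrite trmxK.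
rewrite !mulmxA -(mulmxA Jform).
have -> : (invmx b)^T *m map_mx Num.conj (invmx b) = (invmx (b *m b^t*))^T.
  by rewrite invmx_mul ?adj_unit // trmx_mul -adj_inv map_trmx trmxK.
have uA := inG_unit hA; have H := inGE (inGV hA).
by rewrite -[RHS](mulKVmx uA) H mulmx1.
Qed.
End Group.

Lemma le_subst (C : numDomainType) (a b a' b' s : C) :
  a = a' -> b = b' -> a' <= s * b' -> a <= s * b.
Proof. by move=> -> ->. Qed.

Lemma rev_ord_geE N k (j : 'I_N) : (k <= N)%N -> (k <= rev_ord j)%N = ~~ (N - k <= j)%N.
Proof. by move=> kN /=; have := ltn_ord j; lia. Qed.

(** * The flow of positive forms towards a flag *)

Section Phi.
Variables (R : realType) (N : nat).
Hypothesis N6 : (6 <= N)%N.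
Local Notation C := R[i].
Local Notation cexp a := ((expR a)%:C)%C.
Implicit Types (v : 'rV[R]_3) (g A B : 'M[C]_N).

Lemma wcoordE v (j : nat) : wcoord N v j =
  (if (1 <= j)%N then v 0 0 - v 0 1 else 0) + (if (N - 1 <= j)%N then v 0 0 - v 0 1 else 0) +
  (if (2 <= j)%N then v 0 1 - v 0 2 else 0) + (if (N - 2 <= j)%N then v 0 1 - v 0 2 else 0) +
  (if (3 <= j)%N then v 0 2 else 0) + (if (N - 3 <= j)%N then v 0 2 else 0) - v 0 0.
Proof.
by rewrite /wcoord /steps big_mkcond !big_cons big_nil /= addr0 !addrA.
Qed.

Lemma wcoord_rev v (j : 'I_N) : wcoord N v (rev_ord j) = - wcoord N v j.
Proof.
have E k (a : R) : (k <= N)%N ->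
    (if (k <= rev_ord j)%N then a else 0) = a - (if (N - k <= j)%N then a else 0).
  by move=> kN; rewrite rev_ord_geE //; case: (N - k <= j)%N; rewrite /= ?subrr ?subr0.
have N3 k : (k <= 3)%N -> (k <= N)%N by move=> k3; apply: leq_trans N6; apply: leq_trans k3 _.
rewrite !wcoordE; move: (nat_of_ord (rev_ord j)) E => r E.
rewrite (E _ _ (N3 1%N isT)) (E _ _ (N3 2%N isT)) (E _ _ (N3 3%N isT)).
rewrite (E _ _ (leq_subr 1 N)) (E _ _ (leq_subr 2 N)) (E _ _ (leq_subr 3 N)).
rewrite (subKn (N3 1%N isT)) (subKn (N3 2%N isT)) (subKn (N3 3%N isT)).
by do 6! [case: ifP => _]; ring.
Qed.

Lemma wcoord_bound v (j : nat) : chamber v -> - v 0 0 <= wcoord N v j <= v 0 0.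
Proof.
case=> h1 h2 h3; rewrite wcoordE.
move: (v 0 0) (v 0 1) (v 0 2) h1 h2 h3 => x y z h1 h2 h3.
by do 6! [case: ifP => _]; lra.
Qed.

Lemma weight_inG v : inG (weight N v).
Proof.
apply/matrixP => i j; rewrite weight_diag tr_diag_mx mul_mx_diag mul_diag_mx !mxE.
case: eqP => [->|_]; last by rewrite mulr0n mulr0 mul0r.
rewrite wcoord_rev mulr1n mulrC mulrA -rmorphM -expRD addrC subrr expR0.
by rewrite mul1r.
Qed.

Lemma weight_unit v : weight N v \in unitmx.
Proof. exact: inG_unit (weight_inG v). Qed.

Lemma dominated_weight s v (b c : 'M[C]_N) : chamber v -> 0 <= s ->
  lower b -> lower c -> c \in unitmx -> dominated s b c ->
  dominated s (b *m weight N v) (c *m weight N v).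
Proof.
move=> cv s0 lb lc uc dom.
have : forall st, all (fun p : nat * R => 0 <= p.2) st -> forall b c : 'M[C]_N,
    lower b -> lower c -> c \in unitmx -> dominated s b c ->
    dominated s (b *m stretches N st) (c *m stretches N st).
  elim=> [_ b1 c1 _ _ _ d1|[k a] st IH /= /andP[a0 st0] b1 c1 lb1 lc1 uc1 d1].
    by rewrite /stretches /= !mulmx1.
  rewrite !mulmxA; apply: (IH st0).
  - exact: lowerM lb1 (lower_stretch _ _).
  - exact: lowerM lc1 (lower_stretch _ _).
  - by rewrite unitmx_mul uc1 stretch_unit ?cexp_neq0.
  - by apply: dominated_stretch s0 lb1 lc1 uc1 d1; rewrite -[1]/(1%:C)%C lecR -expR0 ler_expR.
move=> /(_ _ (chamber_steps N cv) b c lb lc uc dom) dst w.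
have E (d : 'M[C]_N) : nrm (d *m weight N v) w =
    `|cexp (- v 0 0)| ^+ 2 * nrm (d *m stretches N (steps N v)) w.
  rewrite /nrm weightE mulr_sumr; apply: eq_bigr => j _.
  by rewrite -scalemxAr -scalemxAr mxE normrM exprMn.
rewrite !E mulrCA; apply: ler_wpM2l => //; exact: exprn_ge0.
Qed.

(** The default 1 of [xget] is never reached for a positive definite matrix. *)
Definition chol A : 'M[C]_N :=
  locked (xget 1%:M [set b | lowerpos b /\ A = b *m b^t*]%classic).

Lemma cholP A : pd A -> lowerpos (chol A) /\ A = chol A *m (chol A)^t*.
Proof.
move=> /cholesky[b pb AE].
rewrite /chol -lock.
exact: (@xgetPex _ 1%:M [set b | lowerpos b /\ A = b *m b^t*]%classic (ex_intro _ b (conj pb AE))).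
Qed.

Definition frame g A : 'M[C]_N := locked (invmx g *m chol (g *m A *m g^t*)).
(** In the symmetric space this is the time-one flow along the ray from [A] to the boundary point
    given by [g] and [v]: as [g *m frame g A] is lower triangular and the weights increase,
    conjugation by growing weights stays bounded and the rays for different [A] are asymptotic. *)
Definition Phi g v A : 'M[C]_N :=
  locked ((frame g A *m weight N v) *m (frame g A *m weight N v)^t*).

Lemma frameE g A : frame g A = invmx g *m chol (g *m A *m g^t*).
Proof. by rewrite /frame -lock. Qed.

Lemma PhiE g v A :
  Phi g v A = (frame g A *m weight N v) *m (frame g A *m weight N v)^t*.
Proof. by rewrite /Phi -lock. Qed.

Lemma pd_conj g A : g \in unitmx -> pd A -> pd (g *m A *m g^t*).
Proof.
move=> ug /cholesky[b pb ->]; have ub := lowerpos_unit pb.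
have -> : g *m (b *m b^t*) *m g^t* = (g *m b) *m (g *m b)^t* by rewrite adjM !mulmxA.
by apply: pd_sq; rewrite unitmx_mul ug.
Qed.

Lemma frameP g A : g \in unitmx -> pd A ->
  [/\ frame g A \in unitmx, A = frame g A *m (frame g A)^t* & lowerpos (g *m frame g A)].
Proof.
move=> ug pA; have [] := cholP (pd_conj ug pA); rewrite frameE mulKVmx //.
move: (chol _) => c pc cE; have uc := lowerpos_unit pc.
split=> //; first by rewrite unitmx_mul unitmx_inv ug.
rewrite adjM -(mulmxA (invmx g)) (mulmxA c) -cE adj_inv !mulmxA mulVmx // mul1mx.
by rewrite mulmxK // adj_unit.
Qed.

Lemma frame_inG g A : inG g -> pd A -> inG A -> inG (frame g A).
Proof.
move=> hg pA hA; have [pb bE] := cholP (pd_conj (inG_unit hg) pA); rewrite frameE.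
apply: inGM; first exact: inGV.
by apply: inG_cholesky => //; rewrite -bE; apply: inGM (inG_adj hg); apply: inGM.
Qed.

Lemma Phi_pd g v A : g \in unitmx -> pd A -> pd (Phi g v A).
Proof.
move=> ug /(frameP ug)[uf _ _]; rewrite PhiE; apply: pd_sq; by rewrite unitmx_mul uf weight_unit.
Qed.

Lemma Phi_inG g v A : inG g -> pd A -> inG A -> inG (Phi g v A).
Proof.
move=> hg pA hA; have h := inGM (frame_inG hg pA hA) (weight_inG v); rewrite PhiE.
exact: inGM (inG_adj h).
Qed.

Lemma qf_conj g A (w : 'rV[C]_N) : qf (g *m A *m g^t*) w = qf A (w *m g).
Proof. by rewrite /qf adjM !mulmxA. Qed.

Lemma qf_Phi g v A w : qf (Phi g v A) w = nrm (frame g A *m weight N v) w.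
Proof. by rewrite PhiE qf_sq. Qed.

(** Monotonicity up to the factor [s], applied in both directions, is nonexpansiveness for the
    Thompson metric. *)
Lemma Phi_mono g v s A B : g \in unitmx -> chamber v -> 0 <= s -> pd A -> pd B ->
  lowner A (s *: B) -> lowner (Phi g v A) (s *: Phi g v B).
Proof.
move=> ug cv s0 pA pB /lownerZP AB; apply/lownerZP => w; have [pb bE] := cholP (pd_conj ug pA).
have [pc cE] := cholP (pd_conj ug pB).
apply: (le_subst (qf_Phi g v A w) (qf_Phi g v B w)).
have E D x : nrm (frame g D *m weight N v) x =
    nrm (chol (g *m D *m g^t*) *m weight N v) (x *m invmx g).
  by rewrite /nrm frameE !mulmxA.
apply: (le_subst (E A w) (E B w)).
apply: (dominated_weight cv s0 (proj1 pb) (proj1 pc) (lowerpos_unit pc)).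
by move=> x; rewrite -(qf_sq (chol (g *m A *m g^t*))) -bE -(qf_sq (chol (g *m B *m g^t*))) -cE !qf_conj.
Qed.

Lemma nrm_weight v (b : 'M[C]_N) w : chamber v ->
  nrm b w <= cexp (v 0 0) ^+ 2 * nrm (b *m weight N v) w /\
  nrm (b *m weight N v) w <= cexp (v 0 0) ^+ 2 * nrm b w.
Proof.
move=> cv; rewrite /nrm !mulr_sumr; split; apply: ler_sum => j _;
  rewrite mulmxA weight_diag mul_mx_diag [(\matrix_(i, j) _) _ _]mxE [(\row__ _) _ _]mxE;
  have [l1 l2] := andP (wcoord_bound j cv).
  rewrite -exprMn normrM (ger0_norm (_ : 0 <= cexp (wcoord N v j))) ?lecR ?expR_ge0 //.
  apply: lerXn2r; rewrite ?nnegrE ?mulr_ge0 ?normr_ge0 ?(lecR 0) ?expR_ge0 //.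
  rewrite mulrCA -rmorphM -expRD /= ler_peMr //.
  by rewrite -[1]/(1%:C)%C lecR -expR0 ler_expR; lra.
rewrite normrM (ger0_norm (_ : 0 <= cexp (wcoord N v j))) ?lecR ?expR_ge0 //.
rewrite exprMn mulrC ler_wpM2r ?exprn_ge0 //.
by apply: lerXn2r; rewrite ?nnegrE ?lecR ?expR_ge0 // ler_expR.
Qed.

Lemma Phi_bound g v A : g \in unitmx -> chamber v -> pd A ->
  lowner A (cexp (v 0 0) ^+ 2 *: Phi g v A) /\ lowner (Phi g v A) (cexp (v 0 0) ^+ 2 *: A).
Proof.
move=> ug cv pA; have [_ AE _] := frameP ug pA.
have qA w : qf A w = nrm (frame g A) w by rewrite {1}AE qf_sq.
by split; apply/lownerZP => w; have [h1 h2] := nrm_weight (frame g A) w cv;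
  [exact: (le_subst (qA w) (qf_Phi g v A w) h1) | exact: (le_subst (qf_Phi g v A w) (qA w) h2)].
Qed.
End Phi.

(** Bounded sequences converge along a free ultrafilter, all of them at once, so that no
    subsequences have to be extracted. *)
Lemma free_ultrafilter : exists U : set_system nat,
  UltraFilter U /\ forall m, U [set n | (m <= n)%N]%classic.
Proof.
have [U [hU sub]] := @ultraFilterLemma _ \oo%classic _.
by exists U; split=> // m; apply: sub; exists m.
Qed.

(** * Fixed points of the perturbed maps *)

Section UltraLimit.
Variables (R : realType) (U : set_system nat).
Hypothesis hU : UltraFilter U.
Local Notation C := R[i].
Local Open Scope classical_set_scope.

Let fU : ProperFilter U. Proof. exact: ultra_proper. Qed.
#[local] Existing Instance fU.

Lemma ultra_cvg (x : nat -> R) (M : R) : U [set n | `|x n| <= M] -> exists l : R, x @ U --> l.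
Proof.
(* The limit is the supremum of the eventual lower bounds; a number that is not an eventual lower
   bound is, by the ultrafilter property, an eventual strict upper bound. *)
move=> xM; pose S := [set a | U [set n | a <= x n]].
have hS : has_sup S.
  split.
    exists (- M); apply: filterS xM => n /=; rewrite ler_norml => /andP[] //.
  exists M => a /= aS; have [n [/= h1 h2]] := filter_ex (filterI aS xM).
  by apply: le_trans h1 _; apply: le_trans (ler_norm _) h2.
exists (sup S); apply/cvgrPdist_lt => e e0.
have hub := sup_upper_bound hS; have [a aS la] := sup_adherent e0 hS.
have nS : ~ S (sup S + e / 2).
  by move=> /hub; lra.
have : U (~` [set n | sup S + e / 2 <= x n]) by case: (in_ultra_setVsetC [set n | sup S + e / 2 <= x n] hU).
move=> h; apply: filterS (filterI h aS) => n /= [/negP]; rewrite -ltNge => h1 h2.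
rewrite ltr_norml; apply/andP; split; last by lra.
by rewrite ltrNl opprB ltrBlDl; apply: lt_trans h1 _; rewrite ltrD2l; lra.
Qed.

(** Taken in the two real coordinates, so that compactness reduces to [ultra_cvg]. *)
Definition ucvg (x : nat -> C) (l : C) :=
  ((fun n => complex.Re (x n)) @ U --> complex.Re l) /\
  ((fun n => complex.Im (x n)) @ U --> complex.Im l).

Lemma ucvg_cst l : ucvg (fun=> l) l.
Proof. by split; apply: cvg_cst. Qed.

Lemma ucvgD x y l m : ucvg x l -> ucvg y m -> ucvg (fun n => x n + y n) (l + m).
Proof.
case=> a b [c d]; split.
  rewrite (_ : (fun n => _) = (fun n => complex.Re (x n) + complex.Re (y n))); last first.
    by apply/funext => n; case: (x n) (y n) => ? ? [].
  by case: l m a b c d => ? ? [? ?] /= a b c d; apply: cvgD.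
rewrite (_ : (fun n => _) = (fun n => complex.Im (x n) + complex.Im (y n))); last first.
  by apply/funext => n; case: (x n) (y n) => ? ? [].
by case: l m a b c d => ? ? [? ?] /= a b c d; apply: cvgD.
Qed.

Lemma ucvgN x l : ucvg x l -> ucvg (fun n => - x n) (- l).
Proof.
case=> a b; split.
  rewrite (_ : (fun n => _) = (fun n => - complex.Re (x n))); last first.
    by apply/funext => n; case: (x n).
  by case: l a b => ? ? /= a b; apply: cvgN.
rewrite (_ : (fun n => _) = (fun n => - complex.Im (x n))); last first.
  by apply/funext => n; case: (x n).
by case: l a b => ? ? /= a b; apply: cvgN.
Qed.

Lemma ucvgM x y l m : ucvg x l -> ucvg y m -> ucvg (fun n => x n * y n) (l * m).
Proof.
case=> a b [c d]; split.
  rewrite (_ : (fun n => _) = (fun n => complex.Re (x n) * complex.Re (y n) -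
     complex.Im (x n) * complex.Im (y n))); last first.
    by apply/funext => n; case: (x n) (y n) => ? ? [].
  by case: l m a b c d => ? ? [? ?] /= a b c d; apply: cvgB; apply: cvgM.
rewrite (_ : (fun n => _) = (fun n => complex.Re (x n) * complex.Im (y n) +
   complex.Im (x n) * complex.Re (y n))); last first.
  by apply/funext => n; case: (x n) (y n) => ? ? [].
by case: l m a b c d => ? ? [? ?] /= a b c d; apply: cvgD; apply: cvgM.
Qed.

Lemma ucvg_conj x l : ucvg x l -> ucvg (fun n => (x n)^*) (l^*).
Proof.
case=> a b; split.
  rewrite (_ : (fun n => _) = (fun n => complex.Re (x n))); last first.
    by apply/funext => n; case: (x n).
  by case: l a b => ? ? /= a b.
rewrite (_ : (fun n => _) = (fun n => - complex.Im (x n))); last first.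
  by apply/funext => n; case: (x n).
by case: l a b => ? ? /= a b; apply: cvgN.
Qed.

Lemma ucvg_real (r : nat -> R) (a : R) : r @ U --> a -> ucvg (fun n => (r n)%:C%C) (a%:C%C).
Proof. by move=> h; split => //=; apply: cvg_cst. Qed.

Lemma ucvg_near x y l : U [set n | x n = y n] -> ucvg x l -> ucvg y l.
Proof.
move=> h [a b]; split.
  by apply: cvg_trans a; apply: near_eq_cvg; apply: filterS h => n /= ->.
by apply: cvg_trans b; apply: near_eq_cvg; apply: filterS h => n /= ->.
Qed.

Lemma ucvg_unique x l m : ucvg x l -> ucvg x m -> l = m.
Proof.
case=> a b [c d]; apply/eqP; rewrite eq_complex.
by rewrite (cvg_unique _ a c) // (cvg_unique _ b d) // !eqxx.
Qed.

Lemma ucvg_ge0 x l : U [set n | 0 <= x n] -> ucvg x l -> 0 <= l.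
Proof.
move=> h [a b]; rewrite lecE /=.
have hb : (fun n => complex.Im (x n)) @ U --> (0 : R).
  apply/cvgrPdist_lt => e e0; apply: filterS h => n /=.
  by rewrite lecE /= => /andP[/eqP -> _]; rewrite subr0 normr0.
rewrite (cvg_unique _ b hb) // eqxx /=.
rewrite leNgt; apply/negP => l0.
have l0' : 0 < - complex.Re l by rewrite oppr_gt0.
move/cvgrPdist_lt: a => /(_ _ l0') h1.
have [n [/= h2 h3]] := @filter_ex _ U _ _ (@filterI _ U _ _ _ h h1).
move: h2 h3; rewrite lecE /= => /andP[_ h2]; rewrite ltr_norml => /andP[]; lra.
Qed.

Lemma normC_Re_Im (z : C) (M : R) : `|z| <= M%:C%C ->
  `|complex.Re z| <= M /\ `|complex.Im z| <= M.
Proof.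
case: z => a b; rewrite normc_def lecR /= => h.
have k c : c ^+ 2 <= a ^+ 2 + b ^+ 2 -> `|c| <= M.
  by move=> hc; apply: le_trans h; rewrite -sqrtr_sqr; apply: ler_wsqrtr.
by split; apply: k; rewrite ?lerDl ?lerDr ?sqr_ge0.
Qed.

Lemma ucvg_bounded x (M : R) : U [set n | `|x n| <= M%:C%C] -> exists l, ucvg x l.
Proof.
move=> h.
have [a ha] : exists a : R, (fun n => complex.Re (x n)) @ U --> a.
  by apply: (@ultra_cvg _ M); apply: filterS h => n /= /normC_Re_Im[].
have [b hb] : exists b : R, (fun n => complex.Im (x n)) @ U --> b.
  by apply: (@ultra_cvg _ M); apply: filterS h => n /= /normC_Re_Im[].
by exists (a +i* b)%C; split.
Qed.

Lemma ucvg_sum (I : Type) (r : seq I) (P : pred I) (x : I -> nat -> C) l :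
  (forall i, ucvg (x i) (l i)) ->
  ucvg (fun n => \sum_(i <- r | P i) x i n) (\sum_(i <- r | P i) l i).
Proof.
move=> h; elim: r => [|i r ih].
  by rewrite big_nil; under eq_fun do rewrite big_nil; apply: ucvg_cst.
rewrite big_cons; under eq_fun do rewrite big_cons.
by case: (P i) => //; apply: ucvgD.
Qed.

Lemma ucvg_prod (I : Type) (r : seq I) (P : pred I) (x : I -> nat -> C) l :
  (forall i, ucvg (x i) (l i)) ->
  ucvg (fun n => \prod_(i <- r | P i) x i n) (\prod_(i <- r | P i) l i).
Proof.
move=> h; elim: r => [|i r ih].
  by rewrite big_nil; under eq_fun do rewrite big_nil; apply: ucvg_cst.
rewrite big_cons; under eq_fun do rewrite big_cons.
by case: (P i) => //; apply: ucvgM.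
Qed.

Definition mcvg m p (A : nat -> 'M[C]_(m, p)) (L : 'M[C]_(m, p)) := forall i j, ucvg (fun n => A n i j) (L i j).

Lemma mcvg_cst m p (A : 'M[C]_(m, p)) : mcvg (fun=> A) A.
Proof. by move=> i j; apply: ucvg_cst. Qed.

Lemma mcvgM m p q (A : nat -> 'M[C]_(m, p)) (B : nat -> 'M[C]_(p, q)) L M :
  mcvg A L -> mcvg B M -> mcvg (fun n => A n *m B n) (L *m M).
Proof.
move=> hA hB i j; rewrite mxE; under eq_fun do rewrite mxE.
by apply: ucvg_sum => k; apply: ucvgM.
Qed.

Lemma mcvgD m p (A B : nat -> 'M[C]_(m, p)) L M :
  mcvg A L -> mcvg B M -> mcvg (fun n => A n + B n) (L + M).
Proof.
by move=> hA hB i j; rewrite mxE; under eq_fun do rewrite mxE; apply: ucvgD.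
Qed.

Lemma mcvg_tr m p (A : nat -> 'M[C]_(m, p)) L : mcvg A L -> mcvg (fun n => (A n)^T) L^T.
Proof. by move=> h i j; rewrite mxE; under eq_fun do rewrite mxE; apply: h. Qed.

Lemma mcvg_conj m p (A : nat -> 'M[C]_(m, p)) L :
  mcvg A L -> mcvg (fun n => map_mx Num.conj (A n)) (map_mx Num.conj L).
Proof. by move=> h i j; rewrite mxE; under eq_fun do rewrite mxE; apply: ucvg_conj. Qed.

Lemma mcvg_adj m p (A : nat -> 'M[C]_(m, p)) L : mcvg A L -> mcvg (fun n => (A n)^t*) (L^t*).
Proof. by move=> h; apply/mcvg_conj/mcvg_tr. Qed.

Lemma ucvg_det m (A : nat -> 'M[C]_m) L : mcvg A L -> ucvg (fun n => \det (A n)) (\det L).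
Proof.
move=> h; apply: ucvg_sum => s; apply: ucvgM; first exact: ucvg_cst.
by apply: ucvg_prod.
Qed.

Lemma mcvg_unique m p (A : nat -> 'M[C]_(m, p)) L M : mcvg A L -> mcvg A M -> L = M.
Proof. by move=> h k; apply/matrixP => i j; apply: ucvg_unique (h i j) (k i j). Qed.

Lemma mcvg_near m p (A B : nat -> 'M[C]_(m, p)) L :
  U [set n | A n = B n] -> mcvg A L -> mcvg B L.
Proof. by move=> h k i j; apply: ucvg_near (k i j); apply: filterS h => n /= ->. Qed.

Lemma mcvg_bounded m p (A : nat -> 'M[C]_(m, p)) (M : R) :
  U [set n | forall i j, `|A n i j| <= M%:C%C] -> exists L, mcvg A L.
Proof.
move=> h; have k (ij : 'I_m * 'I_p) : exists l, ucvg (fun n => A n ij.1 ij.2) l.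
  by apply: (@ucvg_bounded _ M); apply: filterS h => n /=.
have [l hl] := choice k.
by exists (\matrix_(i, j) l (i, j)) => i j; rewrite mxE; apply: (hl (i, j)).
Qed.
End UltraLimit.

(** * Operator monotonicity and contraction of f_e *)

Section Resolvent.
Variable C : numClosedFieldType.
Implicit Types (N : nat).

Lemma qf1 N (v : 'rV[C]_N) : qf 1%:M v = \sum_j `|v 0 j| ^+ 2.
Proof. by rewrite /qf mulmx1 mxE; apply: eq_bigr => j _; rewrite !mxE normCK. Qed.

Lemma qfD N (A B : 'M[C]_N) v : qf (A + B) v = qf A v + qf B v.
Proof. by rewrite /qf mulmxDr mulmxDl !mxE. Qed.

Lemma qf_real N (A : 'M[C]_N) v : A^t* = A -> qf A v \is Num.real.
Proof.
move=> hA; apply/CrealP; have : (v *m A *m v^t*)^t* = v *m A *m v^t*.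
  by rewrite !adjM trmxCK hA mulmxA.
by rewrite /qf; move: (_ *m _) => M /matrixP/(_ 0 0); rewrite !mxE.
Qed.

Lemma qf_spectral N (u : 'M[C]_N) e v :
  qf (u^t* *m diag_mx e *m u) v = \sum_j e 0 j * `|(v *m u^t*) 0 j| ^+ 2.
Proof.
rewrite /qf -!mulmxA -[u *m v^t*]trmxCK adjM trmxCK mulmxA.
move: (v *m u^t*) => w; rewrite mulmxA mul_mx_diag mxE.
apply: eq_bigr => j _; rewrite !mxE normCK; ring.
Qed.

Lemma spectral_le N (u : 'M[C]_N) (e f : 'rV[C]_N) : (forall j, e 0 j <= f 0 j) ->
  lowner (u^t* *m diag_mx e *m u) (u^t* *m diag_mx f *m u).
Proof.
by move=> ef v; rewrite !qf_spectral; apply: ler_sum => j _; rewrite ler_wpM2r ?exprn_ge0.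
Qed.

(** Expand the nonnegative value of A at v A^(-1) - v B^(-1): it is A^(-1) - 2 B^(-1) at v plus A at
    v B^(-1), and the last term is at most B^(-1) at v. *)
Lemma inv_antitone N (A B : 'M[C]_N) : pd A -> pd B -> lowner A B ->
  lowner (invmx B) (invmx A).
Proof.
move=> pA pB AB v; have uA := pd_unit pA; have uB := pd_unit pB.
case: pA pB => hA pA [hB pB].
set y := v *m invmx B; have q1 : qf (invmx A) v = qf A (v *m invmx A).
  by rewrite /qf adjM adj_inv hA !mulmxA mulmxKV.
have q2 : qf (invmx B) v = qf B y by rewrite /qf adjM adj_inv hB !mulmxA mulmxKV.
have : 0 <= qf A (v *m invmx A - y).
  by have [->|/pA/ltW//] := eqVneq (v *m invmx A - y) 0; rewrite /qf !mul0mx mxE.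
have -> : qf A (v *m invmx A - y) = qf (invmx A) v - qf (invmx B) v *+ 2 + qf A y.
  have e1 : v *m invmx A *m A *m (v *m invmx A)^t* = v *m invmx A *m v^t*.
    by rewrite adjM adj_inv hA mulmxKV // mulmxA.
  have e2 : v *m invmx A *m A *m y^t* = v *m invmx B *m v^t*.
    by rewrite adjM adj_inv hB mulmxKV // mulmxA.
  have e3 : y *m A *m (v *m invmx A)^t* = v *m invmx B *m v^t*.
    by rewrite adjM adj_inv hA mulmxA mulmxK.
  rewrite /qf adjB mulmxBr !mulmxBl e1 e2 e3 !mxE; ring.
have := AB y; rewrite -q2 => h1 h2; rewrite -subr_ge0; apply: le_trans h2 _.
have -> : qf (invmx A) v - qf (invmx B) v *+ 2 + qf A y =
  qf (invmx A) v - qf (invmx B) v + (qf A y - qf (invmx B) v) by ring.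
by rewrite gerDl subr_le0.
Qed.

Definition fe N (eps : C) (B : 'M[C]_N) : 'M[C]_N :=
  (B + eps%:M) *m invmx (1%:M + eps *: B).

Lemma fe_spectral N eps (u : 'M[C]_N) (e : 'rV[C]_N) : 0 < eps -> u \is unitarymx ->
  (forall j, 0 < e 0 j) -> fe eps (u^t* *m diag_mx e *m u) =
  u^t* *m diag_mx (\row_j ((e 0 j + eps) / (1 + eps * e 0 j))) *m u.
Proof.
move=> ep uu e0; have u1 : u^t* *m u = 1%:M by apply: mulmx1C; apply/unitarymxP.
have sp a (b : 'rV[C]_N) : a%:M + u^t* *m diag_mx b *m u = u^t* *m diag_mx (\row_j (a + b 0 j)) *m u.
  have -> : diag_mx (\row_j (a + b 0 j)) = a%:M + diag_mx b.
    by apply/matrixP => i j; rewrite !mxE; case: eqP => _; rewrite ?mulr1n ?mulr0n ?addr0.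
  by rewrite mulmxDr mulmxDl mul_mx_scalar -scalemxAl u1 scalemx1.
rewrite /fe scalemxAl scalemxAr -linearZ /= addrC !sp.
have n0 j : 1 + eps * e 0 j != 0 by rewrite gt_eqF // addr_gt0 ?mulr_gt0.
set X := _ *m diag_mx (\row_j (1 + _)) *m u.
have uX : X \in unitmx.
  rewrite !unitmx_mul adj_unit (unitarymx_unit uu) /= andbT unitmxE det_diag unitfE.
  by apply/prodf_neq0 => j _; rewrite !mxE.
apply: (can_inj (mulmxK uX)); rewrite mulmxKV // /X !mulmxA.
rewrite -[X in _ = X]mulmxA mulmxtVK // !mulmxA; congr (_ *m _).
rewrite -mulmxA mulmx_diag; congr (_ *m diag_mx _).
by apply/rowP => j; rewrite !mxE divfK // addrC.
Qed.

Section Fe.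
Variables (N : nat) (eps : C).
Hypotheses (ep : 0 < eps) (e1 : eps < 1).
Implicit Types (A B : 'M[C]_N).

Let pos1 x : 0 < x -> 0 < 1 + eps * x.
Proof. by move=> x0; rewrite addr_gt0 ?mulr_gt0. Qed.

Lemma pd_scalar (a : C) : 0 < a -> pd (a%:M : 'M[C]_N).
Proof.
move=> a0; have sq : sqrtC a != 0 by rewrite sqrtC_eq0 gt_eqF.
have -> : a%:M = (sqrtC a)%:M *m ((sqrtC a)%:M)^t* :> 'M[C]_N.
  rewrite tr_scalar_mx map_scalar_mx -scalar_mxM -normCK ger0_norm ?sqrtC_ge0 ?ltW //.
  by rewrite sqrtCK.
by apply: pd_sq; rewrite unitmxE det_scalar unitrX // unitfE.
Qed.

Lemma pdD A B : pd A -> pd B -> pd (A + B).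
Proof.
case=> hA pA [hB pB]; split=> [|v v0]; first by rewrite adjD hA hB.
by rewrite qfD addr_gt0 ?pA ?pB.
Qed.

Lemma pdZ a A : 0 < a -> pd A -> pd (a *: A).
Proof.
move=> a0 [hA pA]; split=> [|v v0]; last by rewrite qfZ mulr_gt0 ?pA.
by rewrite adjZ hA (CrealP _) // ger0_real // ltW.
Qed.

Lemma fe_pd A : pd A -> pd (fe eps A).
Proof.
case/pd_spectral => u uu [e [e0 ->]]; rewrite fe_spectral //.
have p j : 0 < (e 0 j + eps) / (1 + eps * e 0 j) by rewrite divr_gt0 ?pos1 ?addr_gt0.
have -> : u^t* *m diag_mx (\row_j ((e 0 j + eps) / (1 + eps * e 0 j))) *m u =
   (u^t* *m diag_mx (\row_j sqrtC ((e 0 j + eps) / (1 + eps * e 0 j)))) *m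
   (u^t* *m diag_mx (\row_j sqrtC ((e 0 j + eps) / (1 + eps * e 0 j))))^t*.
  rewrite adjM trmxCK adj_diag !mulmxA; congr (_ *m _); rewrite -mulmxA mulmx_diag.
  congr (_ *m diag_mx _); apply/rowP => j; rewrite !mxE -normCK ger0_norm ?sqrtCK //.
  by rewrite sqrtC_ge0 ltW.
apply: pd_sq; rewrite unitmx_mul adj_unit (unitarymx_unit uu) /= unitmxE det_diag unitfE.
by apply/prodf_neq0 => j _; rewrite !mxE sqrtC_eq0 gt_eqF.
Qed.

Lemma fe_bound A : pd A ->
  lowner (eps *: 1%:M) (fe eps A) /\ lowner (fe eps A) (eps^-1 *: 1%:M).
Proof.
case/pd_spectral => u uu [e [e0 ->]]; rewrite fe_spectral //.
have u1 : u^t* *m u = 1%:M by apply: mulmx1C; apply/unitarymxP.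
have sc a : a *: 1%:M = u^t* *m diag_mx (const_mx a) *m u.
  by rewrite diag_const_mx mul_mx_scalar -scalemxAl u1.
rewrite !sc; split; apply: spectral_le => j; rewrite !mxE.
  rewrite ler_pdivlMr ?pos1 // mulrDr mulr1 addrC lerD2r mulrA.
  by rewrite ler_piMl ?ltW // -expr2 expr_lt1 // ltW.
rewrite ler_pdivrMr ?pos1 // mulrDr mulr1 mulrA mulVf ?gt_eqF // mul1r addrC lerD2r.
by apply/ltW/(lt_trans e1); rewrite invf_gt1.
Qed.

(** A constant minus a positive multiple of a resolvent: monotonicity of f_e then follows from
    [inv_antitone]. *)
Lemma fe_resolvent A : pd A ->
  fe eps A = eps^-1 *: 1%:M - (eps^-1 - eps) *: invmx (1%:M + eps *: A).
Proof.
move=> pA; have u : 1%:M + eps *: A \in unitmx.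
  by apply/pd_unit/pdD; [apply: pd_scalar | apply: pdZ].
apply: (can_inj (mulmxK u)); rewrite mulmxKV // mulmxBl -!scalemxAl mulVmx // mul1mx.
rewrite scalerDr scalerA mulVf ?gt_eqF // scale1r scalerBl opprB addrC.
by rewrite addrC [RHS]addrAC [_ *: _ + (_ - _)]addrC subrK scalemx1 addrC.
Qed.

Lemma fe_mono A B : pd A -> pd B -> lowner A B -> lowner (fe eps A) (fe eps B).
Proof.
move=> pA pB AB v; rewrite !fe_resolvent // !qfB lerD2l lerN2 !qfZ.
apply: ler_wpM2l.
  by rewrite subr_ge0; apply/ltW/(lt_trans e1); rewrite invf_gt1.
apply: inv_antitone; try by apply: pdD; [apply: pd_scalar | apply: pdZ].
by move=> w; rewrite !qfD lerD2l !qfZ ler_wpM2l ?AB ?ltW.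
Qed.

(** For t <= M the numerator is s t + e = (t + e) + t (s - 1) with t / (t + e) <= M / (M + e), and
    the denominator only grows with s. *)
Lemma fe_contract s M A : 1 <= s -> 0 < M -> pd A -> lowner A (M *: 1%:M) ->
  lowner (fe eps (s *: A)) ((1 + M / (M + eps) * (s - 1)) *: fe eps A).
Proof.
move=> s1 M0 pA AM; have s0 : 0 < s by apply: lt_le_trans s1.
case/pd_spectral: (pA) => u uu [e [e0 AE]].
have eM j : e 0 j <= M.
  rewrite (spectral_entry j uu AE); apply: le_trans (AM _) _.
  rewrite qfZ qf1; under eq_bigr do rewrite mxE; by rewrite unitary_row_norm // mulr1.
have -> : s *: A = u^t* *m diag_mx (s *: e) *m u.
  by rewrite AE linearZ /= -scalemxAr -scalemxAl.
rewrite {}AE !fe_spectral // => [|j]; last by rewrite mxE mulr_gt0.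
rewrite scalemxAl scalemxAr -linearZ /=; apply: spectral_le => j; rewrite !mxE.
move: (e 0 j) (e0 j) (eM j) => x x0 xM.
apply: (@le_trans _ _ ((s * x + eps) / (1 + eps * x))).
  rewrite ler_pM2l ?addr_gt0 ?mulr_gt0 // lef_pV2 ?posrE ?pos1 ?mulr_gt0 //.
  by rewrite lerD2l ler_pM2l // ler_peMl // ltW.
rewrite [X in _ <= X]mulrA ler_pM2r ?invr_gt0 ?pos1 //.
have -> : s * x + eps = x + eps + x * (s - 1) by ring.
rewrite mulrDl mul1r lerD2l mulrAC ler_wpM2r ?subr_ge0 //.
rewrite mulrAC ler_pdivlMr ?addr_gt0 // !mulrDr mulrC lerD2l.
by rewrite ler_pM2r.
Qed.
End Fe.
End Resolvent.

Section LownerLimit.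
Variables (R : realType) (U : set_system nat).
Hypothesis hU : UltraFilter U.
Variable N : nat.
Local Notation C := R[i].
Local Notation mcvg := (@mcvg R U).
Local Notation cR x := (x%:C)%C.
Implicit Types (A B L : 'M[C]_N) (An Bn : nat -> 'M[C]_N).
Local Open Scope classical_set_scope.

Let fU : ProperFilter U. Proof. exact: ultra_proper. Qed.
#[local] Existing Instance fU.

(** Convergence in the Thompson metric, which nonexpansive maps preserve. *)
Definition close An A :=
  forall r : R, 1 < r -> U [set n | lowner (An n) (cR r *: A) /\ lowner A (cR r *: An n)].

Lemma ucvg_qf An A v : mcvg An A -> ucvg U (fun n => qf (An n) v) (qf A v).
Proof.
by move=> h; apply: (mcvgM hU (mcvgM hU (mcvg_cst hU v) h) (mcvg_cst hU (v^t*))).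
Qed.

Lemma ucvg_le (x y : nat -> C) l m : ucvg U x l -> ucvg U y m ->
  U [set n | x n <= y n] -> l <= m.
Proof.
move=> hx hy h; rewrite -subr_ge0; apply: (ucvg_ge0 hU _ (ucvgD hU hy (ucvgN hU hx))).
by apply: filterS h => n /=; rewrite subr_ge0.
Qed.

Lemma mcvg_herm An A : (forall n, (An n)^t* = An n) -> mcvg An A -> A^t* = A.
Proof.
move=> h hA; have := mcvg_adj hU hA; under eq_fun do rewrite h.
by move=> k; apply: mcvg_unique hU _ _ _ _ _ k hA.
Qed.

Lemma le_all_gt1 (a b : C) : 0 <= b -> (forall r : R, 1 < r -> a <= cR r * b) -> a <= b.
Proof.
case: a b => ar ai [br bi]; rewrite lecE /= => /andP[/eqP -> b0] h.
have /h : 1 < 2 :> R by rewrite ltr1n.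
rewrite !lecE /= => /andP[/eqP <- _]; rewrite mulr0 mul0r addr0 eqxx /=.
apply/ler_addgt0Pr => e e0; have b1 : 0 < br + 1 by lra.
have /h : 1 < 1 + e / (br + 1) by rewrite ltrDl divr_gt0.
rewrite lecE /= => /andP[_] /le_trans; apply; rewrite mul0r subr0 mulrDl mul1r lerD2l.
by rewrite mulrAC ler_pdivrMr // ler_wpM2l ?ltW //; lra.
Qed.

Lemma close_lim An A B : (forall n, pd (An n)) -> pd A -> close An A -> mcvg An B -> B = A.
Proof.
move=> hn pA cl hB; have hB' := mcvg_herm (fun n => (hn n).1) hB; case: pA => hA pA.
have A0 v : 0 <= qf A v by have [->|/pA/ltW//] := eqVneq v 0; rewrite /qf !mul0mx mxE.
have le1 r v : 1 < r -> qf B v <= cR r * qf A v.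
  move=> /cl h; apply: (ucvg_le (ucvg_qf v hB) (ucvg_cst hU _)).
  by apply: filterS h => n /= [/lownerZP h1 _]; exact: h1.
have le2 r v : 1 < r -> qf A v <= cR r * qf B v.
  move=> /cl h; apply: (ucvg_le (ucvg_cst hU _) (ucvgM hU (ucvg_cst hU _) (ucvg_qf v hB))).
  by apply: filterS h => n /= [_ /lownerZP h1]; exact: h1.
apply: (lowner_anti hB' hA) => v; [by apply: le_all_gt1 => // r; exact: le1|apply: le_all_gt1 => [|r]; last exact: le2].
have /(le2 _ v) h : 1 < 2 :> R by rewrite ltr1n.
by have := le_trans (A0 v) h; rewrite pmulr_rge0 // ltcR ltr0n.
Qed.

Lemma qf_entry_bound (H : 'M[C]_N) (d : C) v : (forall i j, `|H i j| <= d) ->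
  `|qf H v| <= d * (N * 2)%:R * qf 1%:M v.
Proof.
move=> Hd; rewrite qf1; set S := \sum_j _.
have d0 (i j : 'I_N) : 0 <= d by exact: le_trans (normr_ge0 _) (Hd i j).
have -> : qf H v = \sum_j \sum_i v 0 i * H i j * (v 0 j)^*.
  by rewrite /qf mxE; apply: eq_bigr => j _; rewrite !mxE mulr_suml.
apply: le_trans (ler_norm_sum _ _ _) _.
apply: (@le_trans _ _ (\sum_(j < N) \sum_(i < N) d * (`|v 0 i| ^+ 2 + `|v 0 j| ^+ 2))).
  apply: ler_sum => j _; apply: le_trans (ler_norm_sum _ _ _) _; apply: ler_sum => i _.
  rewrite !normrM norm_conjC mulrAC mulrC.
  have h : `|v 0 i| * `|v 0 j| <= `|v 0 i| ^+ 2 + `|v 0 j| ^+ 2.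
    have [h|h] := real_leP (normr_real (v 0 i)) (normr_real (v 0 j)).
      by apply: le_trans (_ : `|v 0 j| ^+ 2 <= _); rewrite ?lerDr ?exprn_ge0 // expr2 ler_wpM2r.
    by apply: le_trans (_ : `|v 0 i| ^+ 2 <= _); rewrite ?lerDl ?exprn_ge0 // expr2 ler_wpM2l // ltW.
  exact: ler_pM.
rewrite le_eqVlt; apply/orP; left; apply/eqP.
under eq_bigr do rewrite -mulr_sumr big_split /= sumr_const card_ord -/S.
rewrite -mulr_sumr big_split /= sumr_const card_ord -sumrMnl -/S.
rewrite (_ : \sum_(i < N) `|v 0 i| ^+ 2 *+ N = S *+ N); last by rewrite /S sumrMnl.
by rewrite natrM -(mulr_natr S); ring.
Qed.

Lemma mcvg_close (c : R) An A : 0 < c -> (forall n, (An n)^t* = An n) -> A^t* = A ->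
  U [set n | lowner (cR c *: 1%:M) (An n)] -> lowner (cR c *: 1%:M) A ->
  mcvg An A -> close An A.
Proof.
move=> c0 hn hA cn cA hL r r1.
(* [qf_entry_bound] loses a factor 2N, and an error of (r - 1) c is affordable above the lower bound
   c. *)
pose d := (r - 1) * c / (N * 2).+1%:R.
have d0 : 0 < d by rewrite divr_gt0 ?mulr_gt0 ?subr_gt0.
have en (ij : 'I_N * 'I_N) : U [set n | `|An n ij.1 ij.2 - A ij.1 ij.2| <= cR d].
  case: (hL ij.1 ij.2) => /cvgrPdist_lt h1 /cvgrPdist_lt h2.
  have d2 : 0 < d / 2 by rewrite divr_gt0.
  move: (h1 _ d2) (h2 _ d2) => {}h1 {}h2; apply: filterS (filterI h1 h2) => n /=.
  case: (An n _ _) (A _ _) => a b [a' b'] /= [k1 k2].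
  apply: le_trans (_ : `|((a - a')%:C)%C| + `|'i * ((b - b')%:C)%C| <= _).
    apply: le_trans (ler_normD _ _); rewrite (_ : _ + _ = (a +i* b)%C - (a' +i* b')%C) //.
    by apply/eqP; rewrite eq_complex /= !(mul0r, mulr0, mul1r, subr0, addr0, add0r) !eqxx.
  rewrite normrM normCi mul1r !normc_def /= expr0n addr0 addr0 !sqrtr_sqr -rmorphD lecR.
  by rewrite distrC [`|b - _|]distrC; lra.
have {}en : U [set n | forall ij : 'I_N * 'I_N, `|An n ij.1 ij.2 - A ij.1 ij.2| <= cR d].
  exact: filter_forall.
apply: filterS (filterI en cn) => n [/= h1 h2].
have key v : `|qf (An n) v - qf A v| <= cR ((r - 1) * c) * qf 1%:M v.
  rewrite -qfB; apply: le_trans (qf_entry_bound v (d := cR d) _) _.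
    by move=> i j; rewrite !mxE; apply: (h1 (i, j)).
  have q0 : 0 <= qf 1%:M v by rewrite qf1 sumr_ge0 // => i _; rewrite exprn_ge0.
  rewrite ler_wpM2r //.
  rewrite -(rmorph_nat (real_complex R)) -rmorphM lecR /d mulrAC ler_pdivrMr //.
  by rewrite ler_wpM2l ?ler_nat //; apply: mulr_ge0; rewrite ?subr_ge0 ltW.
have k2 (x y : C) v : x \is Num.real -> cR c * qf 1%:M v <= y ->
    `|x - y| <= cR ((r - 1) * c) * qf 1%:M v -> y \is Num.real -> x <= cR r * y.
  move=> xr cy xy yr; have := le_trans (real_ler_norm (rpredB xr yr)) xy.
  rewrite lerBlDr => /le_trans; apply.
  rewrite -[X in _ <= X](_ : (cR r - 1) * y + y = _); last by ring.
  rewrite lerD2r rmorphM rmorphB /= -mulrA ler_wpM2l // subr_ge0.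
  by rewrite lecE /= eqxx ltW.
split; apply/lownerZP => v.
  have := cA v; rewrite qfZ => h; exact: k2 (qf_real v (hn n)) h (key v) (qf_real v hA).
have := h2 v; rewrite qfZ => h; apply: k2 (qf_real v hA) h _ (qf_real v (hn n)).
by rewrite distrC; apply: key.
Qed.

Lemma pd_entry_bound A (M : C) : pd A -> lowner A (M *: 1%:M) ->
  forall i j, `|A i j| <= M * 2.
Proof.
move=> pA AM i j; have dM k : A k k <= M.
  have := AM (delta_mx 0 k); rewrite qfZ qf1.
  rewrite (bigD1 k) //= mxE !eqxx normr1 expr1n big1 ?addr0 ?mulr1 => [|l lk].
    rewrite /qf -rowE => h; apply: le_trans h; rewrite mxE (bigD1 k) //= !mxE !eqxx.
    by rewrite conjC1 mulr1 big1 ?addr0 // => l lk; rewrite !mxE (negbTE lk) conjC0 mulr0.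
  by rewrite mxE (negbTE lk) andbF normr0 expr0n.
have [b _ AE] := cholesky pA.
apply: (@le_trans _ _ (A i i + A j j)); last by rewrite mulr_natr mulr2n lerD.
rewrite AE !mxE -big_split /=; apply: le_trans (ler_norm_sum _ _ _) _.
apply: ler_sum => k _; rewrite !mxE normrM norm_conjC -!normCK.
have [h|h] := real_leP (normr_real (b i k)) (normr_real (b j k)).
  by apply: le_trans (_ : `|b j k| ^+ 2 <= _); rewrite ?lerDr ?exprn_ge0 // expr2 ler_wpM2r.
by apply: le_trans (_ : `|b i k| ^+ 2 <= _); rewrite ?lerDl ?exprn_ge0 // expr2 ler_wpM2l // ltW.
Qed.
End LownerLimit.

(** With P = A + e and Q = 1 + e A, the relation A J A^T = J exchanges the constant and the
    quadratic terms, so P J P^T = Q J Q^T. This is f_e(1/t) = 1/f_e(t) at the level of the group. *)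
Lemma cayley_congr (F : fieldType) n (A J : 'M[F]_n) e : 1%:M + e *: A \in unitmx ->
  A *m J *m A^T = J ->
  (A + e%:M) *m invmx (1%:M + e *: A) *m J *m ((A + e%:M) *m invmx (1%:M + e *: A))^T = J.
Proof.
set P := A + e%:M; set Q := 1%:M + e *: A; move=> uQ hA.
have cm : P *m Q = Q *m P.
  rewrite !mulmxDl !mulmxDr !mulmx1 !mul1mx mul_mx_scalar mul_scalar_mx -scalemxAl -scalemxAr.
  by rewrite addrACA.
have k1 : P *m J *m P^T = Q *m J *m Q^T.
  have t1 : P^T = A^T + e%:M by apply/matrixP => i j; rewrite !mxE eq_sym.
  have t2 : Q^T = 1%:M + e *: A^T by apply/matrixP => i j; rewrite !mxE eq_sym.
  have b1 : P *m J = A *m J + e *: J by rewrite mulmxDl mul_scalar_mx.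
  have b2 : Q *m J = J + e *: (A *m J) by rewrite mulmxDl mul1mx scalemxAl.
  rewrite b1 b2 t1 t2 !mulmxDl !mulmxDr !mulmx1 -!scalemxAl hA !mul_mx_scalar -!scalemxAr hA.
  by rewrite addrACA.
have E : P *m invmx Q = invmx Q *m P.
  by apply: (can_inj (mulmxK uQ)); rewrite mulmxKV // -mulmxA cm mulKmx.
rewrite E trmx_mul !mulmxA -(mulmxA _ _ J) -(mulmxA _ _ P^T) k1 !mulmxA mulVmx // mul1mx.
by rewrite trmx_inv mulmxK // unitmx_tr.
Qed.

Lemma herm_bounded (R : realType) N (H : 'M[R[i]]_N) : H^t* = H ->
  exists2 m : R[i], 0 < m & lowner H (m *: 1%:M).
Proof.
move=> hH; pose d := \sum_i \sum_j `|H i j|.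
have d0 : 0 <= d by do 2! (apply: sumr_ge0 => ? _).
have Hd i j : `|H i j| <= d.
  rewrite /d (bigD1 i) //= (bigD1 j) //= -addrA lerDl addr_ge0 //; first exact: sumr_ge0.
  by do 2! (apply: sumr_ge0 => ? _).
exists (d * (N * 2)%:R + 1); first by rewrite ltr_wpDl // mulr_ge0.
move=> v; rewrite qfZ mulrDl mul1r; apply: le_trans (real_ler_norm (qf_real v hH)) _.
apply: le_trans (qf_entry_bound v Hd) _; by rewrite lerDl qf1; apply: sumr_ge0 => j _; rewrite exprn_ge0.
Qed.

Section Equilibrium.
Variables (R : realType) (N : nat).
Hypothesis N6 : (6 <= N)%N.
Local Notation C := R[i].
Local Notation cR x := (x%:C)%C.
Implicit Types (A B : 'M[C]_N).

(** Inversion in the group is transposition conjugated by [Jform], so an upper bound for [A] also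
    bounds its inverse. *)
Lemma inG_lowner A (M : C) : 0 < M -> pd A -> inG A -> lowner A (M *: 1%:M) ->
  lowner (M^-1 *: 1%:M) A.
Proof.
move=> M0 pA hA AM; have uA := pd_unit pA.
have iA : invmx A = Jform R N *m A^T *m (Jform R N)^T.
  by apply: (can_inj (mulKmx uA)); rewrite mulmxV // inGE.
have p' : pd (invmx A).
  case: pA => hA' pA; split=> [|v v0]; first by rewrite adj_inv hA'.
  rewrite (_ : qf _ v = qf A (v *m invmx A)); last by rewrite /qf adjM adj_inv hA' !mulmxA mulmxKV.
  by apply: pA; apply: contra v0 => /eqP va; rewrite -(mulmxKV uA v) va mul0mx.
have pM : pd (M *: 1%:M : 'M[C]_N) by rewrite scalemx1; apply: pd_scalar.
have h : lowner (invmx A) (M *: 1%:M).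
  move=> v; pose w := map_mx Num.conj (v *m Jform R N).
  have -> : qf (invmx A) v = qf A w.
    rewrite /qf iA; have -> : (w *m A *m w^t*) 0 0 = ((w *m A *m w^t*)^T) 0 0 by rewrite [RHS]mxE.
    have wt : w^t* = (v *m Jform R N)^T.
      by rewrite /w; apply/matrixP => i j; rewrite !mxE conjCK.
    have wT : w^T = (Jform R N)^T *m v^t* by rewrite /w map_trmx adjM J_adj.
    by rewrite wt trmx_mul trmxK trmx_mul wT !mulmxA.
  apply: le_trans (AM w) _; rewrite !qfZ ler_pM2l // !qf1 /w.
  rewrite (reindex_inj rev_ord_inj) /= le_eqVlt; apply/orP; left; apply/eqP.
  apply: eq_bigr => j _; rewrite mxE norm_conjC mulmxJ rev_ordK normrM normrX normrN1.
  by rewrite expr1n mulr1.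
have h2 := inv_antitone p' pM h; rewrite invmxK in h2.
by move=> v; apply: le_trans (h2 v); rewrite [M *: _]scalemx1 invmx_scalar scalemx1.
Qed.

Lemma fe_inG (eps : R) A : 0 < eps -> pd A -> inG A -> inG (fe (cR eps) A).
Proof.
move=> e0 pA hA; have uA := pd_unit pA; set e := cR eps.
have ep : 0 < e by rewrite ltcR.
have u1 : 1%:M + e *: A \in unitmx by apply/pd_unit/pdD; [apply: pd_scalar | apply: pdZ].
have u2 : A + e%:M \in unitmx by apply/pd_unit/pdD; [|apply: pd_scalar].
by rewrite /inG /fe; apply: (cayley_congr u1).
Qed.

Implicit Types (s : seq ('M[C]_N * 'rV[R]_3)).

Fixpoint Psi s A := if s is p :: s' then Psi s' (Phi p.1 p.2 A) else A.

Fixpoint legs s : Prop := if s is p :: s' then [/\ inG p.1, chamber p.2 & legs s'] else True.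

Lemma Psi_pd s A : legs s -> pd A -> pd (Psi s A).
Proof.
elim: s A => [A _ pA|[g v] s IH A [hg cv hs] pA]; first exact: pA.
have p1 := Phi_pd N6 v (inG_unit hg) pA; exact: (IH _ hs p1).
Qed.

Lemma Psi_inG s A : legs s -> pd A -> inG A -> inG (Psi s A).
Proof.
elim: s A => [A _ _ hA|[g v] s IH A [hg cv hs] pA hA]; first exact: hA.
have p1 := Phi_pd N6 v (inG_unit hg) pA.
have h1 := Phi_inG N6 v hg pA hA; exact: (IH _ hs p1 h1).
Qed.

Lemma Psi_mono s c A B : legs s -> 0 <= c -> pd A -> pd B ->
  lowner A (c *: B) -> lowner (Psi s A) (c *: Psi s B).
Proof.
move=> + c0; elim: s A B => [A B _ _ _ AB|[g v] s IH A B [hg cv hs] pA pB AB]; first exact: AB.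
have p1 := Phi_pd N6 v (inG_unit hg) pA; have p2 := Phi_pd N6 v (inG_unit hg) pB.
have h1 := Phi_mono (inG_unit hg) cv c0 pA pB AB; exact: (IH _ _ hs p1 p2 h1).
Qed.

Lemma lowner_mulr a b A B D : 0 <= a -> lowner A (a *: B) -> lowner B (b *: D) ->
  lowner A ((a * b) *: D).
Proof.
move=> a0 /lownerZP AB /lownerZP BD; apply/lownerZP => w; apply: le_trans (AB w) _.
by rewrite -mulrA ler_wpM2l.
Qed.

Lemma Psi_bound s : legs s -> exists2 M : R, 1 <= M & forall A, pd A ->
  lowner A (cR M *: Psi s A) /\ lowner (Psi s A) (cR M *: A).
Proof.
elim: s => [_|[g v] s IH].
  by exists 1 => // A _; rewrite (_ : cR 1 = 1) // scale1r; split=> w.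
case=> hg cv /IH[M M1 HM]; exists (expR (v 0 0) ^+ 2 * M).
  rewrite -[1]mulr1 ler_pM // expr_ge1 ?expR_ge0 // leNgt expR_lt1 -leNgt.
  by case: cv => a b c; lra.
move=> A pA; have p1 := Phi_pd N6 v (inG_unit hg) pA.
have [a1 a2] := Phi_bound (inG_unit hg) cv pA; have [b1 b2] := HM _ p1.
have c0 : 0 <= cR (expR (v 0 0)) ^+ 2 by rewrite exprn_ge0 // lecR expR_ge0.
have M0 : 0 <= cR M by rewrite lecR (le_trans ler01).
have E : cR (expR (v 0 0) ^+ 2 * M) = cR (expR (v 0 0)) ^+ 2 * cR M by rewrite !rmorphM.
rewrite E; split; first exact: lowner_mulr c0 a1 b1.
rewrite mulrC; exact: lowner_mulr M0 b2 a2.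
Qed.

Lemma Psi_close (U : set_system nat) s (An : nat -> 'M[C]_N) A : UltraFilter U -> legs s ->
  (forall n, pd (An n)) -> pd A -> close U An A -> close U (Psi s \o An) (Psi s A).
Proof.
move=> hU hs pn pA cl r r1; have /(@filterS _ U _) := cl r r1; apply=> n /= [h1 h2].
have r0 : 0 <= cR r by rewrite lecR (le_trans ler01) ?ltW.
by split; [exact: Psi_mono hs r0 (pn n) pA h1 | exact: Psi_mono hs r0 pA (pn n) h2].
Qed.

Section FixedPoint.
Variables (s : seq ('M[C]_N * 'rV[R]_3)) (eps : R).
Hypotheses (hs : legs s) (e0 : 0 < eps) (e1 : eps < 1).

Let F A := fe (cR eps) (Psi s A).
Let An n := iter n F 1%:M.

Let E0 : 0 < cR eps. Proof. by rewrite ltcR. Qed.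
Let E1 : cR eps < 1. Proof. by rewrite ltcR. Qed.

Let An_pdG n : pd (An n) /\ inG (An n).
Proof.
elim: n => [|n [p h]]; first by split; [apply: pd_scalar | apply: inG1].
have p' := Psi_pd hs p; have h' := Psi_inG hs p h; split; first exact: (fe_pd E0 p').
exact: (fe_inG e0 p' h').
Qed.

Let An_bound n : lowner (cR eps *: 1%:M) (An n) /\ lowner (An n) (cR eps^-1 *: 1%:M).
Proof.
case: n => [|n].
  split=> w; rewrite qfZ qf1; set q := \sum_j _.
    have q0 : 0 <= q by apply: sumr_ge0 => j _; rewrite exprn_ge0.
    by rewrite ler_piMl // ltW.
  have q0 : 0 <= q by apply: sumr_ge0 => j _; rewrite exprn_ge0.
  by rewrite ler_peMl // fmorphV /= -[X in X <= _]invr1 lef_pV2 ?posrE // ltW.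
have := fe_bound E0 E1 (Psi_pd hs (An_pdG n).1).
by rewrite -fmorphV.
Qed.

Lemma fe_fixpoint : exists A, [/\ pd A, inG A & A = fe (cR eps) (Psi s A)].
Proof.
have [M M1 HM] := Psi_bound hs; have M0 : 0 < M by apply: lt_le_trans M1.
(* The iterates are bounded by 1/eps, hence their images under [Psi] by M'; then [q] is the
   contraction factor of [fe_contract]. *)
pose M' := M * eps^-1; have M'0 : 0 < M' by rewrite mulr_gt0 ?invr_gt0.
pose q := M' / (M' + eps).
have Mq0 : 0 < M' + eps by rewrite addr_gt0.
have q0 : 0 <= q by rewrite divr_ge0 // ltW.
have q1 : q < 1 by rewrite ltr_pdivrMr // mul1r ltrDl.
have PM n : lowner (Psi s (An n)) (cR M' *: 1%:M).
  rewrite rmorphM; apply: lowner_mulr (HM _ (An_pdG n).1).2 (An_bound n).2.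
  by rewrite lecR ltW.
have con A B n (r : R) : 1 <= r -> pd A -> B = An n -> lowner A (cR r *: B) ->
    lowner (F A) (cR (1 + q * (r - 1)) *: F B).
  move=> r1 pA -> AB; have r0 : 0 < cR r by rewrite ltcR (lt_le_trans ltr01).
  have pB := (An_pdG n).1; have pPA := Psi_pd hs pA; have pPB := Psi_pd hs pB.
  have h := Psi_mono hs (ltW r0) pA pB AB.
  have h2 := fe_mono E0 E1 pPA (pdZ r0 pPB) h.
  have cr1 : 1 <= cR r by rewrite lecE /= eqxx.
  have cM : 0 < cR M' by rewrite ltcR.
  have h3 := fe_contract E0 cr1 cM pPB (PM n).
  move=> w; apply: le_trans (h2 w) _; rewrite (_ : cR (1 + _) = 1 + cR M' / (cR M' + cR eps) * (cR r - 1)); first exact: h3 w.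
  by rewrite /q rmorphD rmorphM rmorphB rmorphM fmorphV rmorphD.
(* Multiplicative distance of consecutive iterates; [t 0] is 1/eps, which bounds the distance from
   the identity to the first iterate. *)
pose t n := 1 + q ^+ n * (eps^-1 - 1).
have iv : 1 <= eps^-1 by rewrite invf_ge1 // ltW.
have t1 n : 1 <= t n by rewrite lerDl mulr_ge0 ?exprn_ge0 ?subr_ge0.
have step n : lowner (An n.+1) (cR (t n) *: An n) /\ lowner (An n) (cR (t n) *: An n.+1).
  elim: n => [|n [h1 h2]].
    rewrite /t expr0 mul1r addrC subrK; split; first exact: (An_bound 1).2.
    move=> w; have := (An_bound 1).1 w; rewrite qfZ => h; rewrite qfZ fmorphV /=.
    by rewrite mulrC ler_pdivlMr // mulrC.
  have -> : t n.+1 = 1 + q * (t n - 1) by rewrite /t exprS; ring.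
  split; first exact: con (t1 n) (An_pdG n.+1).1 (erefl (An n)) h1.
  exact: con (t1 n) (An_pdG n).1 (erefl (An n.+1)) h2.
have [U [hU hfree]] := free_ultrafilter.
have pU : ProperFilter U by exact: ultra_proper.
have evt (r : R) : 1 < r -> U [set n | t n <= r]%classic.
  move=> r1; have : (t @ \oo --> (1 : R))%classic.
    have h : ((fun n => 1 + q ^+ n * (eps^-1 - 1)) @ \oo --> (1 + 0 * (eps^-1 - 1) : R))%classic.
      apply: cvgD; first exact: cvg_cst.
      by apply: cvgM; [apply: cvg_expr; rewrite ger0_norm | exact: cvg_cst].
    by move: h; rewrite mul0r addr0.
  move/cvgrPdist_lt => /(_ (r - 1)); rewrite subr_gt0 => /(_ r1) [m _ hm].
  apply: filterS (hfree m) => n /= /hm /=; rewrite ltr_norml => /andP[]; lra.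
have bd n : forall i j, `|An n i j| <= cR (eps^-1 * 2).
  move=> i j; rewrite rmorphM rmorph_nat; exact: (pd_entry_bound (An_pdG n).1 (An_bound n).2).
(* The iterates and the shifted iterates have limits A and A' along [U]. The distances [t n] tend to
   1, so A' = A, and continuity of F gives A' = F A. *)
have [A hA] : exists A, mcvg U An A.
  by apply: (mcvg_bounded hU (M := eps^-1 * 2)); apply: filterS (hfree 0%N) => n _; apply: bd.
have [A' hA'] : exists A', mcvg U (fun n => An n.+1) A'.
  by apply: (mcvg_bounded hU (M := eps^-1 * 2)); apply: filterS (hfree 0%N) => n _; apply: bd.
have herm := mcvg_herm hU (fun n => (An_pdG n).1.1) hA.
have Ae : lowner (cR eps *: 1%:M) A.
  move=> w; apply: (ucvg_le hU (ucvg_cst hU _) (ucvg_qf hU w hA)).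
  by apply: filterS (hfree 0%N) => n _; apply: (An_bound n).1.
have pA : pd A.
  split=> // w w0; apply: lt_le_trans (Ae w); rewrite qfZ mulr_gt0 //.
  by have [_] := pd_scalar N (@ltr01 C); apply.
have GA : inG A.
  have := mcvgM hU (mcvgM hU hA (mcvg_cst hU (Jform R N))) (mcvg_tr hA).
  rewrite (_ : (fun n => _) = fun=> Jform R N); last by apply/funext => n; apply: (An_pdG n).2.
  by move=> k; apply/esym; apply: mcvg_unique hU _ _ _ _ _ (mcvg_cst hU _) k.
have cA : close U An A.
  apply: (mcvg_close hU e0) => //; first by move=> n; apply: (An_pdG n).1.1.
  by apply: filterS (hfree 0%N) => n _; apply: (An_bound n).1.
have EA : A' = A.
  apply: (close_lim hU (fun n => (An_pdG n.+1).1) pA _ hA') => r r1.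
  (* One square root of [r] pays for the passage between consecutive iterates, the other for the
     passage to the limit. *)
  pose r' := Num.sqrt r; have r'1 : 1 < r' by rewrite -sqrtr1 ltr_sqrt // (lt_trans ltr01).
  have rE : cR r = cR r' * cR r' by rewrite -rmorphM -expr2 sqr_sqrtr // ltW // (lt_trans ltr01).
  have r0 : 0 <= cR r' by rewrite lecR (le_trans ler01) ?ltW.
  apply: filterS (filterI (evt _ r'1) (cA _ r'1)) => n /= [h [h1 h2]]; rewrite rE.
  have [s1 s2] := step n; have tr B D : pd D -> lowner B (cR (t n) *: D) -> lowner B (cR r' *: D).
    move=> [_ pD] BD w; apply: le_trans (BD w) _; rewrite !qfZ ler_wpM2r ?lecR //.
    by have [->|/pD/ltW//] := eqVneq w 0; rewrite /qf !mul0mx mxE.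
  split; first exact: lowner_mulr r0 (tr _ _ (An_pdG n).1 s1) h1.
  exact: lowner_mulr r0 h2 (tr _ _ (An_pdG n.+1).1 s2).
exists A; split=> //; rewrite -{1}EA.
apply: (close_lim hU (fun n => (An_pdG n.+1).1) (fe_pd E0 (Psi_pd hs pA)) _ hA') => r r1.
have r0 : 0 < cR r by rewrite ltcR (lt_trans ltr01).
apply: filterS (cA r r1) => n /= [h1 h2].
have sub B D : pd B -> pd D -> lowner B (cR r *: D) ->
    lowner (F B) (cR r *: F D).
  move=> pB pD BD; have pPB := Psi_pd hs pB; have pPD := Psi_pd hs pD.
  have h := Psi_mono hs (ltW r0) pB pD BD.
  have h3 := fe_mono E0 E1 pPB (pdZ r0 pPD) h.
  have cr1 : 1 <= cR r by rewrite lecE /= eqxx ltW.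
  have [m m0 Dm] : exists2 m : C, 0 < m & lowner (Psi s D) (m *: 1%:M).
    exact: herm_bounded pPD.1.
  have h4 := fe_contract E0 cr1 m0 pPD Dm.
  move=> w; apply: le_trans (h3 w) _; apply: le_trans (h4 w) _; rewrite !qfZ.
  apply: ler_wpM2r; first by have [_ p] := fe_pd E0 pPD; have [->|/p/ltW//] := eqVneq w 0; rewrite /qf !mul0mx mxE.
  rewrite -lerBrDl ler_piMl ?subr_ge0 // ler_pdivrMr ?addr_gt0 // mul1r lerDl ltW //.
by split; [exact: sub (An_pdG n).1 pA h1 | exact: sub pA (An_pdG n).1 h2].
Qed.
End FixedPoint.
End Equilibrium.

(** * Limits of fixed points *)

Section RankDrop.
Variables (R : realType) (U : set_system nat).
Hypothesis hU : UltraFilter U.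
Local Notation C := R[i].
Local Notation mcvg := (@mcvg R U).
Local Notation cR x := (x%:C)%C.
Local Open Scope classical_set_scope.

Let fU : ProperFilter U. Proof. exact: ultra_proper. Qed.
#[local] Existing Instance fU.

Lemma unitary_entry_le1 d N (q : 'M[C]_(d, N)) i j : q \is unitarymx -> `|q i j| <= 1.
Proof.
move=> /(unitary_row_norm i) h; rewrite -(@expr_le1 _ 2) //.
by rewrite -h (bigD1 j) //= lerDl sumr_ge0 // => l _; rewrite exprn_ge0.
Qed.

Lemma mcvg_adjugate m (A : nat -> 'M[C]_m) L : mcvg A L -> mcvg (fun n => \adj (A n)) (\adj L).
Proof.
move=> h i j; rewrite !mxE /cofactor; under eq_fun do rewrite !mxE /cofactor.
apply: (ucvgM hU (ucvg_cst hU _)); apply: (ucvg_det hU) => k l.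
by rewrite !mxE; under eq_fun do rewrite !mxE; apply: h.
Qed.

(** Solves the equation for the term that carries the diagonal blowing up. *)
Lemma blowup_split r d N (w : 'M[C]_(r, N)) (f S c P : 'M[C]_N) (a : 'M[C]_(N, d)) (D : 'M[C]_d) (t : 'M[C]_(d, N)) :
  f *m (a *m D *m t + S) *m c *m P = 0 ->
  w *m (f *m a) *m D *m (t *m c *m P) = w *m f *m (- S *m c *m P).
Proof.
rewrite mulmxDr !mulmxDl => /eqP; rewrite addr_eq0 => /eqP k.
have -> : w *m (f *m a) *m D *m (t *m c *m P) = w *m (f *m (a *m D *m t) *m c *m P).
  by rewrite !mulmxA.
by rewrite k !mulNmx !mulmxN !mulmxA.
Qed.

(* Where [delta] blows up, the equation forces [t c P] to vanish on the rows of
   [f t^*]; these are orthonormalised after scaling by [delta] so that they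
   keep full rank in the limit. *)
Lemma rank_drop d N (f P : 'M[C]_N) (t : nat -> 'M[C]_(d, N)) (c S : nat -> 'M[C]_N)
    (delta : nat -> 'rV[C]_d) t0 c0 S0 :
  mcvg t t0 -> mcvg c c0 -> mcvg S S0 ->
  (forall n j, delta n 0 j != 0) -> (forall j, ucvg U (fun n => (delta n 0 j)^-1) 0) ->
  (forall n, f *m ((t n)^t* *m diag_mx (delta n) *m t n + S n) *m c n *m P = 0) ->
  (\rank (t0 *m c0 *m P) + \rank (f *m t0^t*) <= d)%N.
Proof.
move=> ht hc hS dn0 hd eqn.
set M0 := f *m t0^t*; pose r := \rank M0; pose m0 : 'M[C]_(r, d) := row_base M0.
have fm0 : row_free m0 by apply: row_base_free.
have [w wM0] : exists w : 'M[C]_(r, N), w *m M0 = m0.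
  by exists (m0 *m pinvmx M0); rewrite mulmxKpV // eq_row_base.
have [x mx1] : exists x, m0 *m x = 1%:M by apply/row_freeP.
pose m n := w *m (f *m (t n)^t*).
move: (m0) fm0 wM0 mx1 => {}m0 fm0 wM0 mx1.
have hm : mcvg m m0.
  by rewrite -wM0; apply: (mcvgM hU (mcvg_cst hU w)); apply: (mcvgM hU (mcvg_cst hU f)); exact: (mcvg_adj hU ht).
(* The adjugate takes the place of the inverse of [m n *m x]: it converges without any division, and
   the determinant [e n] tends to 1. *)
pose e n := \det (m n *m x).
have he : ucvg U e 1.
  by rewrite -(det1 C r) -mx1; apply: (ucvg_det hU); apply: (mcvgM hU hm (mcvg_cst hU x)).
pose Dinv n : 'M[C]_d := diag_mx (\row_j (delta n 0 j)^-1).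
have hD : mcvg Dinv 0.
  move=> i j; rewrite mxE; under eq_fun do rewrite !mxE.
  by case: eqP => [->|_]; [under eq_fun do rewrite mulr1n | apply: (ucvg_cst hU)].
have DK n : diag_mx (delta n) *m Dinv n = 1%:M.
  rewrite mulmx_diag (_ : \row_j _ = const_mx 1) ?diag_const_mx //.
  by apply/rowP => j; rewrite !mxE divff.
have hqn n : exists q : 'M[C]_(r, d), (forall i j, `|q i j| <= 1) /\
    (row_free (m n) -> q *m q^t* = 1%:M /\ exists X : 'M[C]_r, q = X *m m n *m diag_mx (delta n)).
  have [fm|nf] := boolP (row_free (m n)); last first.
    (* A placeholder for the indices, negligible for [U], where [m n] does not have full rank. *)
    by exists 0; split=> // i j; rewrite mxE normr0.
  have fD : row_free (m n *m diag_mx (delta n)).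
    rewrite /row_free mxrankMfree // row_free_unit.
    by case/mulmx1_unit: (DK n).
  have [q uq [a ua aE]] := unitary_factor fD; exists q; split=> [i j|_].
    exact: unitary_entry_le1.
  split; first exact/unitarymxP.
  by exists (invmx a); rewrite -mulmxA aE mulKmx.
have [q hq] := choice hqn.
have [q0 hq0] : exists q0, mcvg q q0.
  apply: (@mcvg_bounded _ _ hU _ _ _ 1); apply: filterS filterT => n _ i j.
  by rewrite (_ : cR 1 = 1) //; apply: (hq n).1.
have ev : U [set n | row_free (m n)].
  have [/cvgrPdist_lt h _] := he; have /h : 0 < 1 :> R by [].
  apply: filterS => n /= k; have e0 : e n != 0.
    by apply: contraTneq k => ->; rewrite /= subr0 normr1 ltxx.
  rewrite -row_leq_rank; have : \rank (m n *m x) = r.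
    by apply: mxrank_unit; rewrite unitmxE unitfE.
  by move=> rE; apply: leq_trans (mxrankM_maxl (m n) x); rewrite rE.
have q0u : q0 *m q0^t* = 1%:M.
  apply: (mcvg_unique hU (mcvgM hU hq0 (mcvg_adj hU hq0))).
  apply: mcvg_near (mcvg_cst hU 1%:M); apply: filterS ev => n /= /((hq n).2)[] //.
have Y0 : q0 *m (t0 *m c0 *m P) = 0.
  have h1 : mcvg (fun n => e n *: (q n *m (t n *m c n *m P))) (1 *: (q0 *m (t0 *m c0 *m P))).
    have h := mcvgM hU hq0 (mcvgM hU (mcvgM hU ht hc) (mcvg_cst hU P)).
    by move=> i j; rewrite mxE; under eq_fun do rewrite mxE; apply: (ucvgM hU he (h i j)).
  have hadj : exists L, mcvg (fun n => \adj (m n *m x)) L.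
    by exists (\adj (m0 *m x)); apply: mcvg_adjugate; apply: (mcvgM hU hm (mcvg_cst hU x)).
  have [L hL] := hadj.
  have h2 : mcvg (fun n => q n *m Dinv n *m (x *m \adj (m n *m x) *m w *m f *m (- (S n) *m c n *m P)))
     (q0 *m 0 *m (x *m L *m w *m f *m (- S0 *m c0 *m P))).
    apply: (mcvgM hU (mcvgM hU hq0 hD)); apply: (mcvgM hU _ (mcvgM hU (mcvgM hU _ hc) (mcvg_cst hU P))).
      by do 2! apply: (mcvgM hU _ (mcvg_cst hU _)); apply: (mcvgM hU (mcvg_cst hU x) hL).
    by move=> i j; rewrite mxE; under eq_fun do rewrite mxE; apply: (ucvgN hU).
  rewrite mulmx0 mul0mx scale1r in h1 h2.
  apply: (mcvg_unique hU h1); apply: mcvg_near h2; apply: filterS ev => n /= /((hq n).2)[_ [X XE]].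
  have k1 : m n *m diag_mx (delta n) *m (t n *m c n *m P) = w *m f *m (- (S n) *m c n *m P).
    exact: blowup_split (eqn n).
  rewrite XE -[X *m m n *m diag_mx _ *m Dinv n]mulmxA DK mulmx1.
  have -> : X *m m n *m (x *m \adj (m n *m x) *m w *m f *m (- S n *m c n *m P)) =
     X *m (m n *m x *m \adj (m n *m x)) *m (w *m f *m (- S n *m c n *m P)) by rewrite !mulmxA.
  by rewrite mul_mx_adj mul_mx_scalar -scalemxAl -k1 !mulmxA.
have := mulmx0_rank_max Y0; rewrite addnC.
suff -> : \rank q0 = r by [].
apply/eqP; rewrite -[_ == _]/(row_free q0); apply/row_freeP; by exists (q0^t*).
Qed.
End RankDrop.

(** Applied to the form restricted to eigenvectors of a group element with eigenvalues above 1: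
    these span an isotropic subspace. *)
Lemma diag_expand0 (C : numFieldType) d (a : 'rV[C]_d) (X : 'M[C]_d) :
  (forall j, 1 < a 0 j) -> X = diag_mx a *m X *m diag_mx a -> X = 0.
Proof.
move=> a1 E; apply/matrixP => i j; rewrite [RHS]mxE; move/matrixP/(_ i j): E.
rewrite mul_diag_mx mul_mx_diag !mxE mulrAC => /eqP.
rewrite -subr_eq0 -{1}[X i j]mul1r -mulrBl mulf_eq0 => /orP[|/eqP //].
by rewrite subr_eq0 lt_eqF // -[X in X < _]mulr1 ltr_pM.
Qed.

Lemma mul_sub_le (R : realDomainType) (a r q d : R) : 0 <= a -> r + q <= d -> a * r <= a * d - a * q.
Proof. by move=> a0 h; rewrite -mulrBr ler_wpM2l // lerBrDr. Qed.

Lemma flip_sum (R : realDomainType) (x1 x2 x3 y1 y2 y3 : R) : 0 <= x1 + x2 + x3 ->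
  x1 <= - y1 -> x2 <= - y2 -> x3 <= - y3 -> y1 + y2 + y3 <= 0.
Proof. by lra. Qed.

(** The weights are antisymmetric under reversal of the coordinates, so a bound linking ranks at k
    and N - k compares one slope with the opposite of the other. *)
Lemma slope_flip (R : realType) N d (v : 'rV[R]_3) (y z : 'M[R[i]]_(d, N)) :
  (3 <= N)%N -> chamber v -> (forall k, (k <= N)%N -> (rk k y + rk (N - k) z <= d)%N) ->
  slope v y <= - slope v z.
Proof.
move=> N3 [h1 h2 h3] h; have E k k' a : (k <= N)%N -> (k' + k = N)%N -> 0 <= a ->
    a * ((rk k y)%:R : R) <= a * d%:R - a * (rk k' z)%:R.
  move=> kN kk a0; apply: mul_sub_le => //; rewrite -natrD ler_nat.
  by have := h k kN; rewrite (_ : (N - k)%N = k') //; lia.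
have e k a : (k <= 3)%N -> 0 <= a -> a * ((rk k y)%:R : R) <= a * d%:R - a * (rk (N - k) z)%:R.
  by move=> k3; apply: E; lia.
have e' k a : (k <= 3)%N -> 0 <= a -> a * ((rk (N - k) y)%:R : R) <= a * d%:R - a * (rk k z)%:R.
  by move=> k3; apply: E; lia.
have g1 : 0 <= v 0 0 - v 0 1 by rewrite subr_ge0.
have g2 : 0 <= v 0 1 - v 0 2 by rewrite subr_ge0.
have := (e 1%N _ isT g1, e' 1%N _ isT g1, e 2%N _ isT g2, e' 2%N _ isT g2, e 3%N _ isT h3, e' 3%N _ isT h3).
rewrite /slope /level /steps !big_cons !big_nil /=.
move: (rk 1 y) (rk 2 y) (rk 3 y) (rk (N - 1) y) (rk (N - 2) y) (rk (N - 3) y) => a1 a2 a3 a4 a5 a6.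
move: (rk 1 z) (rk 2 z) (rk 3 z) (rk (N - 1) z) (rk (N - 2) z) (rk (N - 3) z) => b1 b2 b3 b4 b5 b6.
by move: (v 0 0) (v 0 1) (v 0 2) => x1 x2 x3 [[[[[]]]]]; lra.
Qed.

(** * Bounded and unbounded families of fixed points *)

Section Limit.
Variables (R : realType) (U : set_system nat).
Hypothesis hU : UltraFilter U.
Variable N : nat.
Hypothesis N6 : (6 <= N)%N.
Local Notation C := R[i].
Local Notation mcvg := (@mcvg R U).
Local Notation cR x := (x%:C)%C.
Local Open Scope classical_set_scope.

Let fU : ProperFilter U. Proof. exact: ultra_proper. Qed.
#[local] Existing Instance fU.

Lemma ucvg0 (x : nat -> C) : (forall e : R, 0 < e -> U [set n | `|x n| <= cR e]) -> ucvg U x 0.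
Proof.
move=> h; split; apply/cvgrPdist_lt => e e0; have e2 : 0 < e / 2 by rewrite divr_gt0.
  apply: filterS (h _ e2) => n /= /normC_Re_Im[k _]; rewrite sub0r normrN; lra.
apply: filterS (h _ e2) => n /= /normC_Re_Im[_ k]; rewrite sub0r normrN; lra.
Qed.

Lemma mcvg_inG (A : nat -> 'M[C]_N) L : (forall n, inG (A n)) -> mcvg A L -> inG L.
Proof.
move=> h hL; have := mcvgM hU (mcvgM hU hL (mcvg_cst hU (Jform R N))) (mcvg_tr hL).
rewrite (_ : (fun n => _) = fun=> Jform R N); last by apply/funext => n; apply: h.
by move=> k; apply/esym; apply: mcvg_unique hU _ _ _ _ _ (mcvg_cst hU _) k.
Qed.

Lemma ucvg_gram d (X : nat -> 'M[C]_(d, N)) L : mcvg X L -> ucvg U (fun n => gram (X n)) (gram L).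
Proof. by move=> h; apply: (ucvg_det hU); apply: (mcvgM hU h (mcvg_adj hU h)). Qed.

Lemma sq_entry_bound (c : 'M[C]_N) (K : C) : lowner (c *m c^t*) (K *: 1%:M) ->
  forall i j, `|c i j| <= 1 + K.
Proof.
move=> h i j; have d1 : qf 1%:M (delta_mx 0 i : 'rV[C]_N) = 1.
  rewrite qf1 (bigD1 i) //= mxE !eqxx normr1 expr1n big1 ?addr0 // => l li.
  by rewrite mxE (negbTE li) andbF normr0 expr0n.
have : `|c i j| ^+ 2 <= K.
  have := h (delta_mx 0 i); rewrite qfZ d1 mulr1 qf_sq /nrm -rowE => h'; apply: le_trans h'.
  by rewrite (bigD1 j) //= mxE lerDl sumr_ge0 // => l _; rewrite exprn_ge0.
move=> k; have [l|l] := real_leP (normr_real (c i j)) (real1 C).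
  by rewrite (le_trans l) // lerDl (le_trans _ k) ?exprn_ge0.
rewrite (le_trans _ (_ : K <= 1 + K)) ?lerDr //; apply: le_trans k.
by rewrite expr2 ler_peMr // ltW.
Qed.

Section Bounded.
Variables (s : seq ('M[C]_N * 'rV[R]_3)) (eps : nat -> R) (A : nat -> 'M[C]_N) (M : R).
Hypotheses (hs : legs s) (e0 : forall n, 0 < eps n) (el : eps @ U --> (0 : R)).
Hypotheses (pA : forall n, pd (A n)) (hA : forall n, inG (A n)).
Hypothesis fA : forall n, A n = fe (cR (eps n)) (Psi s (A n)).
Hypotheses (M0 : 0 < M) (AM : U [set n | lowner (A n) (cR M *: 1%:M)]).

(** Multiplied out as A (1 + e Psi A) = Psi A + e, the fixed point equation passes to the limit e =
    0. *)
Lemma limit_bounded : exists L, [/\ pd L, inG L & Psi s L = L].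
Proof.
have cM : 0 < cR M by rewrite ltcR.
have [L hL] : exists L, mcvg A L.
  apply: (mcvg_bounded hU (M := M * 2)); apply: filterS AM => n /= h i j.
  rewrite rmorphM rmorph_nat; exact: (pd_entry_bound (pA n) h).
have Al : U [set n | lowner (cR M^-1 *: 1%:M) (A n)].
  apply: filterS AM => n /= h; rewrite fmorphV; exact: inG_lowner cM (pA n) (hA n) h.
have Mi : 0 < M^-1 by rewrite invr_gt0.
have herm := mcvg_herm hU (fun n => (pA n).1) hL.
have Ll : lowner (cR M^-1 *: 1%:M) L.
  move=> w; apply: (ucvg_le hU (ucvg_cst hU _) (ucvg_qf hU w hL)).
  by apply: filterS Al => n h; apply: h.
have pL : pd L.
  split=> // w w0; apply: lt_le_trans (Ll w); rewrite qfZ mulr_gt0 ?ltcR //.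
  by have [_] := pd_scalar N (@ltr01 C); apply.
have GL := mcvg_inG hA hL.
have cL := mcvg_close hU Mi (fun n => (pA n).1) herm Al Ll hL.
exists L; split=> //.
have [K K1 HK] := Psi_bound N6 hs; have K0 : 0 < K by apply: lt_le_trans K1.
have K0' : 0 <= cR K by rewrite lecR ltW.
have [B hB] : exists B, mcvg (Psi s \o A) B.
  apply: (mcvg_bounded hU (M := K * M * 2)); apply: filterS AM => n /= h i j.
  have h2 := lowner_mulr K0' (HK _ (pA n)).2 h.
  rewrite rmorphM rmorph_nat rmorphM; exact: (pd_entry_bound (Psi_pd N6 hs (pA n)) h2).
have cB := Psi_close N6 hU hs pA pL cL.
have BE := close_lim hU (fun n => Psi_pd N6 hs (pA n)) (Psi_pd N6 hs pL) cB hB.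
rewrite -BE; have he := ucvg_real hU el.
have h1 : mcvg (fun n => A n + cR (eps n) *: (A n *m Psi s (A n))) (L + 0 *: (L *m B)).
  apply: (mcvgD hU hL) => i j; have h := mcvgM hU hL hB i j.
  by rewrite mxE; under eq_fun do rewrite mxE; apply: (ucvgM hU he h).
have h2 : mcvg (fun n => Psi s (A n) + (cR (eps n))%:M) (B + 0%:M).
  apply: (mcvgD hU hB) => i j; rewrite mxE; under eq_fun do rewrite mxE.
  case: (i == j); first by rewrite mulr1n; under eq_fun do rewrite mulr1n.
  by rewrite mulr0n; under eq_fun do rewrite mulr0n; apply: (ucvg_cst hU).
rewrite scale0r addr0 in h1; rewrite raddf0 addr0 in h2.
apply: (mcvg_unique hU h2); apply: mcvg_near h1; apply: filterS filterT => n _.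
have ce : 0 < cR (eps n) by rewrite ltcR.
have pP := Psi_pd N6 hs (pA n).
have u1 : 1%:M + cR (eps n) *: Psi s (A n) \in unitmx.
  by apply: pd_unit; apply: pdD (pd_scalar _ ltr01) (pdZ ce pP).
rewrite /=; have := fA n; move: (A n) (Psi s (A n)) u1 => X P u1 ->.
by rewrite scalemxAr -[X in X + _]mulmx1 -mulmxDr /fe mulmxKV.
Qed.
End Bounded.

Section Unbounded.
Variables (g1 g2 g3 : 'M[C]_N) (v1 v2 v3 : 'rV[R]_3).
Hypotheses (hg1 : inG g1) (hg2 : inG g2) (hg3 : inG g3).
Hypotheses (cv1 : chamber v1) (cv2 : chamber v2) (cv3 : chamber v3).

(** Everything is normalized by A^(-1/2): [c1], [c2] and [c3] are the frames at the three successive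
    forms multiplied by it, and they stay bounded although [A] does not. [T] indexes the eigenvalues
    of [A] that grow beyond every bound, and [ale] says that [Psi] does not shrink those
    directions. *)
Variables (A u c1 c2 c3 : nat -> 'M[C]_N) (e al : nat -> 'rV[C]_N) (T : {set 'I_N}).
Hypotheses (hA : forall n, inG (A n)).
Hypotheses (uu : forall n, u n \is unitarymx) (a0 : forall n j, 0 < al n 0 j).
Hypothesis AE : forall n, A n = (u n)^t* *m diag_mx (al n) *m u n.
Hypothesis c1_sq : forall n, c1 n *m (c1 n)^t* = 1%:M.
Hypothesis c2_sq : forall n, c2 n *m (c2 n)^t* = (c1 n *m weight N v1) *m (c1 n *m weight N v1)^t*.
Hypothesis c3_sq : forall n, c3 n *m (c3 n)^t* = (c2 n *m weight N v2) *m (c2 n *m weight N v2)^t*.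
Hypothesis c4_sq : forall n, (c3 n *m weight N v3) *m (c3 n *m weight N v3)^t* =
  (u n)^t* *m diag_mx (\row_j (e n 0 j / al n 0 j)) *m u n.
Hypothesis ale : forall n j, 1 <= al n 0 j -> al n 0 j <= e n 0 j.
Hypothesis Tinf : forall j, j \in T -> forall M : R, U [set n | cR M < al n 0 j].
Hypothesis Tfin : forall j, j \notin T -> exists M : R, U [set n | al n 0 j <= cR M].

Let sq n : 'rV[C]_N := \row_j sqrtC (al n 0 j).
Hypothesis lo1 : forall n, lower (g1 *m ((u n)^t* *m diag_mx (sq n) *m u n) *m c1 n).
Hypothesis lo2 : forall n, lower (g2 *m ((u n)^t* *m diag_mx (sq n) *m u n) *m c2 n).
Hypothesis lo3 : forall n, lower (g3 *m ((u n)^t* *m diag_mx (sq n) *m u n) *m c3 n).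

Local Notation d := #|T|.
Let f (i : 'I_d) : 'I_N := enum_val i.
Let t n : 'M[C]_(d, N) := rowsub f (u n).

Let tu n x : t n *m ((u n)^t* *m diag_mx x *m u n) = diag_mx (\row_j x 0 (f j)) *m t n.
Proof.
rewrite /t mul_rowsub_mx !mulmxA (unitarymxP (uu n)) mul1mx !mul_diag_mx.
by apply/matrixP => i j; rewrite !mxE.
Qed.

Let tt n : t n *m (t n)^t* = 1%:M.
Proof.
apply/matrixP => i j; rewrite !mxE.
have /unitarymxP/matrixP/(_ (f i) (f j)) := uu n; rewrite !mxE (inj_eq enum_val_inj) => <-.
by apply: eq_bigr => k _; rewrite !mxE.
Qed.

Let split_sq n x : (u n)^t* *m diag_mx x *m u n = (t n)^t* *m diag_mx (\row_j x 0 (f j)) *m t n +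
  (u n)^t* *m diag_mx (\row_j (if j \in T then 0 else x 0 j)) *m u n.
Proof.
rewrite !mul_mx_diag; apply/matrixP => i j; rewrite !mxE.
rewrite (bigID (mem T)) /=; congr (_ + _).
  rewrite big_enum_val; apply: eq_bigr => k _; by rewrite !mxE.
rewrite [RHS](bigID (mem T)) /= [X in _ = X + _]big1 ?add0r => [|k kT]; last first.
  by rewrite !mxE kT mulr0 mul0r.
by apply: eq_bigr => k kT; rewrite !mxE (negbTE kT).
Qed.

Let S n : 'M[C]_N := (u n)^t* *m diag_mx (\row_j (if j \in T then 0 else sq n 0 j)) *m u n.

Let S_lim : exists S0, mcvg S S0.
Proof.
have hM j : exists M : R, U [set n | `|if j \in T then 0 else sq n 0 j| <= cR M].
  have [jT|/Tfin[M hM]] := boolP (j \in T).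
    by exists 0; apply: filterS filterT => n _ /=; rewrite normr0.
  exists (1 + M); apply: filterS hM => n /= h.
  rewrite mxE ger0_norm ?sqrtC_ge0 ?(ltW (a0 n j)) //.
  have s0 : 0 <= sqrtC (al n 0 j) by rewrite sqrtC_ge0 ltW.
  have k := sqrtCK (al n 0 j); rewrite rmorphD rmorph1.
  have [l|l] := real_leP (ger0_real s0) (real1 C).
    by rewrite (le_trans l) // lerDl (le_trans _ h) // ltW.
  apply: (le_trans _ (_ : cR M <= 1 + cR M)); last by rewrite lerDr.
  by apply: le_trans h; rewrite -[X in _ <= X]k expr2 ler_peMr // ltW.
have [M {}hM] := choice hM.
apply: (mcvg_bounded hU (M := \sum_j M j)).
have /filter_forall h : forall j, \near U, `|if j \in T then 0 else sq U 0 j| <= cR (M j) by [].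
apply: filterS h => n h i j; rewrite /S mul_mx_diag mxE.
apply: le_trans (ler_norm_sum _ _ _) _; rewrite rmorph_sum; apply: ler_sum => k _.
rewrite !mxE !normrM norm_conjC -[X in _ <= X]mulr1 ler_pM ?mulr_ge0 //; last first.
  exact: unitary_entry_le1 (uu n).
rewrite -[X in _ <= X]mul1r ler_pM //; first exact: unitary_entry_le1 (uu n).
by have := h k; rewrite !mxE.
Qed.

Let t_lim : exists t0, mcvg t t0.
Proof.
apply: (mcvg_bounded hU (M := 1)); apply: filterS filterT => n _ i j.
by rewrite mxE (_ : cR 1 = 1) //; exact: unitary_entry_le1 (uu n).
Qed.

Let c_lim (c : nat -> 'M[C]_N) (K : R) : (forall n, lowner (c n *m (c n)^t*) (cR K *: 1%:M)) ->
  exists c0, mcvg c c0.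
Proof.
move=> h; apply: (mcvg_bounded hU (M := 1 + K)); apply: filterS filterT => n _ i j.
by rewrite rmorphD rmorph1; exact: sq_entry_bound (h n) i j.
Qed.

Let weight_sq v (c : 'M[C]_N) K : chamber v -> lowner (c *m c^t*) (cR K *: 1%:M) ->
  lowner ((c *m weight N v) *m (c *m weight N v)^t*) (cR (expR (v 0 0) ^+ 2 * K) *: 1%:M).
Proof.
move=> cv h w; rewrite qf_sq; apply: le_trans (nrm_weight c w cv).2 _.
have E : cR (expR (v 0 0) ^+ 2 * K) = cR (expR (v 0 0)) ^+ 2 * cR K by rewrite !rmorphM.
have c0 : 0 <= cR (expR (v 0 0)) ^+ 2 by rewrite exprn_ge0 // lecR expR_ge0.
have := h w; rewrite qf_sq !qfZ => h'; have := ler_wpM2l c0 h'.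
by rewrite mulrA -E.
Qed.

Let gram_sq (x y : 'M[C]_N) (t' : 'M[C]_(d, N)) : x *m x^t* = y *m y^t* -> gram (t' *m x) = gram (t' *m y).
Proof. by move=> h; rewrite /gram !adjM !mulmxA -!(mulmxA t') h. Qed.

(** Lower triangularity of g A^(1/2) c is the equation required by [rank_drop], the growing part of
    A^(1/2) being the diagonal that blows up. [Jform] turns the initial coordinates of g t0^* into
    the final ones of conj(t0) J g^(-1). *)
Let drop t0 (c : nat -> 'M[C]_N) c0 g : mcvg t t0 -> mcvg c c0 -> inG g ->
  (forall n, lower (g *m ((u n)^t* *m diag_mx (sq n) *m u n) *m c n)) ->
  forall k, (k <= N)%N ->
    (rk k (t0 *m c0) + rk (N - k) (map_mx Num.conj t0 *m Jform R N *m invmx g) <= d)%N.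
Proof.
move=> ht hc hg lo k kN; have [S0 hS] := S_lim.
have h := @rank_drop R U hU d N ((1%:M - cproj C N k) *m g) (cproj C N k) t c S
   (fun n => \row_j sq n 0 (f j)) t0 c0 S0 ht hc hS.
have e0 : (rk (N - k) (map_mx Num.conj t0 *m Jform R N *m invmx g) =
    \rank ((1%:M - cproj C N k) *m g *m t0^t*))%N.
  have h1 : Jform R N *m invmx g = g^T *m Jform R N.
    have := inG_tr hg; rewrite /inG trmxK => h1; apply: (can_inj (mulmxK (inG_unit hg))).
    by rewrite mulmxKV ?inG_unit.
  have h2 : Jform R N *m cproj C N (N - k) = (1%:M - cproj C N k) *m Jform R N.
    rewrite mulmxBl mul1mx mul_mx_diag mul_diag_mx; apply/matrixP => i j; rewrite !mxE.
    case: eqP => [->|_]; last by rewrite mulr0n !mul0r mulr0 subr0.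
    rewrite (rev_ord_geE _ (leq_subr k N)) subKn //; case: (k <= i)%N; rewrite ?mulr1 ?mul1r ?subrr ?mulr0 ?mul0r ?subr0 //.
  rewrite /rk -(mulmxA _ (Jform R N)) h1 -!mulmxA h2 !mulmxA mxrankMfree ?row_free_unit ?J_unit //.
  rewrite -mxrank_tr !trmx_mul trmxK map_trmx; congr (\rank _).
  rewrite !mulmxA; congr (_ *m _ *m _); rewrite linearB /= trmx1 tr_diag_mx //.
rewrite e0; apply: h => [n j|j|n].
- by rewrite !mxE sqrtC_eq0 gt_eqF.
- apply: ucvg0 => r r0; apply: filterS (Tinf (enum_valP j) (r^-1 ^+ 2)) => n /=.
  rewrite !mxE normfV ger0_norm ?sqrtC_ge0 ?(ltW (a0 _ _)) // => h.
  have s0 : 0 < sqrtC (al n 0 (f j)) by rewrite sqrtC_gt0.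
  rewrite -[cR r]invrK lef_pV2 ?posrE ?invr_gt0 ?ltcR // -fmorphV.
  rewrite -(@ler_pXn2r _ 2) ?nnegrE ?lecR ?invr_ge0 ?(ltW r0) ?(ltW s0) //.
  by rewrite sqrtCK -rmorphXn ltW.
have -> : (t n)^t* *m diag_mx (\row_j sq n 0 (f j)) *m t n + S n = (u n)^t* *m diag_mx (sq n) *m u n.
  by rewrite [RHS]split_sq.
have := (lower_cprojP _).1 (lo n) k; by rewrite !mulmxA.
Qed.

(** The volume of the limit space [t0] is 1 before the three weights and at least 1 after them, so
    its slopes in the frames have a nonnegative sum. [slope_flip] moves this, with the opposite
    sign, to conj(t0) J and the flags of the g_i. *)
Lemma unbounded_destabilizes :
  exists z : 'M[C]_(d, N), [/\ row_free z, z *m Jform R N *m z^T = 0 &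
    slope v1 (z *m invmx g1) + slope v2 (z *m invmx g2) + slope v3 (z *m invmx g3) <= 0].
Proof.
have N3 : (3 <= N)%N by apply: leq_trans N6.
have [t0 ht] := t_lim.
have b1 n : lowner (c1 n *m (c1 n)^t*) (cR 1 *: 1%:M) by rewrite c1_sq scale1r.
have b2 n : lowner (c2 n *m (c2 n)^t*) (cR (expR (v1 0 0) ^+ 2 * 1) *: 1%:M).
  by rewrite c2_sq; exact: weight_sq cv1 (b1 n).
have b3 n : lowner (c3 n *m (c3 n)^t*) (cR (expR (v2 0 0) ^+ 2 * (expR (v1 0 0) ^+ 2 * 1)) *: 1%:M).
  by rewrite c3_sq; exact: weight_sq cv2 (b2 n).
have [d1 h1] := c_lim b1; have [d2 h2] := c_lim b2; have [d3 h3] := c_lim b3.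
have gM (c : nat -> 'M[C]_N) c0 : mcvg c c0 -> ucvg U (fun n => gram (t n *m c n)) (gram (t0 *m c0)).
  by move=> h; apply: ucvg_gram; exact: (mcvgM hU ht h).
have wM (c : nat -> 'M[C]_N) c0 v : mcvg c c0 -> mcvg (fun n => c n *m weight N v) (c0 *m weight N v).
  by move=> h; exact: (mcvgM hU h (mcvg_cst hU _)).
have q1 : gram (t0 *m d1) = 1.
  apply: (ucvg_unique hU (gM _ _ h1)).
  rewrite (_ : (fun n => _) = fun=> 1); first exact: (ucvg_cst hU).
  apply/funext => n; rewrite (gram_sq (y := 1%:M)) ?mulmx1 ?c1_sq ?trmx1 ?map_mx1 ?mulmx1 //.
  by rewrite /gram tt det1.
have q2 : gram (t0 *m d2) = gram (t0 *m (d1 *m weight N v1)).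
  apply: (ucvg_unique hU (gM _ _ h2)).
  rewrite (_ : (fun n => _) = (fun n => gram (t n *m (c1 n *m weight N v1)))); first exact: gM (wM _ _ _ h1).
  by apply/funext => n; exact: gram_sq (c2_sq n).
have q3 : gram (t0 *m d3) = gram (t0 *m (d2 *m weight N v2)).
  apply: (ucvg_unique hU (gM _ _ h3)).
  rewrite (_ : (fun n => _) = (fun n => gram (t n *m (c2 n *m weight N v2)))); first exact: gM (wM _ _ _ h2).
  by apply/funext => n; exact: gram_sq (c3_sq n).
have ev : U [set n | forall j : 'I_d, cR 1 < al n 0 (f j)].
  by apply: filter_forall => j; exact: Tinf (enum_valP j) 1.
have q4 : 1 <= gram (t0 *m (d3 *m weight N v3)).
  apply: (ucvg_le hU (ucvg_cst hU 1) (gM _ _ (wM _ _ v3 h3))); apply: filterS ev => n /= h.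
  rewrite /gram adjM mulmxA -(mulmxA (t n)) c4_sq tu -mulmxA tt mulmx1 det_diag.
  elim/big_rec: _ => [|j x _ x1]; first exact: lexx.
  rewrite !mxE -[X in X <= _]mulr1; apply: ler_pM x1; [exact: ler01|exact: ler01|].
  by rewrite (ler_pdivlMr _ _ (a0 n (f j))) mul1r; apply: ale; exact: ltW (h j).
have sl : 0 <= slope v1 (t0 *m d1) + slope v2 (t0 *m d2) + slope v3 (t0 *m d3).
  have k1 : gram (t0 *m (d1 *m weight N v1)) <= cR (expR (2 * slope v1 (t0 *m d1))).
    by have := gram_weight (t0 *m d1) cv1; rewrite q1 mulr1 -mulmxA.
  have k2 : gram (t0 *m (d2 *m weight N v2)) <= cR (expR (2 * slope v2 (t0 *m d2))) * gram (t0 *m (d1 *m weight N v1)).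
    by have := gram_weight (t0 *m d2) cv2; rewrite q2 -(mulmxA t0 d2).
  have k3 : gram (t0 *m (d3 *m weight N v3)) <= cR (expR (2 * slope v3 (t0 *m d3))) * gram (t0 *m (d2 *m weight N v2)).
    by have := gram_weight (t0 *m d3) cv3; rewrite q3 -(mulmxA t0 d3).
  move: (slope v1 _) (slope v2 _) (slope v3 _) k1 k2 k3 => x1 x2 x3 k1 k2 k3.
  have : 1 <= cR (expR (2 * (x1 + x2 + x3))).
    apply: le_trans q4 _; apply: le_trans k3 _; rewrite 2!mulrDr !expRD !rmorphM mulrC.
    apply: ler_wpM2r; first by rewrite lecR expR_ge0.
    apply: le_trans k2 _; rewrite mulrC; apply: ler_wpM2r; first by rewrite lecR expR_ge0.
    exact: k1.
  rewrite lecE /= => /andP[_]; rewrite leNgt expR_lt1 -leNgt; lra.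
exists (map_mx Num.conj t0 *m Jform R N); split.
- rewrite /row_free mxrankMfree ?mxrank_map; last by rewrite row_free_unit J_unit.
  have tt0 : t0 *m t0^t* = 1%:M.
    apply: (mcvg_unique hU (mcvgM hU ht (mcvg_adj hU ht))).
    by rewrite (_ : (fun n => _) = fun=> 1%:M); [exact: mcvg_cst | apply/funext => n; exact: tt].
  by rewrite -[_ == _]/(row_free t0); apply/row_freeP; exists (t0^t*).
- have iso : t0 *m Jform R N *m t0^T = 0.
    apply: (mcvg_unique hU (mcvgM hU (mcvgM hU ht (mcvg_cst hU (Jform R N))) (mcvg_tr ht))).
    apply: mcvg_near (mcvg_cst hU 0); apply: filterS ev => n /= h.
    have tA : t n *m A n = diag_mx (\row_j al n 0 (f j)) *m t n by rewrite AE tu.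
    have E : t n *m Jform R N *m (t n)^T = diag_mx (\row_j al n 0 (f j)) *m
        (t n *m Jform R N *m (t n)^T) *m diag_mx (\row_j al n 0 (f j)).
      rewrite -{1}(hA n) !mulmxA tA -!mulmxA -trmx_mul tA trmx_mul tr_diag_mx !mulmxA //.
    by apply/esym; apply: (diag_expand0 _ E) => j; rewrite mxE; exact: h.
  rewrite trmx_mul !mulmxA -(mulmxA _ (Jform R N) (Jform R N)^T) JJT mulmx1.
  have := congr1 (map_mx Num.conj) iso; rewrite !map_mxM J_conj map_mx0 map_trmx => <-.
  by [].
have f1 := slope_flip N3 cv1 (drop ht h1 hg1 lo1).
have f2 := slope_flip N3 cv2 (drop ht h2 hg2 lo2).
have f3 := slope_flip N3 cv3 (drop ht h3 hg3 lo3).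
exact: flip_sum sl f1 f2 f3.
Qed.
End Unbounded.
End Limit.

Section SpectralRoot.
Variables (C : numClosedFieldType) (N : nat) (u : 'M[C]_N) (al : 'rV[C]_N).
Hypotheses (uu : u \is unitarymx) (a0 : forall j, 0 < al 0 j).

Lemma spectral_mul (x y : 'rV[C]_N) :
  (u^t* *m diag_mx x *m u) *m (u^t* *m diag_mx y *m u) = u^t* *m diag_mx (\row_j (x 0 j * y 0 j)) *m u.
Proof.
by rewrite !mulmxA mulmxtVK // -(mulmxA _ (diag_mx x)) mulmx_diag.
Qed.

Let s := u^t* *m diag_mx (\row_j sqrtC (al 0 j)) *m u.

Lemma spectral_root : exists r, [/\ s *m r = 1%:M,
  r *m (u^t* *m diag_mx al *m u) *m r^t* = 1%:M &
  forall x, r *m (u^t* *m diag_mx x *m u) *m r^t* = u^t* *m diag_mx (\row_j (x 0 j / al 0 j)) *m u].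
Proof.
pose y : 'rV[C]_N := \row_j (sqrtC (al 0 j))^-1.
have y1 : u^t* *m diag_mx (const_mx 1) *m u = 1%:M.
  by rewrite diag_const_mx mulmx1; apply: mulmx1C; apply/unitarymxP.
have s0 j : sqrtC (al 0 j) != 0 by rewrite sqrtC_eq0 gt_eqF.
have ry : (u^t* *m diag_mx y *m u)^t* = u^t* *m diag_mx y *m u.
  rewrite !adjM trmxCK adj_diag mulmxA; congr (_ *m diag_mx _ *m _).
  apply/rowP => j; rewrite !mxE; apply/CrealP; rewrite ger0_real // invr_ge0.
  by rewrite sqrtC_ge0 ltW.
have E x : u^t* *m diag_mx y *m u *m (u^t* *m diag_mx x *m u) *m (u^t* *m diag_mx y *m u)^t* =
   u^t* *m diag_mx (\row_j (x 0 j / al 0 j)) *m u.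
  rewrite ry !spectral_mul; congr (_ *m diag_mx _ *m _); apply/rowP => j; rewrite !mxE.
  by rewrite mulrC mulrA -invfM -expr2 sqrtCK mulrC.
exists (u^t* *m diag_mx y *m u); split=> //.
  rewrite spectral_mul -y1; congr (_ *m diag_mx _ *m _); apply/rowP => j.
  by rewrite !mxE divff.
rewrite E -y1; congr (_ *m diag_mx _ *m _); apply/rowP => j.
by rewrite !mxE divff // gt_eqF.
Qed.
End SpectralRoot.

(** * Stable configurations have a fixed point of [Psi] *)

Section StableFixpoint.
Variables (R : realType) (N : nat).
Hypothesis N6 : (6 <= N)%N.
Local Notation C := R[i].
Local Notation cR x := (x%:C)%C.

Lemma root_frame (g r A : 'M[C]_N) s : inG g -> pd A -> s *m r = 1%:M ->
  (r *m frame g A) *m (r *m frame g A)^t* = r *m A *m r^t* /\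
  lower (g *m s *m (r *m frame g A)).
Proof.
move=> hg pA sr; have [_ XE [lo _]] := frameP (inG_unit hg) pA; split.
  by rewrite adjM mulmxA -(mulmxA r) -XE.
by rewrite !mulmxA -(mulmxA g) sr mulmx1.
Qed.

Lemma root_step (g r A : 'M[C]_N) v :
  (r *m frame g A *m weight N v) *m (r *m frame g A *m weight N v)^t* = r *m Phi g v A *m r^t*.
Proof. by rewrite PhiE -(mulmxA r) adjM !mulmxA. Qed.

Variables (g1 g2 g3 : 'M[C]_N) (v1 v2 v3 : 'rV[R]_3).
Hypotheses (hg1 : inG g1) (hg2 : inG g2) (hg3 : inG g3).
Hypotheses (cv1 : chamber v1) (cv2 : chamber v2) (cv3 : chamber v3).
Hypothesis stable : forall d (z : 'M[C]_(d, N)), (0 < d)%N -> row_free z ->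
  z *m Jform R N *m z^T = 0 ->
  0 < slope v1 (z *m invmx g1) + slope v2 (z *m invmx g2) + slope v3 (z *m invmx g3).
Local Notation s := [:: (g1, v1); (g2, v2); (g3, v3)].

(** f_e moves every positive number towards 1. *)
Lemma moved_ge1 (e x : C) : 0 < e -> e < 1 -> 0 < x ->
  1 <= (x + e) / (1 + e * x) -> (x + e) / (1 + e * x) <= x.
Proof.
move=> e0 e1 x0; have p : 0 < 1 + e * x by rewrite addr_gt0 ?mulr_gt0.
rewrite ler_pdivlMr // mul1r ler_pdivrMr // => h.
have x1 : 1 <= x.
  rewrite -(ler_pM2l (_ : 0 < 1 - e)) ?subr_gt0 // mulr1 mulrBl mul1r lerBlDr addrAC lerBrDr.
  by rewrite addrC [e + x]addrC in h *.
rewrite mulrDr mulr1 lerD2l mulrCA -[X in X <= _]mulr1; apply: ler_wpM2l; first exact: ltW.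
by rewrite -[X in X <= _]mulr1; apply: ler_pM => //; exact: ler01.
Qed.

Lemma stable_fixpoint : exists L, [/\ pd L, inG L & Psi s L = L].
Proof.
have hs : legs s by [].
have [U [hU hfree]] := free_ultrafilter.
have fU : ProperFilter U by exact: ultra_proper.
(* Starting at 1/2 keeps every value below 1. *)
pose eps n : R := (n.+2%:R)^-1.
have e0 n : 0 < eps n by rewrite invr_gt0 ltr0n.
have e1 n : eps n < 1 by rewrite invf_lt1 ?ltr0n // ltr1n.
have el : (eps @ U --> (0 : R))%classic.
  apply/cvgrPdist_lt => x x0.
  have h : ((fun n => n.+1%:R^-1 : R) @ \oo --> (0 : R))%classic by exact: cvg_harmonic.
  move/cvgrPdist_lt: h => /(_ _ x0)[m _ hm].
  apply: filterS (hfree m) => n /= mn.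
  by have := hm n.+1 (leqW mn); rewrite /=.
have hA n : exists X : 'M[C]_N * 'M[C]_N * 'rV[C]_N, [/\ pd X.1.1, inG X.1.1,
    X.1.1 = fe (cR (eps n)) (Psi s X.1.1), X.1.2 \is unitarymx &
    (forall j, 0 < X.2 0 j) /\ Psi s X.1.1 = X.1.2^t* *m diag_mx X.2 *m X.1.2].
  have [A [pA gA fA]] := fe_fixpoint N6 hs (e0 n) (e1 n).
  have [u uu [e [ep eE]]] := pd_spectral (Psi_pd N6 hs pA).
  by exists (A, u, e).
have [X hX] := choice hA.
pose A n := (X n).1.1; pose u n := (X n).1.2; pose e n := (X n).2.
have pA n : pd (A n) by have [] := hX n.
have gA n : inG (A n) by have [] := hX n.
have fA n : A n = fe (cR (eps n)) (Psi s (A n)) by have [] := hX n.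
have uu n : u n \is unitarymx by have [] := hX n.
have ep n j : 0 < e n 0 j by have [_ _ _ _ []] := hX n.
have BE n : Psi s (A n) = (u n)^t* *m diag_mx (e n) *m u n by have [_ _ _ _ []] := hX n.
move: A u e pA gA fA uu ep BE => {X hX hA} A u e pA gA fA uu ep BE.
have E0 n : 0 < cR (eps n) by rewrite ltcR.
have E1 n : cR (eps n) < 1 by rewrite ltcR.
pose al n : 'rV[C]_N := \row_j ((e n 0 j + cR (eps n)) / (1 + cR (eps n) * e n 0 j)).
have a0 n j : 0 < al n 0 j.
  by rewrite mxE divr_gt0 // addr_gt0 // mulr_gt0.
have AE n : A n = (u n)^t* *m diag_mx (al n) *m u n.
  by rewrite {1}fA BE fe_spectral.
have ale n j : 1 <= al n 0 j -> al n 0 j <= e n 0 j.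
  by rewrite mxE; apply: moved_ge1.
move: al a0 AE ale => al a0 AE ale.
pose bd j := exists M : R, U [set n | al n 0 j <= cR M]%classic.
(* The eigenvalues that are not bounded along [U]; by the ultrafilter property they exceed every
   bound. *)
pose T : {set 'I_N} := [set j | ~~ `[< bd j >]]%SET.
have Tfin j : j \notin T -> bd j by rewrite inE negbK => /asboolP.
have [T0|T0] := eqVneq #|T| 0%N.
  have bdj j : bd j by apply: Tfin; move/eqP: T0; rewrite cards_eq0 => /eqP ->; rewrite inE.
  have [M hM] := choice bdj.
  have M0 : 0 < 1 + \sum_j `|M j| by rewrite ltr_pwDl // sumr_ge0.
  apply: (limit_bounded hU N6 hs e0 el pA gA fA M0).
  have hM' : U [set n | forall j, al n 0 j <= cR (M j)]%classic by exact: filter_forall.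
  apply: filterS hM' => n /= h.
  have -> : cR (1 + \sum_j `|M j|) *: 1%:M = (u n)^t* *m diag_mx (const_mx (cR (1 + \sum_j `|M j|))) *m u n.
    by rewrite diag_const_mx mul_mx_scalar -scalemxAl (mulmx1C (unitarymxP (uu n))).
  rewrite AE; apply: spectral_le => j; rewrite mxE; apply: le_trans (h j) _.
  rewrite lecR; apply: le_trans (ler_norm _) _; rewrite (bigD1 j) //= addrCA lerDl.
  by rewrite addr_ge0 // sumr_ge0.
have Tinf j : j \in T -> forall M : R, U [set n | cR M < al n 0 j]%classic.
  rewrite inE => /asboolP nb M.
  have [h|h] := in_ultra_setVsetC [set n | al n 0 j <= cR M]%classic hU.
    by case: nb; exists M.
  apply: filterS h => n /= /negP k; rewrite real_ltNge //.
    by rewrite complex_real.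
  exact: gtr0_real (a0 n j).
have [r hr] := choice (fun n => spectral_root (uu n) (a0 n)).
have pY1 n : pd (Phi g1 v1 (A n)) := Phi_pd N6 v1 (inG_unit hg1) (pA n).
have pY2 n : pd (Phi g2 v2 (Phi g1 v1 (A n))) := Phi_pd N6 v2 (inG_unit hg2) (pY1 n).
have [rs rA rd] : [/\ forall n, (u n)^t* *m diag_mx (\row_j sqrtC (al n 0 j)) *m u n *m r n = 1%:M,
    forall n, r n *m A n *m (r n)^t* = 1%:M &
    forall n, r n *m Psi s (A n) *m (r n)^t* = (u n)^t* *m diag_mx (\row_j (e n 0 j / al n 0 j)) *m u n].
  by split=> n; case: (hr n) => h1 h2 h3; [exact: h1 | rewrite {1}AE; exact: h2 | rewrite BE; exact: h3].
have rf1 n := root_frame hg1 (pA n) (rs n).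
have rf2 n := root_frame hg2 (pY1 n) (rs n).
have rf3 n := root_frame hg3 (pY2 n) (rs n).
pose c1 n := r n *m frame g1 (A n); pose c2 n := r n *m frame g2 (Phi g1 v1 (A n)).
pose c3 n := r n *m frame g3 (Phi g2 v2 (Phi g1 v1 (A n))).
have c1_sq n : c1 n *m (c1 n)^t* = 1%:M := etrans (rf1 n).1 (rA n).
have c2_sq n : c2 n *m (c2 n)^t* = (c1 n *m weight N v1) *m (c1 n *m weight N v1)^t*.
  exact (etrans (rf2 n).1 (esym (root_step g1 (r n) (A n) v1))).
have c3_sq n : c3 n *m (c3 n)^t* = (c2 n *m weight N v2) *m (c2 n *m weight N v2)^t*.
  exact (etrans (rf3 n).1 (esym (root_step g2 (r n) (Phi g1 v1 (A n)) v2))).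
have c4_sq n : (c3 n *m weight N v3) *m (c3 n *m weight N v3)^t* =
    (u n)^t* *m diag_mx (\row_j (e n 0 j / al n 0 j)) *m u n.
  exact (etrans (root_step g3 (r n) (Phi g2 v2 (Phi g1 v1 (A n))) v3) (rd n)).
have lo1 n := (rf1 n).2; have lo2 n := (rf2 n).2; have lo3 n := (rf3 n).2.
have [z [fz iz sz]] := @unbounded_destabilizes R U hU N N6 g1 g2 g3 v1 v2 v3 hg1 hg2 hg3 cv1 cv2 cv3
   A u c1 c2 c3 e al T gA uu a0 AE c1_sq c2_sq c3_sq c4_sq ale Tinf Tfin lo1 lo2 lo3.
have d0 : (0 < #|T|)%N by rewrite lt0n.
by have := lt_le_trans (stable d0 fz iz) sz; rewrite ltxx.
Qed.

End StableFixpoint.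

(** [b] and [a *m w] are factors of the same positive form, so they differ by a unitary matrix. *)
Lemma frame_quotient (C : numClosedFieldType) N (a b w : 'M[C]_N) :
  a \in unitmx -> w \in unitmx -> b *m b^t* = (a *m w) *m (a *m w)^t* ->
  invmx w *m invmx a *m b \is unitarymx /\ w *m (invmx w *m invmx a *m b) = invmx a *m b.
Proof.
move=> ua uw bE; split; last by rewrite !mulmxA mulmxV // mul1mx.
apply/unitarymxP; rewrite !adjM !adj_inv !mulmxA -(mulmxA _ b) bE adjM.
have ua' : a^t* \in unitmx by rewrite adj_unit.
have uw' : w^t* \in unitmx by rewrite adj_unit.
by rewrite !mulmxA mulmxKV // mulVmx // mul1mx mulmxK // mulmxV.
Qed.

Lemma cyclic_quotients (F : fieldType) N (w1 w2 w3 k1 k2 k3 a b c : 'M[F]_N) :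
  a \in unitmx -> b \in unitmx -> c \in unitmx ->
  w1 *m k1 = invmx a *m b -> w2 *m k2 = invmx b *m c -> w3 *m k3 = invmx c *m a ->
  w1 *m k1 *m w2 *m k2 *m w3 *m k3 = 1%:M.
Proof.
move=> ua ub uc h1 h2 h3; rewrite h1 -!mulmxA h3 (mulmxA w2) h2 -!mulmxA.
by rewrite mulKVmx // mulKVmx // mulVmx.
Qed.

Section Closing.
Variables (R : realType) (N : nat).
Hypothesis N6 : (6 <= N)%N.
Local Notation C := R[i].
Local Notation cR x := (x%:C)%C.

Definition closes (v1 v2 v3 : 'rV[R]_3) := exists k1 k2 k3 : 'M[C]_N,
  [/\ [/\ inG k1, inG k2 & inG k3],
      [/\ k1 \is unitarymx, k2 \is unitarymx & k3 \is unitarymx] &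
      weight N v1 *m k1 *m weight N v2 *m k2 *m weight N v3 *m k3 = 1%:M].

Lemma frame_step (g A g' : 'M[C]_N) v (a := frame g A) (b := frame g' (Phi g v A)) :
  inG g -> inG g' -> pd A -> inG A ->
  exists k, [/\ inG k, k \is unitarymx, a \in unitmx & weight N v *m k = invmx a *m b].
Proof.
move=> hg hg' pA hA; have pP := Phi_pd N6 v (inG_unit hg) pA.
have hP := Phi_inG N6 v hg pA hA; have ha := frame_inG hg pA hA; have hb := frame_inG hg' pP hP.
have [ua _ _] := frameP (inG_unit hg) pA; have [_ bE _] := frameP (inG_unit hg') pP.
have uw := weight_unit N6 v; have hw := weight_inG N6 v.
have fq := frame_quotient ua uw (etrans (esym bE) (PhiE g v A)).
exists (invmx (weight N v) *m invmx a *m b); split.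
- exact: inGM (inGM (inGV hw) (inGV ha)) hb.
- exact fq.1.
- exact ua.
exact fq.2.
Qed.

Lemma stable_closes (g1 g2 g3 : 'M[C]_N) (v1 v2 v3 : 'rV[R]_3) :
  inG g1 -> inG g2 -> inG g3 -> chamber v1 -> chamber v2 -> chamber v3 ->
  (forall d (z : 'M[C]_(d, N)), (0 < d)%N -> row_free z -> z *m Jform R N *m z^T = 0 ->
    0 < slope v1 (z *m invmx g1) + slope v2 (z *m invmx g2) + slope v3 (z *m invmx g3)) ->
  closes v1 v2 v3.
Proof.
move=> h1 h2 h3 cv1 cv2 cv3 st.
have [A0 [p0 i0 E]] := stable_fixpoint N6 h1 h2 h3 cv1 cv2 cv3 st.
have p1 := Phi_pd N6 v1 (inG_unit h1) p0; have i1 := Phi_inG N6 v1 h1 p0 i0.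
have p2 := Phi_pd N6 v2 (inG_unit h2) p1; have i2 := Phi_inG N6 v2 h2 p1 i1.
have [k1 [a1 b1 c1 d1]] := frame_step v1 h1 h2 p0 i0.
have [k2 [a2 b2 c2 d2]] := frame_step v2 h2 h3 p1 i1.
have [k3 [a3 b3 c3 d3]] := frame_step v3 h3 h1 p2 i2.
have {}E : Phi g3 v3 (Phi g2 v2 (Phi g1 v1 A0)) = A0 by exact: E.
rewrite E in d3.
exists k1, k2, k3; split; [by [] | by [] |].
exact (cyclic_quotients c1 c2 c3 d1 d2 d3).
Qed.

Lemma wcoordD v w (c : R) j : wcoord N (v + c *: w) j = wcoord N v j + c * wcoord N w j.
Proof.
rewrite !wcoordE !mxE.
by do 6! [case: ifP => _]; ring.
Qed.

Lemma weight_cvg (U : set_system nat) (v w : 'rV[R]_3) (c : nat -> R) : UltraFilter U ->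
  (c @ U --> (0 : R))%classic -> mcvg U (fun n => weight N (v + c n *: w)) (weight N v).
Proof.
move=> hU hc i j; have fU : ProperFilter U by exact: ultra_proper.
rewrite weight_diag mxE; under eq_fun do rewrite weight_diag mxE.
case: (i == j); last by rewrite mulr0n; under eq_fun do rewrite mulr0n; apply: (ucvg_cst hU).
rewrite mulr1n mxE; under eq_fun do rewrite mulr1n mxE wcoordD.
apply: (ucvg_real hU); move: (wcoord N v i) (wcoord N w i) => a b.
have h : ((fun n => a + c n * b) @ U --> a + 0 * b)%classic.
  by apply: cvgD; [exact: cvg_cst | apply: cvgM => //; exact: cvg_cst].
rewrite mul0r addr0 in h.
by apply: (cvg_comp _ _ h); exact: continuous_expR.
Qed.

(** The unitary factors have entries of modulus at most 1, so they converge along an ultrafilter,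
    and their limits close the limit triangle. *)
Lemma closes_lim (v1 v2 v3 w1 w2 w3 : 'rV[R]_3) :
  (forall c : R, 0 < c -> closes (v1 + c *: w1) (v2 + c *: w2) (v3 + c *: w3)) ->
  closes v1 v2 v3.
Proof.
move=> h; have [U [hU hfree]] := free_ultrafilter.
have fU : ProperFilter U by exact: ultra_proper.
pose c n : R := (n.+1%:R)^-1.
have cl : (c @ U --> (0 : R))%classic.
  apply/cvgrPdist_lt => x x0.
  have h' : ((fun n => n.+1%:R^-1 : R) @ \oo --> (0 : R))%classic by exact: cvg_harmonic.
  by move/cvgrPdist_lt: h' => /(_ _ x0)[m _ hm]; apply: filterS (hfree m) => n /= /hm.
have hc n : exists k : 'M[C]_N * 'M[C]_N * 'M[C]_N,
    [/\ [/\ inG k.1.1, inG k.1.2 & inG k.2],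
      [/\ k.1.1 \is unitarymx, k.1.2 \is unitarymx & k.2 \is unitarymx] &
      weight N (v1 + c n *: w1) *m k.1.1 *m weight N (v2 + c n *: w2) *m k.1.2 *m
      weight N (v3 + c n *: w3) *m k.2 = 1%:M].
  have c0 : 0 < c n by rewrite invr_gt0 ltr0n.
  by have [k1 [k2 [k3 hk]]] := h _ c0; exists (k1, k2, k3).
have [k hk] := choice hc.
have lim (x : nat -> 'M[C]_N) : (forall n, inG (x n)) -> (forall n, x n \is unitarymx) ->
    exists x0, [/\ mcvg U x x0, inG x0 & x0 \is unitarymx].
  move=> hx ux; have [x0 hx0] : exists x0, mcvg U x x0.
    apply: (mcvg_bounded hU (M := 1)); apply: filterS (hfree 0%N) => n _ i j.
    by rewrite (_ : cR 1 = 1) //; exact: unitary_entry_le1 (ux n).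
  exists x0; split=> //; first exact (mcvg_inG hU hx hx0).
  apply/unitarymxP; apply: (mcvg_unique hU (mcvgM hU hx0 (mcvg_adj hU hx0))).
  rewrite (_ : (fun n => _) = fun=> 1%:M); first exact: mcvg_cst.
  by apply/funext => n; apply/unitarymxP.
have [x1 [l1 i1 u1]] := lim (fun n => (k n).1.1) (fun n => let: And3 (And3 a _ _) _ _ := hk n in a)
   (fun n => let: And3 _ (And3 a _ _) _ := hk n in a).
have [x2 [l2 i2 u2]] := lim (fun n => (k n).1.2) (fun n => let: And3 (And3 _ a _) _ _ := hk n in a)
   (fun n => let: And3 _ (And3 _ a _) _ := hk n in a).
have [x3 [l3 i3 u3]] := lim (fun n => (k n).2) (fun n => let: And3 (And3 _ _ a) _ _ := hk n in a)
   (fun n => let: And3 _ (And3 _ _ a) _ := hk n in a).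
exists x1, x2, x3; split=> //.
have hw v w := @weight_cvg U v w c hU cl.
have := mcvgM hU (mcvgM hU (mcvgM hU (mcvgM hU (mcvgM hU (hw v1 w1) l1) (hw v2 w2)) l2) (hw v3 w3)) l3.
rewrite (_ : (fun n => _) = fun=> 1%:M); last by apply/funext => n; case: (hk n).
by move=> l; apply: (mcvg_unique hU l); apply: mcvg_cst.
Qed.

Lemma slopeD d (v w : 'rV[R]_3) (c : R) (t : 'M[C]_(d, N)) :
  slope (v + c *: w) t = slope v t + c * slope w t.
Proof.
rewrite /slope /level /steps !big_cons !big_nil /= !mxE.
move: (rk 1 t) (rk 2 t) (rk 3 t) (rk (N - 1) t) (rk (N - 2) t) (rk (N - 3) t) => a1 a2 a3 a4 a5 a6.
ring.
Qed.

Lemma slope0 d (t : 'M[C]_(d, N)) : slope 0 t = 0.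
Proof. by have := slopeD 0 0 (- 1) t; rewrite scaleN1r oppr0 addr0; lra. Qed.
End Closing.

(** * Stability of the generators *)

Section Echelon.
Variable C : numClosedFieldType.
Implicit Types (d N k : nat).

(** An echelon form read from the right: row [i] ends at column [f i], in accordance with flags of
    initial coordinates. *)
Definition leads d N (f : 'I_d -> 'I_N) (y : 'M[C]_(d, N)) :=
  (forall i, y i (f i) != 0) /\ forall i (k : 'I_N), (f i < k)%N -> y i k = 0.

Lemma leads_free d N (f : 'I_d -> 'I_N) y : injective f -> leads f y -> row_free y.
Proof.
move=> injf [nz z]; rewrite -kermx_eq0; apply/rowV0P => u /sub_kermxP uy.
apply/eqP; apply: contraT => /matrix0Pn[i0 [i ui]]; rewrite ord1 in ui.
have [j uj jmax] := @arg_maxnP _ i (fun j => u 0 j != 0) (fun j => f j) ui.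
have : (u *m y) 0 (f j) = u 0 j * y j (f j).
  rewrite mxE (bigD1 j) //= big1 ?addr0 // => l lj.
  have [->|ul] := eqVneq (u 0 l) 0; first by rewrite mul0r.
  have lt : (f l < f j)%N.
    rewrite ltn_neqAle; apply/andP; split; last exact: jmax.
    by apply: contra lj => /eqP/val_inj/injf ->.
  by rewrite (z l (f j) lt) mulr0.
by move/eqP; rewrite uy mxE eq_sym mulf_eq0 (negbTE uj) (negbTE (nz j)).
Qed.

Lemma cprojS N (k : 'I_N) : cproj C N k = cproj C N k.+1 + delta_mx k k.
Proof.
apply/matrixP => i j; rewrite !mxE; have [->|ij] := eqVneq i j.
  rewrite andbb !mulr1n leq_eqVlt; rewrite -(inj_eq val_inj).
  by rewrite eq_sym; case: eqP => [->|_] /=; rewrite ?ltnn ?addr0 ?add0r.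
by rewrite !mulr0n add0r; case: eqP => [<-|//]; rewrite (eq_sym j) (negbTE ij).
Qed.

Lemma rkS_le d N (t : 'M[C]_(d, N)) (k : 'I_N) : (rk k.+1 t <= rk k t <= (rk k.+1 t).+1)%N.
Proof.
apply/andP; split.
  rewrite /rk (_ : cproj C N k.+1 = cproj C N k *m cproj C N k.+1) ?mulmxA ?mxrankM_maxl //.
  rewrite mulmx_diag; congr diag_mx; apply/rowP => j; rewrite !mxE -natrM mulnb andbC.
  by rewrite andb_idr // => /ltnW.
rewrite -[X in (_ <= X)%N]addn1 /rk cprojS mulmxDr; apply: (leq_trans (mxrank_add _ _)); apply: leq_add => //.
by apply: (leq_trans (mxrankM_maxr _ _)); rewrite mxrank_delta.
Qed.

Lemma echelon d N (t : 'M[C]_(d, N)) : row_free t -> exists (a : 'M[C]_d) (f : 'I_d -> 'I_N),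
  [/\ a \in unitmx, injective f, leads f (a *m t) &
      forall k, (k <= N)%N -> rk k t = #|[set i | (k <= f i)%N]|].
Proof.
move=> ft; pose b (j : nat) : nat := (rk j.+1 t < rk j t)%N.
have rkE k : (k <= N)%N -> rk k t = (\sum_(k <= j < N) b j)%N.
  move: {2}(N - k)%N (erefl (N - k)%N) => n; elim: n k => [|n IH] k nE kN.
    have -> : k = N by lia.
    rewrite big_geq // /rk (_ : cproj C N N = 0) ?mulmx0 ?mxrank0 //.
    by apply/matrixP => i j; rewrite !mxE leqNgt ltn_ord mul0rn.
  have kN' : (k < N)%N by lia.
  rewrite big_ltn // -IH //; last by lia.
  by have := rkS_le t (Ordinal kN') => /=; rewrite /b; case: ltnP => /=; lia.
(* The positions are the columns at which the rank of the remaining columns drops. *)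
pose K := [set j : 'I_N | (rk j.+1 t < rk j t)%N].
have rkK k : (k <= N)%N -> rk k t = #|[set j in K | (k <= j)%N]|.
  move=> kN; rewrite rkE // big_geq_mkord -sum1_card big_mkcond [RHS]big_mkcond /=.
  by apply: eq_bigr => j _; rewrite !inE /b; case: (k <= j)%N; case: (_ < _)%N.
have Kd : #|K| = d.
  have := rkK 0%N isT; rewrite /rk (_ : cproj C N 0 = 1%:M); last first.
    by apply/matrixP => i j; rewrite !mxE.
  by rewrite mulmx1 (eqP ft) => ->; apply: eq_card => j; rewrite !inE andbT.
pose f (i : 'I_d) : 'I_N := enum_val (cast_ord (esym Kd) i).
have fK i : f i \in K by apply: enum_valP.
have injf : injective f by move=> i j /enum_val_inj/cast_ord_inj.
have hu (j : 'I_N) : exists u : 'rV[C]_d, j \in K -> u *m t *m cproj C N j.+1 = 0 /\ (u *m t) 0 j != 0.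
  have [jK|] := boolP (j \in K); last by exists 0.
  have : ~~ (kermx (t *m cproj C N j.+1) <= kermx (t *m cproj C N j))%MS.
    apply/negP => /mxrankS; rewrite !mxrank_ker; rewrite inE /rk in jK.
    by have := rank_leq_row (t *m cproj C N j); lia.
  case/row_subPn => i; set u := row i _ => nu; exists u => _.
  have u0 : u *m t *m cproj C N j.+1 = 0.
    by rewrite -mulmxA; apply/sub_kermxP; apply: row_sub.
  split=> //; apply: contra nu => /eqP uj; apply/sub_kermxP; rewrite mulmxA cprojS mulmxDr u0 add0r.
  apply/matrixP => k l; rewrite [RHS]mxE mxE (bigD1 j) //= big1 => [|m mj].
    by rewrite ord1 uj mul0r addr0.
  by rewrite [delta_mx _ _ _ _]mxE (negbTE mj) mulr0.
have [u {}hu] := choice hu.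
pose a : 'M[C]_d := \matrix_i u (f i).
have at_row i (k : 'I_N) : (a *m t) i k = (u (f i) *m t) 0 k.
  by rewrite [LHS]mxE [RHS]mxE; apply: eq_bigr => l _; rewrite [a _ _]mxE.
have ld : leads f (a *m t).
  split=> i; first by rewrite at_row; case: (hu _ (fK i)).
  move=> k fk; rewrite at_row; have [/matrixP/(_ 0 k) h _] := hu _ (fK i).
  by move: h; rewrite mul_mx_diag !mxE fk mulr1.
exists a, f; split=> //.
  rewrite -row_free_unit -row_leq_rank; have := leads_free injf ld.
  by move/eqP => {1}<-; apply: mxrankM_maxl.
move=> k kN; rewrite rkK // -(card_imset _ injf); apply: eq_card => j; rewrite !inE.
apply/andP/imsetP => [[jK kj]|[l]]; last by rewrite inE => ki ->; have := fK l; rewrite inE.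
have jK' : j \in K by rewrite inE.
exists (cast_ord Kd (enum_rank_in jK' j)); rewrite ?inE /f cast_ordK enum_rankK_in //.
Qed.
End Echelon.

Lemma slope_leads (R : realType) d N v (t : 'M[R[i]]_(d, N)) (f : 'I_d -> 'I_N) : (3 <= N)%N ->
  (forall k, (k <= N)%N -> rk k t = #|[set i | (k <= f i)%N]|) ->
  slope v t = \sum_i wcoord N v (f i).
Proof.
move=> N3 h; rewrite /slope /level /wcoord sumrB sumr_const card_ord mulr_natr; congr (_ - _).
under [RHS]eq_bigr do rewrite big_mkcond.
rewrite exchange_big /= !big_seq; apply: eq_bigr => p ps.
have pN : (p.1 <= N)%N by move: ps; rewrite !inE => /or4P[|||/or3P[]] /eqP -> /=; lia.
rewrite h // -sum1_card natr_sum mulr_sumr [in RHS]big_mkcond [LHS]big_mkcond /=.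
by apply: eq_bigr => i _; rewrite inE; case: ifP; rewrite ?mulr1.
Qed.

(** * Counting the zeros of Wronskians *)

Section Wronskian.
Variables (C : numClosedFieldType) (N : nat).
Implicit Types (d : nat).

(* The row [y] encodes the polynomial [\sum_k y_k X^k / k!]; this is its image
   under the [j]-th power of [X d/dX]. *)
Definition theta d (y : 'M[C]_(d, N)) (i : 'I_d) (j : nat) : {poly C} :=
  \sum_(k < N) (y i k * (k%:R ^+ j / k`!%:R)) *: 'X^k.
(** The Euler operator X d/dX replaces the derivative: it keeps the order of vanishing at 0 and does
    not raise degrees, and at other points it loses at most one order. *)
Definition wronski d (y : 'M[C]_(d, N)) : {poly C} := \det (\matrix_(i < d, j < d) theta y i j).

Lemma wronskiM d (a : 'M[C]_d) (y : 'M[C]_(d, N)) : wronski (a *m y) = (\det a)%:P * wronski y.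
Proof.
rewrite /wronski -det_map_mx -det_mulmx; congr (\det _); apply/matrixP => i j; rewrite !mxE /theta.
under eq_bigr do rewrite !mxE mulr_suml scaler_suml.
rewrite exchange_big; apply: eq_bigr => l _; rewrite !mxE mulr_sumr; apply: eq_bigr => k _.
by rewrite mul_polyC scalerA !mulrA.
Qed.

Lemma size_prod_lead d (p : 'I_d -> {poly C}) (e : 'I_d -> nat) : (forall i, (size (p i) <= (e i).+1)%N) ->
  (size (\prod_i p i)%R <= (\sum_i e i).+1)%N /\ (\prod_i p i)`_(\sum_i e i) = \prod_i (p i)`_(e i).
Proof.
move=> h; elim/big_rec3: _ => [|i r m q _ [IH1 IH2]].
  by rewrite size_polyC oner_eq0 coefC.
split.
  apply: leq_trans (size_polyMleq _ _) _; have := h i; lia.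
rewrite coefM (bigD1 (Ordinal (leq_addr m (e i) : (e i < (e i + m).+1)%N))) //= addKn IH2.
rewrite big1 ?addr0 // => -[l ll]; rewrite -val_eqE /= => ne.
have [lt|gt] := ltnP l (e i); first by rewrite [q`_ _]nth_default ?mulr0 //; apply: (leq_trans IH1); lia.
have lt : (e i < l)%N by rewrite ltn_neqAle eq_sym ne.
by rewrite [(p i)`_ _]nth_default ?mul0r //; exact: leq_trans (h i) lt.
Qed.

Lemma det_lead d (M : 'M[{poly C}]_d) (e : 'I_d -> nat) : (forall i j, (size (M i j) <= (e i).+1)%N) ->
  (size (\det M) <= (\sum_i e i).+1)%N /\ (\det M)`_(\sum_i e i) = \det (\matrix_(i, j) (M i j)`_(e i)).
Proof.
move=> h; split.
  apply: (leq_trans (size_sum _ _ _)); apply/bigmax_leqP => s _.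
  rewrite mulr_sign; case: (perm.odd_perm _); rewrite ?size_polyN;
  exact: (@size_prod_lead d (fun i => M i (perm.fun_of_perm s i)) e (fun i => h i _)).1.
rewrite /determinant coef_sum; apply: eq_bigr => s _.
rewrite !mulr_sign; have [_ E] := @size_prod_lead d (fun i => M i (perm.fun_of_perm s i)) e (fun i => h i _).
case: (perm.odd_perm _); rewrite ?coefN E; [congr (- _)|]; by apply: eq_bigr => i _; rewrite mxE.
Qed.

(** The coefficient in top degree is a product of leading coefficients times the Vandermonde
    determinant of the distinct degrees. *)
Lemma wronski_leads d (f : 'I_d -> 'I_N) y : injective f -> leads f y ->
  wronski y != 0 /\ (size (wronski y) <= (\sum_i f i).+1)%N.
Proof.
move=> injf [nz z].
have sz i j : (size ((\matrix_(i < d, j < d) theta y i j) i j) <= (f i).+1)%N.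
  rewrite mxE; apply: (leq_trans (size_sum _ _ _)); apply/bigmax_leqP => k _.
  have [fk|kf] := ltnP (f i) k; first by rewrite z // mul0r scale0r size_poly0.
  by apply: (leq_trans (size_scale_leq _ _)); rewrite size_polyXn.
have [h1 h2] := det_lead sz; split=> //.
suff : (wronski y)`_(\sum_i f i) != 0 by apply: contraNneq => ->; rewrite coef0.
rewrite h2.
have -> : \matrix_(i, j) ((\matrix_(i < d, j < d) theta y i j) i j)`_(f i) =
    diag_mx (\row_i (y i (f i) / (f i)`!%:R)) *m (Vandermonde d (\row_i (f i)%:R))^T.
  apply/matrixP => i j; rewrite mul_diag_mx !mxE coef_sum (bigD1 (f i)) //= coefZ coefXn eqxx mulr1.
  rewrite big1 => [|k kf]; first by rewrite addr0 mulrA mulrAC.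
  by rewrite coefZ coefXn -val_eqE eq_sym in kf *; rewrite (negbTE kf) mulr0.
rewrite det_mulmx det_diag det_tr det_Vandermonde; apply: mulf_neq0.
  apply/prodf_neq0 => i _; rewrite mxE mulf_neq0 // invr_eq0 pnatr_eq0.
apply/prodf_neq0 => i _; apply/prodf_neq0 => j ij; rewrite !mxE subr_eq0 eqr_nat.
by apply: contraTneq ij => /val_inj/injf ->; rewrite ltnn.
Qed.

(** [h j] is the order of vanishing lost in column [j]: it is 0 at the point 0, and j at the point
    -1. *)
Lemma dvdp_det d (q : {poly C}) (M : 'M[{poly C}]_d) (o h : 'I_d -> nat) :
  (forall i j, q ^+ (o i - h j) %| M i j) -> q ^+ (\sum_i o i - \sum_i h i) %| \det M.
Proof.
move=> hM; rewrite /determinant; apply: (big_ind (fun p : {poly C} => q ^+ (\sum_i o i - \sum_i h i) %| p)) => [|x y hx hy|s _].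
- by rewrite dvdp0.
- by rewrite dvdp_add.
rewrite dvdp_mull //.
have hs : (\sum_i h i = \sum_i h (perm.fun_of_perm s i))%N.
  by rewrite [LHS](reindex_inj (@perm.perm_inj _ s)).
apply: (@dvdp_trans _ (\prod_i q ^+ (o i - h (perm.fun_of_perm s i)))).
  rewrite hs; elim/big_rec3: _ => [|i r m k _ IH']; first by rewrite expr0 dvd1p.
  apply: (@dvdp_trans _ (q ^+ (o i - h (perm.fun_of_perm s i)) * q ^+ (k - r))).
    by rewrite -exprD; apply: dvdp_exp2l; lia.
  exact: dvdp_mul.
elim/big_rec2: _ => [|i r m _ IH']; first exact: dvdpp.
exact: dvdp_mul (hM _ _) IH'.
Qed.

Lemma thetaS d (y : 'M[C]_(d, N)) i j : theta y i j.+1 = 'X * (theta y i j)^`().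
Proof.
rewrite /theta raddf_sum mulr_sumr; apply: eq_bigr => -[k kN] _ /=.
rewrite derivZ derivXn; case: k kN => [|k] kN /=; first by rewrite exprS !mul0r ?mulr0 !(scale0r, mulr0n, mulr0, scaler0).
rewrite -[RHS]scalerAr mulrnAr -exprS -scalerMnr scalerMnl; congr (_ *: _).
by rewrite exprS -[RHS]mulr_natr; ring.
Qed.

Lemma dvd_theta d (y : 'M[C]_(d, N)) i (c : C) m j :
  ('X - c%:P) ^+ m %| theta y i 0 -> ('X - c%:P) ^+ (m - j) %| theta y i j.
Proof.
move=> h; elim: j => [|j IH]; first by rewrite subn0.
rewrite thetaS dvdp_mull //.
have [lt|ge] := ltnP j m; last by rewrite (_ : (m - j.+1)%N = 0%N) ?expr0 ?dvd1p //; lia.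
rewrite (_ : (m - j)%N = (m - j.+1).+1) in IH; last by lia.
move: (m - j.+1)%N IH => n /dvdpP[r ->].
rewrite derivM deriv_exp.
rewrite dvdp_add // ?dvdp_mull ?dvdp_mulr //; first by apply: dvdp_exp2l.
by rewrite -mulr_natl; do 2! apply: dvdp_mull; apply: dvdpp.
Qed.

Definition order_ge d (y : 'M[C]_(d, N)) (o : 'I_d -> nat) :=
  forall i (k : 'I_N), (k < o i)%N -> y i k = 0.

Lemma order_dvd d (y : 'M[C]_(d, N)) o : order_ge y o -> forall i j, 'X ^+ (o i) %| theta y i j.
Proof.
move=> oy i j; rewrite /theta; elim/big_rec: _ => [|k p _ IH]; first by rewrite dvdp0.
rewrite dvdp_add //; have [/oy ->|h] := ltnP k (o i); first by rewrite mul0r scale0r dvdp0.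
by rewrite -mul_polyC dvdp_mull // dvdp_exp2l.
Qed.

(** In the basis X^k / k! this is the substitution of X + 1 for X, the exponential of a regular
    nilpotent matrix. *)
Definition shift_mx : 'M[C]_N := \matrix_(j, i) (if (i <= j)%N then ((j - i)`!%:R)^-1 else 0).

Lemma theta_shift d (y : 'M[C]_(d, N)) i :
  theta (y *m shift_mx) i 0 = \sum_(j < N) (y i j / j`!%:R) *: ('X + 1) ^+ j.
Proof.
rewrite /theta; under eq_bigr do rewrite mxE expr0 mul1r mulr_suml scaler_suml.
rewrite exchange_big; apply: eq_bigr => j _.
have f0 n : (n`!%:R : C) != 0 by rewrite pnatr_eq0 -lt0n fact_gt0.
rewrite exprD1n scaler_sumr.
rewrite (big_ord_widen N (fun l => (y i j / j`!%:R) *: ('X^l *+ 'C(j, l)))) //.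
rewrite [RHS]big_mkcond; apply: eq_bigr => k _; rewrite mxE ltnS.
case: leqP => kj; last by rewrite mulr0 mul0r scale0r.
rewrite -[_ *+ 'C(_, _)]scaler_nat scalerA; congr (_ *: _).
have : ('C(j, k) * (k`! * (j - k)`!))%N%:R = (j`!%:R : C) by rewrite bin_fact.
rewrite !natrM => <-; rewrite !invfM -!mulrA; congr (_ * _).
have c0 : ('C(j, k)%:R : C) != 0 by rewrite pnatr_eq0 -lt0n bin_gt0.
by rewrite [RHS]mulrC !mulrA mulfK // mulrC.
Qed.

Lemma order_dvd_shift d (y : 'M[C]_(d, N)) o : order_ge y o ->
  forall i, ('X - (-1)%:P) ^+ (o i) %| theta (y *m shift_mx) i 0.
Proof.
move=> oy i; rewrite theta_shift polyCN opprK; elim/big_rec: _ => [|k p _ IH]; first by rewrite dvdp0.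
rewrite dvdp_add //; have [/oy ->|h] := ltnP k (o i); first by rewrite mul0r scale0r dvdp0.
by rewrite -mul_polyC dvdp_mull // dvdp_exp2l.
Qed.

(** The orders at the distinct points 0 and -1 add up to at most the degree. *)
Lemma wronski_bound d (y1 y3 : 'M[C]_(d, N)) (a2 a3 : 'M[C]_d) f (o2 o3 : 'I_d -> nat) :
  injective f -> leads f y1 -> a2 \in unitmx -> a3 \in unitmx ->
  order_ge (a2 *m y1) o2 -> a3 *m y1 = y3 *m shift_mx -> order_ge y3 o3 ->
  (\sum_i o2 i + (\sum_i o3 i - \sum_(i < d) i) <= \sum_i f i)%N.
Proof.
move=> injf ld u2 u3 h2 e3 h3; have [w0 sw] := wronski_leads injf ld.
rewrite unitmxE unitfE in u2; rewrite unitmxE unitfE in u3.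
have d2 : 'X ^+ (\sum_i o2 i) %| wronski y1.
  have : 'X ^+ (\sum_i o2 i - \sum_(i < d) 0) %| wronski (a2 *m y1).
    by apply: (dvdp_det (h := fun=> 0%N)) => i j; rewrite mxE subn0; apply: order_dvd.
  have z0 : (\sum_(i < d) 0 = 0)%N by rewrite big1.
  by rewrite z0 subn0 wronskiM mul_polyC dvdpZr.
have d3 : ('X - (-1)%:P) ^+ (\sum_i o3 i - \sum_(i < d) i) %| wronski y1.
  have : ('X - (-1)%:P) ^+ (\sum_i o3 i - \sum_(i < d) i) %| wronski (a3 *m y1).
    by apply: dvdp_det => i j; rewrite mxE; apply: dvd_theta; rewrite e3; apply: order_dvd_shift.
  by rewrite wronskiM mul_polyC dvdpZr.
have cop : coprimep ('X ^+ (\sum_i o2 i)) (('X - (-1)%:P) ^+ (\sum_i o3 i - \sum_(i < d) i) : {poly C}).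
  apply: coprimep_expl; apply: coprimep_expr.
  by rewrite coprimep_XsubC rootX oppr_eq0 oner_eq0.
have dv : 'X ^+ (\sum_i o2 i) * ('X - (-1)%:P) ^+ (\sum_i o3 i - \sum_(i < d) i) %| wronski y1.
  by rewrite Gauss_dvdp // d2.
have := leq_trans (dvdp_leq w0 dv) sw; rewrite size_Mmonic ?expf_neq0 ?polyX_eq0 ?monic_exp ?monicXsubC //.
by rewrite size_polyXn size_exp_XsubC addnS /= ltnS.
Qed.

End Wronskian.

(** * Three osculating flags in the group *)

Section Generic.
Variables (R : realType) (N : nat).
Local Notation C := R[i].
Local Notation J := (Jform R N).
Local Notation E := (shift_mx C N).

(** Up to a factor each entry is the alternating binomial sum (1 - 1)^m with m = a + b - (N - 1),
    which leaves only the antidiagonal. *)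
Lemma shift_inG : inG E.
Proof.
apply/matrixP => a b.
have -> : (E *m J *m E^T) a b = \sum_c E a c * ((-1) ^+ c * E b (rev_ord c)).
  by rewrite -mulmxA mxE; apply: eq_bigr => c _; rewrite mulJmx [E^T _ _]mxE.
rewrite [RHS]mxE.
have f0 n : (n`!%:R : C) != 0 by rewrite pnatr_eq0 -lt0n fact_gt0.
have [lt|ge] := ltnP (a + b) N.-1.
  rewrite big1 => [|c _]; last first.
    rewrite !mxE; case: leqP => ca; last by rewrite mul0r.
    case: leqP => cb; last by rewrite !mulr0.
    by move: cb ca lt => /=; have := ltn_ord c; lia.
  case: eqP => // /(congr1 val) /= bE; by move: lt; rewrite bE; have := ltn_ord a; lia.
pose m := (a + b - N.-1)%N.
have ma : (m <= a)%N by rewrite /m; have := ltn_ord b; lia.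
transitivity ((-1) ^+ a * (1 - 1) ^+ m / m`!%:R : C); last first.
  have [m0|m0] := eqVneq m 0%N.
    rewrite m0 expr0 mulr1 divr1 (_ : b == rev_ord a) //.
    by apply/eqP/val_inj => /=; move: m0 ge; rewrite /m; have := ltn_ord a; have := ltn_ord b; lia.
  rewrite subrr expr0n (negbTE m0) mulr0 mul0r; case: eqP => // bE.
  by move: m0; rewrite /m bE /=; have := ltn_ord a; lia.
rewrite exprBn mulr_sumr mulr_suml.
rewrite (big_ord_widen_cond a.+1 xpredT (fun l => (-1) ^+ a * ((-1) ^+ l * 1 ^+ (m - l) * 1 ^+ l *+ 'C(m, l)) / m`!%:R)) //.
rewrite [RHS](reindex_inj rev_ord_inj) /=.
have aN : (a.+1 <= N)%N := ltn_ord a.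
rewrite [RHS]big_mkcond /=.
rewrite (big_ord_widen N (fun c => if (a.+1 - c.+1 < m.+1)%N then
  (-1) ^+ a * ((-1) ^+ (a.+1 - c.+1) * 1 ^+ (m - (a.+1 - c.+1)) * 1 ^+ (a.+1 - c.+1) *+ 'C(m, a.+1 - c.+1)) / m`!%:R else 0)) //.
rewrite [RHS]big_mkcond; apply: eq_bigr => c _; rewrite !mxE ltnS subSS /=.
case: (leqP c a) => ca; last by rewrite mul0r.
rewrite (_ : (N - c.+1 <= b)%N = (a - c < m.+1)%N); last first.
  by rewrite /m; have := ltn_ord c; have := ltn_ord b; lia.
case: ltnP => acm; last by rewrite !mulr0.
rewrite (_ : (b - (N - c.+1))%N = (m - (a - c))%N); last first.
  by move: acm; rewrite /m; have := ltn_ord c; have := ltn_ord b; lia.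
have sE : (-1) ^+ a * (-1) ^+ (a - c) = (-1) ^+ c :> C.
  by rewrite -{1}(subnK ca) exprD mulrAC -expr2 sqrr_sign mul1r.
rewrite !expr1n !mulr1 mulrnAr sE -[(_ ^+ c) *+ _]mulr_natr.
have := bin_fact (acm : (a - c <= m)%N); move/(congr1 (fun n => n%:R : C)); rewrite !natrM => <-.
have c0 : ('C(m, a - c)%:R : C) != 0 by rewrite pnatr_eq0 -lt0n bin_gt0.
move: (_ ^+ c) (_%:R) (_%:R) (_%:R) c0 (f0 (a - c)%N) (f0 (m - (a - c))%N) => w x y z x0 y0 z0.
by field; rewrite x0 y0 z0.
Qed.
End Generic.

Lemma meet_order (f a b c N : nat) : (f < a)%N -> (b <= N)%N -> (c <= N)%N ->
  (N - b + (N - c - 0) <= f)%N -> (N.*2 < a + b + c)%N.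
Proof. lia. Qed.

Lemma meet_count (r1 r2 r3 m1 m2 m3 k1 k2 k3 d : nat) : r1 = k1 -> r2 = k2 -> r3 = k3 ->
  (m1 + k1 = d)%N -> (m2 + k2 = d)%N -> (m3 + k3 = d)%N -> (d.*2 < m1 + m2 + m3)%N ->
  (r1 + r2 + r3 < d)%N.
Proof. lia. Qed.

Lemma base_change (F : fieldType) d N (a b : 'M[F]_d) (z : 'M[F]_(d, N)) (g : 'M[F]_N) :
  a \in unitmx -> g \in unitmx ->
  b *m invmx a *m (a *m (z *m invmx 1%:M)) = b *m (z *m invmx g) *m g.
Proof.
by move=> ua ug; rewrite invmx1 mulmx1 -(mulmxA b) mulKmx // -[RHS]mulmxA mulmxKV.
Qed.

Section Positions.
Variables (R : realType) (N : nat).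
Hypothesis N3 : (3 <= N)%N.
Local Notation C := R[i].
Local Notation J := (Jform R N).
Local Notation E := (shift_mx C N).

Lemma order_J d (L : 'M[C]_(d, N)) (b : 'I_d -> nat) :
  (forall i (k : 'I_N), (b i <= k)%N -> L i k = 0) -> order_ge (L *m J) (fun i => (N - b i)%N).
Proof.
move=> h i k lt; rewrite mulmxJ h ?mul0r //=.
by have := ltn_ord k; lia.
Qed.

Lemma leads_bound d (f : 'I_d -> 'I_N) (y : 'M[C]_(d, N)) : leads f y ->
  forall i (k : 'I_N), ((f i).+1 <= k)%N -> y i k = 0.
Proof. by case=> _ h i k; apply: h. Qed.

Lemma kill_bound d (L : 'M[C]_(d, N)) b : L *m cproj C N b = 0 ->
  forall i (k : 'I_N), (b <= k)%N -> L i k = 0.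
Proof. by move=> /matrixP h i k bk; have := h i k; rewrite mul_mx_diag !mxE bk mulr1. Qed.

Lemma common_kernel d (A B D : 'M[C]_(d, N)) : (\rank A + \rank B + \rank D < d)%N ->
  exists u : 'rV[C]_d, [/\ u != 0, u *m A = 0, u *m B = 0 & u *m D = 0].
Proof.
move=> h; pose M := row_mx A (row_mx B D).
have rM : (\rank M < d)%N.
  have rc m1 m2 (X : 'M[C]_(m1, d)) (Y : 'M[C]_(m2, d)) : (\rank (col_mx X Y) <= \rank X + \rank Y)%N.
    by rewrite -(addsmxE X Y); exact: (mxrank_adds_leqif X Y).1.
  apply: leq_ltn_trans h; rewrite -addnA -(mxrank_tr M) !tr_row_mx.
  apply: leq_trans (rc _ _ _ _) _; rewrite mxrank_tr leq_add2l.
  by apply: leq_trans (rc _ _ _ _) _; rewrite !mxrank_tr.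
have : kermx M != 0 by rewrite -mxrank_eq0 mxrank_ker subn_eq0 -ltnNge.
case/rowV0Pn => u /sub_kermxP; rewrite /M !mul_mx_row => /eqP.
rewrite -[0]row_mx0 => /eqP/eq_row_mx[uA]; rewrite -[0]row_mx0 => /eq_row_mx[uB uD] u0.
by exists u.
Qed.

(** A row ending in the middle column of an odd dimension has, up to sign, the square of its last
    entry as value of the form, which is not zero. *)
Lemma isotropic_leads d (f : 'I_d -> 'I_N) (y : 'M[C]_(d, N)) i : leads f y ->
  y *m J *m y^T = 0 -> (f i).*2.+1 <> N.
Proof.
move=> [nz z] /matrixP/(_ i i) iso fN; have := nz i; apply/negP; rewrite negbK.
have rf : rev_ord (f i) = f i by apply/val_inj => /=; lia.
have : (y *m J *m y^T) i i = y i (f i) * (-1) ^+ (f i) * y i (f i).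
  rewrite mxE (bigD1 (f i)) //= big1 ?addr0 => [|k kf]; first by rewrite mulmxJ rf !mxE.
  rewrite mulmxJ !mxE; have [lt|gt|/val_inj E'] := ltngtP k (f i).
  - by rewrite z ?mul0r //=; lia.
  - by rewrite (z i k) // mulr0.
  - by rewrite E' eqxx in kf.
rewrite iso mxE => /esym/eqP; rewrite mulrAC -expr2 mulf_eq0 signr_eq0 orbF.
by rewrite expf_eq0.
Qed.

(** The flags of 1, J and J E record degree, order at 0 and order at -1. The third item is the
    Wronskian bound. In the fourth, counts exceeding 2d force the three intersections to share a
    vector, and the Wronskian bound for this single polynomial applies. *)
Lemma generic_positions d (z : 'M[C]_(d, N)) : row_free z -> z *m J *m z^T = 0 ->
  exists f1 f2 f3 : 'I_d -> 'I_N,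
  [/\ [/\ injective f1, injective f2 & injective f3],
      [/\ forall i, (f1 i).*2.+1 <> N, forall i, (f2 i).*2.+1 <> N, forall i, (f3 i).*2.+1 <> N & (d.*2 <= N)%N],
      (\sum_i (N.-1 - f2 i) + (\sum_i (N.-1 - f3 i) - \sum_(i < d) i) <= \sum_i f1 i)%N,
      forall a b c, (a <= N)%N -> (b <= N)%N -> (c <= N)%N ->
        (d.*2 < #|[set i | f1 i < a]| + #|[set i | f2 i < b]| + #|[set i | f3 i < c]|)%N ->
        (N.*2 < a + b + c)%N &
      forall v1 v2 v3, slope v1 (z *m invmx 1%:M) + slope v2 (z *m invmx J) + slope v3 (z *m invmx (J *m E)) =
        \sum_i wcoord N v1 (f1 i) + \sum_i wcoord N v2 (f2 i) + \sum_i wcoord N v3 (f3 i)].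
Proof.
move=> fz iso.
have uJ : J \in unitmx := J_unit R N; have uE : E \in unitmx := inG_unit (shift_inG R N).
have hJE : inG (J *m E) := inGM (inG_J R N) (shift_inG R N).
have uJE := inG_unit hJE.
have free g : g \in unitmx -> row_free (z *m invmx g).
  by move=> ug; rewrite /row_free mxrankMfree ?row_free_unit ?unitmx_inv.
have isog g : inG g -> forall a : 'M[C]_d, (a *m (z *m invmx g)) *m J *m (a *m (z *m invmx g))^T = 0.
  move=> hg a; have := inGV hg; rewrite /inG => h.
  rewrite !trmx_mul !mulmxA -(mulmxA _ (invmx g) J) -(mulmxA _ _ (invmx g)^T) h.
  have -> : a *m z *m J *m z^T *m a^T = a *m (z *m J *m z^T) *m a^T by rewrite !mulmxA.
  by rewrite iso mulmx0 mul0mx.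
have u1 : (1%:M : 'M[C]_N) \in unitmx by apply: unitmx1.
have [a1 [f1 [ua1 j1 l1 r1]]] := echelon (free _ u1).
have [a2 [f2 [ua2 j2 l2 r2]]] := echelon (free _ uJ).
have [a3 [f3 [ua3 j3 l3 r3]]] := echelon (free _ uJE).
exists f1, f2, f3; split=> //.
- split=> [i|i|i|].
  + exact: isotropic_leads l1 (isog _ (inG1 R N) a1).
  + exact: isotropic_leads l2 (isog _ (inG_J R N) a2).
  + exact: isotropic_leads l3 (isog _ hJE a3).
  have h := mulmx0_rank_max iso; have rz : \rank z = d by exact: eqP fz.
  have rJ : \rank (z *m J) = d.
    by rewrite mxrankMfree; [exact: rz | rewrite row_free_unit; exact: uJ].
  by rewrite rJ mxrank_tr rz addnn in h.
- have h2 := order_J (leads_bound l2); have h3 := order_J (leads_bound l3).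
  have := @wronski_bound C N d (a1 *m (z *m invmx 1%:M)) (a3 *m (z *m invmx (J *m E)) *m J)
     (a2 *m invmx a1) (a3 *m invmx a1) f1 (fun i => (N - (f2 i).+1)%N) (fun i => (N - (f3 i).+1)%N) j1 l1.
  rewrite !unitmx_mul !unitmx_inv ua1 ua2 ua3 => /(_ isT isT).
  have e2 : a2 *m invmx a1 *m (a1 *m (z *m invmx 1%:M)) = a2 *m (z *m invmx J) *m J.
    exact: base_change ua1 uJ.
  have e3 : a3 *m invmx a1 *m (a1 *m (z *m invmx 1%:M)) = a3 *m (z *m invmx (J *m E)) *m J *m E.
    by rewrite -[RHS]mulmxA; exact: base_change ua1 uJE.
  rewrite e2 => /(_ h2 e3 h3).
  rewrite (eq_bigr (fun i => N.-1 - f2 i)%N) => [|i _]; last by lia.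
  by rewrite [X in (_ + (X - _))%N](eq_bigr (fun i => N.-1 - f3 i)%N) // => i _; lia.
- move=> a b c aN bN cN.
  have cnt (f : 'I_d -> 'I_N) k : (#|[set i | (f i < k)%N]| + #|[set i | (k <= f i)%N]| = d)%N.
    rewrite -[RHS](card_ord d) -(cardsC [set i | (f i < k)%N]).
    by congr (_ + _)%N; apply: eq_card => i; rewrite !inE leqNgt.
  move=> big.
  have rr : (\rank (z *m invmx 1%:M *m cproj C N a) + \rank (z *m invmx J *m cproj C N b) +
      \rank (z *m invmx (J *m E) *m cproj C N c) < d)%N.
    exact: meet_count (r1 a aN) (r2 b bN) (r3 c cN) (cnt f1 a) (cnt f2 b) (cnt f3 c) big.
  have [u [u0 k1 k2 k3]] := common_kernel rr.
  have fy : row_free (u *m z).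
    rewrite /row_free mxrankMfree // rank_rV u0 //.
  have [a' [f [ua' jf lf _]]] := echelon fy.
  pose y := a' *m (u *m z); have kl g k : u *m (z *m invmx g *m cproj C N k) = 0 ->
      a' *m u *m (z *m invmx g) *m cproj C N k = 0.
    by move=> h; rewrite -!mulmxA in h *; rewrite h mulmx0.
  have fa : (f ord0 < a)%N.
    rewrite ltnNge; apply/negP => af; have := lf.1 ord0; apply/negP; rewrite negbK.
    have := kl _ _ k1; rewrite invmx1 mulmx1 => k1'; have h := kill_bound k1' ord0 af.
    by rewrite mulmxA h.
  have h2 := order_J (kill_bound (kl _ _ k2)); have h3 := order_J (kill_bound (kl _ _ k3)).
  have := @wronski_bound C N 1 y (a' *m u *m (z *m invmx (J *m E)) *m J) 1%:M 1%:M f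
     (fun=> (N - b)%N) (fun=> (N - c)%N) jf lf (unitmx1 _ _) (unitmx1 _ _).
  have e2 : 1%:M *m y = a' *m u *m (z *m invmx J) *m J.
    by rewrite mul1mx /y -[in RHS](mulmxA _ _ J) (mulmxKV uJ) mulmxA.
  have e3 : 1%:M *m y = a' *m u *m (z *m invmx (J *m E)) *m J *m E.
    by rewrite mul1mx /y -[in RHS](mulmxA _ J E) -[in RHS](mulmxA _ _ (J *m E)) (mulmxKV uJE) mulmxA.
  rewrite {1}e2 => /(_ h2 e3 h3); rewrite !big_ord1 => h; exact: meet_order fa bN cN h.
- move=> v1 v2 v3.
  by rewrite (slope_leads v1 N3 r1) (slope_leads v2 N3 r2) (slope_leads v3 N3 r3).
Qed.
End Positions.

(** * Enumeration of the possible positions *)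

Fixpoint subs (s : seq nat) : seq (seq nat) :=
  if s is x :: s' then map (cons x) (subs s') ++ subs s' else [:: [::]].

Lemma filter_subs (P : pred nat) (s : seq nat) : [seq x <- s | P x] \in subs s.
Proof.
elim: s => //= x s IH; rewrite mem_cat; case: (P x); last by rewrite IH orbT.
by rewrite map_f.
Qed.

Definition digit_neg (g : seq nat) (i k : nat) : nat := if (k < 3)%N then nth 0%N g (3 * k + i) else 0%N.
Definition digit_pos (N : nat) (g : seq nat) (i k : nat) : nat := digit_neg g i (N.-1 - k).

(* Each position contributes its weight shifted by 3, so that all entries are
   natural numbers. *)
Definition weights N i (s : seq nat) : seq nat :=
  [seq sumn [seq (3 + digit_pos N g i k - digit_neg g i k)%N | k <- s] | g <- generators].

Definition total (p : seq nat * seq nat * seq nat) : seq nat :=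
  [seq (q.1.1 + q.1.2 + q.2)%N | q <- zip (zip p.1.1 p.1.2) p.2].

Definition wronski_ok N d (s1 s2 s3 : seq nat) : bool :=
  (sumn [seq (N.-1 - k)%N | k <- s2] + (sumn [seq (N.-1 - k)%N | k <- s3] - 'C(d, 2)) <= sumn s1)%N.

Definition meet_ok N d (s1 s2 s3 : seq nat) : bool :=
  all (fun a => all (fun b => all (fun c =>
     (d.*2 < count (fun k => (k < a)%N) s1 + count (fun k => (k < b)%N) s2 + count (fun k => (k < c)%N) s3)%N
     ==> (N.*2 < a + b + c)%N) (iota 0 N.+1)) (iota 0 N.+1)) (iota 0 N.+1).

(** With the shift by 3 in three flags and [d] positions, 9 d stands for slope zero. One strict
    inequality is demanded, so that the sum of all generators becomes stable. *)
Definition nonneg_total d (t : seq nat) : bool :=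
  all (fun x => (9 * d <= x)%N) t && has (fun x => (9 * d < x)%N) t.

Definition placements N d := [seq s <- subs (iota 0 N) | (size s == d) && all (fun k => k.*2.+1 != N) s].

(** Isotropic subspaces have dimension at most 3 for N = 6 and N = 7. The [if] confines the
    remaining computation to the triples that pass the Wronskian test. *)
Definition stable_check N : bool := all (fun d =>
  let P i := [seq (s, weights N i s) | s <- placements N d] in
  let P1 := P 0%N in let P2 := P 1%N in let P3 := P 2%N in
  all (fun p1 => all (fun p2 => all (fun p3 =>
    if wronski_ok N d p1.1 p2.1 p3.1 then
      nonneg_total d (total (p1.2, p2.2, p3.2)) || ~~ meet_ok N d p1.1 p2.1 p3.1
    else true) P3) P2) P1) [:: 1%N; 2%N; 3%N].

Lemma stable_check6 : stable_check 6. Proof. by vm_compute. Qed.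
Lemma stable_check7 : stable_check 7. Proof. by vm_compute. Qed.

Lemma stable_checkP N d s1 s2 s3 : stable_check N -> (0 < d <= 3)%N ->
  s1 \in placements N d -> s2 \in placements N d -> s3 \in placements N d ->
  wronski_ok N d s1 s2 s3 -> meet_ok N d s1 s2 s3 ->
  nonneg_total d (total (weights N 0 s1, weights N 1 s2, weights N 2 s3)).
Proof.
move=> /allP/(_ d) h /andP[d0 d3] p1 p2 p3 hw hm.
have /h {h} : d \in [:: 1%N; 2%N; 3%N] by case: d d0 d3 {p1 p2 p3 hw hm h} => [|[|[|[|]]]].
move=> /allP/(_ _ (map_f (fun s => (s, weights N 0 s)) p1)).
move=> /allP/(_ _ (map_f (fun s => (s, weights N 1 s)) p2)).
move=> /allP/(_ _ (map_f (fun s => (s, weights N 2 s)) p3)) /=.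
by rewrite hw hm orbF.
Qed.

Section Stability.
Variables (R : realType) (N : nat).
Hypothesis N6 : (6 <= N)%N.
Local Notation C := R[i].

Lemma place d (f : 'I_d -> 'I_N) : injective f -> (forall i, (f i).*2.+1 <> N) ->
  exists2 s, s \in placements N d & perm_eq s [seq val (f i) | i <- enum 'I_d].
Proof.
move=> injf mid; pose t := [seq val (f i) | i <- enum 'I_d].
have ut : uniq t by rewrite map_inj_uniq ?enum_uniq // => i j /val_inj/injf.
pose s := [seq k <- iota 0 N | k \in t].
have pst : perm_eq s t.
  apply: uniq_perm => //; first by rewrite filter_uniq ?iota_uniq.
  move=> k; rewrite mem_filter mem_iota add0n; apply: andb_idr.
  by case/mapP => i _ ->; rewrite ltn_ord.
exists s => //; rewrite mem_filter filter_subs andbT (perm_size pst) size_map size_enum_ord eqxx /=.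
rewrite (perm_all _ pst); apply/allP => k /mapP[i _ ->]; apply/eqP; exact: mid.
Qed.

Lemma sum_place d (f : 'I_d -> 'I_N) (V : nmodType) (F : nat -> V) s :
  perm_eq s [seq val (f i) | i <- enum 'I_d] -> \sum_(k <- s) F k = \sum_i F (f i).
Proof. by move=> ps; rewrite (perm_big _ ps) big_map big_enum. Qed.

Lemma sumn_place d (f : 'I_d -> 'I_N) (F : nat -> nat) s :
  perm_eq s [seq val (f i) | i <- enum 'I_d] -> sumn [seq F k | k <- s] = (\sum_i F (f i))%N.
Proof. by move=> ps; rewrite sumnE big_map (perm_big _ ps) big_map big_enum. Qed.

Lemma count_place d (f : 'I_d -> 'I_N) a s :
  perm_eq s [seq val (f i) | i <- enum 'I_d] -> count (fun k => (k < a)%N) s = #|[set i | (f i < a)%N]|.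
Proof.
move=> /permP ->; rewrite count_map -sum1_card -sum1_count big_enum_cond /=.
by apply: eq_bigl => i; rewrite inE.
Qed.

Definition dvec (g : seq nat) (i : nat) : 'rV[R]_3 := \row_(c < 3) (nth 0%N g (3 * c + i))%:R.

Lemma wcoord_digits g i k : (k < N)%N -> all (fun x => (x <= 3)%N) g ->
  wcoord N (dvec g i) k = (3 + digit_pos N g i k - digit_neg g i k)%N%:R - 3%:R.
Proof.
move=> kN g3; have dn l : (digit_neg g i l <= 3)%N.
  rewrite /digit_neg; case: ifP => // _; have [lt|ge] := ltnP (3 * l + i) (size g).
    exact: (allP g3) (mem_nth _ lt).
  by rewrite nth_default.
rewrite natrB; last by rewrite (leq_trans (dn k)) // leq_addr.
have x0 : dvec g i 0 0 = (nth 0%N g (3 * 0 + i))%:R by rewrite mxE.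
have x1 : dvec g i 0 1 = (nth 0%N g (3 * 1 + i))%:R by rewrite mxE.
have x2 : dvec g i 0 2 = (nth 0%N g (3 * 2 + i))%:R by rewrite mxE.
rewrite natrD wcoordE {}x0 {}x1 {}x2 /digit_pos /digit_neg {dn}.
have c0 : (N - 1 <= k)%N = (N.-1 - k < 1)%N by lia.
have c1 : (N - 2 <= k)%N = (N.-1 - k < 2)%N by lia.
have c2 : (N - 3 <= k)%N = (N.-1 - k < 3)%N by lia.
rewrite c0 c1 c2; have : ((k < 3) ==> ~~ (N.-1 - k < 3))%N by lia.
move: (N.-1 - k)%N => l; move: k {kN c0 c1 c2} => [|[|[|k]]]; case: l => [|[|[|l]]] //= _; ring.
Qed.

Lemma sum_weights d (f : 'I_d -> 'I_N) g i s : all (fun x => (x <= 3)%N) g ->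
  perm_eq s [seq val (f j) | j <- enum 'I_d] ->
  \sum_j wcoord N (dvec g i) (f j) =
  (sumn [seq (3 + digit_pos N g i k - digit_neg g i k)%N | k <- s])%:R - (3 * d)%:R.
Proof.
move=> g3 ps; under eq_bigr do rewrite wcoord_digits ?ltn_ord //.
rewrite sumrB sumr_const card_ord natrM mulr_natr; congr (_ - _).
by rewrite sumnE big_map natr_sum (sum_place (fun k => (3 + digit_pos N g i k - digit_neg g i k)%N%:R) ps).
Qed.

Lemma shifted_sum (K : comPzRingType) (x y z d : nat) :
  x%:R - (3 * d)%:R + (y%:R - (3 * d)%:R) + (z%:R - (3 * d)%:R) = (x + y + z)%N%:R - (9 * d)%:R :> K.
Proof. by rewrite (natrD _ (x + y)%N z) (natrD _ x y) (natrM _ 9 d) (natrM _ 3 d); ring. Qed.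

Lemma totalE (T : Type) (a b c : T -> nat) (l : seq T) :
  total ([seq a x | x <- l], [seq b x | x <- l], [seq c x | x <- l]) = [seq (a x + b x + c x)%N | x <- l].
Proof. by rewrite /total /=; elim: l => //= x l ->. Qed.

Definition slopes d (z : 'M[C]_(d, N)) (v : 'rV[R]_3 * 'rV[R]_3 * 'rV[R]_3) : R :=
  slope v.1.1 (z *m invmx 1%:M) + slope v.1.2 (z *m invmx (Jform R N)) +
  slope v.2 (z *m invmx (Jform R N *m shift_mx C N)).

Lemma generators_stable d (z : 'M[C]_(d, N)) : stable_check N -> (N <= 7)%N -> (0 < d)%N -> row_free z ->
  z *m Jform R N *m z^T = 0 ->
  (forall g, g \in generators -> 0 <= slopes z (vec_of_digits R g)) /\
  exists2 g, g \in generators & 0 < slopes z (vec_of_digits R g).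
Proof.
move=> chk N7 d0 fz iso; have N3 : (3 <= N)%N by apply: leq_trans N6.
have [f1 [f2 [f3 [[j1 j2 j3] [m1 m2 m3 dN] hw hm sE]]]] := generic_positions N3 fz iso.
have [s1 p1 q1] := place j1 m1; have [s2 p2 q2] := place j2 m2; have [s3 p3 q3] := place j3 m3.
have d3 : (0 < d <= 3)%N by rewrite d0 /=; lia.
have w : wronski_ok N d s1 s2 s3.
  rewrite /wronski_ok (sumn_place (fun k => (N.-1 - k)%N) q2) (sumn_place (fun k => (N.-1 - k)%N) q3).
  have -> : sumn s1 = (\sum_i f1 i)%N by rewrite -(sumn_place id q1) map_id.
  by rewrite -bin2_sum big_mkord.
have m : meet_ok N d s1 s2 s3.
  apply/allP => a; rewrite mem_iota ltnS => /andP[_ aN]; apply/allP => b; rewrite mem_iota ltnS => /andP[_ bN].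
  apply/allP => c; rewrite mem_iota ltnS => /andP[_ cN]; apply/implyP.
  rewrite (count_place a q1) (count_place b q2) (count_place c q3); exact: hm.
have := stable_checkP chk d3 p1 p2 p3 w m; rewrite /weights totalE => /andP[/allP hall /hasP hhas].
(* Digits are at most 3, so the truncated subtraction in [weights] is exact. *)
have gen3 : all (fun g => all (fun x => (x <= 3)%N) g) generators by vm_compute.
have sl g : g \in generators -> slopes z (vec_of_digits R g) =
   (sumn [seq (3 + digit_pos N g 0 k - digit_neg g 0 k)%N | k <- s1] +
    sumn [seq (3 + digit_pos N g 1 k - digit_neg g 1 k)%N | k <- s2] +
    sumn [seq (3 + digit_pos N g 2 k - digit_neg g 2 k)%N | k <- s3])%N%:R - (9 * d)%:R.
  move=> /(allP gen3) g3; rewrite /slopes sE /vec_of_digits /=.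
  have h1 := sum_weights 0 g3 q1; have h2 := sum_weights 1 g3 q2; have h3 := sum_weights 2 g3 q3.
  rewrite [X in X + _ + _]h1 [X in _ + X + _]h2 [X in _ + _ + X]h3.
  exact: shifted_sum.
split=> [g gG|].
  rewrite sl // subr_ge0 ler_nat; apply: hall.
  exact: (map_f (fun g => (sumn [seq (3 + digit_pos N g 0 k - digit_neg g 0 k)%N | k <- s1] +
    sumn [seq (3 + digit_pos N g 1 k - digit_neg g 1 k)%N | k <- s2] +
    sumn [seq (3 + digit_pos N g 2 k - digit_neg g 2 k)%N | k <- s3])%N) gG).
case: hhas => x /mapP[g gG ->] h; exists g => //.
by rewrite sl // subr_gt0 ltr_nat.
Qed.

Lemma slopesD d (z : 'M[C]_(d, N)) (v w : 'rV[R]_3 * 'rV[R]_3 * 'rV[R]_3) (c : R) :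
  slopes z (v + c *: w) = slopes z v + c * slopes z w.
Proof. rewrite /slopes !slopeD.
by move: (slope v.1.1 _) (slope v.1.2 _) (slope v.2 _) => *; ring. Qed.

Lemma slopes_sum d (z : 'M[C]_(d, N)) n (b : 'I_n -> R) (w : 'I_n -> 'rV[R]_3 * 'rV[R]_3 * 'rV[R]_3) :
  slopes z (\sum_k b k *: w k) = \sum_k b k * slopes z (w k).
Proof.
elim/big_rec2: _ => [|k y x _ <-]; first by rewrite /slopes !slope0 !addr0.
by rewrite addrC slopesD addrC.
Qed.

Definition chambers (v : 'rV[R]_3 * 'rV[R]_3 * 'rV[R]_3) := [/\ chamber v.1.1, chamber v.1.2 & chamber v.2].

Lemma chamberD (v w : 'rV[R]_3) (c : R) : 0 <= c -> chamber v -> chamber w -> chamber (v + c *: w).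
Proof.
by move=> c0 [a1 a2 a3] [b1 b2 b3]; split; rewrite !mxE; [apply: lerD|apply: lerD|apply: addr_ge0];
  rewrite // ?ler_wpM2l // mulr_ge0.
Qed.

Lemma chambers_sum n (b : 'I_n -> R) (w : 'I_n -> 'rV[R]_3 * 'rV[R]_3 * 'rV[R]_3) :
  (forall k, 0 <= b k) -> (forall k, chambers (w k)) -> chambers (\sum_k b k *: w k).
Proof.
move=> b0 hw; elim/big_rec: _ => [|k y _ [y1 y2 y3]].
  by split; split; rewrite !mxE.
by rewrite addrC; case: (hw k) => w1 w2 w3; split; apply: chamberD.
Qed.

Lemma chambers_digits g : g \in generators -> chambers (vec_of_digits R g).
Proof.
have : all (fun g => all (fun i => (nth 0%N g (3 * 1 + i) <= nth 0%N g (3 * 0 + i)) &&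
   (nth 0%N g (3 * 2 + i) <= nth 0%N g (3 * 1 + i)))%N [:: 0%N; 1%N; 2%N]) generators by vm_compute.
move=> /allP h /h /and4P[/andP[a1 a2] /andP[b1 b2] /andP[c1 c2] _].
by split; split; rewrite !mxE ?ler0n // ler_nat.
Qed.

Lemma cone_chambers v : cone_of (map (@vec_of_digits R) generators) v -> chambers v.
Proof.
case=> a [a0 ->]; apply: chambers_sum => // k; rewrite (nth_map [::]) -?(size_map (@vec_of_digits R)) //.
apply: chambers_digits; apply: mem_nth; by rewrite -(size_map (@vec_of_digits R)).
Qed.

Lemma cone_closes v : stable_check N -> (N <= 7)%N ->
  cone_of (map (@vec_of_digits R) generators) v -> closes N v.1.1 v.1.2 v.2.
Proof.
move=> chk N7 [a [a0 vE]].
set G := map _ _ in a a0 vE; pose w (k : 'I_(size G)) := G`_k.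
have wG k : exists2 g, g \in generators & w k = vec_of_digits R g.
  have kG : (k < size generators)%N by rewrite -(size_map (@vec_of_digits R)).
  by exists (nth [::] generators k); [exact: mem_nth | rewrite /w /G (nth_map [::])].
(* The sum of all generators, of positive slope on every nonzero isotropic subspace. *)
pose v0 := \sum_k 1 *: w k.
apply: (closes_lim (w1 := v0.1.1) (w2 := v0.1.2) (w3 := v0.2)) => // c c0.
have E : v + c *: v0 = \sum_k (a k + c) *: w k.
  rewrite vE /v0 scaler_sumr -big_split; apply: eq_bigr => k _ /=.
  by rewrite scale1r scalerDl.
have [ch1 ch2 ch3] : chambers (v + c *: v0).
  rewrite E; apply: chambers_sum => k; first by rewrite addr_ge0 // ltW.
  by have [g gG ->] := wG k; exact: chambers_digits.
apply: (@stable_closes R N N6 1%:M (Jform R N) (Jform R N *m shift_mx C N)) => //.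
- exact: inG1.
- exact: inG_J.
- exact: inGM (inG_J R N) (shift_inG R N).
move=> d z d0 fz iso; have [h1 [g gG h2]] := generators_stable chk N7 d0 fz iso.
have -> : slope (v.1.1 + c *: v0.1.1) (z *m invmx 1%:M) + slope (v.1.2 + c *: v0.1.2) (z *m invmx (Jform R N)) +
  slope (v.2 + c *: v0.2) (z *m invmx (Jform R N *m shift_mx C N)) = slopes z (v + c *: v0) by [].
rewrite E slopes_sum.
have [k0 kE] : exists k : 'I_(size G), w k = vec_of_digits R g.
  have lt : (index g generators < size G)%N by rewrite size_map index_mem.
  have lt' : (index g generators < size generators)%N by rewrite index_mem.
  by exists (Ordinal lt); exact (etrans (nth_map [::] 0 _ lt') (congr1 _ (nth_index _ gG))).
rewrite (bigD1 k0) //= ltr_wpDr //.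
  apply: sumr_ge0 => k _; have [g' gG' ->] := wG k.
  by apply: mulr_ge0; [rewrite addr_ge0 // ltW | apply: h1].
by rewrite kE mulr_gt0 // ltr_wpDl.
Qed.
End Stability.

(** * The symplectic case *)

Section Exponential.
Variables (R : realType) (n : nat).
Local Notation C := R[i].
Local Notation cR x := (x%:C)%C.

Lemma expmx_diag (e : 'rV[R]_n.+1) :
  expmx (diag_mx (map_mx (real_complex R) e)) = diag_mx (\row_j cR (expR (e 0 j))).
Proof.
rewrite /expmx; apply: cvg_lim; first exact: norm_hausdorff.
set D := diag_mx (map_mx _ e).
have Dk k : D ^+ k = diag_mx (\row_j cR (e 0 j ^+ k)).
  elim: k => [|k IH]; first by rewrite expr0 -[1]diag_const_mx; congr diag_mx; apply/rowP => j; rewrite !mxE.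
  rewrite exprS IH [X in X = _]mulmx_diag; congr diag_mx; apply/rowP => j.
  by rewrite !mxE exprS rmorphM.
pose S m j : R := series (exp_coeff (e 0 j)) m.
have SE m : series (fun k => (k`!%:R)^-1 *: D ^+ k) m = diag_mx (\row_j cR (S m j)).
  apply/matrixP => i j; rewrite /S /series /= summxE !mxE rmorph_sum -sumrMnl.
  apply: eq_bigr => k _; rewrite Dk !mxE /exp_coeff /= rmorphM fmorphV rmorph_nat mulrC.
  by rewrite mulrnAl.
have hS j : (S^~ j @ \oo --> expR (e 0 j))%classic by exact: is_cvg_series_exp_coeff.
apply/cvgrPdist_lt => eps eps0.
have [r [r0 rE]] : exists r : R, 0 < r /\ eps = cR r.
  by case: eps eps0 => a b; rewrite ltcE /= => /andP[/eqP -> a0]; exists a.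
have near_all : \forall m \near \oo%classic, forall j, `|expR (e 0 j) - S m j| < r.
  by apply: filter_forall => j; move/cvgrPdist_lt: (hS j) => /(_ r r0).
apply: filterS near_all => m h /=; rewrite SE.
set M := diag_mx _ - diag_mx _; suff : mx_norm M < eps by [].
have [->//|/mx_norm_neq0[[i j] /= ->]] := eqVneq (mx_norm M) 0.
rewrite rE !mxE.
case: (i == j); last by rewrite !mulr0n subrr normr0 ltcR.
by rewrite !mulr1n -rmorphB normc_def /= expr0n addr0 sqrtr_sqr ltcR.
Qed.
End Exponential.

(** * Triangles of cosets as product identities *)

Section Coset.
Variables (R : realType) (n : nat) (G : set 'M[R[i]]_n.+1) (iota : 'rV[R]_3 -> 'M[R[i]]_n.+1).
Local Notation C := R[i].
Local Notation K := (maxcompact G).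
Hypothesis G1 : G 1%:M.
Hypothesis GM : forall g h, G g -> G h -> G (g *m h).
Hypothesis GU : forall g, G g -> g \in unitmx.
Hypothesis GV : forall g, G g -> G (invmx g).
Hypothesis GX : forall v, G (expmx (iota v)).

Let K1 : K 1%:M. Proof. by split=> //; apply/unitarymxP; rewrite trmx1 map_mx1 mulmx1. Qed.

Let KM g h : K g -> K h -> K (g *m h).
Proof. by case=> g1 g2 [h1 h2]; split; [exact (GM g1 h1) | exact (mul_unitarymx g2 h2)]. Qed.

Let KV g : K g -> K (invmx g).
Proof.
case=> g1 g2; split; first exact: GV.
by apply/unitarymxP; rewrite adj_inv -invmx_mul ?adj_unit ?GU // (mulmx1C (unitarymxP g2)) invmx1.
Qed.

Let actK (g k : 'M[C]_n.+1) : K k -> act (g *m k) K = act g K.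
Proof.
move=> Kk; apply/seteqP; split=> x [h Kh <-]; first by exists (k *m h); [exact: KM | rewrite mulmxA].
by exists (invmx k *m h); [exact: KM (KV Kk) Kh | rewrite mulmxA -(mulmxA g) mulmxV ?mulmx1 // GU; case: Kk].
Qed.

Let actM (g h : 'M[C]_n.+1) p : act g (act h p) = act (g *m h) p.
Proof.
apply/seteqP; split=> x; first by case=> y [z pz <-] <-; exists z => //; rewrite mulmxA.
by case=> z pz <-; exists (h *m z); [exists z | rewrite mulmxA].
Qed.

Let act1 (p : set 'M[C]_n.+1) : act 1%:M p = p.
Proof.
apply/seteqP; split=> x; first by case=> y py <-; rewrite mul1mx.
by move=> px; exists x => //; rewrite mul1mx.
Qed.

Let act_in (g h : 'M[C]_n.+1) : act g K = act h K -> exists2 k, K k & g = h *m k.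
Proof.
move=> E; have : act g K g by exists 1%:M => //; rewrite mulmx1.
by rewrite E => -[k Kk <-]; exists k.
Qed.

Let quot (X a b g g' h : 'M[C]_n.+1) : g' \in unitmx -> h \in unitmx ->
  g *m h = X *m a -> g' *m h = b -> X *m (a *m invmx b) = g *m invmx g'.
Proof.
move=> ug uh E <-; rewrite invmx_mul // !mulmxA -E mulmxK //.
Qed.

(** Two of the isometries attached to the sides differ at a common vertex by an element of K, and
    the three sides telescope. Conversely the partial products of the identity give the vertices. *)
Lemma D3_closing v1 v2 v3 : D3 G iota (v1, v2, v3) <->
  [/\ chamber v1, chamber v2 & chamber v3] /\ exists k1 k2 k3, [/\ K k1, K k2, K k3 &
   expmx (iota v1) *m k1 *m expmx (iota v2) *m k2 *m expmx (iota v3) *m k3 = 1%:M].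
Proof.
split.
  case=> _ [_ [_ [[[h1 Gh1 <-] [h2 Gh2 <-] [h3 Gh3 <-]]]]] /= [].
  case=> c1 [g1 Gg1 []] + + [c2 [g2 Gg2 []]] + + [c3 [g3 Gg3 []]].
  have fix1 g h : act g (act h K) = basepoint G -> K (g *m h).
    rewrite actM -[basepoint G]act1 => /act_in[k Kk ->]; by rewrite mul1mx.
  have fix2 g h X : act g (act h K) = act X (basepoint G) -> exists2 k, K k & g *m h = X *m k.
    by rewrite actM => /act_in.
  move=> /fix1 b1 /fix2[a1 Ka1 e1] /fix1 b2 /fix2[a2 Ka2 e2] /fix1 b3 /fix2[a3 Ka3 e3].
  split; first by [].
  exists (a1 *m invmx (g2 *m h2)), (a2 *m invmx (g3 *m h3)), (a3 *m invmx (g1 *m h1)).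
  split; [exact: KM (KV b2) | exact: KM (KV b3) | exact: KM (KV b1) |].
  have q1 := quot (GU Gg2) (GU Gh2) e1 erefl; have q2 := quot (GU Gg3) (GU Gh3) e2 erefl.
  have q3 := quot (GU Gg1) (GU Gh1) e3 erefl.
  have iu g : G g -> invmx g \in unitmx by move=> /GU; rewrite unitmx_inv.
  rewrite -{1}(invmxK g1) in q1; rewrite -{1}(invmxK g2) in q2; rewrite -{1}(invmxK g3) in q3.
  exact (cyclic_quotients (iu _ Gg1) (iu _ Gg2) (iu _ Gg3) q1 q2 q3).
case=> -[c1 c2 c3] [k1 [k2 [k3 [K1' K2' K3' E]]]].
have [Gk1 Gk2 Gk3] : [/\ G k1, G k2 & G k3] by case: K1' K2' K3' => ? _ [? _] [? _].
set X1 := expmx (iota v1) in E; set X2 := expmx (iota v2) in E; set X3 := expmx (iota v3) in E.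
have GX1 : G X1 := GX v1; have GX2 : G X2 := GX v2; have GX3 : G X3 := GX v3.
pose h := X1 *m k1; pose h' := h *m X2 *m k2.
have Gh : G h by exact: GM. have Gh' : G h' := GM (GM Gh GX2) Gk2.
have uh := GU Gh; have uh' := GU Gh'.
exists (act 1%:M K), (act h K), (act h' K); split.
  by split; [exists 1%:M | exists h | exists h'].
split=> /=; split=> //.
- exists 1%:M => //; rewrite !act1; split=> //; exact: actK.
- exists (invmx h); first exact: GV.
  rewrite !actM mulVmx // act1; split=> //.
  by rewrite /h' -(mulmxA h) mulKmx // actK.
- exists (invmx h'); first exact: GV.
  rewrite !actM mulVmx // act1; split=> //.
  have -> : invmx h' = X3 *m k3.
    by apply: (can_inj (mulKmx uh')); rewrite mulmxV // /h' /h !mulmxA E.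
  by rewrite mulmx1 actK.
Qed.
End Coset.

Lemma gram_chain (C : numDomainType) (a1 a2 a3 y0 y1 x1 y2 x2 y3 x3 : C) :
  0 <= a1 -> 0 <= a2 -> 0 <= a3 -> 0 < y0 -> y1 = y0 -> x1 <= a1 * y1 -> x1 = y2 ->
  x2 <= a2 * y2 -> x2 = y3 -> x3 <= a3 * y3 -> x3 = y0 -> 1 <= a3 * (a2 * a1).
Proof.
move=> p1 p2 p3 g0 -> g1 <- g2 <- g3 E; rewrite E in g3.
have h := le_trans g3 (ler_wpM2l p3 (le_trans g2 (ler_wpM2l p2 g1))).
by rewrite -(ler_pM2r g0) mul1r -!mulrA.
Qed.

Lemma expR_chain_ge0 (R : realType) (x1 x2 x3 : R) :
  1 <= (expR (2 * x3))%:C%C * ((expR (2 * x2))%:C%C * (expR (2 * x1))%:C%C) :> R[i] -> 0 <= x1 + x2 + x3.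
Proof.
by rewrite -!rmorphM -!expRD lecE /= => /andP[_]; rewrite leNgt expR_lt1 -leNgt; lra.
Qed.

Lemma gram_cycle (C : numClosedFieldType) d N (t : 'M[C]_(d, N)) (w1 w2 w3 u1 u2 u3 : 'M[C]_N) :
  u1 \is unitarymx -> u2 \is unitarymx -> u3 \is unitarymx ->
  w1 *m u1 *m w2 *m u2 *m w3 *m u3 = 1%:M ->
  [/\ gram (t *m 1%:M *m w1) = gram (t *m (w1 *m u1)),
      gram (t *m (w1 *m u1) *m w2) = gram (t *m (w1 *m u1 *m w2 *m u2)) &
      gram (t *m (w1 *m u1 *m w2 *m u2) *m w3) = gram t].
Proof.
move=> U1 U2 U3 E; split.
- by rewrite mulmx1 -(gram_mulr_unitary (t *m w1) U1) -mulmxA.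
- by rewrite -(gram_mulr_unitary (t *m (w1 *m u1) *m w2) U2) -!mulmxA.
rewrite -(gram_mulr_unitary (t *m (w1 *m u1 *m w2 *m u2) *m w3) U3) -[in RHS](mulmx1 t) -E.
by rewrite !mulmxA.
Qed.

Section UnitaryClosing.
Variables (R : realType) (N : nat).
Hypothesis N6 : (6 <= N)%N.
Local Notation C := R[i].
Local Notation cR x := (x%:C)%C.

(** The squared volume of a subspace returns to its value after the cycle, while each weight expands
    it by at most exp(2 slope); the slopes therefore have a nonnegative sum. *)
Lemma unitary_closing_cone (v1 v2 v3 : 'rV[R]_3) (u1 u2 u3 : 'M[C]_N) :
  chamber v1 -> chamber v2 -> chamber v3 ->
  u1 \is unitarymx -> u2 \is unitarymx -> u3 \is unitarymx ->
  weight N v1 *m u1 *m weight N v2 *m u2 *m weight N v3 *m u3 = 1%:M ->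
  cone_of (map (@vec_of_digits R) generators) (v1, v2, v3).
Proof.
move=> cv1 cv2 cv3 U1 U2 U3 E; apply: tri_in_cone N6 _.
have w1 := weight_unit N6 v1; have w2 := weight_unit N6 v2.
have um (A B : 'M[C]_N) : A \in unitmx -> B \in unitmx -> A *m B \in unitmx by rewrite unitmx_mul => ->.
have uc2 := um _ _ w1 (unitarymx_unit U1).
have uc3 := um _ _ (um _ _ uc2 w2) (unitarymx_unit U2).
apply: (tri_slope cv1 cv2 cv3 (unitmx1 C N) uc2 uc3) => d t ft.
have [e1 e2 e3] := gram_cycle t U1 U2 U3 E; have g0 := gram_gt0 ft.
have p (x : R) : 0 <= cR (expR (2 * x)) by rewrite lecR expR_ge0.
have g1 := gram_weight (t *m 1%:M) cv1; have g2 := gram_weight (t *m (weight N v1 *m u1)) cv2.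
have g3 := gram_weight (t *m (weight N v1 *m u1 *m weight N v2 *m u2)) cv3.
have e0 := congr1 (@gram C d N) (mulmx1 t).
apply: expR_chain_ge0; exact (gram_chain (p _) (p _) (p _) g0 e0 g1 e1 g2 e2 g3 e3).
Qed.

Lemma conj_closing (P X1 X2 X3 W1 W2 W3 k1 k2 k3 : 'M[C]_N) : P \is unitarymx ->
  P *m X1 = W1 *m P -> P *m X2 = W2 *m P -> P *m X3 = W3 *m P ->
  X1 *m k1 *m X2 *m k2 *m X3 *m k3 = 1%:M <->
  W1 *m (P *m k1 *m P^t*) *m W2 *m (P *m k2 *m P^t*) *m W3 *m (P *m k3 *m P^t*) = 1%:M.
Proof.
move=> uP h1 h2 h3; have P1 : P^t* *m P = 1%:M by apply: mulmx1C; apply/unitarymxP.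
have P2 : P *m P^t* = 1%:M by apply/unitarymxP.
have e X W : P *m X = W *m P -> W = P *m X *m P^t* by move=> ->; rewrite -mulmxA P2 mulmx1.
have E : W1 *m (P *m k1 *m P^t*) *m W2 *m (P *m k2 *m P^t*) *m W3 *m (P *m k3 *m P^t*) =
    P *m (X1 *m k1 *m X2 *m k2 *m X3 *m k3) *m P^t*.
  rewrite (e _ _ h1) (e _ _ h2) (e _ _ h3) !mulmxA.
  by do 5! rewrite -(mulmxA _ (P^t*) P) P1 mulmx1.
rewrite E; split=> [->|h]; first by rewrite mulmx1.
move: (_ *m k3) h => Y h; transitivity (P^t* *m (P *m Y *m P^t*) *m P).
  by rewrite !mulmxA P1 mul1mx -mulmxA P1 mulmx1.
by rewrite h mulmx1.
Qed.
End UnitaryClosing.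

Lemma conj_closing_back (R : realType) n (P X1 X2 X3 W1 W2 W3 k1 k2 k3 : 'M[R[i]]_n) : P \is unitarymx ->
  P *m X1 = W1 *m P -> P *m X2 = W2 *m P -> P *m X3 = W3 *m P ->
  W1 *m k1 *m W2 *m k2 *m W3 *m k3 = 1%:M ->
  X1 *m (P^t* *m k1 *m P) *m X2 *m (P^t* *m k2 *m P) *m X3 *m (P^t* *m k3 *m P) = 1%:M.
Proof.
move=> uP h1 h2 h3 E; have P2 : P *m P^t* = 1%:M by apply/unitarymxP.
have back (k : 'M[R[i]]_n) : P *m (P^t* *m k *m P) *m P^t* = k.
  by rewrite !mulmxA P2 mul1mx -mulmxA P2 mulmx1.
have sub (l1 l2 l3 : 'M[R[i]]_n) : l1 = k1 -> l2 = k2 -> l3 = k3 ->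
  W1 *m l1 *m W2 *m l2 *m W3 *m l3 = 1%:M by move=> -> -> ->.
exact ((conj_closing _ _ _ uP h1 h2 h3).2 (sub _ _ _ (back k1) (back k2) (back k3))).
Qed.

Lemma conj_unitary (C : numClosedFieldType) n (P k : 'M[C]_n) :
  P \is unitarymx -> k \is unitarymx -> P *m k *m P^t* \is unitarymx.
Proof.
move=> uP uk; have uP' : P^t* \is unitarymx by rewrite trmxC_unitary.
exact (mul_unitarymx (mul_unitarymx uP uk) uP').
Qed.

Lemma conj_unitary_adj (C : numClosedFieldType) n (P k : 'M[C]_n) :
  P \is unitarymx -> k \is unitarymx -> P^t* *m k *m P \is unitarymx.
Proof.
move=> uP uk; have uP' : P^t* \is unitarymx by rewrite trmxC_unitary.
exact (mul_unitarymx (mul_unitarymx uP' uk) uP).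
Qed.

Lemma conj_inv (C : numClosedFieldType) n (P g : 'M[C]_n) :
  P \is unitarymx -> g \in unitmx -> P *m invmx g *m P^t* = invmx (P *m g *m P^t*).
Proof.
move=> uP ug; have P2 : P *m P^t* = 1%:M by apply/unitarymxP.
have P1 : P^t* *m P = 1%:M by apply: mulmx1C.
have uPgP : P *m g *m P^t* \in unitmx by rewrite !unitmx_mul adj_unit ug unitarymx_unit.
apply: (can_inj (mulKmx uPgP)); rewrite mulmxV // !mulmxA -(mulmxA _ (P^t*) P) P1 mulmx1.
by rewrite mulmxK.
Qed.

Section SymplecticC3.
Variable R : realType.
Local Notation C := R[i].
Local Notation cR x := (x%:C)%C.

(** Reorders diag(x, y, z, -x, -y, -z) into -x, -y, -z, z, y, x; the signs of [signC3] make the form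
    alternate like [Jform]. *)
Definition swapC3 (a : 'I_6) : 'I_6 := inord (if (a < 3)%N then (a + 3)%N else (5 - a)%N).
Definition signC3 (a : 'I_6) : C := if (a == 0 :> nat) || (a == 2 :> nat) then -1 else 1.
Definition PC3 : 'M[C]_6 := \matrix_(a, b) (signC3 a *+ (b == swapC3 a)).

Lemma PC3_mul m (M : 'M[C]_(6, m)) a b : (PC3 *m M) a b = signC3 a * M (swapC3 a) b.
Proof.
rewrite mxE (bigD1 (swapC3 a)) //= mxE eqxx mulr1n big1 ?addr0 // => c ca.
by rewrite mxE (negbTE ca) mulr0n mul0r.
Qed.

Lemma mul_PC3T m (M : 'M[C]_(m, 6)) a b : (M *m PC3^T) a b = M a (swapC3 b) * signC3 b.
Proof.
rewrite mxE (bigD1 (swapC3 b)) //= !mxE eqxx mulr1n big1 ?addr0 // => c ca.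
by rewrite !mxE (negbTE ca) mulr0n mulr0.
Qed.

Lemma swapC3_val a : swapC3 a = (if (a < 3)%N then (a + 3)%N else (5 - a)%N) :> nat.
Proof. by rewrite inordK //; have := ltn_ord a; case: (ltnP a 3) => h1 h2; lia. Qed.

Lemma PC3_real : PC3^t* = PC3^T.
Proof.
apply/matrixP => a b; rewrite !mxE rmorphMn /signC3; congr (_ *+ _).
by case: ifP; rewrite ?rmorphN1 ?rmorph1.
Qed.

Lemma PC3_unitary : PC3 \is unitarymx.
Proof.
apply/unitarymxP; rewrite PC3_real; apply/matrixP => a b.
rewrite mul_PC3T [PC3 _ _]mxE [RHS]mxE mulrnAl /signC3 -!val_eqE /= !swapC3_val.
by case: a b => [[|[|[|[|[|[|?]]]]]] ?] [[|[|[|[|[|[|?]]]]]] ?] //=; rewrite ?mulr0n ?mulr1n ?mulrNN ?mulr1.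
Qed.

Lemma JmxE i j : Jmx R i j = (j == i + 3 :> nat)%N%:R - (i == j + 3 :> nat)%N%:R.
Proof.
rewrite /Jmx mxE; case: splitP => i' iE; rewrite mxE; case: splitP => j' jE; rewrite !mxE iE jE;
  have := ltn_ord i'; have := ltn_ord j'; rewrite -?val_eqE /=.
- by do 2 case: eqP => ?; rewrite ?subrr //; lia.
- by do 3 case: eqP => ?; rewrite ?subr0 //; lia.
- by do 3 case: eqP => ?; rewrite ?sub0r ?oppr0 //; lia.
by do 2 case: eqP => ?; rewrite ?subrr //; lia.
Qed.

Lemma PC3_form : PC3 *m Jmx R *m PC3^T = Jform R 6.
Proof.
apply/matrixP => a b; rewrite mul_PC3T PC3_mul [RHS]mxE JmxE !swapC3_val /signC3 -val_eqE.
case: a b => [[|[|[|[|[|[|?]]]]]] ?] [[|[|[|[|[|[|?]]]]]] ?] //=;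
  rewrite ?mulr0n ?mulr1n ?subrr ?subr0 ?sub0r ?mulr0 ?mul0r //; ring.
Qed.

Lemma PC3_weight v : PC3 *m expmx (cartanC3 v) = weight 6 v *m PC3.
Proof.
have -> : cartanC3 v = diag_mx (map_mx (real_complex R) (row_mx v (- v))).
  by rewrite /cartanC3 map_row_mx map_mxN.
rewrite expmx_diag weight_diag mul_diag_mx mul_mx_diag; apply/matrixP => a b; rewrite !mxE.
have [->|_] := eqVneq b (swapC3 a); last by rewrite !mulr0n mul0r mulr0.
rewrite mulr1n mulrC; congr (cR (expR _) * _); rewrite wcoordE.
have row3 (k : 'I_3) : v 0 k = if k == 0 :> nat then v 0 0 else if k == 1 :> nat then v 0 1 else v 0 2.
  by case: k => [[|[|[|?]]] ?] //=; congr (v 0 _); apply/val_inj.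
case: splitP => k; rewrite ?mxE swapC3_val (row3 k) => kE;
  case: a kE => [[|[|[|[|[|[|?]]]]]] ?] /= kE; rewrite -?kE /=; try (by have := ltn_ord k; lia); try ring.
- have k0 : k = 0%N :> nat by lia.
  by rewrite k0 /=; ring.
- have k0 : k = 1%N :> nat by lia.
  by rewrite k0 /=; ring.
have k0 : k = 2%N :> nat by lia.
by rewrite k0 /=; ring.
Qed.

Lemma Sp6_inG (g : 'M[C]_6) : Sp6 g <-> inG (PC3 *m g *m PC3^t*).
Proof.
have P1 : PC3 *m PC3^T = 1%:M by rewrite -PC3_real; apply/unitarymxP; exact: PC3_unitary.
have P2 : PC3^T *m PC3 = 1%:M by apply: mulmx1C.
have J0 : PC3^T *m Jform R 6 *m PC3 = Jmx R.
  by rewrite -PC3_form !mulmxA P2 mul1mx -mulmxA P2 mulmx1.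
have J2 : Jmx R *m Jmx R = - 1%:M.
  have JJ : Jform R 6 *m Jform R 6 = - 1%:M.
    have := JJT R 6; rewrite J_sign -scalemxAr => h.
    by rewrite -h -signr_odd scaleN1r opprK.
  rewrite -J0 !mulmxA -(mulmxA _ PC3 PC3^T) P1 mulmx1 -(mulmxA _ (Jform R 6) (Jform R 6)) JJ.
  by rewrite mulmxN mulNmx mulmx1 P2.
(* [Sp6] has the transpose on the left and [inG] on the right; J^2 = -1 lets one pass between the
   two. *)
have tr (h : 'M[C]_6) : h *m Jmx R *m h^T = Jmx R -> h^T *m Jmx R *m h = Jmx R.
  move=> E; have : h *m (- (Jmx R *m h^T *m Jmx R)) = 1%:M.
    by rewrite mulmxN !mulmxA E J2 opprK.
  move/mulmx1C => E2; have := congr1 (mulmx (Jmx R)) E2.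
  by rewrite mulmx1 mulNmx mulmxN !mulmxA J2 !mulNmx mul1mx opprK.
have k (h : 'M[C]_6) : (PC3 *m h *m PC3^T) *m Jform R 6 *m (PC3 *m h *m PC3^T)^T =
    PC3 *m (h *m Jmx R *m h^T) *m PC3^T.
  by rewrite -J0 !trmx_mul trmxK !mulmxA.
have inj (A B : 'M[C]_6) : PC3 *m A *m PC3^T = PC3 *m B *m PC3^T -> A = B.
  move=> h; have := congr1 (fun M => PC3^T *m M *m PC3) h.
  by rewrite !mulmxA P2 !mul1mx -!mulmxA P2 !mulmx1.
rewrite /Sp6 /inG PC3_real k -PC3_form /=; split=> [h|/inj h].
  by have := tr g^T; rewrite !trmxK => /(_ h) ->.
exact: tr.
Qed.

Lemma D3_C3_cone : D3_C3 R = cone_of (map (@vec_of_digits R) generators).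
Proof.
have uP := PC3_unitary.
have P1 : PC3^t* *m PC3 = 1%:M by apply: mulmx1C; apply/unitarymxP.
have P2 : PC3 *m PC3^t* = 1%:M by apply/unitarymxP.
have cM (g h : 'M[C]_6) : PC3 *m (g *m h) *m PC3^t* = (PC3 *m g *m PC3^t*) *m (PC3 *m h *m PC3^t*).
  by rewrite !mulmxA -(mulmxA _ (PC3^t*) PC3) P1 mulmx1.
have back (h : 'M[C]_6) : PC3 *m (PC3^t* *m h *m PC3) *m PC3^t* = h.
  by rewrite !mulmxA P2 mul1mx -mulmxA P2 mulmx1.
have uPP := unitarymx_unit uP.
have GU (g : 'M[C]_6) : Sp6 g -> g \in unitmx.
  by move=> /Sp6_inG/inG_unit; rewrite !unitmx_mul => /andP[/andP[_]].
have G1 : Sp6 (1%:M : 'M[C]_6) by apply/Sp6_inG; rewrite mulmx1 P2; exact: inG1.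
have GM (g h : 'M[C]_6) : Sp6 g -> Sp6 h -> Sp6 (g *m h).
  by move=> /Sp6_inG hg /Sp6_inG hh; apply/Sp6_inG; rewrite cM; exact: inGM.
have GV (g : 'M[C]_6) : Sp6 g -> Sp6 (invmx g).
  move=> hg; have ug := GU _ hg; move/Sp6_inG: hg => hg; apply/Sp6_inG.
  rewrite (_ : PC3 *m invmx g *m PC3^t* = invmx (PC3 *m g *m PC3^t*)); first exact: inGV.
  exact: conj_inv uP ug.
have GX (v : 'rV[R]_3) : Sp6 (expmx (cartanC3 v)).
  refine (proj2 (Sp6_inG (expmx (cartanC3 v))) _); rewrite PC3_weight -mulmxA P2 mulmx1; exact: weight_inG.
have key := D3_closing G1 GM GU GV GX.
apply/seteqP; split=> -[[v1 v2] v3].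
  case/key => -[ch1 ch2 ch3] [k1 [k2 [k3 [[s1 u1] [s2 u2] [s3 u3]] E]]].
  apply: (@unitary_closing_cone R 6 isT v1 v2 v3 _ _ _ ch1 ch2 ch3
    (conj_unitary uP u1) (conj_unitary uP u2) (conj_unitary uP u3)).
  exact ((conj_closing k1 k2 k3 uP (PC3_weight v1) (PC3_weight v2) (PC3_weight v3)).1 E).
move=> hc; apply/key; split; first exact: (cone_chambers hc).
have [k1 [k2 [k3 [[i1 i2 i3] [u1 u2 u3] E]]]] := @cone_closes R 6 isT _ stable_check6 isT hc.
have uk (k : 'M[C]_6) : inG k -> k \is unitarymx -> maxcompact (@Sp6 R) (PC3^t* *m k *m PC3).
  move=> ik uk; split.
    by refine (proj2 (Sp6_inG _) _); rewrite back.
  exact (conj_unitary_adj uP uk).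
exists (PC3^t* *m k1 *m PC3), (PC3^t* *m k2 *m PC3), (PC3^t* *m k3 *m PC3).
split; [exact (uk _ i1 u1) | exact (uk _ i2 u2) | exact (uk _ i3 u3) |].
exact (conj_closing_back uP (PC3_weight v1) (PC3_weight v2) (PC3_weight v3) E).
Qed.
End SymplecticC3.

(** * The spin case *)

Section Tensor.
Variable K : comNzRingType.

Lemma tens_mulmx m n p q m' p' (A : 'M[K]_(m, n)) (B : 'M[K]_(p, q)) (A' : 'M[K]_(n, m')) (B' : 'M[K]_(q, p')) :
  (A *t B) *m (A' *t B') = (A *m A') *t (B *m B').
Proof.
apply/matrixP => i j; rewrite !mxE mulr_sum; apply: eq_bigr => k _; rewrite !mxE.
by rewrite mulrACA.
Qed.

Lemma tensDl m n p q (A A' : 'M[K]_(m, n)) (B : 'M[K]_(p, q)) : (A + A') *t B = A *t B + A' *t B.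
Proof. by apply/matrixP => i j; rewrite !mxE mulrDl. Qed.

Lemma tensDr m n p q (A : 'M[K]_(m, n)) (B B' : 'M[K]_(p, q)) : A *t (B + B') = A *t B + A *t B'.
Proof. by apply/matrixP => i j; rewrite !mxE mulrDr. Qed.

Lemma tensZl m n p q c (A : 'M[K]_(m, n)) (B : 'M[K]_(p, q)) : (c *: A) *t B = c *: (A *t B).
Proof. by apply/matrixP => i j; rewrite !mxE mulrA. Qed.

Lemma tensZr m n p q c (A : 'M[K]_(m, n)) (B : 'M[K]_(p, q)) : A *t (c *: B) = c *: (A *t B).
Proof. by apply/matrixP => i j; rewrite !mxE mulrCA. Qed.

Lemma unindex_eq m n (i j : 'I_(m * n)) : (i == j) =
  ((mxtens_unindex i).1 == (mxtens_unindex j).1) && ((mxtens_unindex i).2 == (mxtens_unindex j).2).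
Proof.
rewrite -(inj_eq (can_inj (@mxtens_unindexK m n))).
by case: (mxtens_unindex i) (mxtens_unindex j) => a b [a' b']; rewrite xpair_eqE.
Qed.

Lemma tens_diag m n (a : 'rV[K]_m) (b : 'rV[K]_n) : diag_mx a *t diag_mx b =
  diag_mx (\row_k (a 0 (mxtens_unindex k).1 * b 0 (mxtens_unindex k).2)).
Proof.
apply/matrixP => i j; rewrite !mxE unindex_eq.
by case: eqP => [->|_]; case: eqP => [->|_]; rewrite /= ?mulr0n ?mulr1n ?mul0r ?mulr0.
Qed.

Lemma tens11 m n : (1%:M : 'M[K]_m) *t (1%:M : 'M[K]_n) = 1%:M.
Proof. by apply/matrixP => i j; rewrite !mxE unindex_eq -natrM mulnb. Qed.
End Tensor.

Lemma tens_adj (C : numClosedFieldType) m n p q (A : 'M[C]_(m, n)) (B : 'M[C]_(p, q)) :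
  (A *t B)^t* = A^t* *t B^t*.
Proof. by apply/matrixP => i j; rewrite !mxE rmorphM. Qed.

Section Pauli.
Variable R : realType.
Local Notation C := R[i].
Local Notation x := (sigmax R).
Local Notation y := (sigmay R).
Local Notation z := (sigmaz R).
Local Notation ii := (0 +i* 1 : C)%C.

Lemma ii2 : ii * ii = -1.
Proof. by apply/eqP; rewrite eq_complex /= !mul0r !mulr0 !mul1r ?mulr1 sub0r addr0 oppr0 !eqxx. Qed.

Ltac mx2 := apply/matrixP; case=> [[|[|?]] ?] //; case=> [[|[|?]] ?] //;
  rewrite !mxE ?big_ord_recl ?big_ord0 ?mxE /=; rewrite ?mulr0n ?mulr1n -?complexiE;
  try (by ring); try (by ring: ii2).

Lemma xx : x *m x = 1%:M. Proof. by mx2. Qed.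
Lemma yy : y *m y = 1%:M. Proof. by mx2. Qed.
Lemma zz : z *m z = 1%:M. Proof. by mx2. Qed.
Lemma yE : y = ii *: (x *m z). Proof. by mx2. Qed.
Lemma xy : x *m y = - (y *m x). Proof. by mx2. Qed.
Lemma yz : z *m y = - (y *m z). Proof. by mx2. Qed.
Lemma zx : z *m x = - (x *m z). Proof. by mx2. Qed.
Lemma x_adj : x^t* = x.
Proof. by apply/matrixP => i j; rewrite !mxE eq_sym rmorph_nat. Qed.
Lemma z_adj : z^t* = z.
Proof. by apply/matrixP => i j; rewrite !mxE eq_sym; case: eqP => [->|_]; rewrite ?rmorph0 // rmorphMn rmorphXn rmorphN1. Qed.
Lemma y_adj : y^t* = y.
Proof.
apply/matrixP; case=> [[|[|?]] ?] //; case=> [[|[|?]] ?] //; rewrite !mxE /= ?rmorph0 //;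
by apply/eqP; rewrite eq_complex /= ?oppr0 ?opprK !eqxx.
Qed.
Lemma z_diag : z = diag_mx (\row_(j < 2) (-1) ^+ j).
Proof. by apply/matrixP => i j; rewrite !mxE; case: eqP => [->|]. Qed.
End Pauli.

Definition anticomm (K : nzRingType) n (A B : 'M[K]_n) := A *m B = - (B *m A).

Lemma anticomm_sym (K : nzRingType) n (A B : 'M[K]_n) : anticomm A B -> anticomm B A.
Proof. by rewrite /anticomm => ->; rewrite opprK. Qed.

Section Tensor8.
Variable K : comNzRingType.
Implicit Types A B D : 'M[K]_2.

Definition tens8 A B D : 'M[K]_8 := A *t B *t D.

Lemma tens8_mul A B D A' B' D' :
  tens8 A B D *m tens8 A' B' D' = tens8 (A *m A') (B *m B') (D *m D').
Proof.
rewrite /tens8 -(tens_mulmx A B A' B'); exact (tens_mulmx (A *t B) D (A' *t B') D').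
Qed.

Lemma tens8_1 : tens8 1%:M 1%:M 1%:M = 1%:M.
Proof. by rewrite /tens8 (tens11 K 2 2 : _ = _); exact: (tens11 K (2 * 2) 2). Qed.

Lemma tens8Z1 c A B D : tens8 (c *: A) B D = c *: tens8 A B D.
Proof. by rewrite /tens8 (tensZl c A B : _ = _); exact: (tensZl c (A *t B) D). Qed.

Lemma tens8Z2 c A B D : tens8 A (c *: B) D = c *: tens8 A B D.
Proof. by rewrite /tens8 (tensZr c A B : _ = _); exact: (tensZl c (A *t B) D). Qed.

Lemma tens8Z3 c A B D : tens8 A B (c *: D) = c *: tens8 A B D.
Proof. exact: (tensZr c (A *t B) D). Qed.

Lemma tens8_sq A B D : A *m A = 1%:M -> B *m B = 1%:M -> D *m D = 1%:M ->
  tens8 A B D *m tens8 A B D = 1%:M.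
Proof. by rewrite tens8_mul => -> -> ->; exact: tens8_1. Qed.

Lemma tens8_anti1 A B D A' B' D' : anticomm A A' -> comm_mx B B' -> comm_mx D D' ->
  anticomm (tens8 A B D) (tens8 A' B' D').
Proof. by rewrite /anticomm /comm_mx !tens8_mul => -> -> ->; rewrite -scaleN1r tens8Z1 scaleN1r. Qed.

Lemma tens8_anti2 A B D A' B' D' : comm_mx A A' -> anticomm B B' -> comm_mx D D' ->
  anticomm (tens8 A B D) (tens8 A' B' D').
Proof. by rewrite /anticomm /comm_mx !tens8_mul => -> -> ->; rewrite -scaleN1r tens8Z2 scaleN1r. Qed.

Lemma tens8_anti3 A B D A' B' D' : comm_mx A A' -> comm_mx B B' -> anticomm D D' ->
  anticomm (tens8 A B D) (tens8 A' B' D').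
Proof. by rewrite /anticomm /comm_mx !tens8_mul => -> -> ->; rewrite -scaleN1r tens8Z3 scaleN1r. Qed.
End Tensor8.

Lemma tens8_adj (C : numClosedFieldType) (A B D : 'M[C]_2) :
  (tens8 A B D)^t* = tens8 (A^t*) (B^t*) (D^t*).
Proof.
transitivity ((A *t B)^t* *t D^t*); first exact: (tens_adj (A *t B) D).
by rewrite (tens_adj A B).
Qed.

Section GammaList.
Variables (C : numClosedFieldType) (x y z : 'M[C]_2).
Hypotheses (xx : x *m x = 1%:M) (yy : y *m y = 1%:M) (zz : z *m z = 1%:M).
Hypotheses (axy : anticomm x y) (axz : anticomm x z) (ayz : anticomm y z).
Hypotheses (xa : x^t* = x) (ya : y^t* = y) (za : z^t* = z).

(** The Pauli matrices are replaced by variables, so that only their relations enter. *)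
Definition gamma_list : seq 'M[C]_8 :=
  [:: tens8 x 1%:M 1%:M; tens8 y 1%:M 1%:M; tens8 z x 1%:M; tens8 z y 1%:M;
      tens8 z z x; tens8 z z y; tens8 z z z].

Let x1 : comm_mx x 1%:M. Proof. exact: comm_mx1. Qed.
Let y1 : comm_mx y 1%:M. Proof. exact: comm_mx1. Qed.
Let z1 : comm_mx z 1%:M. Proof. exact: comm_mx1. Qed.
Let i1 : comm_mx (1%:M : 'M[C]_2) 1%:M. Proof. exact: comm_mx1. Qed.
Let zz' : comm_mx z z. Proof. by []. Qed.
Let ix : comm_mx 1%:M x. Proof. exact: comm1mx. Qed.
Let iy : comm_mx 1%:M y. Proof. exact: comm1mx. Qed.
Let iz : comm_mx 1%:M z. Proof. exact: comm1mx. Qed.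
Let ii : (1%:M : 'M[C]_2) *m 1%:M = 1%:M. Proof. exact: mulmx1. Qed.

Ltac comm_tac := first [exact x1 | exact y1 | exact z1 | exact i1 | exact zz' | exact ix | exact iy | exact iz].
Ltac anti_tac := first [exact axy | exact axz | exact ayz].
Ltac anti8 := first [refine (tens8_anti1 _ _ _); [anti_tac | comm_tac | comm_tac]
  | refine (tens8_anti2 _ _ _); [comm_tac | anti_tac | comm_tac]
  | refine (tens8_anti3 _ _ _); [comm_tac | comm_tac | anti_tac]].

Lemma gamma_list_anticomm (i j : nat) : (i < j < 7)%N -> anticomm gamma_list`_i gamma_list`_j.
Proof.
case/andP => ij j7.
by case: j ij j7 => [|[|[|[|[|[|[|j]]]]]]] // ij _; case: i ij => [|[|[|[|[|[|i]]]]]] // _; anti8.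
Qed.

Lemma gamma_list_sq (j : nat) : (j < 7)%N -> gamma_list`_j *m gamma_list`_j = 1%:M.
Proof.
by case: j => [|[|[|[|[|[|[|j]]]]]]] // _;
  refine (tens8_sq _ _ _); first [exact xx | exact yy | exact zz | exact ii].
Qed.

Lemma gamma_list_adj (j : nat) : (j < 7)%N -> (gamma_list`_j)^t* = gamma_list`_j.
Proof.
have ia : (1%:M : 'M[C]_2)^t* = 1%:M by rewrite trmx1 map_mx1.
by case: j => [|[|[|[|[|[|[|j]]]]]]] // _; rewrite /= tens8_adj ?xa ?ya ?za ?ia.
Qed.
End GammaList.

(** * Clifford relations and the vector representation *)

Section Clifford.
Variable R : realType.
Local Notation C := R[i].

Lemma gammaE (j : nat) : gamma R j = (gamma_list (sigmax R) (sigmay R) (sigmaz R))`_j.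
Proof. by []. Qed.

Let axy : anticomm (sigmax R) (sigmay R). Proof. exact: xy. Qed.
Let axz : anticomm (sigmax R) (sigmaz R). Proof. by rewrite /anticomm zx opprK. Qed.
Let ayz : anticomm (sigmay R) (sigmaz R). Proof. by apply: anticomm_sym; exact: yz. Qed.

Lemma gamma_anticomm (i j : nat) : (i < j < 7)%N -> anticomm (gamma R i) (gamma R j).
Proof. rewrite !gammaE; exact: (gamma_list_anticomm axy axz ayz). Qed.

Lemma gamma_sq (j : nat) : (j < 7)%N -> gamma R j *m gamma R j = 1%:M.
Proof. rewrite !gammaE; exact: (gamma_list_sq (xx R) (yy R) (zz R)). Qed.

Lemma gamma_adj (j : nat) : (j < 7)%N -> (gamma R j)^t* = gamma R j.
Proof. rewrite !gammaE; exact: (gamma_list_adj (x_adj R) (y_adj R) (z_adj R)). Qed.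

Lemma gamma_anti (i j : 'I_7) : gamma R i *m gamma R j + gamma R j *m gamma R i = (2 *+ (i == j))%:M.
Proof.
have [->|ij] := eqVneq i j; first by rewrite gamma_sq // mulr1n -raddfD.
rewrite mulr0n; have [lt|le] := ltnP i j.
  by rewrite gamma_anticomm ?lt ?ltn_ord // addNr raddf0.
rewrite [X in _ + X]gamma_anticomm ?ltn_ord ?andbT ?subrr ?raddf0 //.
by rewrite ltn_neqAle le eq_sym andbT.
Qed.

Implicit Types (u w : 'rV[C]_7) (c : C).

Definition dot u w : C := (u *m w^T) 0 0.

Lemma dotE u w : dot u w = \sum_j u 0 j * w 0 j.
Proof. by rewrite /dot mxE; apply: eq_bigr => j _; rewrite mxE. Qed.

Lemma dot_sq u : dot u u = \sum_(j < 7) u 0 j ^+ 2.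
Proof. by rewrite dotE; apply: eq_bigr => j _; rewrite expr2. Qed.

Lemma cliffordD u w : clifford (u + w) = clifford u + clifford w.
Proof. by rewrite /clifford -big_split /=; apply: eq_bigr => j _; rewrite mxE scalerDl. Qed.

Lemma cliffordZ c u : clifford (c *: u) = c *: clifford u.
Proof. by rewrite /clifford scaler_sumr; apply: eq_bigr => j _; rewrite mxE scalerA. Qed.

Lemma cliffordN u : clifford (- u) = - clifford u.
Proof. by rewrite -scaleN1r cliffordZ scaleN1r. Qed.

Lemma clifford_delta (j : 'I_7) : clifford (delta_mx 0 j) = gamma R j.
Proof.
rewrite /clifford (bigD1 j) //= big1 ?addr0 ?mxE ?eqxx ?scale1r // => k kj.
by rewrite mxE (negbTE kj) andbF scale0r.
Qed.

Lemma clifford_mul u w : clifford u *m clifford w + clifford w *m clifford u = (dot u w *+ 2)%:M.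
Proof.
have e (a b : 'rV[C]_7) : clifford a *m clifford b =
    \sum_i \sum_j (a 0 i * b 0 j) *: (gamma R i *m gamma R j).
  rewrite /clifford mulmx_suml; apply: eq_bigr => i _; rewrite mulmx_sumr; apply: eq_bigr => j _.
  by rewrite -scalemxAl -scalemxAr scalerA.
rewrite (e u) (e w) [X in _ + X]exchange_big -big_split /= dotE -sumrMnl raddf_sum; apply: eq_bigr => i _.
rewrite -big_split /= (bigD1 i) //= big1 ?addr0 => [|j ji].
  by rewrite [w 0 i * _]mulrC -scalerDr gamma_anti eqxx mulr1n scale_scalar_mx mulr_natr.
by rewrite [w 0 j * _]mulrC -scalerDr gamma_anti eq_sym (negbTE ji) mulr0n raddf0 scaler0.
Qed.

Lemma clifford_sq w : dot w w = 1 -> clifford w *m clifford w = 1%:M.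
Proof.
move=> w1; have := clifford_mul w w; rewrite w1 -mulr2n -scaler_nat => h.
have two : (2 : C) != 0 by rewrite pnatr_eq0.
apply: (scalerI two); rewrite h; rewrite scale_scalar_mx mulr1 //.
Qed.

Lemma clifford_eq0 u : clifford u = 0 -> u = 0.
Proof.
move=> u0; apply/rowP => j; have := clifford_mul u (delta_mx 0 j).
rewrite u0 mul0mx mulmx0 addr0 dotE (bigD1 j) //= big1 => [|k kj]; last first.
  by rewrite mxE (negbTE kj) andbF mulr0.
rewrite mxE !eqxx mulr1 addr0 => /matrixP/(_ 0 0).
by rewrite !mxE eqxx mulr1n -mulr_natr => /esym/eqP; rewrite mulf_eq0 pnatr_eq0 orbF => /eqP.
Qed.

Lemma clifford_inj u w : clifford u = clifford w -> u = w.
Proof.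
by move=> h; apply/eqP; rewrite -subr_eq0; apply/eqP/clifford_eq0; rewrite cliffordD cliffordN h subrr.
Qed.

Lemma clifford_adj w : (clifford w)^t* = clifford (map_mx Num.conj w).
Proof.
rewrite /clifford raddf_sum raddf_sum; apply: eq_bigr => j _.
rewrite -[LHS]/((w 0 j *: gamma R j)^t*) linearZ /= map_mxZ gamma_adj // mxE //.
Qed.

Lemma clifford_mulmx m (u : 'rV[C]_m) (P : 'M[C]_(m, 7)) :
  clifford (u *m P) = \sum_a u 0 a *: clifford (row a P).
Proof.
rewrite mulmx_sum_row; apply: (big_ind2 (fun a b => clifford a = b)) => [|a b c d <- <-|i _].
- by rewrite -(scale0r 0) cliffordZ scale0r.
- by rewrite cliffordD.
by rewrite cliffordZ.
Qed.

End Clifford.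

Section VectorAction.
Variable R : realType.
Local Notation C := R[i].
Implicit Types (u w : 'rV[C]_7) (g h : 'M[C]_8) (r s : 'M[C]_7) (l : seq 'rV[C]_7).

(** The vector representation g c(u) g^(-1) = c(u r^T), written without inverses. *)
Definition acts g r := forall u, g *m clifford u = clifford (u *m r^T) *m g.

Definition mirror w : 'M[C]_7 := 1%:M - (w^T *m w) *+ 2.

Lemma acts1 : acts 1%:M 1%:M.
Proof. by move=> u; rewrite trmx1 !mulmx1 mul1mx. Qed.

Lemma acts_mul g h r s : acts g r -> acts h s -> acts (g *m h) (r *m s).
Proof. by move=> hg hh u; rewrite -mulmxA hh mulmxA hg trmx_mul !mulmxA. Qed.

Lemma acts_unique r : acts 1%:M r -> r = 1%:M.
Proof.
move=> h; apply: trmx_inj; rewrite trmx1; apply/row_matrixP => j; rewrite !rowE mulmx1.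
by apply: clifford_inj; have := h (delta_mx 0 j); rewrite mul1mx mulmx1.
Qed.

Lemma mul_mirror u w : u *m mirror w = u - (dot u w *+ 2) *: w.
Proof.
rewrite mulmxBr mulmx1 -[_ *+ 2]scaler_nat -scalemxAr mulmxA [u *m w^T]mx11_scalar mul_scalar_mx.
by rewrite scalerA mulr_natl.
Qed.

Lemma mirror_sym w : (mirror w)^T = mirror w.
Proof. by rewrite /mirror raddfB raddfMn /= trmx1 trmx_mul trmxK. Qed.

Lemma dotC u w : dot u w = dot w u.
Proof. by rewrite !dotE; apply: eq_bigr => j _; rewrite mulrC. Qed.

Lemma dotZr c u w : dot u (c *: w) = c * dot u w.
Proof. by rewrite !dotE mulr_sumr; apply: eq_bigr => j _; rewrite mxE mulrCA. Qed.

Lemma dotZl c u w : dot (c *: u) w = c * dot u w.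
Proof. by rewrite dotC dotZr dotC. Qed.

Lemma dotBl u1 u2 w : dot (u1 - u2) w = dot u1 w - dot u2 w.
Proof. by rewrite /dot mulmxBl !mxE. Qed.

Lemma dotBr u w1 w2 : dot u (w1 - w2) = dot u w1 - dot u w2.
Proof. by rewrite dotC dotBl !(dotC _ u). Qed.

Lemma mirrorK w : dot w w = 1 -> mirror w *m mirror w = 1%:M.
Proof.
move=> w1; apply/row_matrixP => j; rewrite rowE mulmxA rowE mulmx1; move: (delta_mx 0 j) => u.
rewrite !mul_mirror dotBl dotZl w1 mulr1; apply/rowP => k; rewrite !mxE; ring.
Qed.

Lemma mirror_orth w : dot w w = 1 -> mirror w *m (mirror w)^T = 1%:M.
Proof. by rewrite mirror_sym; exact: mirrorK. Qed.

(** The Clifford relation gives w u w = 2 (u, w) w - u, the opposite of the reflection of u. *)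
Lemma acts_clifford w : dot w w = 1 -> acts (clifford w) (- mirror w).
Proof.
move=> w1 u; rewrite linearN /= mirror_sym mulmxN mul_mirror opprB cliffordD cliffordN cliffordZ.
rewrite mulmxDl mulNmx -scalemxAl clifford_sq // scale_scalar_mx mulr1 -clifford_mul.
by rewrite [X in X - _]addrC addrK.
Qed.

Lemma acts_prod l : (forall w, w \in l -> dot w w = 1) ->
  acts (\prod_(w <- l) clifford w) (\prod_(w <- l) - mirror w).
Proof.
elim: l => [|w l IH] hl; first by rewrite !big_nil; exact: acts1.
rewrite !big_cons; apply: acts_mul; last by apply: IH => v vl; apply: hl; rewrite in_cons vl orbT.
by apply/acts_clifford/hl; rewrite mem_head.
Qed.

Lemma prod_mirror_orth l : (forall w, w \in l -> dot w w = 1) ->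
  (\prod_(w <- l) - mirror w) *m (\prod_(w <- l) - mirror w)^T = 1%:M.
Proof.
elim: l => [|w l IH] hl; first by rewrite !big_nil trmx1 mulmx1.
rewrite !big_cons; have e : dot w w = 1 by apply: hl; rewrite mem_head.
have {}IH : (\prod_(j <- l) - mirror j) *m (\prod_(j <- l) - mirror j)^T = 1%:M.
  by apply: IH => v vl; apply: hl; rewrite in_cons vl orbT.
move: IH; move: (\prod_(j <- l) _) => M IH; rewrite -[_ * M]/(_ *m M) trmx_mul.
by rewrite mulmxA -(mulmxA _ M) IH mulmx1 linearN /= mulNmx mulmxN opprK mirror_orth.
Qed.

(** The gamma matrices are Hermitian, so taking adjoints conjugates the vector; comparing both
    expressions for g c(u) g^* shows that [r] is real. *)
Lemma acts_real g r : g \is unitarymx -> r *m r^T = 1%:M -> acts g r -> map_mx Num.conj r = r.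
Proof.
move=> ug rr hg; have g1 : g *m g^t* = 1%:M by apply/unitarymxP.
have e u : g *m clifford u *m g^t* = clifford (u *m r^T) by rewrite hg -mulmxA g1 mulmx1.
have cc (a : 'rV[C]_7) : map_mx Num.conj (map_mx Num.conj a) = a.
  by apply/rowP => j; rewrite !mxE conjCK.
have e' u : g *m clifford u *m g^t* = clifford (u *m (map_mx Num.conj r)^T).
  have := congr1 (fun M : 'M[C]_8 => M^t*) (e (map_mx Num.conj u)).
  by rewrite /= !adjM trmxCK !clifford_adj cc map_mxM cc mulmxA map_trmx.
apply: trmx_inj; apply/row_matrixP => j; rewrite !rowE; apply: clifford_inj.
by rewrite -e' e.
Qed.

Lemma acts_unitary g r : g \is unitarymx -> r *m r^T = 1%:M -> acts g r -> r \is unitarymx.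
Proof.
move=> ug rr hg; apply/unitarymxP.
by rewrite -[r^t*]map_trmx (acts_real ug rr hg).
Qed.

Lemma Spin7_seq l : ~~ odd (size l) -> (forall w, w \in l -> dot w w = 1) ->
  Spin7 (\prod_(w <- l) clifford w).
Proof. by move=> ol hl; exists l; split=> // w wl; rewrite -dot_sq hl. Qed.

Lemma Spin7P g : Spin7 g -> exists l,
  [/\ ~~ odd (size l), forall w, w \in l -> dot w w = 1 & g = \prod_(w <- l) clifford w].
Proof. by move=> [l [ol hl ->]]; exists l; split=> // w wl; rewrite dot_sq hl. Qed.

Lemma Spin7_acts g : Spin7 g -> exists2 r, r *m r^T = 1%:M & acts g r.
Proof.
move=> /Spin7P[l [_ hl ->]]; exists (\prod_(w <- l) - mirror w); first exact: prod_mirror_orth.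
exact: acts_prod.
Qed.

Lemma Spin7_1 : Spin7 (1%:M : 'M[C]_8).
Proof. by have := @Spin7_seq [::] isT; rewrite big_nil; apply. Qed.

Lemma Spin7M g h : Spin7 g -> Spin7 h -> Spin7 (g *m h).
Proof.
move=> /Spin7P[l [ol hl ->]] /Spin7P[l' [ol' hl' ->]].
rewrite -[_ *m _]/(_ * _) -big_cat; apply: Spin7_seq => [|w].
  by rewrite size_cat oddD (negbTE ol) (negbTE ol').
by rewrite mem_cat => /orP[/hl|/hl'].
Qed.

Lemma clifford_prod_rev l : (forall w, w \in l -> dot w w = 1) ->
  \prod_(w <- l) clifford w *m \prod_(w <- rev l) clifford w = 1%:M.
Proof.
elim: l => [|w l IH] hl; first by rewrite !big_nil mulmx1.
rewrite rev_cons -cats1 big_cat big_seq1 big_cons.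
have e : clifford w *m clifford w = 1%:M by apply: clifford_sq; apply: hl; rewrite mem_head.
have {}IH : \prod_(j <- l) clifford j *m \prod_(j <- rev l) clifford j = 1%:M.
  by apply: IH => v vl; apply: hl; rewrite in_cons vl orbT.
move: IH; move: (\prod_(j <- l) _) (\prod_(j <- rev l) _) (clifford w) e => M N c e IH.
by rewrite -[LHS]/((c *m M) *m (N *m c)) mulmxA -(mulmxA c M) IH mulmx1.
Qed.

Lemma Spin7U g : Spin7 g -> g \in unitmx.
Proof. by move=> /Spin7P[l [_ hl ->]]; have [] := mulmx1_unit (clifford_prod_rev hl). Qed.

Lemma Spin7V g : Spin7 g -> Spin7 (invmx g).
Proof.
move=> sg; have ug := Spin7U sg; case/Spin7P: sg ug => l [ol hl ->] ug.
rewrite (_ : invmx _ = \prod_(w <- rev l) clifford w).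
  by apply: Spin7_seq => [|w]; rewrite ?size_rev // mem_rev; exact: hl.
by apply: (can_inj (mulKmx ug)); rewrite mulmxV // clifford_prod_rev.
Qed.

(** This pins down the modulus of the scalars in the group. *)
Lemma Spin7_det g : Spin7 g -> `|\det g| = 1.
Proof.
move=> /Spin7P[l [_ hl ->]]; elim: l hl => [|w l IH] hl; first by rewrite big_nil det1 normr1.
rewrite big_cons -[_ * _]/(_ *m _) det_mulmx normrM IH; last by move=> v vl; apply: hl; rewrite in_cons vl orbT.
have := congr1 (fun M : 'M[C]_8 => `|\det M|) (clifford_sq (hl w (mem_head w l))).
rewrite /= det_mulmx normrM det1 normr1 mulr1 -expr2 => /eqP; rewrite sqrf_eq1 => /orP[/eqP //|/eqP h].
by have := normr_ge0 (\det (clifford w)); rewrite h ler0N1.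
Qed.
End VectorAction.

Section Schur.
Variables (K : numClosedFieldType).

Definition bit1 (k : 'I_(2 * 2 * 2)) : 'I_2 := (mxtens_unindex (mxtens_unindex k).1).1.
Definition bit2 (k : 'I_(2 * 2 * 2)) : 'I_2 := (mxtens_unindex (mxtens_unindex k).1).2.
Definition bit3 (k : 'I_(2 * 2 * 2)) : 'I_2 := (mxtens_unindex k).2.

Lemma bits_eq k k' : (k == k') = [&& bit1 k == bit1 k', bit2 k == bit2 k' & bit3 k == bit3 k'].
Proof. by rewrite unindex_eq unindex_eq -andbA. Qed.

Lemma tens8_diag (a b c : 'rV[K]_2) : tens8 (diag_mx a) (diag_mx b) (diag_mx c) =
  diag_mx (\row_(k < 8) (a 0 (bit1 k) * b 0 (bit2 k) * c 0 (bit3 k))).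
Proof.
rewrite /tens8 (tens_diag a b).
refine (etrans (tens_diag (\row_k (a 0 (mxtens_unindex k).1 * b 0 (mxtens_unindex k).2)) c) _).
by congr diag_mx; apply/rowP => k; rewrite !mxE.
Qed.

Lemma tens8_const : tens8 (const_mx 1) (const_mx 1) (const_mx 1) = const_mx 1 :> 'M[K]_8.
Proof. by apply/matrixP => i j; rewrite !mxE !mulr1. Qed.

Lemma tens8_zprod (z : 'M[K]_2) c : z *m z = 1%:M ->
  (c *: tens8 z 1%:M 1%:M) *m (c *: tens8 1%:M z 1%:M) *m (c *: tens8 1%:M 1%:M z) *m tens8 z z z =
  (c * c * c)%:M.
Proof.
move=> zz; rewrite -!(scalemxAr, scalemxAl) !tens8_mul !mulmx1 !mul1mx zz tens8_1 !scalerA.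
by rewrite scale_scalar_mx mulr1.
Qed.

Let zr : 'rV[K]_2 := \row_j (-1) ^+ j.

Lemma comm_diag_entry (L : 'M[K]_8) d (i j : 'I_8) : comm_mx L (diag_mx d) -> L i j != 0 -> d 0 i = d 0 j.
Proof.
rewrite /comm_mx mul_mx_diag mul_diag_mx => /matrixP/(_ i j); rewrite !mxE mulrC => h n0.
by apply/esym/(mulIf n0).
Qed.

(** The signs of the three [z] separate the eight basis vectors, so commuting with them forces a
    diagonal matrix. The matrix of all ones, a product of factors 1 + x, then makes the diagonal
    constant. *)
Lemma comm_scalar (L : 'M[K]_8) (x z : 'M[K]_2) : z = diag_mx zr -> 1%:M + x = const_mx 1 ->
  comm_mx L (tens8 z 1%:M 1%:M) -> comm_mx L (tens8 1%:M z 1%:M) -> comm_mx L (tens8 1%:M 1%:M z) ->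
  comm_mx L (tens8 x 1%:M 1%:M) -> comm_mx L (tens8 1%:M x 1%:M) -> comm_mx L (tens8 1%:M 1%:M x) ->
  exists c, L = c%:M.
Proof.
move=> zE xE z1 z2 z3 x1 x2 x3.
have id_diag : (1%:M : 'M[K]_2) = diag_mx (const_mx 1) by rewrite diag_const_mx.
have zinj (i j : 'I_2) : zr 0 i = zr 0 j -> i = j.
  have two : (-1 : K) <> 1.
    move=> h; have /eqP : (1 : K) + 1 = 0 by rewrite -{1}h addNr.
    by rewrite -mulr2n pnatr_eq0.
  case: i j => [[|[|?]] ?] [[|[|?]] ?] //; rewrite !mxE /= ?expr0 ?expr1 => h; try exact/val_inj.
  by case: (two (esym h)).
have dg : L = diag_mx (\row_i L i i).
  apply/matrixP => i j; rewrite [RHS]mxE [X in X *+ _]mxE; have [<- //|ij] := eqVneq i j.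
  rewrite mulr0n; apply: contraNeq ij => n0; rewrite (bits_eq i j); move: z1 z2 z3.
  rewrite zE id_diag !tens8_diag => /comm_diag_entry/(_ n0) h1 /comm_diag_entry/(_ n0) h2.
  move=> /comm_diag_entry/(_ n0) h3; have re (f : 'I_8 -> K) k : (\row_k f k) 0 k = f k by rewrite mxE.
  have ce (k : 'I_2) : (const_mx 1 : 'rV[K]_2) 0 k = 1 by rewrite mxE.
  move: h1 h2 h3; rewrite !re !ce.
  by rewrite !mulr1 !mul1r => /zinj -> /zinj -> /zinj ->; rewrite !eqxx.
have ones : comm_mx L (const_mx 1).
  have t1 (A B D : 'M[K]_2) : tens8 (A + x) B D = tens8 A B D + tens8 x B D.
    by rewrite /tens8 (tensDl A x B); exact (tensDl (A *t B) (x *t B) D).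
  have t2 (A B D : 'M[K]_2) : tens8 A (B + x) D = tens8 A B D + tens8 A x D.
    by rewrite /tens8 (tensDr A B x); exact (tensDl (A *t B) (A *t x) D).
  have t3 (A B D : 'M[K]_2) : tens8 A B (D + x) = tens8 A B D + tens8 A B x.
    exact (tensDr (A *t B) D x).
  have c1 : comm_mx L (tens8 1%:M 1%:M 1%:M) by rewrite tens8_1; exact: comm_mx1.
  have -> : const_mx 1 = tens8 (1%:M + x) 1%:M 1%:M *m tens8 1%:M (1%:M + x) 1%:M *m tens8 1%:M 1%:M (1%:M + x) :> 'M[K]_8.
    by rewrite !tens8_mul !mulmx1 !mul1mx xE tens8_const.
  by rewrite t1 t2 t3; apply: comm_mxM; [apply: comm_mxM|]; apply: comm_mxD.
move: dg ones; move: (\row_i L i i) => d -> ones; exists (d 0 0); apply/matrixP => i j.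
rewrite mxE [RHS]mxE; congr (_ *+ _).
move: ones; rewrite /comm_mx mul_mx_diag mul_diag_mx => /matrixP/(_ 0 i).
by rewrite mxE [RHS]mxE [const_mx _ _ _]mxE mulr1 mul1r.
Qed.
End Schur.

Section CliffordCenter.
Variable R : realType.
Local Notation C := R[i].
Local Notation x := (sigmax R).
Local Notation y := (sigmay R).
Local Notation z := (sigmaz R).
Local Notation ii := (0 +i* 1 : C)%C.

Lemma sigma_xy : x *m y = ii *: z.
Proof. by rewrite yE -scalemxAr mulmxA xx mul1mx. Qed.

Lemma gamma01 : gamma R 0 *m gamma R 1 = ii *: tens8 z 1%:M 1%:M.
Proof. by rewrite !gammaE /= tens8_mul sigma_xy !mulmx1 tens8Z1. Qed.

Lemma gamma23 : gamma R 2 *m gamma R 3 = ii *: tens8 1%:M z 1%:M.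
Proof. by rewrite !gammaE /= tens8_mul sigma_xy zz !mulmx1 tens8Z2. Qed.

Lemma gamma45 : gamma R 4 *m gamma R 5 = ii *: tens8 1%:M 1%:M z.
Proof. by rewrite !gammaE /= tens8_mul sigma_xy zz tens8Z3. Qed.

Lemma ii_neq0 : ii != 0.
Proof. by rewrite eq_complex /= negb_and oner_eq0 orbT. Qed.

Lemma comm_mxZ_inv n (c : C) (A B : 'M[C]_n) : c != 0 -> comm_mx A (c *: B) -> comm_mx A B.
Proof. by move=> c0; rewrite /comm_mx -scalemxAr -scalemxAl => /(scalerI c0). Qed.

Lemma gamma_prod : \prod_(j < 7) gamma R j = (- ii)%:M.
Proof.
rewrite !big_ord_recl big_ord0 /= /bump /= !addn0 !add1n mulr1.
have E (a b c d e f g : 'M[C]_8) : a * (b * (c * (d * (e * (f * g))))) =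
  (a *m b) *m (c *m d) *m (e *m f) *m g by rewrite !mulmxE !mulrA.
rewrite E gamma01 gamma23 gamma45 (gammaE R 6) (tens8_zprod _ (zz R)).
by rewrite ii2 mulN1r.
Qed.

Lemma gamma_center (L : 'M[C]_8) : (forall j, (j < 7)%N -> comm_mx L (gamma R j)) -> exists c, L = c%:M.
Proof.
move=> h.
have z1 : comm_mx L (tens8 z 1%:M 1%:M).
  by apply: (comm_mxZ_inv ii_neq0); rewrite -gamma01; apply: comm_mxM; exact: h.
have z2 : comm_mx L (tens8 1%:M z 1%:M).
  by apply: (comm_mxZ_inv ii_neq0); rewrite -gamma23; apply: comm_mxM; exact: h.
have z3 : comm_mx L (tens8 1%:M 1%:M z).
  by apply: (comm_mxZ_inv ii_neq0); rewrite -gamma45; apply: comm_mxM; exact: h.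
have x1 : comm_mx L (tens8 x 1%:M 1%:M) by exact: (h 0%N).
have x2 : comm_mx L (tens8 1%:M x 1%:M).
  have <- : tens8 z 1%:M 1%:M *m gamma R 2 = tens8 1%:M x 1%:M.
    by rewrite gammaE /= tens8_mul zz !mulmx1 mul1mx.
  exact (comm_mxM z1 (h 2 isT)).
have x3 : comm_mx L (tens8 1%:M 1%:M x).
  have <- : tens8 z 1%:M 1%:M *m (tens8 1%:M z 1%:M *m gamma R 4) = tens8 1%:M 1%:M x.
    by rewrite gammaE /= !tens8_mul zz !mul1mx zz.
  exact (comm_mxM z1 (comm_mxM z2 (h 4 isT))).
apply: (comm_scalar (z_diag R) _ z1 z2 z3 x1 x2 x3).
apply/matrixP => i j; rewrite !mxE; case: eqP => _; by rewrite ?addr0 ?add0r.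
Qed.
End CliffordCenter.

(** * Lifting real orthogonal matrices to the spin group *)

Section Lift.
Variable R : realType.
Local Notation C := R[i].
Implicit Types (a b u w : 'rV[C]_7) (r : 'M[C]_7) (l : seq 'rV[C]_7).

Definition realmx m n (A : 'M[C]_(m, n)) := map_mx Num.conj A = A.

Lemma realmx_entry m n (A : 'M[C]_(m, n)) i j : realmx A -> (A i j)^* = A i j.
Proof. by move=> /matrixP/(_ i j); rewrite mxE. Qed.

Lemma dot_ge0 u : realmx u -> 0 <= dot u u.
Proof.
move=> hu; rewrite dotE; apply: sumr_ge0 => j _.
by rewrite -{2}(realmx_entry 0 j hu) mul_conjC_ge0.
Qed.

Lemma dot_eq0 u : realmx u -> dot u u = 0 -> u = 0.
Proof.
move=> hu; have e j : u 0 j * u 0 j = u 0 j * (u 0 j)^*.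
  by rewrite realmx_entry.
rewrite dotE => /psumr_eq0P h; apply/rowP => j; rewrite mxE; apply/eqP.
rewrite -mul_conjC_eq0 -e; apply/eqP; apply: h => // k _; rewrite e; exact: mul_conjC_ge0.
Qed.

(** The mirror is the one orthogonal to a - b. *)
Lemma mirror_swap a b : realmx a -> realmx b -> dot a a = 1 -> dot b b = 1 -> b != a ->
  exists w, [/\ realmx w, dot w w = 1, b *m mirror w = a &
    forall u, dot u a = 0 -> dot u b = 0 -> u *m mirror w = u].
Proof.
move=> ra rb a1 b1 ba; set d := a - b.
have rd : realmx d by rewrite /realmx /d map_mxB ra rb.
have N0 : dot d d != 0.
  by apply: contraNneq ba => /(dot_eq0 rd)/eqP; rewrite subr_eq0 eq_sym.
have cn0 : sqrtC (dot d d) != 0 by rewrite sqrtC_eq0.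
have cc : sqrtC (dot d d) * sqrtC (dot d d) = dot d d by rewrite -expr2 sqrtCK.
have cr : (sqrtC (dot d d))^* = sqrtC (dot d d) by rewrite geC0_conj // sqrtC_ge0 dot_ge0.
have dd : dot d d = - (dot b d *+ 2).
  rewrite /d dotBl !dotBr (dotC a b) a1 b1; ring.
move: (sqrtC _) cn0 cc cr => c cn0 cc cr; exists (c^-1 *: d); split.
- by rewrite /realmx map_mxZ rd; congr (_ *: _); rewrite fmorphV; exact: (congr1 GRing.inv cr).
- rewrite dotZl dotZr -cc; by field.
- rewrite mul_mirror dotZr scalerA.
  have -> : c^-1 * dot b d *+ 2 * c^-1 = -1.
    have e : dot b d *+ 2 = - (c * c) by rewrite cc dd opprK.
    by rewrite -mulrnAr e; field.
  by rewrite scaleN1r opprK /d addrCA subrr addr0.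
move=> u ua ub; rewrite mul_mirror dotZr dotBr ua ub subrr mulr0 mul0rn scale0r subr0 //.
Qed.

Lemma row_dot r i j : r *m r^T = 1%:M -> dot (row i r) (row j r) = (i == j)%:R.
Proof.
move=> rr; have := congr1 (fun M : 'M[C]_7 => M i j) rr; rewrite /= [in RHS]mxE => <-.
by rewrite dotE mxE; apply: eq_bigr => k _; rewrite !mxE.
Qed.

Lemma delta_real (j : 'I_7) : realmx (delta_mx 0 j : 'rV[C]_7).
Proof. by apply/rowP => k; rewrite !mxE rmorph_nat. Qed.

Lemma dot_delta (j k : 'I_7) : dot (delta_mx 0 j) (delta_mx 0 k) = (j == k)%:R :> C.
Proof.
by rewrite -[delta_mx 0 j]mulmx1 -[delta_mx 0 k]mulmx1 -!rowE row_dot // trmx1 mulmx1.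
Qed.

(* Cartan-Dieudonne over the reals: the rows are put in place one after the
   other. *)
Lemma orth_mirrors n r : (n <= 7)%N -> realmx r -> r *m r^T = 1%:M ->
  (forall j : 'I_7, (j < 7 - n)%N -> row j r = delta_mx 0 j) ->
  exists l, [/\ forall w, w \in l -> dot w w = 1, forall w, w \in l -> realmx w &
    r = \prod_(w <- l) mirror w].
Proof.
elim: n r => [|n IH] r n7 realr rr fix_r.
  exists [::]; split=> //; rewrite big_nil; apply/row_matrixP => j.
  by rewrite [RHS]rowE mulmx1 fix_r // subn0.
have kP : (7 - n.+1 < 7)%N by rewrite ltn_subrL.
have kS : (7 - n = (7 - n.+1).+1)%N by rewrite -subSn // subSS.
set k := Ordinal kP; have [kk|kk] := eqVneq (row k r) (delta_mx 0 k).
  apply: (IH r (ltnW n7) realr rr) => j; rewrite kS ltnS leq_eqVlt => /orP[/eqP jk|]; last exact: fix_r.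
  by rewrite (_ : j = k) //; apply: val_inj.
have rk : realmx (row k r) by rewrite /realmx map_row realr.
have k1 : dot (row k r) (row k r) = 1 by rewrite row_dot // eqxx.
have d1 : dot (delta_mx 0 k) (delta_mx 0 k) = 1 :> C by rewrite dot_delta eqxx.
have [w [rw w1 wk wfix]] := mirror_swap (delta_real k) rk d1 k1 kk.
have [|||l [l1 lr E]] := IH (r *m mirror w) (ltnW n7).
- rewrite /realmx map_mxM realr; congr (_ *m _).
  by rewrite /mirror map_mxB map_mx1 raddfMn /= map_mxM -map_trmx rw.
- by rewrite trmx_mul mulmxA -(mulmxA r) mirror_orth // mulmx1.
- move=> j; rewrite kS ltnS row_mul leq_eqVlt => /orP[/eqP jk|jk].
    by rewrite (_ : j = k) //; apply: val_inj.
  have jnk : j != k by apply: contraTneq jk => ->; rewrite ltnn.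
  have fj := fix_r j jk; transitivity (row j r); last exact fj.
  apply: wfix; first by rewrite fj dot_delta (negbTE jnk).
  by rewrite row_dot // (negbTE jnk).
exists (rcons l w); split.
- by move=> v; rewrite mem_rcons in_cons => /orP[/eqP ->|/l1].
- by move=> v; rewrite mem_rcons in_cons => /orP[/eqP ->|/lr].
rewrite big_rcons /= -E -[LHS]mulmx1 -(mirrorK w1) mulmxA //.
Qed.

Lemma clifford_unitary w : realmx w -> dot w w = 1 -> clifford w \is unitarymx.
Proof. by move=> rw w1; apply/unitarymxP; rewrite clifford_adj rw clifford_sq. Qed.

Lemma clifford_prod_unitary l : (forall w, w \in l -> dot w w = 1) -> (forall w, w \in l -> realmx w) ->
  \prod_(w <- l) clifford w \is unitarymx.
Proof.
move=> l1 lr; rewrite big_seq; apply: (big_ind (fun g : 'M[C]_8 => g \is unitarymx)).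
- by apply/unitarymxP; rewrite trmx1 map_mx1 mulmx1.
- by move=> g h; exact: mul_unitarymx.
by move=> w wl; apply: clifford_unitary; [exact: lr | exact: l1].
Qed.

Lemma prod_mirrorN l : \prod_(w <- l) - mirror w = (-1) ^+ size l *: \prod_(w <- l) mirror w :> 'M[C]_7.
Proof.
elim: l => [|w l IH]; first by rewrite !big_nil scale1r.
by rewrite !big_cons IH exprS mulN1r mulNr -scalerAr scaleNr.
Qed.

(* A product of an odd number of vectors is completed to an even one by
   gamma_0 ... gamma_6, which is a scalar. *)
Lemma Spin7_lift r : realmx r -> r *m r^T = 1%:M ->
  exists g (e : bool), [/\ Spin7 g, g \is unitarymx & acts g ((-1) ^+ e *: r)].
Proof.
move=> rr r1; have [//|l [l1 lr E]] := orth_mirrors (leqnn 7) rr r1.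
have hl := acts_prod l1; rewrite prod_mirrorN -E -signr_odd in hl.
have ul := clifford_prod_unitary l1 lr; have [ol|ol] := boolP (odd (size l)); last first.
  exists (\prod_(w <- l) clifford w), false.
  by rewrite (negbTE ol) in hl; split; [exact: Spin7_seq ol l1 | exact ul | exact hl].
set l0 : seq 'rV[C]_7 := [seq delta_mx 0 j | j <- index_enum 'I_7].
have l01 w : w \in l0 -> dot w w = 1 by move=> /mapP[j _ ->]; rewrite dot_delta eqxx.
have l0r w : w \in l0 -> realmx w by move=> /mapP[j _ ->]; exact: delta_real.
have l0E : \prod_(w <- l0) clifford w = (- (0 +i* 1)%C)%:M :> 'M[C]_8.
  by rewrite -gamma_prod /l0 big_map; apply: eq_bigr => j _; rewrite clifford_delta.
have o0 : odd (size l0) by rewrite size_map [index_enum _]unlock -enumT size_enum_ord.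
have ll1 w : w \in l ++ l0 -> dot w w = 1 by rewrite mem_cat => /orP[/l1|/l01].
have llr w : w \in l ++ l0 -> realmx w by rewrite mem_cat => /orP[/lr|/l0r].
exists (\prod_(w <- l ++ l0) clifford w), true; split.
- by apply: (Spin7_seq _ ll1); rewrite size_cat oddD ol o0.
- exact (clifford_prod_unitary ll1 llr).
move: hl; rewrite ol big_cat /= l0E; move: (\prod_(w <- l) _) => g hg u.
by rewrite -[g * _]/(g *m _) mul_mx_scalar -scalemxAl hg scalemxAr.
Qed.
End Lift.

Section Tensor8Add.
Variable K : comNzRingType.
Implicit Types A B D : 'M[K]_2.

Lemma tens8D1 A A' B D : tens8 (A + A') B D = tens8 A B D + tens8 A' B D.
Proof. by rewrite /tens8 (tensDl A A' B); exact (tensDl (A *t B) (A' *t B) D). Qed.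

Lemma tens8D2 A B B' D : tens8 A (B + B') D = tens8 A B D + tens8 A B' D.
Proof. by rewrite /tens8 (tensDr A B B'); exact (tensDl (A *t B) (A *t B') D). Qed.

Lemma tens8D3 A B D D' : tens8 A B (D + D') = tens8 A B D + tens8 A B D'.
Proof. exact (tensDr (A *t B) D D'). Qed.

Lemma tens8_split A B D : tens8 A 1%:M 1%:M *m tens8 1%:M B 1%:M *m tens8 1%:M 1%:M D = tens8 A B D.
Proof. by rewrite !tens8_mul !mulmx1 !mul1mx. Qed.
End Tensor8Add.

Section Torus2.
Variables (C : numClosedFieldType) (x z : 'M[C]_2).
Hypotheses (zz : z *m z = 1%:M) (zx : z *m x = - (x *m z)).

(** With y = i x z, [raising] is x + i y and [lowering] is x - i y: eigenvectors for conjugation by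
    diagonal matrices. *)
Definition raising := x - x *m z.
Definition lowering := x + x *m z.
(* The element diag(a, b) for z = diag(1, -1). *)
Definition torus2 (a b : C) : 'M[C]_2 := ((a + b) / 2) *: 1%:M + ((a - b) / 2) *: z.

Let half_sum (a b : C) : (a + b) / 2 + (a - b) / 2 = a. Proof. by field. Qed.
Let half_diff (a b : C) : (a + b) / 2 - (a - b) / 2 = b. Proof. by field. Qed.

Lemma torus2_raising a b : a * b = 1 -> torus2 a b *m raising = (a * a) *: (raising *m torus2 a b).
Proof.
move=> ab; have zr : z *m raising = raising.
  by rewrite /raising mulmxBr mulmxA zx mulNmx -mulmxA zz mulmx1 opprK addrC.
have rz : raising *m z = - raising.
  by rewrite /raising mulmxBl -mulmxA zz mulmx1 opprB.
move: raising zr rz => r zr rz.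
rewrite /torus2 mulmxDl mulmxDr -!(scalemxAl, scalemxAr) zr rz mul1mx mulmx1 scalerN -scalerDl -scalerBl.
by rewrite half_sum half_diff scalerA -mulrA ab mulr1.
Qed.

Lemma torus2_lowering a b : a * b = 1 -> torus2 a b *m lowering = (b * b) *: (lowering *m torus2 a b).
Proof.
move=> ab; have zl : z *m lowering = - lowering.
  by rewrite /lowering mulmxDr mulmxA zx mulNmx -mulmxA zz mulmx1 opprD addrC.
have lz : lowering *m z = lowering.
  by rewrite /lowering mulmxDl -mulmxA zz mulmx1 addrC.
move: lowering zl lz => l zl lz.
rewrite /torus2 mulmxDl mulmxDr -!(scalemxAl, scalemxAr) zl lz mul1mx mulmx1 scalerN -scalerDl -scalerBl.
by rewrite half_sum half_diff scalerA -mulrA (mulrC b a) ab mulr1.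
Qed.

Lemma torus2_z a b : torus2 a b *m z = z *m torus2 a b.
Proof. by rewrite /torus2 mulmxDl mulmxDr -!(scalemxAl, scalemxAr) mul1mx mulmx1. Qed.
End Torus2.

Section TorusAction.
Variables (C : numClosedFieldType) (x z : 'M[C]_2).
Hypotheses (zz : z *m z = 1%:M) (zx : z *m x = - (x *m z)).
Variables (a1 b1 a2 b2 a3 b3 : C).
Hypotheses (ab1 : a1 * b1 = 1) (ab2 : a2 * b2 = 1) (ab3 : a3 * b3 = 1).
Local Notation T := (tens8 (torus2 z a1 b1) (torus2 z a2 b2) (torus2 z a3 b3)).
Local Notation up := (raising x z).
Local Notation lo := (lowering x z).

Let T1 (a b : C) : torus2 z a b *m 1%:M = 1%:M *m torus2 z a b.
Proof. by rewrite mulmx1 mul1mx. Qed.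

Lemma torus_up1 : T *m tens8 up 1%:M 1%:M = (a1 * a1) *: (tens8 up 1%:M 1%:M *m T).
Proof. by rewrite !tens8_mul (torus2_raising zz zx ab1) !T1 tens8Z1. Qed.

Lemma torus_lo1 : T *m tens8 lo 1%:M 1%:M = (b1 * b1) *: (tens8 lo 1%:M 1%:M *m T).
Proof. by rewrite !tens8_mul (torus2_lowering zz zx ab1) !T1 tens8Z1. Qed.

Lemma torus_up2 : T *m tens8 z up 1%:M = (a2 * a2) *: (tens8 z up 1%:M *m T).
Proof. by rewrite !tens8_mul (torus2_raising zz zx ab2) torus2_z !T1 tens8Z2. Qed.

Lemma torus_lo2 : T *m tens8 z lo 1%:M = (b2 * b2) *: (tens8 z lo 1%:M *m T).
Proof. by rewrite !tens8_mul (torus2_lowering zz zx ab2) torus2_z !T1 tens8Z2. Qed.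

Lemma torus_up3 : T *m tens8 z z up = (a3 * a3) *: (tens8 z z up *m T).
Proof. by rewrite !tens8_mul (torus2_raising zz zx ab3) !torus2_z tens8Z3. Qed.

Lemma torus_lo3 : T *m tens8 z z lo = (b3 * b3) *: (tens8 z z lo *m T).
Proof. by rewrite !tens8_mul (torus2_lowering zz zx ab3) !torus2_z tens8Z3. Qed.

Lemma torus_z : T *m tens8 z z z = tens8 z z z *m T.
Proof. by rewrite !tens8_mul !torus2_z. Qed.
End TorusAction.

Section ExpB3.
Variable R : realType.
Local Notation C := R[i].
Local Notation x := (sigmax R).
Local Notation y := (sigmay R).
Local Notation z := (sigmaz R).
Local Notation ii := (0 +i* 1 : C)%C.
Local Notation cR r := (r%:C)%C.

Lemma dotDl (u1 u2 w : 'rV[C]_7) : dot (u1 + u2) w = dot u1 w + dot u2 w.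
Proof. by rewrite /dot mulmxDl mxE. Qed.

Lemma dotDr (u w1 w2 : 'rV[C]_7) : dot u (w1 + w2) = dot u w1 + dot u w2.
Proof. by rewrite dotC dotDl !(dotC _ u). Qed.

Lemma cartanB3_tens (v : 'rV[R]_3) : cartanB3 v = cR (v 0 0 / 2) *: tens8 z 1%:M 1%:M +
  cR (v 0 1 / 2) *: tens8 1%:M z 1%:M + cR (v 0 2%R / 2) *: tens8 1%:M 1%:M z.
Proof.
have k (c : C) : c * - 'i * ii = c by rewrite -complexiE -mulrA mulNr ii2 opprK mulr1.
have t (c : C) (m : nat) (M : 'M[C]_8) : gamma R m *m gamma R m.+1 = ii *: M ->
  (c * - 'i) *: (gamma R m *m gamma R m.+1) = c *: M by move=> ->; rewrite scalerA k.
have s3 (F : 'I_3 -> 'M[C]_8) : \sum_j F j = F 0 + F 1 + F 2%R.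
  rewrite !big_ord_recl big_ord0 addr0 addrA.
  by congr (F _ + F _ + F _); apply: val_inj.
rewrite /cartanB3 s3.
exact (congr2 +%R (congr2 +%R (t _ (2 * 0)%N _ (gamma01 R)) (t _ (2 * 1)%N _ (gamma23 R)))
  (t _ (2 * 2)%N _ (gamma45 R))).
Qed.

Lemma torus2_diag (t : R) : torus2 z (cR (expR t)) (cR (expR (- t))) =
  diag_mx (\row_(j < 2) cR (expR ((-1) ^+ j * t))).
Proof.
rewrite /torus2; apply/matrixP; case=> [[|[|?]] ?] //; case=> [[|[|?]] ?] //; rewrite !mxE /=;
  rewrite ?mulr0n ?mulr1n ?expr0 ?expr1 ?mulN1r ?mul1r ?mulr0 ?addr0 //; by field.
Qed.

Lemma expmx_cartanB3 (v : 'rV[R]_3) : expmx (cartanB3 v) =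
  tens8 (torus2 z (cR (expR (v 0 0 / 2))) (cR (expR (- (v 0 0 / 2)))))
        (torus2 z (cR (expR (v 0 1 / 2))) (cR (expR (- (v 0 1 / 2)))))
        (torus2 z (cR (expR (v 0 2%R / 2))) (cR (expR (- (v 0 2%R / 2))))).
Proof.
pose e : 'rV[R]_8 := \row_k ((-1) ^+ bit1 k * (v 0 0 / 2) + (-1) ^+ bit2 k * (v 0 1 / 2) +
  (-1) ^+ bit3 k * (v 0 2%R / 2)).
have sgn (n : nat) : cR ((-1 : R) ^+ n) = (-1) ^+ n :> C.
  exact (etrans (rmorphXn (real_complex R) n (-1)) (congr1 (fun u : C => u ^+ n) (rmorphN1 (real_complex R)))).
have -> : cartanB3 v = diag_mx (map_mx (real_complex R) e).
  have id_diag : (1%:M : 'M[C]_2) = diag_mx (const_mx 1) by rewrite diag_const_mx.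
  rewrite cartanB3_tens z_diag id_diag !tens8_diag -!linearZ -!linearD /=; congr diag_mx.
  have ce (k : 'I_2) : (const_mx 1 : 'rV[C]_2) 0 k = 1 by rewrite mxE.
  have se (k : 'I_2) : (\row_(j < 2) (-1) ^+ j : 'rV[C]_2) 0 k = (-1) ^+ k by rewrite mxE.
  have ze (c : C) (f : 'I_8 -> C) k : (c *: \row_k f k) 0 k = c * f k by rewrite mxE [X in c * X]mxE.
  have ae (A B : 'rV[C]_8) k : (A + B) 0 k = A 0 k + B 0 k by rewrite mxE.
  apply/rowP => k; rewrite !ae !ze [RHS]mxE [e 0 k]mxE !ce !se !mulr1 !mul1r.
  by rewrite !raddfD /= !rmorphM /= !sgn ![_ * (-1) ^+ _]mulrC.
rewrite expmx_diag !torus2_diag tens8_diag; congr diag_mx.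
have te (t : R) (k : 'I_2) : (\row_(j < 2) cR (expR ((-1) ^+ j * t)) : 'rV[C]_2) 0 k =
  cR (expR ((-1) ^+ k * t)) by rewrite mxE.
by apply/rowP => k; rewrite mxE [RHS]mxE [e 0 k]mxE !te !expRD !rmorphM.
Qed.

Lemma plane_Spin7 (i j : 'I_7) (a b : C) : i != j -> a * b = 1 ->
  Spin7 (((a + b) / 2)%:M + ((a - b) / 2 * - ii) *: (gamma R i *m gamma R j)).
Proof.
(* For a = exp t and b = exp(-t) these are cosh t and -i sinh t. The element is the product of e_i
   with c e_i + s e_j, a unit vector for the complex form. *)
move=> ij ab; set c := (a + b) / 2; set s := (a - b) / 2 * - ii.
have cs : c * c + s * s = 1.
  transitivity (((a + b) / 2) ^+ 2 - ((a - b) / 2) ^+ 2); first by rewrite /c /s; ring: (ii2 R).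
  by transitivity (a * b); [field | exact: ab].
have := @Spin7_seq R [:: delta_mx 0 i; c *: delta_mx 0 i + s *: delta_mx 0 j] isT.
rewrite !big_cons big_nil mulr1 cliffordD !cliffordZ !clifford_delta.
rewrite -[_ * _]/(_ *m _) mulmxDr -!scalemxAr gamma_sq // scale_scalar_mx mulr1; apply=> w.
rewrite !inE => /orP[/eqP -> | /eqP ->]; first by rewrite dot_delta eqxx.
rewrite dotDl !dotDr !dotZl !dotZr !dot_delta !eqxx (eq_sym j) (negbTE ij) !mulr0 addr0 add0r !mulr1.
exact: cs.
Qed.

Lemma expmx_cartanB3_Spin7 (v : 'rV[R]_3) : Spin7 (expmx (cartanB3 v)).
Proof.
have ab (t : R) : cR (expR t) * cR (expR (- t)) = 1 by rewrite -rmorphM /= -expRD subrr expR0.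
have k (c s : C) (M : 'M[C]_8) : c%:M + (s * - ii) *: (ii *: M) = c *: 1%:M + s *: M.
  by rewrite scalerA -mulrA mulNr ii2 opprK mulr1 scale_scalar_mx mulr1.
have p0 := @plane_Spin7 0 1 _ _ isT (ab (v 0 0 / 2)).
have p1 := @plane_Spin7 2 (@Ordinal 7 3 isT) _ _ isT (ab (v 0 1 / 2)).
have p2 := @plane_Spin7 (@Ordinal 7 4 isT) (@Ordinal 7 5 isT) _ _ isT (ab (v 0 2%R / 2)).
have {}p0 : Spin7 (tens8 (torus2 z (cR (expR (v 0 0 / 2))) (cR (expR (- (v 0 0 / 2))))) 1%:M 1%:M).
  move: p0; rewrite (gamma01 R : gamma R (0%R : 'I_7) *m gamma R (1%R : 'I_7) = _) k.
  by rewrite /torus2 tens8D1 !tens8Z1 tens8_1.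
have {}p1 : Spin7 (tens8 1%:M (torus2 z (cR (expR (v 0 1 / 2))) (cR (expR (- (v 0 1 / 2))))) 1%:M).
  move: p1; rewrite (gamma23 R : gamma R (2%R : 'I_7) *m gamma R (@Ordinal 7 3 isT) = _) k.
  by rewrite /torus2 tens8D2 !tens8Z2 tens8_1.
have {}p2 : Spin7 (tens8 1%:M 1%:M (torus2 z (cR (expR (v 0 2%R / 2))) (cR (expR (- (v 0 2%R / 2)))))).
  move: p2; rewrite (gamma45 R : gamma R (@Ordinal 7 4 isT) *m gamma R (@Ordinal 7 5 isT) = _) k.
  by rewrite /torus2 tens8D3 !tens8Z3 tens8_1.
rewrite expmx_cartanB3 -tens8_split; exact (Spin7M (Spin7M p0 p1) p2).
Qed.
End ExpB3.

Section Ladder8.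
Variables (C : numClosedFieldType) (x y z : 'M[C]_2) (k : C).
Implicit Types A B : 'M[C]_2.

Lemma raise1 A B : k *: y = - (x *m z) -> tens8 x A B + k *: tens8 y A B = tens8 (raising x z) A B.
Proof. by move=> e; rewrite -tens8Z1 -tens8D1 e. Qed.

Lemma raise2 A B : k *: y = - (x *m z) -> tens8 A x B + k *: tens8 A y B = tens8 A (raising x z) B.
Proof. by move=> e; rewrite -tens8Z2 -tens8D2 e. Qed.

Lemma raise3 A B : k *: y = - (x *m z) -> tens8 A B x + k *: tens8 A B y = tens8 A B (raising x z).
Proof. by move=> e; rewrite -tens8Z3 -tens8D3 e. Qed.

Lemma lower1 A B : k *: y = x *m z -> tens8 x A B + k *: tens8 y A B = tens8 (lowering x z) A B.
Proof. by move=> e; rewrite -tens8Z1 -tens8D1 e. Qed.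

Lemma lower2 A B : k *: y = x *m z -> tens8 A x B + k *: tens8 A y B = tens8 A (lowering x z) B.
Proof. by move=> e; rewrite -tens8Z2 -tens8D2 e. Qed.

Lemma lower3 A B : k *: y = x *m z -> tens8 A B x + k *: tens8 A B y = tens8 A B (lowering x z).
Proof. by move=> e; rewrite -tens8Z3 -tens8D3 e. Qed.
End Ladder8.

Section WeightBasis.
Variable R : realType.
Local Notation C := R[i].
Local Notation x := (sigmax R).
Local Notation y := (sigmay R).
Local Notation z := (sigmaz R).
Local Notation ii := (0 +i* 1 : C)%C.
Local Notation cR r := (r%:C)%C.
Local Notation o7 k := (@Ordinal 7 k isT).

Lemma conj_ii : ii^* = - ii.
Proof. by apply/eqP; rewrite eq_complex /= oppr0 !eqxx. Qed.

Definition half_root : C := sqrtC (1 / 2).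

Lemma half_rootK : half_root * half_root = 1 / 2.
Proof. by rewrite -expr2 sqrtCK. Qed.

Lemma half_root_conj : half_root^* = half_root.
Proof. by rewrite geC0_conj // sqrtC_ge0 divr_ge0. Qed.

Definition pvec (d : C * 'I_7 * C * 'I_7) : 'rV[C]_7 :=
  d.1.1.1 *: (delta_mx 0 d.1.1.2 + d.1.2 *: delta_mx 0 d.2).

(* The vectors e_(2k) -+ i e_(2k+1) are the weight vectors of the Cartan
   subalgebra; the signs make their Gram matrix alternate like Jform. *)
Definition pdata (a : nat) : C * 'I_7 * C * 'I_7 :=
  match a with
  | 0 => (- half_root, o7 0, - ii, o7 1)
  | 1 => (half_root, o7 2, - ii, o7 3)
  | 2 => (- half_root, o7 4, - ii, o7 5)
  | 3 => (1 : C, o7 6, 0 : C, o7 0)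
  | 4 => (half_root, o7 4, ii, o7 5)
  | 5 => (half_root, o7 2, ii, o7 3)
  | _ => (half_root, o7 0, ii, o7 1)
  end.

Definition PB3 : 'M[C]_7 := \matrix_(a < 7) pvec (pdata a).

Lemma dot_pvec d d' : dot (pvec d) (pvec d') = d.1.1.1 * d'.1.1.1 *
  ((d.1.1.2 == d'.1.1.2)%:R + d'.1.2 * (d.1.1.2 == d'.2)%:R +
   d.1.2 * (d.2 == d'.1.1.2)%:R + d.1.2 * d'.1.2 * (d.2 == d'.2)%:R).
Proof.
rewrite /pvec dotZl dotZr dotDl !dotDr !dotZl !dotZr !dot_delta.
by move: (_ == _)%:R (_ == _)%:R (_ == _)%:R (_ == _)%:R => b1 b2 b3 b4; ring.
Qed.

Lemma pvec_conj c i k j : map_mx Num.conj (pvec (c, i, k, j)) = pvec (c^*, i, k^*, j).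
Proof. by rewrite /pvec /= map_mxZ map_mxD map_mxZ !delta_real. Qed.

Lemma dot_weight_basis (a b : nat) : (a < 7)%N -> (b < 7)%N ->
  dot (pvec (pdata a)) (pvec (pdata b)) = - ((-1) ^+ a *+ (a + b == 6)%N).
Proof.
have hh := half_rootK; have i2 := ii2 R.
case: a => [|[|[|[|[|[|[|a]]]]]]] // _; case: b => [|[|[|[|[|[|[|b]]]]]]] // _;
  rewrite dot_pvec /= -?(inj_eq val_inj) /= ?mulr1n ?mulr0n ?mulr0 ?mulr1 ?add0r ?addr0 ?mulr0 ?oppr0 ?mul0r;
  move: half_root hh ii i2 => h hh i i2; try done; try (by ring: hh i2);
  rewrite !(mulrN, mulNr) ?opprK i2 ?opprK hh; by field.
Qed.

Lemma dot_weight_basis_conj (a b : nat) : (a < 7)%N -> (b < 7)%N ->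
  dot (pvec (pdata a)) (map_mx Num.conj (pvec (pdata b))) = (a == b)%:R.
Proof.
have hh := half_rootK; have i2 := ii2 R; have ci := conj_ii; have ch := half_root_conj.
have cN (u : C) : (- u)^* = - u^* by rewrite rmorphN.
have c0 : (0 : C)^* = 0 by rewrite rmorph0.
have c1 : (1 : C)^* = 1 by rewrite rmorph1.
case: a => [|[|[|[|[|[|[|a]]]]]]] // _; case: b => [|[|[|[|[|[|[|b]]]]]]] // _;
  rewrite [pdata _]/= [X in map_mx _ (pvec X)]/= pvec_conj ?cN ?ci ?ch ?c0 ?c1 dot_pvec /= -?(inj_eq val_inj) /= ?mulr1n ?mulr0n ?mulr0 ?mulr1 ?add0r ?addr0 ?mulr0 ?oppr0 ?mul0r;
  move: half_root hh {ch} ii i2 {ci} => h hh i i2; try done; try (by ring: hh i2);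
  rewrite !(mulrN, mulNr) ?opprK i2 ?opprK hh; by field.
Qed.

Lemma mul_trmx_dot (A B : 'M[C]_7) i j : (A *m B^T) i j = dot (row i A) (row j B).
Proof. by rewrite dotE mxE; apply: eq_bigr => k _; rewrite !mxE. Qed.

Lemma PB3_unitary : PB3 \is unitarymx.
Proof.
apply/unitarymxP; apply/matrixP => a b; rewrite -[PB3^t*]map_trmx mul_trmx_dot -map_row !rowK.
by rewrite dot_weight_basis_conj // mxE.
Qed.

Lemma PB3_form : PB3 *m PB3^T = - Jform R 7.
Proof.
apply/matrixP => a b; rewrite mul_trmx_dot !rowK dot_weight_basis // !mxE; congr (- (_ *+ _)).
by rewrite -val_eqE /=; have := ltn_ord a; have := ltn_ord b; move: (val a) (val b) => m n; lia.
Qed.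

Lemma torus_weight (v : 'rV[R]_3) (a : nat) : (a < 7)%N ->
  expmx (cartanB3 v) *m clifford (pvec (pdata a)) =
  cR (expR (wcoord 7 v a)) *: (clifford (pvec (pdata a)) *m expmx (cartanB3 v)).
Proof.
have yr : ii *: y = - (x *m z) by rewrite yE scalerA ii2 scaleN1r.
have yl : - ii *: y = x *m z by rewrite scaleNr yr opprK.
have up1 : gamma R 0 + ii *: gamma R 1 = tens8 (raising x z) 1%:M 1%:M.
  rewrite !gammaE; exact (raise1 _ _ yr).
have up2 : gamma R 2 + ii *: gamma R 3 = tens8 z (raising x z) 1%:M.
  rewrite !gammaE; exact (raise2 _ _ yr).
have up3 : gamma R 4 + ii *: gamma R 5 = tens8 z z (raising x z).
  rewrite !gammaE; exact (raise3 _ _ yr).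
have lo1 : gamma R 0 + - ii *: gamma R 1 = tens8 (lowering x z) 1%:M 1%:M.
  rewrite !gammaE; exact (lower1 _ _ yl).
have lo2 : gamma R 2 + - ii *: gamma R 3 = tens8 z (lowering x z) 1%:M.
  rewrite !gammaE; exact (lower2 _ _ yl).
have lo3 : gamma R 4 + - ii *: gamma R 5 = tens8 z z (lowering x z).
  rewrite !gammaE; exact (lower3 _ _ yl).
have ab (t : R) : cR (expR t) * cR (expR (- t)) = 1 by rewrite -rmorphM /= -expRD subrr expR0.
have aa (t : R) : cR (expR (t / 2)) * cR (expR (t / 2)) = cR (expR t).
  by rewrite -rmorphM /= -expRD -splitr.
have bb (t : R) : cR (expR (- (t / 2))) * cR (expR (- (t / 2))) = cR (expR (- t)).
  by rewrite -rmorphM /= -expRD -opprD -splitr.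
have tr (T M : 'M[C]_8) (h w w' : C) (i j : 'I_7) k : w = w' ->
    gamma R i + k *: gamma R j = M -> T *m M = w *: (M *m T) ->
    T *m clifford (pvec (h, i, k, j)) = w' *: (clifford (pvec (h, i, k, j)) *m T).
  move=> <-; rewrite /pvec /= cliffordZ cliffordD cliffordZ !clifford_delta => -> e.
  by rewrite -scalemxAr e -scalemxAl !scalerA mulrC.
rewrite expmx_cartanB3 wcoordE.
have ab0 := ab (v 0 0 / 2); have ab1 := ab (v 0 1 / 2); have ab2 := ab (v 0 2%R / 2).
have cE (s t : R) : s = t -> cR (expR s) = cR (expR t) by move=> ->.
case: a => [|[|[|[|[|[|[|a]]]]]]] // _.
- refine (tr _ _ _ _ _ (o7 0) (o7 1) _ _ lo1 (torus_lo1 (zz R) (zx R) _ _ _ _ ab0)).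
  by rewrite bb; apply: cE; rewrite /=; ring.
- refine (tr _ _ _ _ _ (o7 2) (o7 3) _ _ lo2 (torus_lo2 (zz R) (zx R) _ _ _ _ ab1)).
  by rewrite bb; apply: cE; rewrite /=; ring.
- refine (tr _ _ _ _ _ (o7 4) (o7 5) _ _ lo3 (torus_lo3 (zz R) (zx R) _ _ _ _ ab2)).
  by rewrite bb; apply: cE; rewrite /=; ring.
(* The vector e_6 of weight zero; its second index in [pdata] is a dummy with coefficient 0. *)
- have g6 : gamma R 6 + 0 *: gamma R 0 = tens8 z z z.
    rewrite (scale0r (gamma R 0)) (addr0 (gamma R 6)); exact (gammaE R 6).
  refine (tr _ (tens8 (sigmaz R) (sigmaz R) (sigmaz R)) _ 1 _ (o7 6) (o7 0) 0 _ g6 _).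
    transitivity (cR (expR (0 : R))); first by rewrite expR0.
    by apply: cE; rewrite /=; ring.
  by rewrite scale1r; exact: torus_z.
- refine (tr _ _ _ _ _ (o7 4) (o7 5) _ _ up3 (torus_up3 (zz R) (zx R) _ _ _ _ ab2)).
  by rewrite aa; apply: cE; rewrite /=; ring.
- refine (tr _ _ _ _ _ (o7 2) (o7 3) _ _ up2 (torus_up2 (zz R) (zx R) _ _ _ _ ab1)).
  by rewrite aa; apply: cE; rewrite /=; ring.
refine (tr _ _ _ _ _ (o7 0) (o7 1) _ _ up1 (torus_up1 (zz R) (zx R) _ _ _ _ ab0)).
by rewrite aa; apply: cE; rewrite /=; ring.
Qed.
End WeightBasis.

Lemma conj_form_orth (K : comNzRingType) n (P Q J k : 'M[K]_n) : P *m Q = 1%:M -> Q *m Q^T = - J ->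
  k *m J *m k^T = J -> (P *m k *m Q) *m (P *m k *m Q)^T = 1%:M.
Proof.
move=> PQ QQ hk; rewrite !trmx_mul; transitivity (P *m (k *m (Q *m Q^T) *m k^T) *m P^T).
  by rewrite !mulmxA.
by rewrite QQ mulmxN mulNmx hk -QQ mulmxA PQ mul1mx -trmx_mul PQ trmx1.
Qed.

(** * Transfer between Spin(7) and the orthogonal group *)

Section SpinB3.
Variable R : realType.
Local Notation C := R[i].
Local Notation cR r := (r%:C)%C.

(* Conjugate of the weight basis: with it the vector action of exp(v) is
   Q^* weight(v) Q. *)
Definition QB3 : 'M[C]_7 := map_mx Num.conj (PB3 R).

Lemma QB3_unitary : QB3 \is unitarymx.
Proof.
have h : PB3 R *m (PB3 R)^t* = 1%:M by apply/unitarymxP; exact: PB3_unitary.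
apply/unitarymxP; have := congr1 (map_mx Num.conj) h.
by rewrite map_mxM map_mx1 => h'; rewrite /QB3 map_trmx; exact h'.
Qed.

Lemma QB3_form : QB3 *m QB3^T = - Jform R 7.
Proof.
have := congr1 (map_mx Num.conj) (PB3_form R); rewrite map_mxM map_mxN map_trmx -/QB3 => ->.
have J_conj : map_mx Num.conj (Jform R 7) = Jform R 7.
  by apply/matrixP => a b; rewrite mxE mxE rmorphMn rmorphXn rmorphN1.
exact (congr1 (fun M => - M) J_conj).
Qed.

Lemma expmx_cartanB3_acts (v : 'rV[R]_3) : acts (expmx (cartanB3 v)) (QB3^t* *m weight 7 v *m QB3).
Proof.
have P1 : (PB3 R)^t* *m PB3 R = 1%:M by apply: mulmx1C; apply/unitarymxP; exact: PB3_unitary.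
have Qt : QB3^t* = (PB3 R)^T by apply/matrixP => a b; rewrite !mxE conjCK.
have Qt' : QB3^T = (PB3 R)^t* by rewrite /QB3 map_trmx.
have tr : (QB3^t* *m weight 7 v *m QB3)^T = (PB3 R)^t* *m weight 7 v *m PB3 R.
  by rewrite Qt !trmx_mul Qt' trmxK weight_diag tr_diag_mx mulmxA.
move=> u; rewrite tr !mulmxA; set u' := u *m (PB3 R)^t*.
have -> : clifford u = clifford (u' *m PB3 R) by rewrite /u' -mulmxA P1 mulmx1.
rewrite !clifford_mulmx mulmx_sumr mulmx_suml; apply: eq_bigr => a _.
rewrite rowK -scalemxAr torus_weight // -scalemxAl scalerA; congr (_ *: _).
by rewrite weight_diag mul_mx_diag [RHS]mxE [(\row__ _) _ _]mxE.
Qed.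

Lemma conj_inG_orth (k : 'M[C]_7) : inG k -> (QB3^t* *m k *m QB3) *m (QB3^t* *m k *m QB3)^T = 1%:M.
Proof.
move=> hk; have Q1 : QB3^t* *m QB3 = 1%:M by apply: mulmx1C; apply/unitarymxP; exact: QB3_unitary.
exact (conj_form_orth Q1 QB3_form hk).
Qed.

Lemma orth_unitary_real (r : 'M[C]_7) : r *m r^T = 1%:M -> r \is unitarymx -> realmx r.
Proof.
move=> rr /unitarymxP ru; have [_ ur] := mulmx1_unit (mulmx1C rr).
have e : r^t* = r^T by apply: (can_inj (mulKmx (_ : r \in unitmx))); [have [] := mulmx1_unit rr | rewrite ru rr].
by apply: trmx_inj; rewrite map_trmx.
Qed.

Lemma acts_lift (k : 'M[C]_7) : inG k -> k \is unitarymx -> exists g (e : bool),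
  [/\ Spin7 g, g \is unitarymx & acts g ((-1) ^+ e *: (QB3^t* *m k *m QB3))].
Proof.
move=> hk uk; have rr := conj_inG_orth hk.
exact (Spin7_lift (orth_unitary_real rr (conj_unitary_adj QB3_unitary uk)) rr).
Qed.

(** An element acting by 1 commutes with all gamma matrices. One acting by -1 would anticommute with
    each, hence with their product since seven is odd; but this product is a nonzero scalar, so the
    element would vanish. *)
Lemma acts_scalar (L : 'M[C]_8) (e : bool) : L \in unitmx -> acts L ((-1) ^+ e)%:M -> exists c, L = c%:M.
Proof.
move=> uL h; have hj (j : nat) (j7 : (j < 7)%N) : L *m gamma R j = (-1) ^+ e *: (gamma R j *m L).
  have := h (delta_mx 0 (Ordinal j7)); rewrite tr_scalar_mx mul_mx_scalar cliffordZ.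
  by rewrite !clifford_delta scalemxAl.
case: e hj {h} => hj; last by apply: gamma_center => j /hj; rewrite scale1r.
have hs (s : seq 'I_7) : L *m \prod_(j <- s) gamma R j = (-1) ^+ size s *: (\prod_(j <- s) gamma R j *m L).
  elim: s => [|j s IH]; first by rewrite !big_nil mulmx1 mul1mx scale1r.
  rewrite !big_cons -[_ * _]/(_ *m _) mulmxA hj // -scalemxAl -mulmxA IH -scalemxAr scalerA mulmxA.
  by rewrite /= expr1 exprS.
have := hs (index_enum 'I_7); rewrite gamma_prod [index_enum _]unlock -enumT size_enum_ord.
rewrite mul_mx_scalar mul_scalar_mx -signr_odd /= expr1 scaleN1r => /eqP.
rewrite -subr_eq0 opprK -scalerDl scaler_eq0 -opprD oppr_eq0 -mulr2n -mulr_natr mulf_eq0 pnatr_eq0 orbF.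
rewrite (negbTE (ii_neq0 R)) /= => /eqP L0; move: uL; rewrite L0 unitmxE det0 unitr0 //.
Qed.

Lemma scalar_Spin7_unitary (L : 'M[C]_8) c : L = c%:M -> Spin7 L -> L \is unitarymx.
Proof.
move=> Lc /Spin7_det; rewrite Lc det_scalar normrX => /eqP; rewrite pexpr_eq1 // => /eqP c1.
apply/unitarymxP; rewrite tr_scalar_mx map_scalar_mx -scalar_mxM.
by rewrite -[c * _](normCK c) c1 expr1n.
Qed.

(** The k_i lift only up to sign, so the lifted product acts by a sign. It is then a scalar of
    modulus one in the group, and the last factor absorbs it. *)
Lemma Spin7_closing (v1 v2 v3 : 'rV[R]_3) (k1 k2 k3 : 'M[C]_7) :
  [/\ inG k1, inG k2 & inG k3] -> [/\ k1 \is unitarymx, k2 \is unitarymx & k3 \is unitarymx] ->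
  weight 7 v1 *m k1 *m weight 7 v2 *m k2 *m weight 7 v3 *m k3 = 1%:M ->
  exists g1 g2 g3, [/\ maxcompact (@Spin7 R) g1, maxcompact (@Spin7 R) g2, maxcompact (@Spin7 R) g3 &
    expmx (cartanB3 v1) *m g1 *m expmx (cartanB3 v2) *m g2 *m expmx (cartanB3 v3) *m g3 = 1%:M].
Proof.
move=> [i1 i2 i3] [u1 u2 u3] E.
have [g1 [e1 [s1 w1 a1]]] := acts_lift i1 u1; have [g2 [e2 [s2 w2 a2]]] := acts_lift i2 u2.
have [g3 [e3 [s3 w3 a3]]] := acts_lift i3 u3.
have Q2 : QB3 *m QB3^t* = 1%:M by apply/unitarymxP; exact: QB3_unitary.
have tw v : QB3 *m (QB3^t* *m weight 7 v *m QB3) = weight 7 v *m QB3.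
  by rewrite !mulmxA Q2 mul1mx.
have rE : (QB3^t* *m weight 7 v1 *m QB3) *m (QB3^t* *m k1 *m QB3) *m (QB3^t* *m weight 7 v2 *m QB3) *m
    (QB3^t* *m k2 *m QB3) *m (QB3^t* *m weight 7 v3 *m QB3) *m (QB3^t* *m k3 *m QB3) = 1%:M.
  exact (conj_closing_back QB3_unitary (tw v1) (tw v2) (tw v3) E).
have aL := acts_mul (acts_mul (acts_mul (acts_mul (acts_mul (expmx_cartanB3_acts v1) a1)
  (expmx_cartanB3_acts v2)) a2) (expmx_cartanB3_acts v3)) a3.
have sL := Spin7M (Spin7M (Spin7M (Spin7M (Spin7M (expmx_cartanB3_Spin7 v1) s1)
  (expmx_cartanB3_Spin7 v2)) s2) (expmx_cartanB3_Spin7 v3)) s3.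
have sgn (a b c d e f : 'M[C]_7) : a *m b *m c *m d *m e *m f = 1%:M ->
    a *m ((-1) ^+ e1 *: b) *m c *m ((-1) ^+ e2 *: d) *m e *m ((-1) ^+ e3 *: f) =
    ((-1) ^+ (e1 (+) e2 (+) e3))%:M.
  move=> h; rewrite -!(scalemxAr, scalemxAl) h !scalerA scale_scalar_mx mulr1 !signr_addb.
  by rewrite mulrC mulrCA mulrC.
have {rE} aL := eq_ind _ (acts _) aL _ (sgn _ _ _ _ _ _ rE).
move: aL sL; set M := _ *m expmx (cartanB3 v3); move=> aL sL.
have uL := Spin7U sL; have [c Lc] := acts_scalar uL aL.
have /unitarymxP LL := scalar_Spin7_unitary Lc sL.
have iL : invmx (M *m g3) = (M *m g3)^t*.
  by apply: (can_inj (mulKmx uL)); rewrite mulmxV.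
exists g1, g2, (g3 *m invmx (M *m g3)); split; [by split | by split | | by rewrite mulmxA mulmxV].
split; first exact: Spin7M s3 (Spin7V sL).
rewrite iL; apply: mul_unitarymx w3 _; rewrite trmxC_unitary; exact/unitarymxP.
Qed.

Lemma D3_B3_cone : D3_B3 R = cone_of (map (@vec_of_digits R) generators).
Proof.
have key := D3_closing (@Spin7_1 R) (@Spin7M R) (@Spin7U R) (@Spin7V R) (@expmx_cartanB3_Spin7 R).
have Q2 : QB3 *m QB3^t* = 1%:M by apply/unitarymxP; exact: QB3_unitary.
have tw v : QB3 *m (QB3^t* *m weight 7 v *m QB3) = weight 7 v *m QB3.
  by rewrite !mulmxA Q2 mul1mx.
apply/seteqP; split=> -[[v1 v2] v3].
  case/key => -[ch1 ch2 ch3] [g1 [g2 [g3 [[s1 u1] [s2 u2] [s3 u3]] E]]].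
  have [r1 o1 a1] := Spin7_acts s1; have [r2 o2 a2] := Spin7_acts s2; have [r3 o3 a3] := Spin7_acts s3.
  have aL := acts_mul (acts_mul (acts_mul (acts_mul (acts_mul (expmx_cartanB3_acts v1) a1)
    (expmx_cartanB3_acts v2)) a2) (expmx_cartanB3_acts v3)) a3.
  have rE := acts_unique (eq_ind _ (fun M => acts M _) aL _ E).
  apply: (@unitary_closing_cone R 7 isT v1 v2 v3 _ _ _ ch1 ch2 ch3
    (conj_unitary QB3_unitary (acts_unitary u1 o1 a1)) (conj_unitary QB3_unitary (acts_unitary u2 o2 a2))
    (conj_unitary QB3_unitary (acts_unitary u3 o3 a3))).
  exact ((conj_closing r1 r2 r3 QB3_unitary (tw v1) (tw v2) (tw v3)).1 rE).
move=> hc; apply/key; split; first exact: (cone_chambers hc).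
have [k1 [k2 [k3 [ik uk E]]]] := @cone_closes R 7 isT _ stable_check7 isT hc.
exact (Spin7_closing ik uk E).
Qed.
End SpinB3.

Theorem theorem5p1 (R : realType) :
  D3_C3 R = cone_of (map (@vec_of_digits R) generators) /\
  D3_B3 R = cone_of (map (@vec_of_digits R) generators).
Proof. split; [exact: D3_C3_cone | exact: D3_B3_cone]. Qed.
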